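(* Let $\Theta$ be a 2-dimensional compact Riemannian manifold, $T:\Theta\to\Theta$ a topologically mixing $C^2$-Anosov diffeomorphism and $g:\Theta\to(0,\infty)$ a Hölder continuous function. Then $$\dim_P(N_t)=2>\dim_H(N_t)\quad\text{for }t\in(\gamma_{\min},\gamma_c^-).$$
   Context: $\mathcal{P}_T(\Theta)$ denotes the set of $T$-invariant Borel probability measures on $\Theta$. Write $\mu(\psi)=\int\psi\,d\mu$, and $h_T(\mu)$ for the metric entropy. $T_\theta\Theta=E^s(\theta)\oplus E^u(\theta)$ is the splitting into stable and unstable subspaces of $T$, and $\|dT|E^s\|$ is the function $\theta\mapsto\|d_\theta T|_{E^s(\theta)}\|$. $\dim_H$ and $\dim_P$ are Hausdorff and packing dimension with respect to the Riemannian metric. Put $\gamma(\mu)=\int\log g\,d\mu$, $\gamma_{\min}=\inf_{\mu\in\mathcal{P}_T(\Theta)}\gamma(\mu)$. The Sinai-Ruelle-Bowen measure $\mu_{\mathrm{SRB}}^-$ of $T^{-1}$ is the unique $\mu\in\mathcal{P}_T(\Theta)$ such that $$h_T(\mu)+\mu(\log\|dT|E^s\|)=\sup_{\nu\in\mathcal{P}_T(\Theta)}\bigl(h_T(\nu)+\nu(\log\|dT|E^s\|)\bigr)=0,$$ and $\gamma_c^-=\gamma(\mu_{\mathrm{SRB}}^-)$. Write $\mathbb{R}_\geqslant=[0,\infty)$. The function $h\in C^1(\mathbb{R}_\geqslant;\mathbb{R})$ is strictly concave with $h(0)=0$, $h'(x)>0$ for $x>0$, $h'(0)=1$ and $\lim_{x\to\infty}h(x)/x=0$.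 For $t\in\mathbb{R}$ let $f_t(\theta,x)=e^{-t}g(\theta)h(x)$ on $\Theta\times\mathbb{R}_\geqslant$, and iterate: $f_t^0(\theta,x)=x$, $f_t^1=f_t$, $f_t^n(\theta,x)=f_t(T^{n-1}\theta,f_t^{n-1}(\theta,x))$. For each $t$ fix $M_t>0$ such that $f_t(\theta,M_t)<M_t$ for all $\theta\in\Theta$ (such $M_t$ exists), and define the maximal invariant function $$\varphi_t(\theta)=\lim_{n\to\infty}f_t^n(T^{-n}\theta,M_t)=\inf_nf_t^n(T^{-n}\theta,M_t).$$ Set $N_t=\{\theta\in\Theta:\varphi_t(\theta)=0\}$. *)

(* Defs.v *)
(* MathComp / MathComp-Analysis. *)
From HB Require Import structures.
From mathcomp Require Import all_boot all_order all_algebra.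
From mathcomp Require Import all_classical all_reals all_analysis.

Set Implicit Arguments.
Unset Strict Implicit.
Unset Printing Implicit Defensive.

Import Order.TTheory GRing.Theory Num.Theory.
Import numFieldNormedType.Exports.

Local Open Scope classical_set_scope.
Local Open Scope ring_scope.

(* For open U and finite-dimensional V: f is C^(k+1) on U iff it is
   differentiable at every point of U and each of its directional derivatives
   is C^k on U. *)
Fixpoint Ck (R : realType) (V W : normedModType R) (k : nat) (U : set V)
    (f : V -> W) : Prop :=
  if k is k'.+1 then
    (forall x, U x -> differentiable f x) /\
    (forall v : V, Ck k' U (fun x => 'D_v f x))
  else forall x, U x -> {for x, continuous f}.

(* A chart is a total function cfun, only meaningful on the domain cdom,
   together with a total function cinv inverting it on cfun @` cdom. *)
Record chart (R : realType) (n : nat) (M : Type) := Chart {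
  cdom : set M ;
  cfun : M -> 'rV[R]_n ;
  cinv : 'rV[R]_n -> M }.

Definition cimg (R : realType) (n : nat) (M : Type) (c : chart R n M) :
  set 'rV[R]_n := cfun c @` cdom c.

Definition is_chart (R : realType) (n : nat) (M : topologicalType)
    (c : chart R n M) : Prop :=
  [/\ open (cdom c),
      open (cimg c),
      (forall p, cdom c p -> cinv c (cfun c p) = p),
      {within cdom c, continuous (cfun c)} &
      {within cimg c, continuous (cinv c)}].

(* The tangent space at p is 'rV[R]_n, read in the preferred chart chart_at p;
   gram p is the Gram matrix of the Riemannian metric in that chart.  Since
   p |-> chart_at p is an arbitrary choice, smoothness of the metric is
   expressed in the coordinates of each chart c of the atlas: the coordinate
   vector v at x is carried to the preferred chart at cinv c x by the
   differential of the transition map. *)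
Record riemannian_manifold (R : realType) (n : nat) (M : topologicalType) :=
  RiemannianManifold {
  atlas : set (chart R n M) ;
  chart_at : M -> chart R n M ;
  gram : M -> 'M[R]_n ;
  manifold_hausdorff : hausdorff_space M ;
  manifold_second_countable : @second_countable M ;
  atlas_chart : forall c, atlas c -> is_chart c ;
  atlas_compatible : forall c c' k, atlas c -> atlas c' ->
    Ck k (cfun c @` (cdom c `&` cdom c')) (cfun c' \o cinv c) ;
  chart_at_atlas : forall p, atlas (chart_at p) ;
  chart_at_dom : forall p, cdom (chart_at p) p ;
  gram_sym : forall p, (gram p)^T = gram p ;
  gram_pos : forall p (v : 'rV[R]_n), v != 0 ->
    0 < (v *m gram p *m v^T) 0 0 ;
  gram_smooth : forall c k (v w : 'rV[R]_n), atlas c ->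
    Ck k (cimg c) (fun x : 'rV[R]_n =>
      let p := cinv c x in
      let u := 'd (cfun (chart_at p) \o cinv c) x in
      (u v *m gram p *m (u w)^T) 0 0) }.

Section Geometry.
Variables (R : realType) (n : nat) (M : topologicalType).
Variable X : riemannian_manifold R n M.

Definition rnorm (p : M) (v : 'rV[R]_n) : R :=
  Num.sqrt ((v *m gram X p *m v^T) 0 0).

Definition tangent_map (F : M -> M) (p : M) (v : 'rV[R]_n) : 'rV[R]_n :=
  'd (cfun (chart_at X (F p)) \o F \o cinv (chart_at X p))
     (cfun (chart_at X p) p) v.

Definition Ck_map (k : nat) (F : M -> M) : Prop :=
  continuous F /\
  forall c c', atlas X c -> atlas X c' ->
    Ck k (cfun c @` (cdom c `&` F @^-1` cdom c')) (cfun c' \o F \o cinv c).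

Definition C1_curve (a : R -> M) : Prop :=
  continuous a /\
  forall c, atlas X c -> Ck 1 (a @^-1` cdom c) (cfun c \o a : R -> 'rV[R]_n).

Definition speed (a : R -> M) (s : R) : R :=
  rnorm (a s) ('D_1 (cfun (chart_at X (a s)) \o a : R -> 'rV[R]_n) s).

Definition curve_length (a : R -> M) : \bar R :=
  (\int[lebesgue_measure]_(s in `[0%R, 1%R]) (speed a s)%:E)%E.

(* Infimum of the lengths of C^1 curves from p to q; +oo if there are none. *)
Definition rdist (p q : M) : \bar R :=
  ereal_inf [set curve_length a |
    a in [set a : R -> M | [/\ C1_curve a, a 0 = p & a 1 = q]]].

Definition holder (g : M -> R) : Prop :=
  exists C alpha : R, [/\ 0 < C, 0 < alpha <= 1 &
    forall p q, (`|g p - g q|%:E <= C%:E * poweR (rdist p q) alpha)%E].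

Definition Ck_diffeomorphism (k : nat) (T Tinv : M -> M) : Prop :=
  [/\ cancel T Tinv, cancel Tinv T, Ck_map k T & Ck_map k Tinv].

Definition anosov_splitting (T Tinv : M -> M)
    (Es Eu : M -> {vspace 'rV[R]_n}) : Prop :=
  [/\ forall p, (Es p + Eu p)%VS = fullv /\ (Es p :&: Eu p)%VS = 0%VS,
      forall p, tangent_map T p @` [set` Es p] = [set` Es (T p)],
      forall p, tangent_map T p @` [set` Eu p] = [set` Eu (T p)] &
      exists C lambda : R, [/\ 0 < C, 0 < lambda < 1,
        forall (k : nat) p v, v \in Es p ->
          rnorm (iter k T p) (tangent_map (iter k T) p v)
            <= C * lambda ^+ k * rnorm p v &
        forall (k : nat) p v, v \in Eu p ->
          rnorm (iter k Tinv p) (tangent_map (iter k Tinv) p v)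
            <= C * lambda ^+ k * rnorm p v]].

Definition norm_dT_on (T : M -> M) (E : M -> {vspace 'rV[R]_n}) (p : M) : R :=
  sup [set rnorm (T p) (tangent_map T p v) |
        v in [set v | v \in E p /\ rnorm p v <= 1]].

End Geometry.

Definition topologically_mixing (M : topologicalType) (T : M -> M) : Prop :=
  forall U V : set M, open U -> open V -> U !=set0 -> V !=set0 ->
    exists N : nat, forall k, (N <= k)%N -> (iter k T @` U) `&` V !=set0.

Section Dimensions.
Variables (R : realType) (M : Type) (d : M -> M -> \bar R).
Local Open Scope ereal_scope.

(* 0 is thrown in so that the empty set has diameter 0 rather than -oo. *)
Definition diam (U : set M) : \bar R :=
  ereal_sup (0 |` [set d x.1 x.2 | x in [set x | U x.1 /\ U x.2]]).

Definition hausdorff_premeasure (s delta : R) (A : set M) : \bar R :=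
  ereal_inf [set \sum_(0 <= i <oo) poweR (diam (U i)) s |
    U in [set U : nat -> set M |
      A `<=` \bigcup_i U i /\ forall i, diam (U i) <= delta%:E]].

Definition hausdorff_measure (s : R) (A : set M) : \bar R :=
  ereal_sup [set hausdorff_premeasure s delta A |
    delta in [set delta : R | (0 < delta)%R]].

Definition hausdorff_dim (A : set M) : \bar R :=
  ereal_inf [set s%:E |
    s in [set s : R | (0 < s)%R /\ hausdorff_measure s A = 0]].

(* Suprema over finite packings by disjoint closed balls centred in A; they
   agree with suprema over countable packings as the terms are nonnegative. *)
Definition packing_sums (s delta : R) (A : set M) : set (\bar R) :=
  [set y | exists (m : nat) (c : 'I_m -> M) (r : 'I_m -> R),
    [/\ forall i, [/\ A (c i), (0 < r i)%R & (2 * r i <= delta)%R],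
        trivIset setT (fun i => [set q | d (c i) q <= (r i)%:E]) &
        y = (\sum_(i < m) powR (2 * r i) s)%R%:E]].

Definition packing_premeasure (s : R) (A : set M) : \bar R :=
  ereal_inf [set ereal_sup (packing_sums s delta A) |
    delta in [set delta : R | (0 < delta)%R]].

Definition packing_measure (s : R) (A : set M) : \bar R :=
  ereal_inf [set \sum_(0 <= i <oo) packing_premeasure s (F i) |
    F in [set F : nat -> set M | A `<=` \bigcup_i F i]].

Definition packing_dim (A : set M) : \bar R :=
  ereal_inf [set s%:E |
    s in [set s : R | (0 < s)%R /\ packing_measure s A = 0]].

End Dimensions.

Notation borel M := (g_sigma_algebraType (@open M)).

Section Ergodic.
Variables (R : realType) (M : ptopologicalType) (T : M -> M).

Definition invariant_probability : set (probability (borel M) R) :=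
  [set mu | forall A : set (borel M), measurable A -> mu (T @^-1` A) = mu A].

(* A finite measurable partition is encoded by its labelling xi : M -> 'I_k
   with measurable fibres; the cells of the join of its first m preimages are
   indexed by words w of length m. *)
Definition join_entropy (mu : probability (borel M) R) (k : nat)
    (xi : M -> 'I_k) (m : nat) : R :=
  - \sum_(w : {ffun 'I_m -> 'I_k})
      let p := fine (mu [set x : M | forall i : 'I_m, xi (iter i T x) = w i]) in
      p * ln p.

Definition partition_entropy (mu : probability (borel M) R) (k : nat)
    (xi : M -> 'I_k) : \bar R :=
  limn (fun m : nat => (join_entropy mu xi m.+1 / m.+1%:R)%:E).

Definition metric_entropy (mu : probability (borel M) R) : \bar R :=
  ereal_sup [set y | exists (k : nat) (xi : M -> 'I_k),
    (forall i, measurable (xi @^-1` [set i] : set (borel M))) /\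
    y = partition_entropy mu xi].

Definition mean (psi : M -> R) (mu : probability (borel M) R) : R :=
  \int[mu]_(x in [set: borel M]) psi x.

Definition free_energy (psi : M -> R) (mu : probability (borel M) R) : \bar R :=
  (metric_entropy mu + (mean psi mu)%:E)%E.

Definition pressure (psi : M -> R) : \bar R :=
  ereal_sup [set free_energy psi nu | nu in invariant_probability].

Definition gamma (g : M -> R) (mu : probability (borel M) R) : R :=
  mean (fun x => ln (g x)) mu.

Definition gamma_min (g : M -> R) : R :=
  inf [set gamma g mu | mu in invariant_probability].

End Ergodic.

Definition is_srb_inverse (R : realType) (n : nat) (M : ptopologicalType)
    (X : riemannian_manifold R n M) (T : M -> M)
    (Es : M -> {vspace 'rV[R]_n}) (mu : probability (borel M) R) : Prop :=
  let psi := fun p => ln (norm_dT_on X T Es p) in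
  [/\ invariant_probability T mu,
      free_energy T psi mu = pressure T psi &
      pressure T psi = 0%E].

(* dh is the derivative of h on the closed half-line, one-sided at 0; the
   values of h and dh at negative arguments are irrelevant. *)
Definition C1_nonneg (R : realType) (h dh : R -> R) : Prop :=
  (forall x, 0 <= x ->
     (fun y => (h y - h x) / (y - x))
       @ within [set y | 0 <= y] x^' --> dh x) /\
  {within `[0, +oo[, continuous dh}.

Definition strictly_concave_nonneg (R : realType) (h : R -> R) : Prop :=
  forall x y a : R, 0 <= x -> 0 <= y -> x != y -> 0 < a < 1 ->
    a * h x + (1 - a) * h y < h (a * x + (1 - a) * y).

Definition fibre_profile (R : realType) (h dh : R -> R) : Prop :=
  C1_nonneg h dh /\ strictly_concave_nonneg h /\
  [/\ h 0 = 0,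
      forall x, 0 < x -> 0 < dh x,
      dh 0 = 1 &
      (fun x => h x / x) @ +oo --> (0 : R)].

Section SkewProduct.
Variables (R : realType) (M : Type) (T Tinv : M -> M).
Variables (g : M -> R) (h : R -> R).

Definition fibre_map (t : R) (p : M) (x : R) : R := expR (- t) * g p * h x.

Fixpoint fibre_iter (t : R) (k : nat) (p : M) (x : R) : R :=
  if k is k'.+1 then fibre_map t (iter k' T p) (fibre_iter t k' p x) else x.

(* The maximal invariant function.  When fibre_map t p (B t) < B t for all p,
   the sequence is nonincreasing, so the limit is also its infimum. *)
Definition invariant_function (B : R -> R) (t : R) (p : M) : R :=
  limn (fun k : nat => fibre_iter t k (iter k Tinv p) (B t)).

Definition zero_set (B : R -> R) (t : R) : set M :=
  [set p | invariant_function B t p = 0].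

End SkewProduct.

(* Main.v *)
(* Put F = T^-1 and S_n = ln g o F + ... + ln g o F^n.  Since h(x) <= x and
   h'(0) = 1, a point where S_n - n t is unbounded below lies in N_t, and at a
   point of N_t one has S_n <= n t' infinitely often, for every t' > t.

   Hausdorff dimension.  For a power G of F the area of a Bowen ball of length n
   is comparable to w_n, the product of the norms of dT|E^s along the orbit; this
   is proved by counting points of fine nets in coordinates adapted to the
   splitting.  Let c < c'.  If the total weight w_n of n-separated sets decayed
   exponentially neither in {S_n <= n c} nor in {S_n >= n c'}, then by
   specification both events would have mass bounded below at every scale and
   every place, and the means of S over dyadic windows would lose a definite
   amount of variance at each doubling.  For c' < gamma_c decay in
   {S_n >= n c'} contradicts the inequality h(mu) + mu(f) <= P(f) for the SRB
   measure, an equilibrium state of zero pressure, and f a small perturbation of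
   ln |dT|E^s| by ln g.  So {S_n <= n c} has exponentially small area, and
   covering it by balls of exponentially small radius gives a dimension below 2.

   Packing dimension.  For t > gamma_min, specification makes the set where
   S_n - n t is unbounded below a dense G_delta.  By Baire, some piece of any
   countable cover of N_t is dense in a ball, and there it contains enough
   separated points to have large packing sums for every s < 2. *)

Require Import Defs.
From HB Require Import structures.
From mathcomp Require Import all_boot all_order all_algebra.
From mathcomp Require Import all_classical all_reals all_analysis.
From mathcomp Require Import ring lra zify measurable_realfun.

Set Implicit Arguments.
Unset Strict Implicit.
Unset Printing Implicit Defensive.

Import Order.TTheory GRing.Theory Num.Theory.
Import numFieldNormedType.Exports.

Local Open Scope classical_set_scope.
Local Open Scope ring_scope.

(** * Calculus in coordinates *)

(** [rdist] is an infimum over curves, awkward for dynamics. The dynamical estimates use [mdist],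
    built from finitely many charts and comparable to [rdist] at small scale. The splitting is only
    shown to be continuous, so the rates at two nearby points cannot be compared with a summable
    error. Distortion is therefore measured against the derivative at the centre of a Bowen ball:
    the maps are C^{1,1}, and the distance to the orbit of the centre decays geometrically from both
    ends of the time interval, so the second-order errors are summable. Area is never constructed.
    r^2 times counting measure on an r-net replaces it, with r finer than all Bowen balls in
    question; disjointness and inclusion of balls then become statements on cardinalities. The
    entropy inequality is Gibbs' inequality for the words of a partition against an explicit mixture
    over orbits of a spanning set. A set of zero area may have dimension 2. The exponential rate
    matters because covering balls of time n have radius about C^{-n}: lowering the exponent below 2
    costs an exponential factor, which the rate must beat. *)

Lemma coord_le_norm (R : realType) m n (M : 'M[R]_(m, n)) i j :
  `|M i j| <= `|M|.
Proof.
rewrite [leRHS]mx_normrE.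
exact: (le_bigmax_cond 0 (fun x : 'I_m * 'I_n => `|M x.1 x.2|) (isT : xpredT (i, j))).
Qed.

Lemma norm_le_coord (R : realType) m n (M : 'M[R]_(m, n)) (K : R) :
  0 <= K -> (forall i j, `|M i j| <= K) -> `|M| <= K.
Proof.
by move=> K0 MK; rewrite [leLHS]mx_normrE; apply: bigmax_le => // -[i j] _; exact: MK.
Qed.

(** Each coordinate of [F] along the segment is a real function of one variable, to which the mean
    value theorem applies. The norm is the sup norm, so the coordinatewise bounds suffice. *)
Lemma segment_mean_value (R : realType) n m (F : 'rV[R]_n -> 'rV[R]_m)
    (y z : 'rV[R]_n) (K : R) :
  (forall s, 0 <= s <= 1 -> differentiable F (z + s *: (y - z)) /\
     `|'d F (z + s *: (y - z)) (y - z)| <= K) ->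
  `|F y - F z| <= K.
Proof.
move=> H.
have K0 : 0 <= K.
  by apply: le_trans (H 0 _).2; [exact: normr_ge0 | rewrite lexx ler01].
apply: norm_le_coord => // i j.
pose q (s : R) : 'rV[R]_n := z + s *: (y - z).
have dq (s : R) : is_diff s q ( *:%R^~ (y - z)).
  have -> : q = (fun s : R => z + s *: (y - z)) by [].
  apply: is_diff_eq; by rewrite add0r.
pose f (s : R) : R := (F (q s)) i j.
have fD (s : R) : 0 <= s <= 1 -> is_derive s 1 f ('d F (q s) (y - z) i j).
  move=> s01; have [dF _] := H s s01.
  have dFq : differentiable (F \o q) s.
    by apply: differentiable_comp => //; case: (dq s).
  have df : differentiable f s.
    exact: (differentiable_comp dFq (differentiable_coord _ i j)).
  apply: DeriveDef; first exact: diff_derivable.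
  rewrite deriveE //.
  have -> : f = (fun M : 'rV[R]_m => M i j) \o (F \o q) by [].
  rewrite diff_comp //; last exact: differentiable_coord.
  rewrite diff_comp; [|by case: (dq s)|by []].
  rewrite /= (_ : 'd q s 1 = y - z); last first.
    by case: (dq s) => _ ->; rewrite scale1r.
  pose c := (fun M : 'rV[R]_m => M i j).
  have cl : linear c by move=> k a b; rewrite /c !mxE.
  pose cL : {linear 'rV[R]_m -> R} :=
    HB.pack c (GRing.isLinear.Build _ _ _ _ c cl).
  have cc : continuous cL by exact: coord_continuous.
  by rewrite (_ : 'd (fun M : 'rV[R]_m => M i j) _ = 'd cL (F (q s))) // diff_lin.
have [| |e e01] := @MVT_segment R f (fun s => 'd F (q s) (y - z) i j) 0 1 ler01.
- by move=> s; rewrite in_itv/= => /andP[a b]; apply: fD; rewrite !ltW.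
- apply: derivable_within_continuous => s; rewrite in_itv/= => s01.
  by have [] := fD s s01.
rewrite subr0 mulr1 /f /q scale0r addr0 scale1r [z + _]addrC subrK => fe.
rewrite !mxE fe.
apply: le_trans (H e _).2; last by move: e01; rewrite in_itv.
exact: coord_le_norm.
Qed.

Lemma nbhs_normr (R : realType) (V : normedModType R) (x : V) (P : V -> Prop) :
  (\forall y \near x, P y) <-> exists2 e : R, 0 < e & forall y, `|y - x| < e -> P y.
Proof.
split=> [/nbhs_ballP[e/= e0 xe]|[e e0 xe]]; last first.
  by apply/nbhs_ballP; exists e => //= y; rewrite -ball_normE/= distrC => /xe.
by exists e => // y yx; apply: xe; rewrite -ball_normE/= distrC.
Qed.

Lemma diff_rowE (R : realType) n m (f : 'rV[R]_n -> 'rV[R]_m) (w v : 'rV[R]_n) :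
  differentiable f w -> 'd f w v = \sum_i v 0 i *: 'D_(delta_mx 0 i) f w.
Proof.
move=> df; rewrite {1}[v]row_sum_delta linear_sum; apply: eq_bigr => i _.
by rewrite linearZ deriveE.
Qed.

Lemma norm_lincomb (R : realType) n (W : normedModType R) (v : 'rV[R]_n)
    (F : 'I_n -> W) (B : R) :
  (forall i, `|F i| <= B) -> `|\sum_i v 0 i *: F i| <= n%:R * B * `|v|.
Proof.
move=> FB; apply: le_trans (ler_norm_sum _ _ _) _.
apply: (@le_trans _ _ (\sum_(i < n) `|v| * B)).
  by apply: ler_sum => i _; rewrite normrZ ler_pM // coord_le_norm.
by rewrite sumr_const card_ord -[leLHS]mulr_natl [`|v| * B]mulrC mulrA.
Qed.

Lemma segment_norm_lt (R : realType) (V : normedModType R) (x y z : V) (e s : R) :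
  0 <= s <= 1 -> `|y - x| < e -> `|z - x| < e -> `|z + s *: (y - z) - x| < e.
Proof.
move=> /andP[s0 s1] yx zx.
have -> : z + s *: (y - z) - x = s *: (y - x) + (1 - s) *: (z - x).
  by rewrite scalerBl scale1r addrCA -scalerBr opprB addrA subrK addrAC.
apply: le_lt_trans (ler_normD _ _) _; rewrite !normrZ ger0_norm // ger0_norm ?subr_ge0 //.
have [->|sn0] := eqVneq s 0; first by rewrite mul0r add0r subr0 mul1r.
rewrite (_ : e = s * e + (1 - s) * e); last by rewrite -mulrDl addrC subrK mul1r.
apply: ltr_leD; first by rewrite ltr_pM2l // lt_neqAle eq_sym sn0.
by rewrite ler_wpM2l ?subr_ge0 // ltW.
Qed.

(** The finitely many partial derivatives are continuous, hence bounded near [x]; balls are convex,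
    so the mean value inequality turns the bound on the differential into a Lipschitz bound. *)
Lemma Ck1_lipschitz_near (R : realType) n m (U : set 'rV[R]_n)
    (g : 'rV[R]_n -> 'rV[R]_m) (x : 'rV[R]_n) :
  open U -> Ck 1 U g -> U x ->
  exists2 K : R, 0 < K & exists2 e : R, 0 < e & forall y, `|y - x| < e ->
    [/\ U y, differentiable g y, forall v, `|'d g y v| <= K * `|v| &
    forall z, `|z - x| < e -> `|g y - g z| <= K * `|y - z|].
Proof.
move=> oU [dg cg] Ux.
have : \forall y \near x, U y /\ forall i : 'I_n,
    `|'D_(delta_mx 0 i) g y| < \sum_(i < n) (`|'D_(delta_mx 0 i) g x| + 1).
  near=> y; split; first by near: y; apply: open_nbhs_nbhs.
  near: y; apply: filter_forall => i.
  have := cg (delta_mx 0 i) x Ux => /cvgr_dist_lt => /(_ 1 ltr01).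
  apply: filterS => y xy; rewrite (bigD1 i) //=.
  apply: ltr_wpDr; first by apply: sumr_ge0 => j _; rewrite addr_ge0.
  rewrite -ltrBlDl; apply: le_lt_trans (lerB_dist _ _) _.
  by rewrite distrC.
move=> /nbhs_normr[e e0 H].
set B := \sum_(i < n) _ in H.
have B0 : 0 <= B by apply: sumr_ge0 => j _; rewrite addr_ge0.
have dB y v : `|y - x| < e -> `|'d g y v| <= (n%:R * B + 1) * `|v|.
  move=> /H[Uy yB]; rewrite diff_rowE; last exact: dg.
  apply: le_trans (norm_lincomb (B := B) _ _) _; first by move=> i; rewrite ltW.
  by rewrite ler_wpM2r // lerDl.
exists (n%:R * B + 1); first by rewrite ltr_wpDl // mulr_ge0.
exists e => // y yx; split.
- by case: (H y yx).
- by apply: dg; case: (H y yx).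
- by move=> v; exact: dB.
move=> z zx; apply: segment_mean_value => s s01.
have szx := segment_norm_lt s01 yx zx.
by split; [apply: dg; case: (H _ szx)|exact: dB].
Unshelve. all: by end_near. Qed.

Lemma CkSW (R : realType) (V W : normedModType R) k (U : set V) (f : V -> W) :
  Ck k.+1 U f -> Ck k U f.
Proof.
elim: k f => [|k IH] f; last by case=> df cf; split=> // v; apply/IH/cf.
by case=> df _ x Ux; apply: differentiable_continuous; exact: df.
Qed.

Lemma diff_sub_linear (R : realType) (V W : normedModType R) (f : V -> W)
    (D : {linear V -> W}) (x v : V) : differentiable f x -> continuous D ->
  differentiable (fun u => f u - D u) x /\
  'd (fun u => f u - D u) x v = 'd f x v - D v.
Proof.
move=> df cD.
pose Df : V -> W := 'd f x; pose DD : V -> W := D.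
have dfx : is_diff x f Df by split.
have dL : is_diff x DD DD.
  by apply: DiffDef; [exact: linear_differentiable | exact: diff_lin].
have [dF eF] : is_diff x (f - DD) (Df - DD) by exact: is_diffB.
by split; [exact: dF | exact: (congr1 (@^~ v) eF)].
Qed.

Lemma diff_dist_le (R : realType) n m (f : 'rV[R]_n -> 'rV[R]_m)
    (x w u : 'rV[R]_n) (B : R) : differentiable f x -> differentiable f w ->
  (forall i, `|'D_(delta_mx 0 i) f x - 'D_(delta_mx 0 i) f w| <= B) ->
  `|'d f x u - 'd f w u| <= n%:R * B * `|u|.
Proof.
move=> dx dw H.
have E := congr2 (fun a b : 'rV[R]_m => `|a - b|) (diff_rowE u dx) (diff_rowE u dw).
rewrite [leLHS]E -sumrB.
by under eq_bigr do rewrite -scalerBr; exact: norm_lincomb.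
Qed.

(** Mean value inequality for [f - 'd f w], whose differential at a point of the segment is
    controlled by the Lipschitz constants of the partial derivatives. The base point [w] is
    independent of [y] and [z]: later it is the centre of a Bowen ball and [y], [z] are two other
    points of the ball. *)
Lemma Ck2_estimate_near (R : realType) n m (U : set 'rV[R]_n)
    (f : 'rV[R]_n -> 'rV[R]_m) (x : 'rV[R]_n) :
  open U -> Ck 2 U f -> U x ->
  exists2 K : R, 0 < K & exists2 e : R, 0 < e & forall w, `|w - x| < e ->
    [/\ U w, differentiable f w, forall v, `|'d f w v| <= K * `|v| &
    forall y z, `|y - x| < e -> `|z - x| < e ->
      `|f y - f z - 'd f w (y - z)|
        <= K * Num.max `|y - w| `|z - w| * `|y - z|].
Proof.
move=> oU Cf Ux; have [df cf] := Cf.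
have [K0 K00 [e0 e00 H0]] := Ck1_lipschitz_near oU (CkSW Cf) Ux.
have /choice[K1 /choice[e1 H1]] : forall i : 'I_n, exists K e : R,
    [/\ 0 < K, 0 < e & forall y z, `|y - x| < e -> `|z - x| < e ->
    `|'D_(delta_mx 0 i) f y - 'D_(delta_mx 0 i) f z| <= K * `|y - z|].
  move=> i; have [K K_gt0 [e e_gt0 H]] := Ck1_lipschitz_near oU (cf (delta_mx 0 i)) Ux.
  by exists K, e; split=> // y z yx zx; case: (H y yx) => _ _ _; exact.
have /nbhs_normr[e e_gt0 He] : \forall y \near x, `|y - x| < e0 /\ forall i, `|y - x| < e1 i.
  have near_lt r : 0 < r -> \forall y \near x, `|y - x| < r.
    by move=> r0; apply/nbhs_normr; exists r.
  have ne1 : \forall y \near x, forall i, `|y - x| < e1 i.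
    by apply: (@filter_forall _ _ (fun i y => `|y - x| < e1 i) (nbhs x) _) => i; apply: near_lt; case: (H1 i).
  by apply: filterS2 (near_lt _ e00) ne1 => y.
pose B := \sum_(i < n) K1 i.
have K1B i : K1 i <= B.
  by rewrite /B (bigD1 i) //= lerDl sumr_ge0 // => j _; case: (H1 j) => /ltW.
have B0 : 0 <= B by apply: sumr_ge0 => j _; case: (H1 j) => /ltW.
exists (n%:R * B + K0); first by rewrite ltr_wpDl // mulr_ge0.
exists e => // w wx; have [Uw dw dwK _] := H0 w (He _ wx).1; split=> //.
  by move=> v; apply: le_trans (dwK v) _; rewrite ler_wpM2r // lerDr mulr_ge0.
move=> y z yx zx.
have cD : continuous 'd f w by apply: diff_continuous.
have -> : f y - f z - 'd f w (y - z) = (f y - 'd f w y) - (f z - 'd f w z).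
  by rewrite linearB !opprB addrACA [RHS]addrACA [- f z + _]addrC.
apply: (@segment_mean_value _ _ _ (fun u => f u - 'd f w u)) => s s01.
set xi := z + s *: (y - z).
have xix : `|xi - x| < e by exact: segment_norm_lt.
have dxi : differentiable f xi by case: (H0 _ (He _ xix).1).
have [dF eF] := diff_sub_linear (y - z) dxi cD.
split; first exact: dF.
have xiw : `|xi - w| <= Num.max `|y - w| `|z - w|.
  (* Convexity of the open ball around [w] whose radius would be the distance of [xi] itself: [xi]
     would be strictly closer to [w] than it is. *)
  rewrite leNgt; apply/negP => lt.
  have : `|xi - w| < `|xi - w|; last by rewrite ltxx.
  by apply: segment_norm_lt => //; apply: le_lt_trans lt; rewrite le_max lexx ?orbT.
have Hi i : `|'D_(delta_mx 0 i) f xi - 'D_(delta_mx 0 i) f w|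
    <= B * Num.max `|y - w| `|z - w|.
  have [_ _ H] := H1 i; apply: le_trans (H _ _ _ _) _.
  - exact: (He _ xix).2.
  - exact: (He _ wx).2.
  by rewrite ler_pM // ltW //; case: (H1 i).
have eqle (a b c : R) : a = b -> b <= c -> a <= c by move=> ->.
apply: (eqle _ _ _ (congr1 Num.norm eF)); apply: le_trans (diff_dist_le _ dxi dw Hi) _.
rewrite mulrA ler_wpM2r // ler_wpM2r ?lerDl ?(ltW K00) //.
Qed.

(** * Charts, and second-order estimates uniform over finitely many charts *)

Section ChartBasics.
Variables (R : realType) (n : nat) (M : topologicalType) (c : chart R n M).
Hypothesis cc : is_chart c.

Lemma chart_dom_open : open (cdom c). Proof. by case: cc. Qed.

Lemma chart_imgK xi : cimg c xi -> cdom c (cinv c xi) /\ cfun c (cinv c xi) = xi.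
Proof. by case: cc => _ _ K _ _ [p cp <-]; rewrite K. Qed.

Lemma chart_domK p : cdom c p -> cimg c (cfun c p) /\ cinv c (cfun c p) = p.
Proof. by case: cc => _ _ K _ _ cp; split; [exists p | exact: K]. Qed.

Lemma chart_cts p : cdom c p -> {for p, continuous (cfun c)}.
Proof.
case: cc => oD _ _ cD _ cp.
by have := cD; rewrite continuous_open_subspace // => /(_ p); rewrite inE; exact.
Qed.

Lemma chart_inv_cts xi : cimg c xi -> {for xi, continuous (cinv c)}.
Proof.
case: cc => _ oD _ _ cD cp.
by have := cD; rewrite continuous_open_subspace // => /(_ xi); rewrite inE; exact.
Qed.

Lemma chart_image_open (O : set M) : open O -> open (cfun c @` (cdom c `&` O)).
Proof.
move=> oO.
have -> : cfun c @` (cdom c `&` O) = cimg c `&` cinv c @^-1` O.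
  apply/seteqP; split=> [_ [p [cp Op] <-]|xi [xic Oxi]] /=.
    by have [? ->] := chart_domK cp; split.
  by have [? e] := chart_imgK xic; exists (cinv c xi).
rewrite openE => xi [xic Oxi]; rewrite /interior.
apply: filterI; first by apply: open_nbhs_nbhs; split=> //; case: cc.
by apply: (chart_inv_cts xic); exact: open_nbhs_nbhs.
Qed.

Lemma chart_near p e : cdom c p -> 0 < e ->
  \forall q \near p, cdom c q /\ `|cfun c q - cfun c p| < e.
Proof.
move=> cp e0; apply: filterI.
  by apply: open_nbhs_nbhs; split=> //; exact: chart_dom_open.
have := chart_cts cp => /cvgr_dist_lt /(_ e e0).
by apply: filterS => q; rewrite distrC.
Qed.

Lemma chart_nbhs p (P : M -> Prop) : cdom c p -> (\forall q \near p, P q) ->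
  exists2 e : R, 0 < e & forall q, cdom c q -> `|cfun c q - cfun c p| < e -> P q.
Proof.
move=> cp Pp; have [cp' pK] := chart_domK cp.
have /(_ P) := chart_inv_cts cp'; rewrite pK => /(_ Pp) /nbhs_normr[e e0 H].
by exists e => // q cq /H; rewrite /= (chart_domK cq).2.
Qed.

End ChartBasics.

Section FiniteCharts.
Variables (R : realType) (n : nat) (M : ptopologicalType).
Variable X : riemannian_manifold R n M.

(** The balls of radius [fc_rad] cover, while the charts reach three times as far. The margin keeps
    everything near a point inside the chart chosen for that point. *)
Record finite_charts := FiniteCharts {
  fc_size : nat ;
  fc : 'I_fc_size -> chart R n M ;
  fc_ctr : 'I_fc_size -> 'rV[R]_n ;
  fc_rad : 'I_fc_size -> R ;
  fc_atlas : forall k, atlas X (fc k) ;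
  fc_rad_gt0 : forall k, 0 < fc_rad k ;
  fc_img : forall k xi, `|xi - fc_ctr k| <= 3 * fc_rad k -> cimg (fc k) xi ;
  fc_cover : forall x, exists k,
    cdom (fc k) x /\ `|cfun (fc k) x - fc_ctr k| < fc_rad k }.

Hypothesis cM : compact [set: M].

Lemma finite_charts_exist : inhabited finite_charts.
Proof.
have cat p := atlas_chart (chart_at_atlas X p).
have /choice[r Hr] : forall p, exists r : R, 0 < r /\
    forall xi, `|xi - cfun (chart_at X p) p| <= 3 * r -> cimg (chart_at X p) xi.
  move=> p; have [ip _] := chart_domK (cat p) (chart_at_dom X p).
  have : nbhs (cfun (chart_at X p) p) (cimg (chart_at X p)).
    by apply: open_nbhs_nbhs; split=> //; case: (cat p).
  move=> /nbhs_normr[e e0 H]; exists (e / 4); split; first by rewrite divr_gt0.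
  by move=> xi xie; apply: H; apply: le_lt_trans xie _; lra.
pose V p : set M := [set q | cdom (chart_at X p) q /\
  `|cfun (chart_at X p) q - cfun (chart_at X p) p| < r p].
have oV p : [set: M] p -> open (V p).
  move=> _; rewrite openE => q [cq qp]; rewrite /interior.
  have : 0 < r p - `|cfun (chart_at X p) q - cfun (chart_at X p) p| by rewrite subr_gt0.
  move=> /(chart_near (cat p) cq); apply: filterS => q' [cq' q'q]; split=> //.
  rewrite -(subrK (cfun (chart_at X p) q) (cfun _ q')) -addrA.
  by apply: le_lt_trans (ler_normD _ _) _; rewrite -ltrBrDr.
have := cM; rewrite compact_cover.
move=> /(_ _ setT V oV)[|D _ DV].
  by move=> p _; exists p => //; split; [exact: chart_at_dom | rewrite subrr normr0; case: (Hr p)].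
pose s := finmap.enum_fset D.
pose p k := tnth (in_tuple s) k.
apply: inhabits; apply: (@FiniteCharts (size s) (fun k => chart_at X (p k))
  (fun k => cfun (chart_at X (p k)) (p k)) (fun k => r (p k))).
- by move=> k; exact: chart_at_atlas.
- by move=> k; case: (Hr (p k)).
- by move=> k; case: (Hr (p k)).
- move=> x; have [q Dq Vq] := DV x I.
  have qs : (index q s < size s)%N by rewrite index_mem.
  exists (Ordinal qs); rewrite (_ : p _ = q) //.
  by rewrite /p (tnth_nth q)/= nth_index.
Qed.

End FiniteCharts.

Section UniformC11.
Variables (R : realType) (n : nat) (M : ptopologicalType).
Variable X : riemannian_manifold R n M.

Definition chart_diff (c c' : chart R n M) (F : M -> M) (w : M) :=
  'd (cfun c' \o F \o cinv c) (cfun c w).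

Lemma Ck_map_id k : Ck_map X k id.
Proof.
split=> [x|c c' ac ac']; first exact: cvg_id.
exact: (atlas_compatible k ac ac').
Qed.

Lemma local_C11 (F : M -> M) (c c' : chart R n M) (x : M) :
  Ck_map X 2 F -> atlas X c -> atlas X c' -> cdom c x -> cdom c' (F x) ->
  exists2 K : R, 0 < K & exists2 e : R, 0 < e &
  forall w, cdom c w -> `|cfun c w - cfun c x| < e ->
  [/\ cdom c' (F w), differentiable (cfun c' \o F \o cinv c) (cfun c w),
      forall v, `|chart_diff c c' F w v| <= K * `|v| &
      forall y z, cdom c y -> cdom c z ->
        `|cfun c y - cfun c x| < e -> `|cfun c z - cfun c x| < e ->
        `|cfun c' (F y) - cfun c' (F z)
          - chart_diff c c' F w (cfun c y - cfun c z)|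
        <= K * Num.max `|cfun c y - cfun c w| `|cfun c z - cfun c w|
           * `|cfun c y - cfun c z|].
Proof.
move=> [cF CF] ac ac' cx c'Fx.
have cc := atlas_chart ac; have cc' := atlas_chart ac'.
have oU : open (cfun c @` (cdom c `&` F @^-1` cdom c')).
  apply: (chart_image_open cc); apply: open_comp => [y _|]; first exact: cF.
  exact: chart_dom_open.
have Ux : (cfun c @` (cdom c `&` F @^-1` cdom c')) (cfun c x) by exists x.
have [K K0 [e e0 H]] := Ck2_estimate_near oU (CF c c' ac ac') Ux.
exists K => //; exists e => // w cw wx.
have [Uw dw dK HK] := H _ wx; split=> //.
  have [p [cp cFp] e1] := Uw.
  by rewrite -[w](chart_domK cc cw).2 -e1 (chart_domK cc cp).2.
move=> y z cy cz yx zx; have := HK _ _ yx zx.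
by rewrite /= (chart_domK cc cy).2 (chart_domK cc cz).2.
Qed.

(** One number [K] bounds the derivative and the second-order error, and [K^-1] is the radius of
    validity. Every clause weakens as [K] grows, which is what a compactness argument needs. *)
Definition C11_bound (K : R) (c c' : chart R n M) (F : M -> M) (w : M) :=
  [/\ differentiable (cfun c' \o F \o cinv c) (cfun c w),
      forall v, `|chart_diff c c' F w v| <= K * `|v|,
      forall y, cdom c y -> `|cfun c y - cfun c w| < K^-1 -> cdom c' (F y) &
      forall y z, cdom c y -> cdom c z ->
        `|cfun c y - cfun c w| < K^-1 -> `|cfun c z - cfun c w| < K^-1 ->
        `|cfun c' (F y) - cfun c' (F z)
          - chart_diff c c' F w (cfun c y - cfun c z)|
        <= K * Num.max `|cfun c y - cfun c w| `|cfun c z - cfun c w|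
           * `|cfun c y - cfun c z|].

Variable A : finite_charts X.

Definition reg (k : 'I_(fc_size A)) (l : R) : set M :=
  [set x | cdom (fc k) x /\ `|cfun (fc k) x - fc_ctr k| <= l * fc_rad k].

Lemma reg_le k l l' x : l <= l' -> reg k l x -> reg k l' x.
Proof.
move=> ll' [cx xl]; split=> //; apply: le_trans xl _.
by rewrite ler_wpM2r // ltW // fc_rad_gt0.
Qed.

Lemma fc_chart (k : 'I_(fc_size A)) : is_chart (fc k).
Proof. exact: (atlas_chart (fc_atlas k)). Qed.

(** The region is the image of a closed coordinate ball, which is compact and lies in the image of
    the chart; compact subsets of a Hausdorff space are closed. *)
Lemma reg_closed k l : l <= 3 -> closed (reg k l).
Proof.
move=> l3; apply: (compact_closed (manifold_hausdorff X)).
pose B : set 'rV[R]_n := [set xi | `|xi - fc_ctr k| <= l * fc_rad k].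
have Bimg xi : B xi -> cimg (fc k) xi.
  move=> Bxi; apply: fc_img; apply: le_trans Bxi _.
  by rewrite ler_wpM2r // ltW // fc_rad_gt0.
have -> : reg k l = cinv (fc k) @` B.
  apply/seteqP; split=> [x [cx xl]|_ [xi Bxi <-]].
    by exists (cfun (fc k) x) => //; exact: (chart_domK (fc_chart k) cx).2.
  by have [c1 c2] := chart_imgK (fc_chart k) (Bimg _ Bxi); split=> //; rewrite c2.
apply: continuous_compact.
  apply: continuous_in_subspaceT => xi /set_mem Bxi.
  exact: (chart_inv_cts (fc_chart k) (Bimg _ Bxi)).
apply: bounded_closed_compact.
  exists (l * fc_rad k + `|fc_ctr k|); split; first exact: num_real.
  move=> r lr xi Bxi; rewrite -(subrK (fc_ctr k) xi).
  by apply: le_trans (ler_normD _ _) (le_trans _ (ltW lr)); rewrite lerD2r.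
have -> : B = (fun xi => `|xi - fc_ctr k|) @^-1` [set r | r <= l * fc_rad k] by [].
apply: closed_comp => [xi _|]; last exact: closed_le.
apply: (@cvg_norm _ _ _ (nbhs xi) _ (fun xi => xi - fc_ctr k)).
exact: (@cvgB _ _ _ (nbhs xi) _ id (cst (fc_ctr k)) _ _ cvg_id (cvg_cst _)).
Qed.

Hypothesis cM : compact [set: M].

Lemma near_not_reg (F : M -> M) (k : 'I_(fc_size A)) l x : continuous F -> l <= 3 ->
  ~ reg k l (F x) -> \forall w \near x, ~ reg k l (F w).
Proof.
move=> cF l3 nx; apply: (cF x (~` reg k l)); apply: open_nbhs_nbhs; split=> //.
by apply: closed_openC; exact: reg_closed.
Qed.

(** Local bounds are glued by compactness, with [K] tending to infinity. At a point outside one of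
    the regions the claim holds nearby for free, since the regions are closed and their complements
    are neighbourhoods. *)
Lemma uniform_C11 (F : M -> M) : Ck_map X 2 F ->
  exists2 K : R, 1 <= K & forall (k j : 'I_(fc_size A)) w, reg k 2 w -> reg j 2 (F w) ->
    C11_bound K (fc k) (fc j) F w.
Proof.
move=> CF; have [cF _] := CF.
have le23 : 2 <= 3 :> R by rewrite ler_nat.
pose P (K : R) (w : M) := forall kj : 'I_(fc_size A) * 'I_(fc_size A),
  reg kj.1 2 w -> reg kj.2 2 (F w) -> C11_bound K (fc kj.1) (fc kj.2) F w.
have Ploc x : [set: M] x -> \forall w \near x & K \near +oo, P K w.
  move=> _.
  apply: (@filter_forall _ _ (fun kj Kw => reg kj.1 2 Kw.1 -> reg kj.2 2 (F Kw.1) ->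
     C11_bound Kw.2 (fc kj.1) (fc kj.2) F Kw.1)
     (filter_prod (nbhs x) (pinfty_nbhs R)) _) => -[k j] /=.
  have [rk|nrk] := pselect (reg k 2 x); last first.
    have H := near_not_reg (F := id) (fun x => cvg_id) le23 nrk.
    by exists ([set w | ~ reg k 2 w], setT); [split=> //; exact: filterT|move=> [w K] [/= h _] /h].
  have [rj|nrj] := pselect (reg j 2 (F x)); last first.
    have H := near_not_reg cF le23 nrj.
    by exists ([set w | ~ reg j 2 (F w)], setT); [split=> //; exact: filterT|move=> [w K] [/= h _] _ /h].
  have [K0 K00 [e e0 H]] := local_C11 CF (fc_atlas k) (fc_atlas j) rk.1 rj.1.
  exists ([set w | cdom (fc k) w /\ `|cfun (fc k) w - cfun (fc k) x| < e / 2],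
          [set K | Num.max K0 (2 / e) < K]).
    split; first by apply: (chart_near (fc_chart k) rk.1); rewrite divr_gt0.
    by apply: nbhs_pinfty_gt; exact: num_real.
  move=> [w K] [/= [cw wx]]; rewrite gt_max => /andP[K0K eK] _ _.
  have K_gt0 : 0 < K by apply: lt_trans K0K.
  have Ke : K^-1 < e / 2 by rewrite -[e / 2]invrK ltf_pV2 ?posrE ?invr_gt0 ?divr_gt0 // invf_div.
  have wxe : `|cfun (fc k) w - cfun (fc k) x| < e by lra.
  have tr y : `|cfun (fc k) y - cfun (fc k) w| < K^-1 ->
      `|cfun (fc k) y - cfun (fc k) x| < e.
    move=> yw; rewrite -(subrK (cfun (fc k) w) (cfun _ y)) -addrA.
    by apply: le_lt_trans (ler_normD _ _) _; lra.
  have [cFw dw dK HK] := H w cw wxe; split=> //.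
  - by move=> v; apply: le_trans (dK v) _; rewrite ler_wpM2r // ltW.
  - by move=> y cy /tr yx; have [] := H y cy yx.
  - move=> y z cy cz /tr yx /tr zx; apply: le_trans (HK _ _ cy cz yx zx) _.
    apply: ler_wpM2r => //; apply: ler_wpM2r; last exact: ltW.
    by rewrite le_max normr_ge0.
have /compact_near_coveringP/(_ _ (+oo : set_system R) P _ Ploc) PK := cM.
have [K [K1 PK']] : exists K, 1 <= K /\ [set: M] `<=` P K.
  have : \forall K \near +oo, 1 <= K /\ [set: M] `<=` P K.
    by apply: filterI => //; apply: nbhs_pinfty_ge; exact: num_real.
  by move=> /filter_ex[K HK]; exists K.
by exists K => // k j w; exact: (PK' w I (k, j)).
Qed.

End UniformC11.

(** * A metric adapted to finitely many charts *)

Lemma min_dist_le (R : realDomainType) (a u v : R) :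
  `|Num.min a u - Num.min a v| <= `|u - v|.
Proof.
by rewrite /Num.min; case: ifPn => ?; case: ifPn => ?;
  rewrite ler_norml; case: (ler0P (u - v)) => ?; apply/andP; split; lra.
Qed.

Section Metric.
Variables (R : realType) (n : nat) (M : ptopologicalType).
Variables (X : riemannian_manifold R n M) (A : finite_charts X).

Definition lip_fun : set (M -> R) :=
  [set f | (forall x, 0 <= f x <= 1) /\
    forall (k : 'I_(fc_size A)) p q, reg k 2 p -> reg k 2 q ->
      `|f p - f q| <= `|cfun (fc k) p - cfun (fc k) q|].

(* The largest metric bounded by 1 which does not exceed the coordinate
   distance of any of the finitely many charts. *)
Definition mdist (p q : M) : R := sup [set `|f p - f q| | f in lip_fun].

Lemma lip_fun_dist1 f p q : lip_fun f -> `|f p - f q| <= 1.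
Proof.
move=> [f01 _]; have /andP[a b] := f01 p; have /andP[c d] := f01 q.
by rewrite ler_norml; apply/andP; split; lra.
Qed.

Lemma mdist_sup p q : has_sup [set `|f p - f q| | f in lip_fun].
Proof.
split; last by exists 1 => _ [f Lf <-]; exact: lip_fun_dist1.
exists `|(0 : R) - 0|; exists (fun=> 0) => //; split=> [x|k p' q' _ _].
  by rewrite lexx ler01.
by rewrite subrr normr0.
Qed.

Lemma lip_fun_le f p q : lip_fun f -> `|f p - f q| <= mdist p q.
Proof. by move=> Lf; apply: (sup_upper_bound (mdist_sup p q)); exists f. Qed.

Lemma mdist_le p q (B : R) :
  (forall f, lip_fun f -> `|f p - f q| <= B) -> mdist p q <= B.
Proof.
move=> H; apply: ge_sup; first by case: (mdist_sup p q).
by move=> _ [f Lf <-]; exact: H.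
Qed.

Lemma mdist_ge0 p q : 0 <= mdist p q.
Proof.
have [[_ [f Lf _]] _] := mdist_sup p q.
exact: le_trans (normr_ge0 _) (lip_fun_le p q Lf).
Qed.

Lemma mdist_le1 p q : mdist p q <= 1.
Proof. by apply: mdist_le => f; exact: lip_fun_dist1. Qed.

Lemma mdistxx p : mdist p p = 0.
Proof.
by apply/eqP; rewrite eq_le mdist_ge0 andbT; apply: mdist_le => f _; rewrite subrr normr0.
Qed.

Lemma mdistC p q : mdist p q = mdist q p.
Proof.
by apply/eqP; rewrite eq_le; apply/andP; split; apply: mdist_le => f Lf;
  rewrite distrC; exact: lip_fun_le.
Qed.

Lemma mdist_triangle q p r : mdist p r <= mdist p q + mdist q r.
Proof.
apply: mdist_le => f Lf; rewrite -(subrK (f q) (f p)) -addrA.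
by apply: le_trans (ler_normD _ _) (lerD _ _); exact: lip_fun_le.
Qed.

Lemma mdist_chart_le (k : 'I_(fc_size A)) p q : reg k 2 p -> reg k 2 q ->
  mdist p q <= `|cfun (fc k) p - cfun (fc k) q|.
Proof. by move=> pk qk; apply: mdist_le => f [_ /(_ _ _ _ pk qk)]. Qed.

Lemma fc_rad_bounds : exists2 B : R, 1 <= B &
  forall k : 'I_(fc_size A), B^-1 <= fc_rad k <= B.
Proof.
pose S := \sum_(k < fc_size A) (fc_rad k + (fc_rad k)^-1).
have S0 (j : 'I_(fc_size A)) : 0 <= fc_rad j + (fc_rad j)^-1.
  by rewrite addr_ge0 // ?invr_ge0 ltW // fc_rad_gt0.
have S_ge0 : 0 <= S by apply: sumr_ge0.
exists (1 + S) => [|k]; first by rewrite lerDl.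
have kS : fc_rad k + (fc_rad k)^-1 <= S.
  by rewrite /S (bigD1 k) //= lerDl; apply: sumr_ge0.
have rk := fc_rad_gt0 k; have rki : 0 < (fc_rad k)^-1 by rewrite invr_gt0.
apply/andP; split; last by lra.
by rewrite invf_ple ?posrE //; lra.
Qed.

Hypothesis cM : compact [set: M].

(** A lower bound for a supremum needs one good test function. The constant [c] absorbs the
    Lipschitz constant [K + 1] of the transition maps and the extreme values of the radii. *)
Lemma mdist_chart_ge : exists2 c : R, 0 < c &
  forall (k : 'I_(fc_size A)) p q, reg k (3 / 2) p -> mdist p q < c ->
    reg k 2 q /\ c * `|cfun (fc k) p - cfun (fc k) q| <= mdist p q.
Proof.
have [K K1 HK] := uniform_C11 A cM (Ck_map_id X 2).
have [B B1 HB] := fc_rad_bounds.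
pose c := ((K + 1) * B)^-1.
have B0 : 0 < B by lra.
have K0 : 0 < K by lra.
have K10 : 0 < K + 1 by lra.
have c0 : 0 < c by rewrite invr_gt0 mulr_gt0.
have cK1 : c * (K + 1) <= 1.
  rewrite /c invfM -mulrA [_ * (K + 1)]mulrC mulrA mulVf ?mul1r ?gt_eqF //.
  by rewrite invf_le1.
have cB : c * B = (K + 1)^-1 by rewrite /c invfM -mulrA mulVf ?mulr1 ?gt_eqF.
have c1 : c <= 1 by apply: le_trans cK1; rewrite ler_pMr //; lra.
have crad (k : 'I_(fc_size A)) : 0 < c * (fc_rad k / 2) < K^-1 /\ c * (fc_rad k / 2) <= 1.
  have /andP[_ kB] := HB k; have rk := fc_rad_gt0 k.
  have h : c * (fc_rad k / 2) < (K + 1)^-1.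
    by rewrite -cB ltr_pM2l //; lra.
  split; last by apply: le_trans (ltW h) _; rewrite invf_le1 //; lra.
  apply/andP; split; first by rewrite mulr_gt0 //; lra.
  by apply: lt_trans h _; rewrite ltf_pV2 ?posrE //; lra.
have near_lip (j k : 'I_(fc_size A)) p q : reg j 2 p -> reg j 2 q -> reg k 2 p ->
    `|cfun (fc j) p - cfun (fc j) q| < K^-1 ->
    cdom (fc k) q /\ c * `|cfun (fc k) p - cfun (fc k) q| <= `|cfun (fc j) p - cfun (fc j) q|.
  move=> jp jq kp pq; have [_ dK cq] := HK j k p jp kp.
  move=> /(_ p q jp.1 jq.1); rewrite subrr normr0 invr_gt0 K0.
  rewrite [`|_ q - _ p|]distrC => /(_ isT pq); rewrite maxEle normr_ge0 => H.
  split; first by apply: cq; [exact: jq.1|rewrite distrC].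
  set D := `|cfun (fc j) p - cfun (fc j) q| in H pq *.
  have D0 : 0 <= D by rewrite /D.
  have : `|cfun (fc k) p - cfun (fc k) q| <= (K + 1) * D.
    have -> : cfun (fc k) p - cfun (fc k) q = (cfun (fc k) p - cfun (fc k) q -
      chart_diff (fc j) (fc k) id p (cfun (fc j) p - cfun (fc j) q)) +
      chart_diff (fc j) (fc k) id p (cfun (fc j) p - cfun (fc j) q) by rewrite subrK.
    apply: le_trans (ler_normD _ _) _; rewrite mulrDl addrC lerD //; apply: le_trans H _.
    by rewrite ler_wpM2r // -(@mulfV _ K) ?gt_eqF // ler_wpM2l // ltW.
  move=> h; apply: (@le_trans _ _ (c * ((K + 1) * D))); first by rewrite ler_wpM2l // ltW.
  by rewrite mulrA -[leRHS]mul1r ler_wpM2r.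
have cB1 : c / (2 * B) <= c.
  by rewrite ler_pdivrMr ?ler_pMr ?mulr_gt0 //; lra.
exists (c / (2 * B)); first by rewrite divr_gt0 // mulr_gt0.
move=> k p q kp pq.
(* Coordinate distance to [p], cut off at half the radius and scaled by [c]. It is constant outside
   the region of the chart, and being at most [c * (fc_rad k / 2) < K^-1] it satisfies the Lipschitz
   condition trivially for points at coordinate distance [K^-1] or more. *)
pose f y := if `[< cdom (fc k) y >] then
   c * Num.min (fc_rad k / 2) `|cfun (fc k) p - cfun (fc k) y| else c * (fc_rad k / 2).
have /andP[Bk kB] := HB k; have rk := fc_rad_gt0 k.
have min_itv y : 0 <= Num.min (fc_rad k / 2) `|cfun (fc k) p - cfun (fc k) y| <= fc_rad k / 2.
  by rewrite le_min normr_ge0 andbT ge_min lexx /= andbT; lra.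
have f_itv y : 0 <= f y <= c * (fc_rad k / 2).
  rewrite /f; have /andP[m0 m1] := min_itv y; case: ifP => _; last first.
    by rewrite lexx andbT mulr_ge0 //; lra.
  by rewrite mulr_ge0 ?(ltW c0) // ler_wpM2l // ltW.
have f_in y : cdom (fc k) y ->
    f y = c * Num.min (fc_rad k / 2) `|cfun (fc k) p - cfun (fc k) y|.
  by move=> cy; rewrite /f; case: asboolP.
have f_out y : ~ reg k 2 y -> f y = c * (fc_rad k / 2).
  move=> ny; rewrite /f; case: ifPn => // /asboolP cy.
  congr (c * _); apply/min_idPl; rewrite leNgt; apply/negP => h; apply: ny; split=> //.
  rewrite -(subrK (cfun (fc k) p) (cfun _ y)) -addrA.
  apply: le_trans (ler_normD _ _) _; rewrite distrC.
  by have := kp.2; lra.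
have f_lip y z (j : 'I_(fc_size A)) : reg j 2 y -> reg j 2 z -> reg k 2 y ->
    `|cfun (fc j) y - cfun (fc j) z| < K^-1 ->
    `|f y - f z| <= `|cfun (fc j) y - cfun (fc j) z|.
  move=> jy jz ky yz; have [cz] := near_lip _ _ _ _ jy jz ky yz.
  apply: le_trans; rewrite (f_in _ ky.1) (f_in _ cz) -mulrBr normrM (ger0_norm (ltW c0)).
  rewrite ler_wpM2l ?(ltW c0) //; apply: le_trans (min_dist_le _ _ _) _.
  by apply: le_trans (ler_dist_dist _ _) _; rewrite opprB addrC addrA subrK distrC.
have Lf : lip_fun f.
  split=> [y|j y z jy jz].
    by have /andP[a b] := f_itv y; rewrite a (le_trans b) // (crad k).2.
  have [yz|yz] := ltP `|cfun (fc j) y - cfun (fc j) z| K^-1; last first.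
    apply: le_trans yz; have /andP[_ /ltW h] := (crad k).1; apply: le_trans h.
    have /andP[y0 y1] := f_itv y; have /andP[z0 z1] := f_itv z.
    by rewrite ler_norml; apply/andP; split; lra.
  have [ky|ky] := pselect (reg k 2 y); first exact: f_lip.
  have [kz|kz] := pselect (reg k 2 z).
    by rewrite distrC [leRHS]distrC; apply: f_lip => //; rewrite distrC.
  by rewrite !f_out // subrr normr0.
have fp : f p = 0.
  by rewrite (f_in _ kp.1) subrr normr0 min_r ?mulr0 //; lra.
have := lip_fun_le p q Lf; rewrite fp sub0r normrN ger0_norm; last by have /andP[] := f_itv q.
move=> fq.
have cr : c / (2 * B) <= c * (fc_rad k / 2).
  by rewrite invfM [_^-1 / _]mulrC ler_pM2l // ler_pM2r // invr_gt0.
have fqlt : f q < c * (fc_rad k / 2) by apply: le_lt_trans fq (lt_le_trans pq cr).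
have kq : reg k 2 q.
  by apply: contrapT => /f_out fqE; move: fqlt; rewrite fqE ltxx.
split=> //; move: fq fqlt; rewrite (f_in _ kq.1) ltr_pM2l // => fq.
rewrite gt_min ltxx /= => /ltW/min_r h; rewrite h in fq.
by apply: le_trans _ fq; rewrite ler_wpM2r.
Qed.

Lemma mdist_nbhs p (P : M -> Prop) : (\forall q \near p, P q) <->
  exists2 e : R, 0 < e & forall q, mdist p q < e -> P q.
Proof.
have [k [cp kp]] := fc_cover A p.
have kp1 : reg k (3 / 2) p.
  by split=> //; have := fc_rad_gt0 k; lra.
split=> [Pp|[e e0 H]].
  have [c c0 Hc] := mdist_chart_ge.
  have [e e0 He] := chart_nbhs (fc_chart k) cp Pp.
  exists (c * Num.min 1 e); first by rewrite mulr_gt0 // lt_min ltr01.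
  move=> q pq; have pqc : mdist p q < c.
    by apply: lt_le_trans pq _; rewrite ler_piMr ?ge_min ?lexx // ltW.
  have [kq h] := Hc k p q kp1 pqc; apply: He; first by case: kq.
  have := le_lt_trans h pq; rewrite ltr_pM2l // lt_min => /andP[_].
  by rewrite distrC.
have d0 : 0 < Num.min e (fc_rad k / 2) by rewrite lt_min e0 divr_gt0 // fc_rad_gt0.
apply: filterS (chart_near (fc_chart k) cp d0) => q [cq].
rewrite lt_min => /andP[qe qr]; apply: H; apply: le_lt_trans qe.
rewrite distrC; apply: mdist_chart_le.
  by apply: (reg_le _ kp1); lra.
split=> //; rewrite -(subrK (cfun (fc k) p) (cfun _ q)) -addrA.
by apply: le_trans (ler_normD _ _) _; have := fc_rad_gt0 k; lra.
Qed.

End Metric.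

(** * Linear approximation, the chain rule in charts, and local coordinates *)

Lemma differentiable_dist (R : numFieldType) (V W : normedModType R) (f : V -> W) x :
  differentiable f x -> forall e : R, 0 < e ->
  \forall h \near (0 : V), `|f (h + x) - f x - 'd f x h| <= e * `|h|.
Proof.
move=> /diff_locally /eqaddoP H e e0; have := H e e0.
by apply: filterS => h; rewrite !fctE/= opprD addrA.
Qed.

Lemma differentiable_intro (R : numFieldType) (V W : normedModType R) (f : V -> W)
    (L : {linear V -> W}) x : continuous L ->
  (forall e : R, 0 < e -> \forall h \near (0 : V), `|f (h + x) - f x - L h| <= e * `|h|) ->
  differentiable f x /\ 'd f x = L :> (V -> W).
Proof.
move=> cL H.
have E : f \o shift x = cst (f x) + L +o_ 0 id.
  apply/eqaddoP => e e0; have := H e e0.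
  by apply: filterS => h; rewrite !fctE/= opprD addrA.
have dE := diff_unique cL E; split=> //.
by apply/diff_locallyP; rewrite dE.
Qed.

Lemma near_eq_diff (R : numFieldType) (V W : normedModType R) (f g : V -> W) x :
  (\forall y \near x, f y = g y) -> differentiable f x ->
  differentiable g x /\ 'd g x = 'd f x :> (V -> W).
Proof.
move=> fg df; apply: differentiable_intro => [|e e0]; first exact: diff_continuous.
have fgx : f x = g x by exact: nbhs_singleton fg.
have : \forall h \near (0 : V), f (h + x) = g (h + x).
  by move: fg; rewrite (near_shift 0 x)/= subr0.
by apply: filterS2 (differentiable_dist df e0) => h; rewrite fgx => + <-.
Qed.

Section ChainRule.
Variables (R : realType) (n : nat) (M : ptopologicalType).
Implicit Types c : chart R n M.

Definition chart_smooth c c' (F : M -> M) (x : M) :=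
  differentiable (cfun c' \o F \o cinv c) (cfun c x).

(** Inserting the intermediate chart [c2] changes the composite only where [c2] is not defined, and
    continuity of [F] keeps that away from [x]; the usual chain rule then applies to the local
    representatives. *)
Lemma chart_diff_comp (F G : M -> M) c1 c2 c3 x : is_chart c1 -> is_chart c2 ->
  {for x, continuous F} -> cdom c1 x -> cdom c2 (F x) ->
  chart_smooth c1 c2 F x -> chart_smooth c2 c3 G (F x) ->
  chart_smooth c1 c3 (G \o F) x /\
  forall v, chart_diff c1 c3 (G \o F) x v
            = chart_diff c2 c3 G (F x) (chart_diff c1 c2 F x v).
Proof.
move=> h1 h2 cF cx cFx dF dG.
have [xi xK] := chart_domK h1 cx.
pose f := cfun c2 \o F \o cinv c1; pose g := cfun c3 \o G \o cinv c2.
have fE : f (cfun c1 x) = cfun c2 (F x) by rewrite /f /= xK.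
have dG' : differentiable g (f (cfun c1 x)) by rewrite fE.
have E : \forall y \near cfun c1 x, (g \o f) y = (cfun c3 \o (G \o F) \o cinv c1) y.
  have cy : \forall y \near cfun c1 x, cdom c2 (F (cinv c1 y)).
    have cFi : {for cfun c1 x, continuous (F \o cinv c1)}.
      apply: continuous_comp; first exact: (chart_inv_cts h1 xi).
      by rewrite xK.
    apply: (cFi (cdom c2)); apply: open_nbhs_nbhs; split; first exact: chart_dom_open.
    by rewrite /= xK.
  by apply: filterS cy => y cy; rewrite /g /f /= (chart_domK h2 cy).2.
have [dh dE] := near_eq_diff E (differentiable_comp dF dG').
split; [exact: dh | move=> v].
have e1 := congr1 (@^~ v) dE; have e2 := congr1 (@^~ v) (diff_comp dF dG').
by rewrite /chart_diff -fE; exact: etrans e1 e2.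
Qed.

End ChainRule.

Section LocalCoordinates.
Variables (R : realType) (n : nat) (M : ptopologicalType).
Variables (X : riemannian_manifold R n M) (A : finite_charts X).
Hypothesis cM : compact [set: M].
Local Notation d := (mdist A).

(** An arbitrary choice, so [loc] and [lin] do not depend continuously on the base point. Passing
    between neighbouring base points is done by the transition derivative [lin id]. *)
Definition idx (x : M) : 'I_(fc_size A) := projT1 (cid (fc_cover A x)).

Definition loc (x q : M) : 'rV[R]_n := cfun (fc (idx x)) q - cfun (fc (idx x)) x.

(** [x'] only selects the chart in which the value is read. It may differ from [F x], as is needed
    along pseudo-orbits. *)
Definition lin (F : M -> M) (x x' : M) :=
  chart_diff (fc (idx x)) (fc (idx x')) F x.

Lemma idx_reg x : cdom (fc (idx x)) x /\ reg (idx x) 1 x.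
Proof.
rewrite /idx; case: cid => k [/= cx xk]; split=> //; split=> //.
by rewrite mul1r ltW.
Qed.

Lemma loc_sub x q q' : loc x q - loc x q' = cfun (fc (idx x)) q - cfun (fc (idx x)) q'.
Proof. by rewrite /loc opprB addrA subrK. Qed.

Lemma locxx x : loc x x = 0. Proof. by rewrite /loc subrr. Qed.

Lemma loc_dist : exists2 C : R, 1 <= C & [/\
  forall x q, d x q < C^-1 -> reg (idx x) 2 q,
  forall x q q', d x q < C^-1 -> d x q' < C^-1 ->
    d q q' <= `|loc x q - loc x q'| <= C * d q q' &
  forall x v, `|v| < C^-1 -> exists2 q, loc x q = v & d x q <= `|v|].
Proof.
have [c c0 Hc] := mdist_chart_ge A cM; have [B B1 HB] := fc_rad_bounds A.
have ic0 : 0 < c^-1 by rewrite invr_gt0.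
pose C := 1 + 2 * c^-1 + 2 * B + 2 * B * c^-1.
have B0 : 0 < B by lra.
have Bc0 : 0 < B * c^-1 by rewrite mulr_gt0.
have [C1 C0 cC CB' CBc'] : [/\ 1 <= C, 0 < C, 2 * c^-1 <= C, 2 * B <= C & 2 * B * c^-1 <= C].
  by rewrite /C; split; lra.
have Cc : 2 * C^-1 <= c.
  rewrite -[c]invrK -[2]invrK -invfM lef_pV2 ?posrE ?invr_gt0 ?mulr_gt0 ?invr_gt0 //; lra.
have half_rad (k : 'I_(fc_size A)) : (2 * B)^-1 <= fc_rad k / 2.
  by have /andP[h _] := HB k; rewrite invfM mulrC; lra.
have CB (k : 'I_(fc_size A)) : C^-1 <= fc_rad k / 2.
  by apply: le_trans (half_rad k); rewrite lef_pV2 ?posrE ?mulr_gt0.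
have CcB (k : 'I_(fc_size A)) : c^-1 * C^-1 <= fc_rad k / 2.
  apply: le_trans (half_rad k); rewrite -invfM lef_pV2 ?posrE ?mulr_gt0 //.
  by move: CBc'; rewrite ler_pdivrMr // [C * c]mulrC.
have near1 x q : d x q < C^-1 -> reg (idx x) (3 / 2) q.
  move=> xq; have [cx rx] := idx_reg x; have rk := fc_rad_gt0 (idx x).
  have rx' : reg (idx x) (3 / 2) x by apply: (reg_le _ rx); lra.
  have xqc : d x q < c by lra.
  have [rq h] := Hc _ _ q rx' xqc.
  split; first by case: rq.
  rewrite -(subrK (cfun (fc (idx x)) x) (cfun _ q)) -addrA.
  apply: le_trans (ler_normD _ _) _; have := rx.2; have := CcB (idx x).
  have : `|cfun (fc (idx x)) x - cfun (fc (idx x)) q| <= c^-1 * C^-1.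
    rewrite mulrC ler_pdivlMr // mulrC; apply: le_trans h (ltW xq).
  by rewrite distrC; lra.
have near2 x q : d x q < C^-1 -> reg (idx x) 2 q.
  by move=> /near1; apply: reg_le; lra.
exists C => //; split=> // [x q q' xq xq'|x v vC].
  rewrite loc_sub mdist_chart_le; [|exact: near2|exact: near2].
  have qq' : d q q' < c.
    by apply: le_lt_trans (mdist_triangle A x q q') _; rewrite [d q x]mdistC; lra.
  have [_ h] := Hc _ _ q' (near1 _ _ xq) qq'.
  apply: (@le_trans _ _ (c^-1 * d q q')).
    by rewrite mulrC ler_pdivlMr // mulrC.
  by rewrite ler_wpM2r ?mdist_ge0 //; lra.
have [cx rx] := idx_reg x; have rk := fc_rad_gt0 (idx x); have := CB (idx x) => Ck.
have xv : `|v + cfun (fc (idx x)) x - fc_ctr (idx x)| <= 2 * fc_rad (idx x).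
  by rewrite -addrA; apply: le_trans (ler_normD _ _) _; have := rx.2; lra.
have [|cq qE] := chart_imgK (fc_chart (idx x)) (xi := v + cfun (fc (idx x)) x).
  by apply: fc_img; lra.
exists (cinv (fc (idx x)) (v + cfun (fc (idx x)) x)); first by rewrite /loc qE addrK.
have e : v = cfun (fc (idx x)) (cinv (fc (idx x)) (v + cfun (fc (idx x)) x)) - cfun (fc (idx x)) x.
  by rewrite qE addrK.
rewrite [X in _ <= `|X|]e distrC; apply: mdist_chart_le; first by apply: (reg_le _ rx); lra.
by split=> //; rewrite qE.
Qed.

End LocalCoordinates.

Section C11Maps.
Variables (R : realType) (n : nat) (M : ptopologicalType).
Variables (X : riemannian_manifold R n M) (A : finite_charts X).
Hypothesis cM : compact [set: M].
Local Notation d := (mdist A).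
Local Notation idx := (idx A).
Local Notation loc := (loc A).
Local Notation lin := (lin A).

(** Compactness in the form used from here on: a property of scales that holds locally for all small
    scales holds everywhere at one scale. *)
Lemma mdist_compact (P : R -> M -> Prop) :
  (forall x, exists2 e : R, 0 < e & forall y r, d x y < e -> 0 < r < e -> P r y) ->
  exists2 r : R, 0 < r & forall x, P r x.
Proof.
move=> H.
have Ploc x : [set: M] x -> \forall w \near x & r \near (0 : R)^'+, P r w.
  move=> _; have [e e0 He] := H x.
  exists ([set w | d x w < e], [set r | 0 < r < e]).
    split; first by apply/(mdist_nbhs A cM); exists e.
    by near=> r; apply/andP; split; [near: r; exact: nbhs_right_gt|near: r; exact: nbhs_right_lt].
  by move=> [w r] [/= ? ?]; exact: He.
have /compact_near_coveringP/(_ _ ((0 : R)^'+) P _ Ploc) PK := cM.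
have : \forall r \near (0 : R)^'+, 0 < r /\ [set: M] `<=` P r.
  by apply: filterI => //; exact: nbhs_right_gt.
by move=> /filter_ex[r [r0 Pr]]; exists r => // x; exact: Pr.
Unshelve. all: by end_near. Qed.

Lemma mdist_unif_cts (F : M -> M) : continuous F -> forall e : R, 0 < e ->
  exists2 r : R, 0 < r & forall x y, d x y < r -> d (F x) (F y) < e.
Proof.
move=> cF e e0.
apply: (mdist_compact (P := fun r x => forall y, d x y < r -> d (F x) (F y) < e)) => x.
have : \forall y \near x, d (F x) (F y) < e / 2.
  apply: (cF x (fun y => d (F x) y < e / 2)); apply/(mdist_nbhs A cM).
  by exists (e / 2) => //; rewrite divr_gt0.
move=> /(mdist_nbhs A cM)[r r0 H]; exists (r / 2); first by rewrite divr_gt0.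
move=> y s xy /andP[s0 sr] z yz; apply: le_lt_trans (mdist_triangle A (F x) _ _) _.
rewrite mdistC.
have /H h1 : d x y < r by lra.
have /H h2 : d x z < r by apply: le_lt_trans (mdist_triangle A y _ _) _; lra.
lra.
Qed.

(** A class of maps closed under composition, with estimates stated in [mdist] and in the chosen
    charts. The Lipschitz bound is global, the other estimates hold at distances below [K^-1]. *)
Definition C11 (F : M -> M) := continuous F /\
  exists2 K : R, 1 <= K & [/\
    forall y z, d (F y) (F z) <= K * d y z,
    forall x x', d (F x) x' < K^-1 -> chart_smooth (fc (idx x)) (fc (idx x')) F x,
    forall x x' v, d (F x) x' < K^-1 -> `|lin F x x' v| <= K * `|v| &
    forall x x' y z, d (F x) x' < K^-1 -> d x y < K^-1 -> d x z < K^-1 ->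
      `|loc x' (F y) - loc x' (F z) - lin F x x' (loc x y - loc x z)|
        <= K * (d x y + d x z) * d y z].

Lemma Ck_C11 F : Ck_map X 2 F -> C11 F.
Proof.
move=> CF; have [cF _] := CF; split=> //.
have [C C1 [regC locC surC]] := loc_dist A cM.
have [K0 K01 HK] := uniform_C11 A cM CF.
have C0 : 0 < C by lra.
have K00 : 0 < K0 by lra.
have iC0 : 0 < C^-1 by rewrite invr_gt0.
have [r r0 Hr] := mdist_unif_cts cF iC0.
have reg1 x : reg (idx x) 2 x by have [_] := idx_reg A x; apply: reg_le; lra.
pose L := K0 * C * C; have L0 : 0 < L by rewrite /L !mulr_gt0.
have L1 : K0 <= L by rewrite /L -mulrA ler_peMr ?(ltW K00) // mulr_ege1.
have bd x x' : d (F x) x' < C^-1 -> C11_bound K0 (fc (idx x)) (fc (idx x')) F x.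
  by move=> xx'; apply: HK; [exact: reg1|apply: regC; rewrite mdistC].
have loc_lt x q : d x q < C^-1 -> `|loc x q| <= C * d x q.
  move=> xq; have := locC x x q; rewrite mdistxx iC0 => /(_ isT xq) /andP[_].
  by rewrite locxx sub0r normrN.
have K0C : (K0 * C)^-1 <= C^-1.
  by rewrite lef_pV2 ?posrE ?mulr_gt0 // ler_peMl // ltW.
have est x x' y z : d (F x) x' < C^-1 -> d x y < (K0 * C)^-1 -> d x z < (K0 * C)^-1 ->
    `|loc x' (F y) - loc x' (F z) - lin F x x' (loc x y - loc x z)|
        <= L * (d x y + d x z) * d y z.
  move=> xx' xy xz; have [_ _ _ H] := bd x x' xx'.
  have xyC : d x y < C^-1 by apply: lt_le_trans xy K0C.
  have xzC : d x z < C^-1 by apply: lt_le_trans xz K0C.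
  have sm u : d x u < C^-1 -> d x u < (K0 * C)^-1 -> `|loc x u| < K0^-1.
    move=> xuC xu; apply: le_lt_trans (loc_lt _ _ xuC) _.
    by rewrite -ltr_pdivlMl // -invfM mulrC.
  have := H y z (regC _ _ xyC).1 (regC _ _ xzC).1 (sm _ xyC xy) (sm _ xzC xz).
  rewrite -!loc_sub locxx !subr0 => /le_trans; apply.
  have /andP[_ h] := locC _ _ _ xyC xzC.
  have : Num.max `|loc x y| `|loc x z| <= C * (d x y + d x z).
    rewrite mulrDr ge_max; have := loc_lt _ _ xyC; have := loc_lt _ _ xzC.
    have := mdist_ge0 A x y; have := mdist_ge0 A x z => a b c e.
    by apply/andP; split; nra.
  move=> hm; rewrite /L -[K0 * C * C * _ * _]mulrA -[K0 * C * C]mulrA.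
  rewrite -(mulrA K0 (C * C)) -(mulrA K0); rewrite ler_wpM2l ?(ltW K00) //.
  have -> : C * C * ((d x y + d x z) * d y z) = (C * (d x y + d x z)) * (C * d y z) by ring.
  by apply: ler_pM; [rewrite le_max normr_ge0|exact: normr_ge0|exact: hm|exact: h].
pose r' := Num.min r (K0 * C)^-1.
have r'0 : 0 < r' by rewrite lt_min r0 invr_gt0 mulr_gt0.
have lip y z : d y z < r' -> d (F y) (F z) <= (3 * L) * d y z.
  rewrite lt_min => /andP[yzr yz].
  have yzC : d y z < C^-1 by apply: lt_le_trans yz K0C.
  have Fyz := Hr _ _ yzr.
  have := locC (F y) (F y) (F z); rewrite mdistxx => /(_ iC0 Fyz) /andP[h _].
  apply: le_trans h _.
  have := est y (F y) y z; rewrite !mdistxx => /(_ iC0 _ yz).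
  rewrite invr_gt0 mulr_gt0 // => /(_ isT) e.
  have [_ dK _ _] := bd y (F y) ltac:(by rewrite mdistxx).
  rewrite -[X in `|X|](subrK (lin F y (F y) (loc y y - loc y z))).
  apply: le_trans (ler_normD _ _) _.
  have h2 : `|lin F y (F y) (loc y y - loc y z)| <= K0 * `|loc y y - loc y z| := dK _.
  have : `|loc y y - loc y z| <= C * d y z.
    by have /andP[] := locC y y z ltac:(by rewrite mdistxx) yzC.
  have := mdist_le1 A y z; have := mdist_ge0 A y z.
  set u := loc y y - loc y z in h2 e *.
  set D := d y z in e *; set N := `|u| in h2 *; clearbody D N => D0 D1 hN.
  have hN' : K0 * N <= L * D.
    apply: le_trans (_ : K0 * (C * D) <= _); first by rewrite ler_wpM2l // ltW.
    by rewrite /L -!mulrA ler_wpM2l ?(ltW K00) // ler_wpM2l ?(ltW C0) // ler_peMl.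
  have : L * (0 + D) * D <= L * D by rewrite add0r -mulrA ler_wpM2l ?(ltW L0) // ler_piMr.
  have LD0 : 0 <= L * D by rewrite mulr_ge0 // ltW.
  lra.
pose K := 3 * L + C + r'^-1 + K0 * C.
have ir0 : 0 < r'^-1 by rewrite invr_gt0.
have [K1 KL KC Kr KKC] : [/\ 1 <= K, 3 * L <= K, C <= K, r'^-1 <= K & K0 * C <= K].
  have : 0 < K0 * C by rewrite mulr_gt0.
  by rewrite /K => ?; split; lra.
have K_gt0 : 0 < K by lra.
have iK (u : R) : 0 < u -> u <= K -> K^-1 <= u^-1.
  by move=> u0 uK; rewrite lef_pV2 ?posrE.
have iKr : K^-1 <= r' by rewrite -[r']invrK iK.
exists K => //; split.
(* Beyond the scale [r'] the Lipschitz bound is free, because [mdist] never exceeds 1. *)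
- move=> y z; have [yz|yz] := ltP (d y z) r'.
    by apply: le_trans (lip _ _ yz) _; rewrite ler_wpM2r // mdist_ge0.
  apply: le_trans (mdist_le1 _ _ _) _; apply: le_trans (_ : r'^-1 * r' <= _).
    by rewrite mulVf // gt_eqF.
  by apply: ler_pM => //; rewrite ltW.
- move=> x x' xx'; have [] // := bd x x'.
  by apply: lt_le_trans xx' _; exact: iK.
- move=> x x' v xx'; have [|_ dK _ _] := bd x x'.
    by apply: lt_le_trans xx' _; exact: iK.
  by apply: le_trans (dK v) _; rewrite ler_wpM2r //; lra.
- move=> x x' y z xx' xy xz.
  have iKC : K^-1 <= (K0 * C)^-1 by apply: iK => //; rewrite mulr_gt0.
  apply: le_trans (est _ _ _ _ _ _ _) _.
  + by apply: lt_le_trans xx' _; exact: iK.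
  + exact: lt_le_trans xy iKC.
  + exact: lt_le_trans xz iKC.
  by rewrite ler_wpM2r ?mdist_ge0 // ler_wpM2r ?addr_ge0 ?mdist_ge0 //; lra.
Qed.

End C11Maps.

(** * Hyperbolic splittings *)

Lemma dist_linear_le (R : realType) (V : normedModType R) (L : {linear V -> V})
    (a w u : V) (B1 B2 K : R) : `|a - L w| <= B1 -> `|w - u| <= B2 ->
  (forall v, `|L v| <= K * `|v|) -> `|a - L u| <= B1 + `|K| * B2.
Proof.
move=> h1 h2 hL; have -> : a - L u = (a - L w) + L (w - u).
  by rewrite linearB addrA subrK.
apply: le_trans (ler_normD _ _) (lerD h1 _); apply: le_trans (hL _) _.
by apply: le_trans (ler_wpM2r _ (ler_norm K)) _ => //; rewrite ler_wpM2l.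
Qed.

Section C11Comp.
Variables (R : realType) (n : nat) (M : ptopologicalType).
Variables (X : riemannian_manifold R n M) (A : finite_charts X).
Hypothesis cM : compact [set: M].
Local Notation d := (mdist A).
Local Notation idx := (idx A).
Local Notation loc := (loc A).
Local Notation lin := (lin A).
Local Notation C11 := (C11 A).

Lemma lin_comp (F G : M -> M) : C11 F -> C11 G ->
  exists2 e : R, 0 < e & forall x y, d (G (F x)) y < e ->
    chart_smooth (fc (idx x)) (fc (idx y)) (G \o F) x /\
    forall v, lin (G \o F) x y v = lin G (F x) y (lin F x (F x) v).
Proof.
move=> [cF [KF KF1 [_ sF _ _]]] [cG [KG KG1 [_ sG _ _]]].
exists KG^-1; first by rewrite invr_gt0; lra.
move=> x y xy; apply: chart_diff_comp.
- exact: fc_chart.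
- exact: fc_chart.
- exact: cF.
- exact: (idx_reg A x).1.
- exact: (idx_reg A (F x)).1.
- by apply: sF; rewrite mdistxx invr_gt0; lra.
- exact: sG.
Qed.

Lemma C11_comp (F G : M -> M) : C11 F -> C11 G -> C11 (G \o F).
Proof.
move=> HF HG; have [e e0 He] := lin_comp HF HG.
have [cF [KF KF1 [lipF sF dF estF]]] := HF.
have [cG [KG KG1 [lipG sG dG estG]]] := HG.
split; first by move=> x; apply: continuous_comp; [exact: cF|exact: cG].
have KF0 : 0 < KF by lra.
have KG0 : 0 < KG by lra.
have KFG : 1 <= KF * KG by rewrite mulr_ege1.
have ie0 : 0 < e^-1 by rewrite invr_gt0.
pose K := 2 * (KG * KF * KF) + e^-1.
have KFF : KG * KF <= KG * KF * KF by rewrite ler_peMr // mulr_ge0 // ltW.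
have [K1 K2 Ke] : [/\ 1 <= K, KF * KG <= K & e^-1 <= K].
  by rewrite /K [KF * KG]mulrC in KFG *; split; lra.
have iK (u : R) : 0 < u -> u <= K -> K^-1 <= u^-1.
  by move=> u0 uK; rewrite lef_pV2 ?posrE //; lra.
have Ke' : K^-1 <= e by rewrite -[e]invrK iK.
have KGK : KG <= K by apply: le_trans K2; rewrite ler_peMl // ltW.
have KFK : KF <= K by apply: le_trans K2; rewrite ler_peMr // ltW.
exists K => //; split.
- move=> y z; apply: le_trans (lipG _ _) _; apply: le_trans (_ : KG * (KF * d y z) <= _).
    by rewrite ler_wpM2l // ltW.
  by rewrite mulrA ler_wpM2r ?mdist_ge0 // mulrC.
- by move=> x x' xx'; case: (He x x' (lt_le_trans xx' Ke')).
- move=> x x' v xx'; have [_ ->] := He x x' (lt_le_trans xx' Ke').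
  apply: le_trans (dG _ _ _ _) _; first by apply: lt_le_trans xx' _; exact: iK.
  apply: le_trans (_ : KG * (KF * `|v|) <= _).
    by rewrite ler_wpM2l ?(ltW KG0) // dF // mdistxx invr_gt0.
  by rewrite mulrA ler_wpM2r // mulrC.
- move=> x x' y z xx' xy xz; have [_ linE] := He x x' (lt_le_trans xx' Ke').
  have lt_G w : d x w < K^-1 -> d (F x) (F w) < KG^-1.
    move=> xw; apply: le_lt_trans (lipF _ _) _; rewrite -ltr_pdivlMl // -invfM.
    by apply: lt_le_trans xw _; apply: iK => //; rewrite mulr_gt0.
  have hG := estG (F x) x' (F y) (F z) (lt_le_trans xx' (iK _ KG0 KGK)) (lt_G _ xy) (lt_G _ xz).
  have hF := estF x (F x) y z ltac:(by rewrite mdistxx invr_gt0)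
     (lt_le_trans xy (iK _ KF0 KFK)) (lt_le_trans xz (iK _ KF0 KFK)).
  rewrite [X in `|_ - X|]linE.
  have hL v : `|lin G (F x) x' v| <= KG * `|v|.
    by apply: dG; exact: lt_le_trans xx' (iK _ KG0 KGK).
  apply: le_trans (dist_linear_le hG hF hL) _.
  have D0 : 0 <= d x y + d x z by rewrite addr_ge0 ?mdist_ge0.
  have D1 : d (F x) (F y) + d (F x) (F z) <= KF * (d x y + d x z).
    by rewrite mulrDr lerD.
  apply: le_trans (_ : KG * (KF * (d x y + d x z)) * (KF * d y z) +
     KG * (KF * (d x y + d x z) * d y z) <= _).
    apply: lerD; last by rewrite ger0_norm // ltW.
    apply: ler_pM; [|exact: mdist_ge0| |exact: lipF].
      by rewrite mulr_ge0 ?(ltW KG0) // addr_ge0 ?mdist_ge0.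
    by rewrite ler_wpM2l ?(ltW KG0).
  have -> : KG * (KF * (d x y + d x z)) * (KF * d y z) + KG * (KF * (d x y + d x z) * d y z)
     = (KG * KF * KF + KG * KF) * ((d x y + d x z) * d y z) by ring.
  rewrite -[leRHS]mulrA; apply: ler_wpM2r; first by rewrite mulr_ge0 // mdist_ge0.
  by rewrite /K; lra.
Qed.

Lemma C11_iter F k : C11 F -> C11 (iter k F).
Proof.
move=> CF; elim: k => [|k IH]; first exact: (Ck_C11 A cM (Ck_map_id X 2)).
exact: (C11_comp IH CF).
Qed.

Lemma lin_iterS F k x v : C11 F ->
  lin (iter k.+1 F) x (iter k.+1 F x) v =
  lin F (iter k F x) (iter k.+1 F x) (lin (iter k F) x (iter k F x) v).
Proof.
move=> CF; have [e e0 H] := lin_comp (C11_iter k CF) CF.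
by have [|_] := H x (iter k.+1 F x); [rewrite mdistxx|exact].
Qed.

Lemma chart_diff_id (c : chart R n M) x v : is_chart c -> cdom c x ->
  chart_diff c c id x v = v.
Proof.
move=> hc cx; have [xi _] := chart_domK hc cx.
have E : \forall y \near cfun c x, (id : 'rV[R]_n -> 'rV[R]_n) y = (cfun c \o id \o cinv c) y.
  have : nbhs (cfun c x) (cimg c) by apply: open_nbhs_nbhs; split=> //; case: hc.
  by apply: filterS => y cy /=; rewrite (chart_imgK hc cy).2.
have [dE e1] := near_eq_diff E (ex_diff (is_diff_def := is_diff_id (cfun c x))).
have e2 := congr1 (@^~ v) e1.
apply: etrans e2 _.
by have e3 := diff_val (is_diff_def := is_diff_id (cfun c x)); rewrite [LHS](congr1 (@^~ v) e3).
Qed.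

Lemma lin_id x v : lin id x x v = v.
Proof. by apply: chart_diff_id; [exact: fc_chart|exact: (idx_reg A x).1]. Qed.

Lemma lin_cancel F G x v : C11 F -> C11 G -> cancel F G ->
  lin G (F x) x (lin F x (F x) v) = v.
Proof.
move=> CF CG FG; have [e e0 H] := lin_comp CF CG.
have [|_ <-] := H x x; first by rewrite FG mdistxx.
have -> : G \o F = id by apply/funext => y /=; rewrite FG.
exact: lin_id.
Qed.

End C11Comp.

(** * The Riemannian norm in charts *)

Lemma continuous_sum_fin (R : realType) (T : topologicalType) (I : Type) (r : seq I)
    (F : I -> T -> R) : (forall i, continuous (F i)) ->
  continuous (fun x => \sum_(i <- r) F i x).
Proof.
move=> cF; elim: r => [|i r IH] x.
  by under eq_fun do rewrite big_nil; exact: cvg_cst.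
under eq_fun do rewrite big_cons.
by apply: (@cvgD _ _ _ (nbhs x) _ (F i)); [exact: cF|exact: IH].
Qed.

Lemma bilinear_form_sum (R : realType) n m (L : {linear 'rV[R]_n -> 'rV[R]_m})
    (G : 'M[R]_m) (v w : 'rV[R]_n) :
  (L v *m G *m (L w)^T) 0 0 =
  \sum_i \sum_j v 0 i * w 0 j *
    (L (delta_mx 0 i) *m G *m (L (delta_mx 0 j))^T) 0 0.
Proof.
have -> : L v = \sum_i v 0 i *: L (delta_mx 0 i).
  by rewrite {1}[v]row_sum_delta linear_sum; apply: eq_bigr => i _; rewrite linearZ.
have -> : L w = \sum_i w 0 i *: L (delta_mx 0 i).
  by rewrite {1}[w]row_sum_delta linear_sum; apply: eq_bigr => i _; rewrite linearZ.
rewrite !mulmx_suml summxE; apply: eq_bigr => i _.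
rewrite linear_sum mulmx_sumr summxE; apply: eq_bigr => j _.
by rewrite linearZ/= -!scalemxAl -scalemxAr !mxE mulrA.
Qed.

Lemma quad_dist_le (R : realType) n (v : 'rV[R]_n) (a b : 'I_n -> 'I_n -> R) (e : R) :
  (forall i j, `|a i j - b i j| <= e) ->
  `|\sum_i \sum_j v 0 i * v 0 j * a i j - \sum_i \sum_j v 0 i * v 0 j * b i j|
    <= n%:R ^+ 2 * e * `|v| ^+ 2.
Proof.
move=> H; rewrite -sumrB.
apply: le_trans (ler_norm_sum _ _ _) _.
have -> : n%:R ^+ 2 * e * `|v| ^+ 2 = \sum_(i < n) \sum_(j < n) `|v| ^+ 2 * e.
  by rewrite !sumr_const !card_ord -mulrnA -[RHS]mulr_natl natrM expr2; ring.
apply: ler_sum => i _; rewrite -sumrB; apply: le_trans (ler_norm_sum _ _ _) _.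
apply: ler_sum => j _; rewrite -mulrBr !normrM expr2.
by rewrite ler_pM ?mulr_ge0 // ler_pM // coord_le_norm.
Qed.

Section RiemannianNorm.
Variables (R : realType) (n : nat) (M : ptopologicalType).
Variables (X : riemannian_manifold R n M).
Implicit Types c : chart R n M.

(** The Riemannian metric at [p] read in the chart [c]: the matrix [gram] lives in the preferred
    chart at [p], so vectors are first carried there. *)
Definition chart_form c (p : M) (v w : 'rV[R]_n) : R :=
  (chart_diff c (chart_at X p) id p v *m gram X p
    *m (chart_diff c (chart_at X p) id p w)^T) 0 0.

Lemma chart_form_sum c p v w : chart_form c p v w =
  \sum_i \sum_j v 0 i * w 0 j * chart_form c p (delta_mx 0 i) (delta_mx 0 j).
Proof. exact: bilinear_form_sum. Qed.

Lemma atlas_smooth c c' F p : Ck_map X 2 F -> atlas X c -> atlas X c' -> cdom c p ->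
  cdom c' (F p) -> chart_smooth c c' F p.
Proof.
move=> CF ac ac' cp cFp; have [K _ [e e0 H]] := local_C11 CF ac ac' cp cFp.
by have [|_] := H p cp; first by rewrite subrr normr0.
Qed.

Lemma chart_diff_trans c1 c2 c3 p v : atlas X c1 -> atlas X c2 -> atlas X c3 ->
  cdom c1 p -> cdom c2 p -> cdom c3 p ->
  chart_diff c2 c3 id p (chart_diff c1 c2 id p v) = chart_diff c1 c3 id p v.
Proof.
move=> a1 a2 a3 h1 h2 h3.
have s c c' : atlas X c -> atlas X c' -> cdom c p -> cdom c' p -> chart_smooth c c' id p.
  by move=> ac ac' cp cp'; apply: atlas_smooth => //; exact: Ck_map_id.
have [_ H] := @chart_diff_comp _ _ _ id id c1 c2 c3 p (atlas_chart a1) (atlas_chart a2)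
   cvg_id h1 h2 (s _ _ a1 a2 h1 h2) (s _ _ a2 a3 h2 h3).
exact: (esym (H v)).
Qed.

Lemma chart_diff_idK c1 c2 p v : atlas X c1 -> atlas X c2 -> cdom c1 p -> cdom c2 p ->
  chart_diff c2 c1 id p (chart_diff c1 c2 id p v) = v.
Proof.
move=> a1 a2 h1 h2; rewrite chart_diff_trans //.
exact: (chart_diff_id v (atlas_chart a1) h1).
Qed.

Lemma rnorm_chart_form c p v : atlas X c -> cdom c p ->
  rnorm X p v = Num.sqrt (chart_form c p (chart_diff (chart_at X p) c id p v)
                                         (chart_diff (chart_at X p) c id p v)).
Proof.
move=> ac cp; rewrite /rnorm /chart_form; congr (Num.sqrt ((_ *m _ *m _^T) 0 0)).
  by rewrite chart_diff_idK //; [exact: chart_at_atlas|exact: chart_at_dom].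
by rewrite chart_diff_idK //; [exact: chart_at_atlas|exact: chart_at_dom].
Qed.

Lemma chart_form_gt0 c p v : atlas X c -> cdom c p -> v != 0 -> 0 < chart_form c p v v.
Proof.
move=> ac cp v0; apply: gram_pos; apply/negP => /eqP u0.
have := @chart_diff_idK c (chart_at X p) p v ac (chart_at_atlas X p) cp (chart_at_dom X p).
have -> := congr1 (chart_diff (chart_at X p) c id p) u0.
by rewrite linear0 => v00; rewrite -v00 eqxx in v0.
Qed.

Lemma chart_form_cts c p0 v w (e : R) : atlas X c -> cdom c p0 -> 0 < e ->
  \forall p \near p0, `|chart_form c p v w - chart_form c p0 v w| < e.
Proof.
move=> ac cp0 e0; have hc := atlas_chart ac; have [xi0 _] := chart_domK hc cp0.
pose F (x : 'rV[R]_n) : R := let p := cinv c x in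
  let u := 'd (cfun (chart_at X p) \o cinv c) x in (u v *m gram X p *m (u w)^T) 0 0.
have cF : {for cfun c p0, continuous F} := @gram_smooth _ _ _ X c 0 v w ac _ xi0.
have FE p : cdom c p -> F (cfun c p) = chart_form c p v w.
  by move=> cp; rewrite /F (chart_domK hc cp).2.
clearbody F.
have /nbhs_normr[r r0 H] : \forall x \near cfun c p0, `|F (cfun c p0) - F x| < e.
  by move: cF => /cvgr_dist_lt; exact.
apply: filterS (chart_near hc cp0 r0) => p [cp /H].
by rewrite distrC (FE _ cp) (FE _ cp0).
Qed.

(** At [p0] the form has a positive minimum on the unit sphere, and homogeneity spreads the bound to
    all vectors. Nearby, each of the n^2 coefficients moves by at most [e], which costs at most half
    of that minimum. *)
Lemma chart_form_bounds c p0 : atlas X c -> cdom c p0 ->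
  exists2 m : R, 0 < m & \forall p \near p0, forall v,
    m * `|v| ^+ 2 <= chart_form c p v v <= m^-1 * `|v| ^+ 2.
Proof.
move=> ac cp0.
pose Q (v : 'rV[R]_n) : R := chart_form c p0 v v.
have QZ k v : Q (k *: v) = k ^+ 2 * Q v.
  rewrite /Q !chart_form_sum mulr_sumr; apply: eq_bigr => i _.
  by rewrite mulr_sumr; apply: eq_bigr => j _; rewrite !mxE; ring.
have Q0 : Q 0 = 0 by have := QZ 0 0; rewrite scale0r expr0n mul0r.
have cQ : continuous Q.
  have -> : Q = (fun v : 'rV[R]_n => \sum_i \sum_j v 0 i * v 0 j *
     chart_form c p0 (delta_mx 0 i) (delta_mx 0 j)).
    by apply/funext => v; rewrite /Q chart_form_sum.
  apply: continuous_sum_fin => i; apply: continuous_sum_fin => j v.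
  apply: (@cvgM _ _ (nbhs v) _ (fun v : 'rV[R]_n => v 0 i * v 0 j)); last exact: cvg_cst.
  by apply: (@cvgM _ _ (nbhs v) _ (fun v : 'rV[R]_n => v 0 i)); exact: coord_continuous.
have [m0 m00 Hm0] : exists2 m : R, 0 < m & forall v, m * `|v| ^+ 2 <= Q v.
  pose S : set 'rV[R]_n := [set v | `|v| = 1].
  (* The unit sphere is empty exactly in dimension zero. *)
  have [[u Su]|S0] := pselect (S !=set0); last first.
    exists 1 => // v; have [->|v0] := eqVneq v 0.
      by rewrite normr0 expr0n mulr0 Q0.
    exfalso; apply: S0; exists (`|v|^-1 *: v).
    by rewrite /S/= normrZ normfV normr_id mulVf // normr_eq0.
  have cS : compact S.
    apply: bounded_closed_compact.
      by exists 1; split; [exact: num_real|move=> r r1 v Sv; apply: le_trans (ltW r1); rewrite le_eqVlt; apply/orP; left; apply/eqP; exact: Sv].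
    have -> : S = Num.norm @^-1` [set 1] by [].
    apply: closed_comp => [v _|]; first exact: norm_continuous.
    exact: closed_eq.
  have [|v Sv Hv] := @EVT_min_rV R n Q S (ex_intro _ u Su) cS.
    by apply: continuous_subspaceT.
  move/set_mem: Sv => Sv.
  have v0 : v != 0 by rewrite -normr_eq0 Sv oner_eq0.
  exists (Q v); first exact: chart_form_gt0.
  move=> w; have [->|w0] := eqVneq w 0.
    by rewrite normr0 expr0n mulr0 Q0.
  have := Hv (`|w|^-1 *: w); rewrite inE /S/= normrZ normfV normr_id mulVf ?normr_eq0 // => /(_ erefl).
  by rewrite QZ exprVn ler_pdivlMl ?exprn_gt0 ?normr_gt0 // mulrC.
pose e := m0 / (2 * (n%:R ^+ 2 + 1)).
have n0 : 0 < n%:R ^+ 2 + 1 :> R by rewrite ltr_wpDl // exprn_ge0.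
have e0 : 0 < e by rewrite divr_gt0 // mulr_gt0.
have en : n%:R ^+ 2 * e <= m0 / 2.
  rewrite /e mulrA ler_pdivrMr ?mulr_gt0 //.
  rewrite (_ : m0 / 2 * (2 * (n%:R ^+ 2 + 1)) = n%:R ^+ 2 * m0 + m0) ?lerDl ?ltW //.
  by field.
pose B := \sum_(i < n) \sum_(j < n) `|chart_form c p0 (delta_mx 0 i) (delta_mx 0 j)|.
have B0 : 0 <= B by apply: sumr_ge0 => i _; apply: sumr_ge0.
have QB v : Q v <= B * `|v| ^+ 2.
  rewrite /Q chart_form_sum /B mulr_suml; apply: ler_sum => i _.
  rewrite mulr_suml; apply: ler_sum => j _; apply: le_trans (ler_norm _) _.
  by rewrite mulrC !normrM ler_wpM2l // expr2 ler_pM // coord_le_norm.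
have near_e : \forall p \near p0, forall ij : 'I_n * 'I_n,
    `|chart_form c p (delta_mx 0 ij.1) (delta_mx 0 ij.2)
      - chart_form c p0 (delta_mx 0 ij.1) (delta_mx 0 ij.2)| < e.
  apply: (@filter_forall _ _ (fun (ij : 'I_n * 'I_n) p =>
    `|chart_form c p (delta_mx 0 ij.1) (delta_mx 0 ij.2)
      - chart_form c p0 (delta_mx 0 ij.1) (delta_mx 0 ij.2)| < e) (nbhs p0) _) => ij.
  exact: chart_form_cts.
pose m := Num.min (m0 / 2) (B + m0)^-1.
have Bm0 : 0 < B + m0 by rewrite ltr_wpDl.
have m_gt0 : 0 < m by rewrite lt_min divr_gt0 // invr_gt0.
exists m => //; apply: filterS near_e => p H v.
have : `|chart_form c p v v - Q v| <= n%:R ^+ 2 * e * `|v| ^+ 2.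
  rewrite /Q !chart_form_sum; apply: quad_dist_le => i j.
  by apply: ltW; exact: (H (i, j)).
have v2 : 0 <= `|v| ^+ 2 by rewrite exprn_ge0.
move=> h; have h1 : `|chart_form c p v v - Q v| <= m0 / 2 * `|v| ^+ 2.
  by apply: le_trans h _; rewrite ler_wpM2r.
have mm0 : m * `|v| ^+ 2 <= m0 / 2 * `|v| ^+ 2 by rewrite ler_wpM2r // ge_min lexx.
have im : B + m0 <= m^-1.
  by rewrite -[B + m0]invrK lef_pV2 ?posrE ?invr_gt0 // ge_min lexx orbT.
have im2 : (B + m0) * `|v| ^+ 2 <= m^-1 * `|v| ^+ 2 by rewrite ler_wpM2r.
have hm := Hm0 v; have hB := QB v.
move: h1; rewrite ler_norml => /andP[a b]; apply/andP; split; first lra.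
have := mulr_ge0 (ltW m00) v2; lra.
Qed.

End RiemannianNorm.

Section TangentCoordinates.
Variables (R : realType) (n : nat) (M : ptopologicalType).
Variables (X : riemannian_manifold R n M) (A : finite_charts X).
Hypothesis cM : compact [set: M].
Local Notation d := (mdist A).
Local Notation idx := (idx A).
Local Notation loc := (loc A).
Local Notation lin := (lin A).

(** Tangent vectors are given in the preferred chart at [p], estimates in the finitely many charts.
    [conv] and [deconv] translate between the two. *)
Definition conv (p : M) := chart_diff (chart_at X p) (fc (idx p)) id p.

Definition deconv (p : M) := chart_diff (fc (idx p)) (chart_at X p) id p.

Lemma idx_dom p : cdom (fc (idx p)) p. Proof. by case: (idx_reg A p). Qed.

Lemma convK p v : deconv p (conv p v) = v.
Proof.
by apply: chart_diff_idK;
  [exact: chart_at_atlas|exact: fc_atlas|exact: chart_at_dom|exact: idx_dom].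
Qed.

Lemma deconvK p v : conv p (deconv p v) = v.
Proof.
by apply: chart_diff_idK;
  [exact: fc_atlas|exact: chart_at_atlas|exact: idx_dom|exact: chart_at_dom].
Qed.

Lemma chart_form_unif : exists2 r : R, 0 < r & forall p, forall k : 'I_(fc_size A), reg k 2 p ->
forall v, r * `|v| ^+ 2 <= chart_form X (fc k) p v v <= r^-1 * `|v| ^+ 2.
Proof.
apply: (@mdist_compact _ _ _ _ A cM (fun r p => forall k : 'I_(fc_size A), reg k 2 p ->
  forall v, r * `|v| ^+ 2 <= chart_form X (fc k) p v v <= r^-1 * `|v| ^+ 2)) => p.
have /choice[m Hm] : forall k : 'I_(fc_size A), exists m : R, 0 < m /\
    \forall q \near p, reg k 2 q -> forall v,
    m * `|v| ^+ 2 <= chart_form X (fc k) q v v <= m^-1 * `|v| ^+ 2.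
  move=> k; have [cp|ncp] := pselect (cdom (fc k) p).
    have [m m0 Hm] := chart_form_bounds (fc_atlas k) cp.
    by exists m; split=> //; apply: filterS Hm => q.
  exists 1; split=> //.
  have nr : ~ reg k 2 p by case.
  have le23 : 2 <= 3 :> R by lra.
  by apply: filterS (near_not_reg (F := id) (fun x => cvg_id) le23 nr) => q.
have : \forall q \near p, forall k : 'I_(fc_size A), reg k 2 q -> forall v,
    m k * `|v| ^+ 2 <= chart_form X (fc k) q v v <= (m k)^-1 * `|v| ^+ 2.
  apply: (@filter_forall _ _ (fun (k : 'I_(fc_size A)) q => reg k 2 q -> forall v,
    m k * `|v| ^+ 2 <= chart_form X (fc k) q v v <= (m k)^-1 * `|v| ^+ 2)
    (nbhs p) _) => k.
  by case: (Hm k).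
move=> /(mdist_nbhs A cM)[e e0 He].
pose B := \sum_(k < fc_size A) (m k)^-1.
have mB k : (m k)^-1 <= B.
  rewrite /B (bigD1 k) //= lerDl sumr_ge0 // => j _.
  by rewrite invr_ge0 ltW //; case: (Hm j).
have B0 : 0 <= B by apply: sumr_ge0 => j _; rewrite invr_ge0 ltW //; case: (Hm j).
exists (Num.min e (B + 1)^-1); first by rewrite lt_min e0 invr_gt0 ltr_wpDl.
move=> q s + /andP[s0 /ltW]; rewrite lt_min le_min => /andP[pq _] /andP[_ sB] k rk v.
have [mk0 _] := Hm k.
have h : s <= m k.
  apply: le_trans sB _; rewrite -[m k]invrK lef_pV2 ?posrE ?invr_gt0 // ?ltr_wpDl //.
  by apply: le_trans (mB k) _; rewrite lerDl.
have /andP[h1 h2] := He q pq k rk v.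
have v2 : 0 <= `|v| ^+ 2 by rewrite exprn_ge0.
apply/andP; split; first by apply: le_trans h1; rewrite ler_wpM2r.
by apply: le_trans h2 _; rewrite ler_wpM2r // lef_pV2 ?posrE.
Qed.

Lemma rnorm_conv_bounds : exists2 C : R, 1 <= C &
  forall p v, C^-1 * `|conv p v| <= rnorm X p v <= C * `|conv p v|.
Proof.
have [r r0 H] := chart_form_unif.
pose C := 1 + r^-1 + r.
have ir0 : 0 < r^-1 by rewrite invr_gt0.
have C1 : 1 <= C by rewrite /C; lra.
have C0 : 0 < C by lra.
have CC : C <= C ^+ 2 by rewrite expr2 ler_peMr // ltW.
have rC : r^-1 <= C ^+ 2 by apply: le_trans CC; rewrite /C; lra.
have rC' : (C^-1) ^+ 2 <= r.
  rewrite exprVn -[r]invrK lef_pV2 ?posrE ?exprn_gt0 //.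
have sqr (a b : R) : 0 <= a -> Num.sqrt (a ^+ 2 * b ^+ 2) = a * `|b|.
  by move=> a0; rewrite -exprMn sqrtr_sqr normrM ger0_norm.
exists C => // p v; rewrite (rnorm_chart_form v (fc_atlas (idx p)) (idx_dom p)).
have reg2 : reg (idx p) 2 p by apply: reg_le (idx_reg A p).2; lra.
have /andP[h1 h2] := H p (idx p) reg2 (conv p v).
have v2 : 0 <= `|conv p v| ^+ 2 by rewrite exprn_ge0.
have Q0 : 0 <= chart_form X (fc (idx p)) p (conv p v) (conv p v).
  by apply: le_trans h1; rewrite mulr_ge0 // ltW.
rewrite -/(conv p v); apply/andP; split.
  rewrite -[`|conv p v|]normr_id -sqr ?invr_ge0 ?(ltW C0) //; apply: ler_wsqrtr.
  by apply: le_trans h1; rewrite ler_wpM2r.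
rewrite -[`|conv p v|]normr_id -sqr ?(ltW C0) //; apply: ler_wsqrtr.
by apply: le_trans h2 _; rewrite ler_wpM2r.
Qed.

Definition smooth_map (F : M -> M) := continuous F /\
  forall c c' x, atlas X c -> atlas X c' -> cdom c x -> cdom c' (F x) ->
    chart_smooth c c' F x.

Lemma Ck_smooth F : Ck_map X 2 F -> smooth_map F.
Proof. by move=> CF; split; [case: CF|move=> *; exact: (atlas_smooth CF)]. Qed.

Lemma smooth_comp F G : smooth_map F -> smooth_map G -> smooth_map (G \o F).
Proof.
move=> [cF sF] [cG sG]; split.
  by move=> x; apply: continuous_comp; [exact: cF|exact: cG].
move=> c c' x ac ac' cx c'x; pose c2 := chart_at X (F x).
have a2 : atlas X c2 := chart_at_atlas X (F x).
have d2 : cdom c2 (F x) := chart_at_dom X (F x).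
have [h _] := @chart_diff_comp _ _ _ F G c c2 c' x (atlas_chart ac) (atlas_chart a2)
   (cF x) cx d2 (sF _ _ _ ac a2 cx d2) (sG _ _ _ a2 ac' d2 c'x).
exact: h.
Qed.

Lemma smooth_iter F k : smooth_map F -> smooth_map (iter k F).
Proof.
move=> sF; elim: k => [|k IH]; first exact: (Ck_smooth (Ck_map_id X 2)).
exact: (smooth_comp IH sF).
Qed.

Lemma lin_conv F p v : smooth_map F ->
  lin F p (F p) (conv p v) = conv (F p) (tangent_map X F p v).
Proof.
move=> sF; have [cF dF] := sF; have [ci di] := Ck_smooth (Ck_map_id X 2).
have a1 := chart_at_atlas X p; have d1 := chart_at_dom X p.
have a2 := chart_at_atlas X (F p); have d2 := chart_at_dom X (F p).
have a3 := fc_atlas (idx p); have d3 := idx_dom p.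
have a4 := fc_atlas (idx (F p)); have d4 := idx_dom (F p).
have [_ h1] := @chart_diff_comp _ _ _ id F _ _ _ p (atlas_chart a1) (atlas_chart a3)
   cvg_id d1 d3 (di _ _ _ a1 a3 d1 d3) (dF _ _ _ a3 a4 d3 d4).
have [_ h2] := @chart_diff_comp _ _ _ F id _ _ _ p (atlas_chart a1) (atlas_chart a2)
   (cF p) d1 d2 (dF _ _ _ a1 a2 d1 d2) (di _ _ _ a2 a4 d2 d4).
exact: etrans (esym (h1 v)) (h2 v).
Qed.

End TangentCoordinates.

Lemma geometric_lt (R : realType) (C l e : R) : 0 < l < 1 -> 0 < e ->
  exists k : nat, C * l ^+ k < e.
Proof.
move=> /andP[l0 l1] e0.
have : (fun k : nat => C * l ^+ k) @ \oo --> (0 : R).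
  rewrite -(mulr0 C); apply: (@cvgMr _ _ _ _ (fun k : nat => l ^+ k)).
  by apply: cvg_expr; rewrite ger0_norm // ltW.
move=> /cvgr_dist_lt /(_ e e0) [N _ H]; exists N.
by have := H N (leqnn N); rewrite sub0r normrN; apply: le_lt_trans (ler_norm _).
Qed.

(** Compares linear maps through an actual point displaced by [t *: v], with images [a] and [b].
    With errors of order t^2 in the hypotheses, division by [t] leaves an error of order t. *)
Lemma linear_comp_dist (R : realType) (V : normedModType R) (L1 L2 L3 : {linear V -> V})
    (a b v : V) (t B1 B2 B3 K : R) : 0 < t -> 0 <= K ->
  `|a - L1 (t *: v)| <= B1 -> `|a - L2 b| <= B2 -> `|b - L3 (t *: v)| <= B3 ->
  (forall u, `|L2 u| <= K * `|u|) ->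
  `|L1 v - L2 (L3 v)| <= t^-1 * (B1 + B2 + K * B3).
Proof.
move=> t0 K0 h1 h2 h3 h4; rewrite ler_pdivlMl //.
rewrite -(ger0_norm (ltW t0)) -normrZ scalerBr -!linearZ.
have -> : L1 (t *: v) - L2 (L3 (t *: v)) =
    (a - L2 b) - (a - L1 (t *: v)) + L2 (b - L3 (t *: v)).
  by rewrite (linearB L2) opprB [a - L2 b + _]addrC !subrKA.
apply: le_trans (ler_normD _ _) (lerD _ _).
  by apply: le_trans (ler_normB _ _) _; rewrite addrC lerD.
by apply: le_trans (h4 _) _; rewrite ler_wpM2l.
Qed.

Section HyperbolicSplitting.
Variables (R : realType) (n : nat) (M : ptopologicalType).
Variables (X : riemannian_manifold R n M) (A : finite_charts X).
Hypothesis cM : compact [set: M].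
Local Notation d := (mdist A).
Local Notation idx := (idx A).
Local Notation loc := (loc A).
Local Notation lin := (lin A).
Local Notation C11 := (C11 A).

(** Symmetric under exchanging [F] with [Fi] and [S] with [U], so every fact about one direction
    gives the other by [hyp_splitting_sym]. The subspaces are predicates on vectors in the
    coordinates of [idx]. *)
Record hyp_splitting (F Fi : M -> M) (S U : M -> 'rV[R]_n -> Prop) : Prop :=
 HypSplitting {
  hs_F : C11 F ;
  hs_Fi : C11 Fi ;
  hs_K : cancel F Fi ;
  hs_Ki : cancel Fi F ;
  hs_S : forall p a v w, S p v -> S p w -> S p (a *: v + w) ;
  hs_U : forall p a v w, U p v -> U p w -> U p (a *: v + w) ;
  hs_dec : forall p v, exists s u, [/\ S p s, U p u & v = s + u] ;
  hs_cap : forall p v, S p v -> U p v -> v = 0 ;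
  hs_SF : forall p v, S p v -> S (F p) (lin F p (F p) v) ;
  hs_SFi : forall p v, S p v -> S (Fi p) (lin Fi p (Fi p) v) ;
  hs_UF : forall p v, U p v -> U (F p) (lin F p (F p) v) ;
  hs_UFi : forall p v, U p v -> U (Fi p) (lin Fi p (Fi p) v) ;
  hs_rate : exists C l : R, [/\ 1 <= C, 0 < l < 1,
    forall k p v, S p v -> `|lin (iter k F) p (iter k F p) v| <= C * l ^+ k * `|v| &
    forall k p v, U p v -> `|lin (iter k Fi) p (iter k Fi p) v| <= C * l ^+ k * `|v|] }.

Lemma hyp_splitting_sym F Fi S U : hyp_splitting F Fi S U -> hyp_splitting Fi F U S.
Proof.
move=> [h1 h2 h3 h4 h5 h6 h7 h8 h9 h10 h11 h12 [C [l [hC hl hs hu]]]].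
split=> //; last by exists C, l.
  by move=> p v; have [s [u [a b c]]] := h7 p v; exists u, s; split=> //; rewrite addrC.
by move=> p v a b; apply: (h8 p).
Qed.

Section Consequences.
Variables (F Fi : M -> M) (S U : M -> 'rV[R]_n -> Prop).
Hypothesis H : hyp_splitting F Fi S U.

Lemma iter_cancel k : cancel (iter k F) (iter k Fi).
Proof.
elim: k => [//|k IH] x.
by rewrite iterSr /= (hs_K H) IH.
Qed.

Lemma hs_S0 p : S p 0.
Proof.
have [s [u [Ss _ _]]] := hs_dec H p 0.
by have := hs_S H (-1) Ss Ss; rewrite scaleN1r addNr.
Qed.

Lemma hs_SZ p a v : S p v -> S p (a *: v).
Proof. by move=> Sv; rewrite -[a *: v]addr0; apply: (hs_S H) => //; exact: hs_S0. Qed.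

Lemma hs_S_iter k p v : S p v -> S (iter k F p) (lin (iter k F) p (iter k F p) v).
Proof.
move=> Sv; elim: k => [|k IH]; first by rewrite lin_id.
by rewrite (lin_iterS cM _ _ _ (hs_F H)); exact: (hs_SF H IH).
Qed.

Lemma hs_U_iter k p v : U p v -> U (iter k F p) (lin (iter k F) p (iter k F p) v).
Proof.
move=> Sv; elim: k => [|k IH]; first by rewrite lin_id.
by rewrite (lin_iterS cM _ _ _ (hs_F H)); exact: (hs_UF H IH).
Qed.

Lemma lin_iterK k p v :
  lin (iter k Fi) (iter k F p) p (lin (iter k F) p (iter k F p) v) = v.
Proof.
apply: lin_cancel => //; [exact: C11_iter (hs_F H)|exact: C11_iter (hs_Fi H)|].
exact: iter_cancel.
Qed.

Lemma hs_U_expand C l k p v :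
  (forall k p v, U p v -> `|lin (iter k Fi) p (iter k Fi p) v| <= C * l ^+ k * `|v|) ->
  U p v -> `|v| <= C * l ^+ k * `|lin (iter k F) p (iter k F p) v|.
Proof.
move=> h Uv; have := h k _ _ (hs_U_iter k Uv).
have e := iter_cancel k p; rewrite [X in lin _ _ X]e => h1.
by rewrite -[X in `|X| <= _](lin_iterK k p v).
Qed.

(** Take [k] with contraction factor below 1/2. After [k] steps [u] has at least doubled and [s] has
    at least halved, so the image of [s + u] is at least about the size of [u]; as the derivative of
    the iterate is bounded, [s + u] cannot be much shorter than [u]. *)
Lemma splitting_angle : exists2 c : R, 1 <= c &
  forall p s u, S p s -> U p u -> `|u| <= c * `|s + u|.
Proof.
have [C [l [C1 l01 hS hU]]] := hs_rate H.
have [k Hk] := geometric_lt C l01 (ltac:(lra) : 0 < (1 / 2 : R)).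
have [_ [K K1 [_ _ hK _]]] := C11_iter cM k (hs_F H).
have l0 : 0 <= C * l ^+ k.
  by have /andP[? _] := l01; rewrite mulr_ge0 ?exprn_ge0 // ?ltW //; lra.
exists (K + 1); first lra.
move=> p s u Ss Uu.
have h1 := hs_U_expand k hU Uu.
have h2 := hS k p s Ss.
have h3 : `|lin (iter k F) p (iter k F p) (s + u)| <= K * `|s + u|.
  by apply: hK; rewrite mdistxx invr_gt0; lra.
have h4 : `|lin (iter k F) p (iter k F p) u| <=
    `|lin (iter k F) p (iter k F p) (s + u)| + `|lin (iter k F) p (iter k F p) s|.
  by rewrite -[X in `|X| <= _](addKr (lin (iter k F) p (iter k F p) s)) -linearD addrC
     ler_normB.
have h5 : `|s| <= `|s + u| + `|u| by rewrite -{1}(addrK u s) ler_normB.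
move: l0 Hk h1 h2 h3 h4; set a := C * l ^+ k.
have a1 := normr_ge0 (s + u); have a2 := normr_ge0 u; have a3 := normr_ge0 s.
set x := `|lin _ _ _ u|; set y := `|lin _ _ _ (s + u)|; set z := `|lin _ _ _ s|.
have x0 : 0 <= x by rewrite /x.
move: h5 a1 a2 a3; set s' := `|s|; set u' := `|u|; set v' := `|s + u|.
clearbody a x y z s' u' v'; move=> h5 a1 a2 a3 l0 Hk h1 h2 h3 h4.
have : u' <= 1 / 2 * x by apply: le_trans h1 _; rewrite ler_wpM2r // ltW.
have : z <= 1 / 2 * s' by apply: le_trans h2 _; rewrite ler_wpM2r // ltW.
move=> hz hu; have : 0 <= K * v' by rewrite mulr_ge0 //; lra.
by rewrite mulrDl; lra.
Qed.

End Consequences.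

(** Continuity of the derivative with a linear modulus, although source and target charts may
    change: the change of base point appears as [lin id x x']. *)
Lemma lin_near (F : M -> M) : C11 F -> exists2 K : R, 1 <= K &
  forall e x x' v, 0 < e < K^-1 -> d x x' < e ->
  `|lin F x (F x') v - lin F x' (F x') (lin id x x' v)| <= K * e * `|v|.
Proof.
move=> CF; have [cF [K1 K11 [lipF _ dF estF]]] := CF.
have [ci [K2 K21 [_ _ di esti]]] := Ck_C11 A cM (Ck_map_id X 2).
have [C C1 [_ locC surC]] := loc_dist A cM.
have K10 : 0 < K1 by lra.
have K20 : 0 < K2 by lra.
have C0 : 0 < C by lra.
pose K := 2 * (K1 * K1) + 6 * K1 + K2 + 2 * C + K1 * K2.
have K12 : 0 < K1 * K2 by rewrite mulr_gt0.
have K11' : 0 < K1 * K1 by rewrite mulr_gt0.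
exists K; first by rewrite /K; lra.
have K41 : 4 * K1 + K1 * K2 <= K by rewrite /K; lra.
have iK (u : R) : 0 < u -> u <= K -> K^-1 <= u^-1.
  by move=> u0 uK; rewrite lef_pV2 ?posrE // /K; lra.
move=> e x x' v /andP[e0 eK] xx'.
have K0 : 0 < K by rewrite /K; lra.
have [v0|v0] := eqVneq v 0.
  have z1 : lin F x (F x') v = 0 by rewrite v0; exact: linear0.
  have z3 : lin id x x' v = 0 by rewrite v0; exact: linear0.
  have z2 : lin F x' (F x') (lin id x x' v) = 0.
    by apply: etrans (congr1 _ z3) _; exact: linear0.
  have -> : `|lin F x (F x') v - lin F x' (F x') (lin id x x' v)| = 0.
    by apply: etrans (congr2 (fun a b => `|a - b|) z1 z2) _; rewrite subrr normr0.
  by rewrite !mulr_ge0 // ltW.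
have nv0 : 0 < `|v| by rewrite normr_gt0.
have [e1 e2 e3 e4] : [/\ e < (K1 * K1)^-1, e < (2 * K1)^-1, e < K2^-1 & e < (2 * C)^-1].
  by split; apply: lt_le_trans eK _; apply: iK; rewrite ?mulr_gt0 // /K; lra.
have tE : `|(e / `|v|) *: v| = e.
  by rewrite normrZ ger0_norm ?divfK ?gt_eqF // divr_ge0 // ltW.
have e5 : e < C^-1.
  by apply: lt_le_trans e4 _; rewrite lef_pV2 ?posrE ?mulr_gt0 //; lra.
(* The probe point sits at displacement of length [e]. The second-order errors are then of size e^2,
   and of size [e] after rescaling to [v]. *)
have [|q qE xq] := surC x ((e / `|v|) *: v); first by rewrite tE.
rewrite tE in xq.
have x'q : d x' q <= 2 * e.
  by apply: le_trans (mdist_triangle A x x' q) _; rewrite mdistC; lra.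
have b1 : d x' q + d x x' <= 3 * e by lra.
have ie2 : 2 * e < K1^-1 by move: e2; rewrite invfM -ltr_pdivlMl ?invr_gt0 // invrK.
have eK1 : e < K1^-1 by lra.
have e6 : d (F x) (F x') < K1^-1.
  apply: le_lt_trans (lipF _ _) _; apply: le_lt_trans (_ : K1 * e < _).
    by rewrite ler_wpM2l ?(ltW K10) // ltW.
  by rewrite -ltr_pdivlMl // -invfM.
have dxx y : d y y < K1^-1 by rewrite mdistxx invr_gt0.
have h1 := estF x (F x') q x e6 (le_lt_trans xq eK1) (dxx x).
have x'x : d x' x < K1^-1 by rewrite mdistC; lra.
have h2 := estF x' (F x') q x (dxx _) (le_lt_trans x'q ie2) x'x.
have h3 : `|loc x' q - loc x' x - lin id x x' (loc x q - loc x x)| <=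
    K2 * (d x q + d x x) * d q x.
  by apply: esti; [exact: lt_trans xx' e3|exact: le_lt_trans xq e3|rewrite mdistxx invr_gt0].
have qxE : loc x q - loc x x = (e / `|v|) *: v by rewrite locxx subr0.
rewrite qxE in h1; rewrite qxE in h3.
have t0 : 0 < e / `|v| by rewrite divr_gt0.
have := linear_comp_dist t0 (ltW K10) h1 h2 h3 (fun u => dF x' (F x') u (dxx _)).
move=> /le_trans; apply.
rewrite mdistxx !addr0 [d q x]mdistC [d x' x]mdistC invf_div.
have dq0 := mdist_ge0 A x q.
have dd : d x q * d x q <= e * e by rewrite ler_pM.
have b2 : (d x' q + d x x') * d x q <= 3 * (e * e).
  apply: le_trans (_ : (3 * e) * e <= _); last by rewrite mulrA.
  by apply: ler_pM; [rewrite addr_ge0 ?mdist_ge0|exact: mdist_ge0|exact: b1|exact: xq].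
apply: le_trans (ler_wpM2l _ (_ : _ <= K * (e * e))) _; last first.
- by rewrite le_eqVlt; apply/orP; left; apply/eqP; field; rewrite gt_eqF.
- rewrite -!mulrA.
  apply: le_trans (_ : K1 * (e * e) + K1 * (3 * (e * e)) + K1 * (K2 * (e * e)) <= _).
    by apply: lerD; [apply: lerD|]; rewrite ler_wpM2l ?(ltW K10) // ler_wpM2l ?(ltW K20).
  have -> : K1 * (e * e) + K1 * (3 * (e * e)) + K1 * (K2 * (e * e)) =
     (4 * K1 + K1 * K2) * (e * e) by ring.
  by apply: ler_wpM2r; [rewrite mulr_ge0 // ltW|exact: K41].
- by rewrite divr_ge0 // ltW.
Qed.

End HyperbolicSplitting.

Lemma linear_sub_split (R : nzRingType) (V : lmodType R) (L : {linear V -> V}) (a s u : V) :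
  L u = a - (a - L (s + u)) - L s.
Proof. by rewrite opprB [a + _]addrC subrK linearD addrAC subrr add0r. Qed.

Section SplittingContinuity.
Variables (R : realType) (n : nat) (M : ptopologicalType).
Variables (X : riemannian_manifold R n M) (A : finite_charts X).
Hypothesis cM : compact [set: M].
Local Notation d := (mdist A).
Local Notation loc := (loc A).
Local Notation lin := (lin A).
Variables (F Fi : M -> M) (S U : M -> 'rV[R]_n -> Prop).

Lemma lin_bound (G : M -> M) : C11 A G -> exists2 K : R, 1 <= K &
  forall x y v, d (G x) y < K^-1 -> `|lin G x y v| <= K * `|v|.
Proof. by move=> [_ [K K1 [_ _ h _]]]; exists K. Qed.

Lemma lin_factor (G : M -> M) : C11 A G -> exists2 e : R, 0 < e &
  forall x y v, d (G x) y < e -> lin G x y v = lin id (G x) y (lin G x (G x) v).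
Proof.
move=> CG; have [e e0 h] := lin_comp CG (Ck_C11 A cM (Ck_map_id X 2)).
by exists e => // x y v xy; have [_ h'] := h x y xy; exact: h'.
Qed.

(** If a vector of [S x], moved to [x'], had a sizeable component in [U x'], a high iterate would
    expand that component while contracting the vector at [x]; the two derivatives of this fixed
    iterate are close for [x'] near [x]. No modulus of continuity is obtained. *)
Lemma splitting_cts : hyp_splitting A F Fi S U -> forall eta : R, 0 < eta ->
  exists2 e : R, 0 < e & forall x x' v s u, d x x' < e -> S x v -> S x' s -> U x' u ->
    lin id x x' v = s + u -> `|u| <= eta * `|v|.
Proof.
move=> H eta eta0; have [C [l [C1 l01 hS hU]]] := hs_rate H.
have [Ki Ki1 hKi] := lin_bound (Ck_C11 A cM (Ck_map_id X 2)).
have Ki0 : 0 < Ki by lra.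
pose a0 := Num.min (1 / 2) (eta / (2 * (2 * Ki + 1))).
have a00 : 0 < a0 by rewrite lt_min; apply/andP; split; rewrite divr_gt0 ?mulr_gt0 //; lra.
have [k Hk] := geometric_lt C l01 a00.
have CFk := C11_iter cM k (hs_F H).
have [e1 e10 hfac] := lin_factor CFk.
have [K K1 hnear] := lin_near cM CFk.
have [cF [L L1 [lipF _ _ _]]] := CFk.
have K0 : 0 < K by lra.
have L0 : 0 < L by lra.
pose e := Num.min (Num.min (K^-1 / 2) (e1 / L)) (Num.min (Ki^-1 / L) Ki^-1).
have e0 : 0 < e by rewrite !lt_min !divr_gt0 ?invr_gt0.
exists e => // x x' v s u xx' Sv Ss Uu Jv.
move: (xx'); rewrite !lt_min => /andP[/andP[xK xe1] /andP[xKiL xKi]].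
have FF : d (iter k F x) (iter k F x') <= L * d x x' by exact: lipF.
have hu : `|u| <= C * l ^+ k * `|lin (iter k F) x' (iter k F x') u|.
  exact: (hs_U_expand cM H k hU Uu).
have hs : `|lin (iter k F) x' (iter k F x') s| <= C * l ^+ k * `|s| by exact: hS.
have hsu : `|s + u| <= Ki * `|v| by rewrite -Jv; apply: hKi.
have hv : `|lin (iter k F) x (iter k F x') v| <= Ki * (C * l ^+ k * `|v|).
  have E : lin (iter k F) x (iter k F x') v =
      lin id (iter k F x) (iter k F x') (lin (iter k F) x (iter k F x) v).
    by apply: hfac; apply: le_lt_trans FF _; rewrite mulrC -ltr_pdivlMr.
  rewrite [X in `|X| <= _]E; apply: le_trans (hKi _ _ _ _) _.
    by apply: le_lt_trans FF _; rewrite mulrC -ltr_pdivlMr.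
  by apply: ler_wpM2l; [exact: ltW|exact: hS].
have hJ : `|lin (iter k F) x (iter k F x') v
     - lin (iter k F) x' (iter k F x') (s + u)| <= `|v|.
  rewrite -Jv.
  have eK : 0 < K^-1 / 2 < K^-1.
    by apply/andP; split; [rewrite divr_gt0 ?invr_gt0|rewrite ltr_pdivrMr // ltr_pMr ?invr_gt0 // ltrDl].
  apply: le_trans (hnear _ _ _ _ eK xK) _.
  rewrite mulrA mulfV ?gt_eqF // mul1r ler_piMl //; lra.
have htri : `|lin (iter k F) x' (iter k F x') u| <= `|v| + Ki * (C * l ^+ k * `|v|)
     + C * l ^+ k * `|s|.
  have E : lin (iter k F) x' (iter k F x') u =
    (lin (iter k F) x (iter k F x') v - (lin (iter k F) x (iter k F x') v
     - lin (iter k F) x' (iter k F x') (s + u))) - lin (iter k F) x' (iter k F x') s.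
    exact: linear_sub_split.
  rewrite [X in `|X| <= _]E; apply: le_trans (ler_normB _ _) (lerD _ hs).
  by apply: le_trans (ler_normB _ _) _; rewrite addrC; exact: lerD hJ hv.
have hs' : `|s| <= Ki * `|v| + `|u|.
  apply: le_trans (_ : `|s + u| + `|u| <= _); last by rewrite lerD2r.
  by rewrite -{1}(addrK u s) ler_normB.
have l0 : 0 <= C * l ^+ k.
  by have /andP[? _] := l01; rewrite mulr_ge0 ?exprn_ge0 // ?ltW //; lra.
move: Hk; rewrite lt_min => /andP[Hk1 Hk2].
have v0 := normr_ge0 v; have u0 := normr_ge0 u.
have {}htri := le_trans hu (ler_wpM2l l0 htri).
move: htri hs' v0 u0 Hk1 Hk2 l0; clear -Ki1 eta0.
move: `|u| `|v| `|s| (C * l ^+ k) => nu nv ns a htri hs' v0 u0 Hk1 Hk2 l0.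
have k0 : 0 < 2 * (2 * Ki + 1) by lra.
rewrite ltr_pdivlMr // in Hk2.
have h1 : a * (nv + Ki * (a * nv) + a * ns) <= a * (nv + Ki * nv * (1 / 2)
    + (Ki * nv + nu) * (1 / 2)).
  apply: ler_wpM2l => //.
  have : a * nv <= 1 / 2 * nv by rewrite ler_wpM2r // ltW.
  have Kn : 0 <= Ki * nv by rewrite mulr_ge0 //; lra.
  have : a * ns <= 1 / 2 * (Ki * nv + nu).
    apply: le_trans (_ : a * (Ki * nv + nu) <= _); first by rewrite ler_wpM2l.
    by rewrite ler_wpM2r ?addr_ge0 // ltW.
  move=> h2 h3; have : Ki * (a * nv) <= Ki * (1 / 2 * nv) by rewrite ler_wpM2l //; lra.
  lra.
have h2 : a * nu <= 1 / 2 * nu by rewrite ler_wpM2r // ltW.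
have h3 : a * (2 * (2 * Ki + 1)) * nv <= eta * nv by rewrite ler_wpM2r // ltW.
have h4 : 0 <= a * (Ki * nv) by rewrite !mulr_ge0 //; lra.
lra.
Qed.

(** The coordinates at [x] and at [x'] of a probe point are both comparable to its distance from
    [x], so the derivative of the transition cannot shrink vectors much. *)
Lemma lin_id_lower : exists2 c : R, 0 < c & forall x x' v, d x x' < c ->
  c * `|v| <= `|lin id x x' v|.
Proof.
have [ci [K K1 [_ _ di esti]]] := Ck_C11 A cM (Ck_map_id X 2).
have [C C1 [_ locC surC]] := loc_dist A cM.
have K0 : 0 < K by lra.
have C0 : 0 < C by lra.
pose e := (4 * C * K)^-1.
have CK : 0 < C * K by rewrite mulr_gt0.
have [eC eK] : e < C^-1 /\ e < K^-1.
  have h1 : C <= C * K by rewrite ler_peMr // ltW.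
  have h2 : K <= C * K by rewrite ler_peMl // ltW.
  by split; rewrite ltf_pV2 ?posrE -?mulrA ?mulr_gt0 //; lra.
have e0 : 0 < e by rewrite invr_gt0 -mulrA mulr_gt0.
have iC : 0 < C^-1 by rewrite invr_gt0.
have iK : 0 < K^-1 by rewrite invr_gt0.
pose c := Num.min ((2 * C)^-1) (Num.min (C^-1 - e) K^-1).
have c0 : 0 < c by rewrite !lt_min invr_gt0 mulr_gt0 // subr_gt0 eC invr_gt0.
exists c => // x x' v; rewrite !lt_min => /andP[_ /andP[xx'1 xx'2]].
have [->|v0] := eqVneq v 0; first by rewrite normr0 mulr0.
have nv0 : 0 < `|v| by rewrite normr_gt0.
have t0 : 0 < e / `|v| by rewrite divr_gt0.
have tE : `|(e / `|v|) *: v| = e.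
  by rewrite normrZ ger0_norm ?divfK ?gt_eqF // ltW.
have [|q qE xq] := surC x ((e / `|v|) *: v); first by rewrite tE.
rewrite tE in xq.
have xq' : d x q < C^-1 by lra.
have x'q : d x' q < C^-1.
  by apply: le_lt_trans (mdist_triangle A x x' q) _; rewrite mdistC; lra.
have x'x : d x' x < C^-1 by rewrite mdistC; lra.
have dxx : d x x < C^-1 by rewrite mdistxx.
have /andP[_ h1] := locC x q x xq' dxx.
have /andP[h2 _] := locC x' q x x'q x'x.
have h3 : `|loc x' q - loc x' x - lin id x x' (loc x q - loc x x)| <=
    K * (d x q + d x x) * d q x.
  by apply: esti; [exact: xx'2|exact: le_lt_trans xq eK|rewrite mdistxx].
rewrite locxx subr0 qE in h1 h3; rewrite tE in h1.
rewrite mdistxx addr0 [d q x]mdistC in h1 h2 h3.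
have hL : `|lin id x x' ((e / `|v|) *: v)| = e / `|v| * `|lin id x x' v|.
  have E : lin id x x' ((e / `|v|) *: v) = (e / `|v|) *: lin id x x' v by exact: linearZ.
  by rewrite [X in `|X| = _]E normrZ ger0_norm // ltW.
have h4 : `|loc x' q - loc x' x| <= K * d x q * d x q + e / `|v| * `|lin id x x' v|.
  rewrite -hL; apply: le_trans (lerD h3 (lexx _)).
  by rewrite -[X in `|X| <= _](subrK (lin id x x' ((e / `|v|) *: v))) ler_normD.
have h5 : K * d x q * d x q <= e / (4 * C).
  apply: le_trans (_ : K * e * e <= _).
    by rewrite -!mulrA ler_wpM2l ?(ltW K0) // ler_pM ?mdist_ge0.
  rewrite mulrC ler_wpM2l ?(ltW e0) // /e invfM mulrCA mulfV ?mulr1 ?gt_eqF //.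
have h6 : e / C <= d x q by rewrite ler_pdivrMr // mulrC.
have h7 : e / (4 * C) = e / C / 4 by field; rewrite gt_eqF.
have eC0 : 0 < e / C by rewrite divr_gt0.
have h8 : e / C / 2 <= e / `|v| * `|lin id x x' v|.
  move: h2 h4 h5 h6; rewrite h7; move: (e / `|v| * _) `|loc _ _ - _| => a b; lra.
have : (2 * C)^-1 * `|v| <= `|lin id x x' v|.
  rewrite -(ler_pM2l t0) (_ : e / `|v| * ((2 * C)^-1 * `|v|) = e / C / 2) //.
  by field; rewrite !gt_eqF.
by apply: le_trans; rewrite ler_wpM2r // ge_min lexx.
Qed.

End SplittingContinuity.

Definition mixes (R : realType) (M : Type) (d : M -> M -> R) (G : M -> M) :=
  forall p y (r : R), 0 < r -> exists N : nat, forall k, (N <= k)%N ->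
    exists2 q, d p q < r & d y (iter k G q) < r.

Section NonContracting.
Variables (R : realType) (n : nat) (M : ptopologicalType).
Variables (X : riemannian_manifold R n M) (A : finite_charts X).
Hypothesis cM : compact [set: M].
Hypothesis n0 : (0 < n)%N.
Local Notation d := (mdist A).
Local Notation loc := (loc A).
Local Notation lin := (lin A).
Variables (F Fi : M -> M) (S U : M -> 'rV[R]_n -> Prop).

Lemma mdist_gt0_exists : exists y1 y2, 0 < d y1 y2.
Proof.
have [C C1 [_ locC surC]] := loc_dist A cM.
have C0 : 0 < C by lra.
pose x : M := point.
have [|q qE xq] := surC x (const_mx ((2 * C)^-1)).
  apply: le_lt_trans (norm_le_coord (K := (2 * C)^-1) _ _) _.
  - by rewrite invr_ge0 mulr_ge0 // ltW.
  - by move=> i j; rewrite mxE ger0_norm // invr_ge0 mulr_ge0 // ltW.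
  - by rewrite ltf_pV2 ?posrE ?mulr_gt0 //; lra.
exists x, q; rewrite lt_neqAle mdist_ge0 andbT eq_sym; apply/eqP => d0.
have dxx : d x x < C^-1 by rewrite mdistxx invr_gt0.
have dxq : d x q < C^-1 by rewrite d0 invr_gt0.
have /andP[_] := locC x x q dxx dxq; rewrite d0 mulr0 locxx sub0r normrN qE.
move=> /(le_trans (coord_le_norm _ 0 (Ordinal n0))); rewrite mxE.
have i2C : 0 < (2 * C)^-1 by rewrite invr_gt0 mulr_gt0.
by rewrite ger0_norm ?(ltW i2C) // leNgt i2C.
Qed.

Lemma iter_mul (T : Type) (f : T -> T) m j x : iter j (iter m f) x = iter (j * m) f x.
Proof. by elim: j => [//|j IH]; rewrite iterS IH mulSn iterD. Qed.

(** If [S] vanishes at [p0], it vanishes along the whole [Fi]-orbit, all vectors belong to [U], and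
    a power of [Fi] contracts a fixed ball along that orbit. The iterates of the ball stay small, so
    they cannot come near two distinct points at the same late time, which mixing demands. *)
Lemma stable_nontrivial : hyp_splitting A F Fi S U -> mixes d Fi ->
  forall p, exists2 v, S p v & v != 0.
Proof.
move=> H mix p0; apply: contrapT => np0.
have P0 : forall v, S p0 v -> v = 0.
  by move=> v Sv; apply: contrapT => /eqP v0; apply: np0; exists v.
have Pstep p : (forall v, S p v -> v = 0) -> forall v, S (Fi p) v -> v = 0.
  move=> Pp v Sv; have := hs_SF H Sv; rewrite [X in S X _](hs_Ki H) => /Pp E.
  have e1 := lin_cancel (Fi p) v (hs_F H) (hs_Fi H) (hs_K H).
  by rewrite -e1 [X in lin Fi _ _ X]E; exact: linear0.
have Piter j : forall v, S (iter j Fi p0) v -> v = 0.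
  by elim: j => [//|j IH]; exact: Pstep.
have allU j v : U (iter j Fi p0) v.
  have [s [u [Ss Uu ->]]] := hs_dec H (iter j Fi p0) v.
  by rewrite (Piter j s Ss) add0r.
have [Cr [l [Cr1 l01 hS hU]]] := hs_rate H.
have [C C1 [_ locC surC]] := loc_dist A cM.
have C0 : 0 < C by lra.
have c40 : 0 < (4 * C)^-1 by rewrite invr_gt0 mulr_gt0.
have [m Hm] := geometric_lt Cr l01 c40.
have m0 : (0 < m)%N.
  rewrite lt0n; apply/negP => /eqP m0; move: Hm; rewrite m0 expr0 mulr1.
  by move=> h; have : (4 * C)^-1 <= 1; [rewrite invf_le1 ?mulr_gt0 //; lra|lra].
have [_ [K K1 [lipG _ _ estG]]] := C11_iter cM m (hs_Fi H).
have K0 : 0 < K by lra.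
pose G := iter m Fi.
have iC : 0 < C^-1 by rewrite invr_gt0.
have iK : 0 < K^-1 by rewrite invr_gt0.
have [y1 [y2 y12]] := mdist_gt0_exists.
pose r := Num.min (Num.min C^-1 (C^-1 / K)) (Num.min (K^-1 / 4) (d y1 y2 / 8)).
have r0 : 0 < r by rewrite !lt_min !divr_gt0 // iC.
have stay j q : d p0 q < r -> d (iter j G p0) (iter j G q) < r.
  move=> pq; elim: j => [//|j IH].
  have GE : iter j G p0 = iter (j * m) Fi p0 by exact: iter_mul.
  rewrite !iterS; move: (IH); rewrite GE; set p := iter (j * m) Fi p0; set y := iter j G q.
  move=> py; apply: (le_lt_trans _ py).
  move: py; rewrite !lt_min => /andP[/andP[pyC pyCK] /andP[pyK _]].
  have dpp (z : M) (c : R) : 0 < c -> d z z < c by rewrite mdistxx.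
  have h1 : d (G p) (G y) < C^-1.
    by apply: le_lt_trans (lipG _ _) _; rewrite mulrC -ltr_pdivlMr.
  have /andP[h2 _] := locC (G p) (G p) (G y) (dpp _ _ iC) h1.
  have /andP[_ h3] := locC p p y (dpp _ _ iC) pyC.
  have pyK' : d p y < K^-1 by lra.
  have h4 := estG p (G p) p y (dpp _ _ iK) (dpp _ _ iK) pyK'.
  have h5 : `|lin G p (G p) (loc p p - loc p y)| <= (4 * C)^-1 * (C * d p y).
    apply: le_trans (hU m p _ (allU _ _)) _.
    by apply: ler_pM => //; [rewrite mulr_ge0 ?exprn_ge0 //; [lra|case/andP: l01 => /ltW]|exact: ltW].
  apply: le_trans h2 _.
  rewrite -[X in `|X| <= _](subrK (lin G p (G p) (loc p p - loc p y))).
  apply: le_trans (ler_normD _ _) _; apply: le_trans (lerD h4 h5) _.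
  rewrite mdistxx add0r (_ : (4 * C)^-1 * (C * d p y) = d p y / 4); last first.
    by field; rewrite gt_eqF.
  have := mdist_ge0 A p y.
  have : K * d p y <= 1 / 4 by rewrite mulrC -ler_pdivlMr //; lra.
  move: (d p y) => D hD D0; have : K * D * D <= 1 / 4 * D by rewrite ler_wpM2r.
  lra.
have [N1 HN1] := mix p0 y1 r r0; have [N2 HN2] := mix p0 y2 r r0.
pose N := maxn N1 N2.
have N1m : (N1 <= N * m)%N by apply: leq_trans (leq_maxl _ N2) _; rewrite leq_pmulr.
have N2m : (N2 <= N * m)%N by apply: leq_trans (leq_maxr N1 _) _; rewrite leq_pmulr.
have [q1 pq1 yq1] := HN1 _ N1m; have [q2 pq2 yq2] := HN2 _ N2m.
have := stay N _ pq1; have := stay N _ pq2.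
rewrite ![iter N G _]iter_mul => s2 s1.
have t1 := mdist_triangle A (iter (N * m) Fi q1) y1 y2.
have t2 := mdist_triangle A (iter (N * m) Fi p0) (iter (N * m) Fi q1) y2.
have t3 := mdist_triangle A (iter (N * m) Fi q2) (iter (N * m) Fi p0) y2.
rewrite [d (iter _ _ q1) (iter _ _ p0)]mdistC in t2.
rewrite [d (iter _ _ q2) y2]mdistC in t3.
have : r <= d y1 y2 / 8 by rewrite !ge_min lexx !orbT.
lra.
Qed.

End NonContracting.

Section PlaneCoordinates.
Variables (R : realType) (e f : 'rV[R]_2).
Implicit Types v : 'rV[R]_2.

Definition det2 (v w : 'rV[R]_2) : R := v 0 0 * w 0 1 - v 0 1 * w 0 0.

(** Cramer's rule for the frame (e, f). *)
Definition coord1 v : R := det2 v f / det2 e f.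
Definition coord2 v : R := det2 e v / det2 e f.

Lemma row2P (v w : 'rV[R]_2) : v 0 0 = w 0 0 -> v 0 1 = w 0 1 -> v = w.
Proof.
move=> h0 h1; apply/rowP => -[[|[|//]] i].
  by rewrite (_ : Ordinal i = 0) //; exact/val_inj.
by rewrite (_ : Ordinal i = 1) //; exact/val_inj.
Qed.

Lemma det2_neq0 : (forall a b, a *: e + b *: f = 0 -> a = 0 /\ b = 0) -> det2 e f != 0.
Proof.
move=> H; apply/eqP; rewrite /det2 => /eqP; rewrite subr_eq0 => /eqP D0.
have [f1 /eqP] : f 0 1 = 0 /\ - e 0 1 = 0.
  by apply: H; apply: row2P; rewrite !mxE; [rewrite mulrC D0|]; ring.
rewrite oppr_eq0 => /eqP e1.
have [f0 /eqP] : f 0 0 = 0 /\ - e 0 0 = 0.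
  by apply: H; apply: row2P; rewrite !mxE; [|rewrite mulNr D0]; ring.
rewrite oppr_eq0 => /eqP e0; have [] := H 1 0; last by move/eqP; rewrite oner_eq0.
  by rewrite scale0r addr0 scale1r; apply: row2P; rewrite mxE.
Qed.

Hypothesis D0 : det2 e f != 0.

Lemma coordE v : v = coord1 v *: e + coord2 v *: f.
Proof.
by apply: row2P; rewrite !mxE; rewrite /coord1 /coord2 /det2; field.
Qed.

Lemma coord1D a v w : coord1 (a *: v + w) = a * coord1 v + coord1 w.
Proof. by rewrite /coord1 /det2 !mxE; ring. Qed.

Lemma coord2D a v w : coord2 (a *: v + w) = a * coord2 v + coord2 w.
Proof. by rewrite /coord2 /det2 !mxE; ring. Qed.

Lemma coord1B v w : coord1 (v - w) = coord1 v - coord1 w.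
Proof. by rewrite /coord1 /det2 !mxE; ring. Qed.

Lemma coord2B v w : coord2 (v - w) = coord2 v - coord2 w.
Proof. by rewrite /coord2 /det2 !mxE; ring. Qed.

Lemma coord1_lin a b : coord1 (a *: e + b *: f) = a.
Proof. by rewrite /coord1 /det2 !mxE; field. Qed.

Lemma coord2_lin a b : coord2 (a *: e + b *: f) = b.
Proof. by rewrite /coord2 /det2 !mxE; field. Qed.

End PlaneCoordinates.

(** * Hyperbolic coordinates *)

Definition dmax (R : realType) (M : Type) (ku ks : M -> M -> R) (x q q' : M) : R :=
  Num.max `|ku x q - ku x q'| `|ks x q - ks x q'|.

(* Coordinates (ku, ks) centred at each point in which G expands ku by the
   factor a and contracts ks; also between nearby centres. *)
Record hyp_chart (R : realType) (M : Type) (d : M -> M -> R) (G : M -> M)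
    (ku ks : M -> M -> R) (a : M -> R) (C : R) : Prop := HypChart {
  hc_C : 1 <= C ;
  hc_u0 : forall x, ku x x = 0 ;
  hc_s0 : forall x, ks x x = 0 ;
  hc_lip : forall x y, d (G x) (G y) <= C * d x y ;
  hc_bilip : forall x q q', d x q < C^-1 -> d x q' < C^-1 ->
    d q q' <= C * dmax ku ks x q q' /\ dmax ku ks x q q' <= C * d q q' ;
  hc_surj : forall x u s, `|u| < C^-1 -> `|s| < C^-1 ->
    exists2 q, d x q <= C * Num.max `|u| `|s| & ku x q = u /\ ks x q = s ;
  hc_rate : forall x, 3 <= a x <= C ;
  hc_step : forall x, exists al be : R, [/\ `|al| = a x, `|be| <= 1 / 3 &
    forall q q', d x q < C^-1 -> d x q' < C^-1 ->
    `|ku (G x) (G q) - ku (G x) (G q') - al * (ku x q - ku x q')|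
       <= C * (d x q + d x q') * d q q' /\
    `|ks (G x) (G q) - ks (G x) (G q') - be * (ks x q - ks x q')|
       <= C * (d x q + d x q') * d q q'] ;
  hc_jump : forall eta : R, 0 < eta -> exists2 e : R, 0 < e &
    forall x x', d (G x) x' < e -> exists al be : R, [/\ 3 <= `|al|, `|be| <= 1 / 3 &
    forall q q', d x q < e -> d x q' < e ->
    `|ku x' (G q) - ku x' (G q') - al * (ku x q - ku x q')| <= eta * d q q' /\
    `|ks x' (G q) - ks x' (G q') - be * (ks x q - ks x q')| <= eta * d q q'] }.

Lemma addrC_subK (V : zmodType) (a b : V) : a + (b - a) = b.
Proof. by rewrite addrC subrK. Qed.

Section HyperbolicCoordinates.
Variables (R : realType) (M : ptopologicalType).
Variables (X : riemannian_manifold R 2 M) (A : finite_charts X).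
Hypothesis cM : compact [set: M].
Local Notation d := (mdist A).
Local Notation loc := (loc A).
Local Notation lin := (lin A).
Variables (F Fi : M -> M) (S U : M -> 'rV[R]_2 -> Prop).
Hypothesis H : hyp_splitting A F Fi S U.
Variables (nu : M -> 'rV[R]_2 -> R) (Cn : R).
Hypothesis Cn1 : 1 <= Cn.
Hypothesis nuE : forall p v, Cn^-1 * `|v| <= nu p v <= Cn * `|v|.
Hypothesis nuZ : forall p k v, nu p (k *: v) = `|k| * nu p v.
Variables (eS eU : M -> 'rV[R]_2).
Hypothesis SeS : forall p, S p (eS p).
Hypothesis UeU : forall p, U p (eU p).
Hypothesis nuS : forall p, nu p (eS p) = 1.
Hypothesis nuU : forall p, nu p (eU p) = 1.

Let Hs : hyp_splitting A Fi F U S := hyp_splitting_sym H.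

Let Cn0 : 0 < Cn. Proof. exact: lt_le_trans ltr01 Cn1. Qed.

Lemma unit_bounds p v : nu p v = 1 -> Cn^-1 <= `|v| <= Cn.
Proof.
move=> nv; have := nuE p v; rewrite nv => /andP[h1 h2]; apply/andP; split.
  by rewrite -[Cn^-1]mulr1 ler_pdivrMl.
by move: h1; rewrite ler_pdivrMl // mulr1.
Qed.

Lemma frame_det p : det2 (eS p) (eU p) != 0.
Proof.
have nz v : nu p v = 1 -> v != 0.
  move=> /unit_bounds/andP[h _]; rewrite -normr_gt0.
  by apply: lt_le_trans h; rewrite invr_gt0.
apply: det2_neq0 => a b E.
have Sa : S p (a *: eS p) by exact: (hs_SZ H).
have Ua : U p (a *: eS p).
  have -> : a *: eS p = (- b) *: eU p.
    by apply/eqP; rewrite scaleNr -addr_eq0 E.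
  exact: (hs_SZ Hs).
have /eqP := hs_cap H Sa Ua; rewrite scaler_eq0 (negbTE (nz _ (nuS p))) orbF => /eqP a0.
move: E; rewrite a0 scale0r add0r => /eqP.
by rewrite scaler_eq0 (negbTE (nz _ (nuU p))) orbF => /eqP b0.
Qed.

Let cS p v := coord1 (eS p) (eU p) v.
Let cU p v := coord2 (eS p) (eU p) v.

Lemma frameE p v : v = cS p v *: eS p + cU p v *: eU p.
Proof. exact: (coordE (frame_det p)). Qed.

Lemma frame_S p v : S p v -> v = cS p v *: eS p.
Proof.
move=> Sv; have E := frameE p v.
have h0 : cU p v *: eU p = 0.
  apply: (hs_cap H); last exact: (hs_SZ Hs).
  have -> : cU p v *: eU p = (- 1) *: (cS p v *: eS p) + v.
    by rewrite [X in _ + X]E scaleN1r addKr.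
  by apply: (hs_S H) => //; exact: (hs_SZ H).
by rewrite {1}E h0 addr0.
Qed.

Lemma frame_U p v : U p v -> v = cU p v *: eU p.
Proof.
move=> Sv; have E := frameE p v.
have h0 : cS p v *: eS p = 0.
  apply: (hs_cap H); first exact: (hs_SZ H).
  have -> : cS p v *: eS p = (- 1) *: (cU p v *: eU p) + v.
    by rewrite [X in _ + X]E scaleN1r addrC addrK.
  by apply: (hs_U H) => //; exact: (hs_SZ Hs).
by rewrite {1}E h0 add0r.
Qed.

Lemma coord_bounds : exists2 C : R, 1 <= C & forall p v,
  [/\ `|cS p v| <= C * `|v|, `|cU p v| <= C * `|v| &
      `|v| <= C * Num.max `|cS p v| `|cU p v|].
Proof.
have [c1 c11 h1] := splitting_angle cM H.
have [c2 c21 h2] := splitting_angle cM Hs.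
have c10 : 0 <= c1 by apply: le_trans c11.
have c20 : 0 <= c2 by apply: le_trans c21.
pose C := (c1 + c2 + 2) * Cn.
have C1 : 1 <= C by rewrite mulr_ege1 //; lra.
exists C => // p v; have E := frameE p v.
have /andP[S1 S2] := unit_bounds (nuS p); have /andP[U1 U2] := unit_bounds (nuU p).
have SS : S p (cS p v *: eS p) by exact: (hs_SZ H).
have UU : U p (cU p v *: eU p) by exact: (hs_SZ Hs).
have hU := h1 p _ _ SS UU; have hS := h2 p _ _ UU SS.
rewrite -E normrZ in hU; rewrite addrC -E normrZ in hS.
have v0 := normr_ge0 v.
have gen (c x y : R) : 0 <= x -> Cn^-1 <= y -> x * y <= c * `|v| -> c <= c1 + c2 + 2 -> x <= C * `|v|.
  move=> x0 yC xy cc; have : x * Cn^-1 <= c * `|v|.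
    by apply: le_trans xy; rewrite ler_wpM2l.
  rewrite ler_pdivrMr // => /le_trans; apply.
  by rewrite /C [_ * Cn * _]mulrAC; apply: ler_wpM2r; [exact: ltW|exact: ler_wpM2r].
split.
- by apply: (gen c2 _ _ _ S1 hS) => //; lra.
- by apply: (gen c1 _ _ _ U1 hU) => //; lra.
rewrite {1}E; apply: le_trans (ler_normD _ _) _.
rewrite [`|cS p v *: _|]normrZ [`|cU p v *: _|]normrZ.
apply: le_trans (_ : Num.max `|cS p v| `|cU p v| * Cn + Num.max `|cS p v| `|cU p v| * Cn <= _).
  have m1 : `|cS p v| <= Num.max `|cS p v| `|cU p v| by rewrite le_max lexx.
  have m2 : `|cU p v| <= Num.max `|cS p v| `|cU p v| by rewrite le_max lexx orbT.
  apply: lerD.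
    exact: (ler_pM (normr_ge0 _) (normr_ge0 _) m1 S2).
  exact: (ler_pM (normr_ge0 _) (normr_ge0 _) m2 U2).
rewrite -mulrDr mulrC ler_wpM2r ?le_max ?normr_ge0 //.
by rewrite /C -[Cn in X in X <= _]mul1r -mulrDl ler_wpM2r ?(ltW Cn0) //; lra.
Qed.

(** The factor by which [m] steps of [Fi] stretch a unit vector of [S], the expanding direction of
    [Fi]. *)
Definition frame_rate m p := nu (iter m Fi p) (lin (iter m Fi) p (iter m Fi p) (eS p)).

Lemma frame_rateE m p : `|cS (iter m Fi p) (lin (iter m Fi) p (iter m Fi p) (eS p))|
  = frame_rate m p.
Proof.
have SG : S (iter m Fi p) (lin (iter m Fi) p (iter m Fi p) (eS p)).
  exact: (hs_U_iter cM Hs m (SeS p)).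
by rewrite /frame_rate [in RHS](frame_S SG) nuZ nuS mulr1.
Qed.

Lemma coord_lin m p v :
  cS (iter m Fi p) (lin (iter m Fi) p (iter m Fi p) v) =
    cS (iter m Fi p) (lin (iter m Fi) p (iter m Fi p) (eS p)) * cS p v /\
  cU (iter m Fi p) (lin (iter m Fi) p (iter m Fi p) v) =
    cU (iter m Fi p) (lin (iter m Fi) p (iter m Fi p) (eU p)) * cU p v.
Proof.
set L := lin (iter m Fi) p (iter m Fi p); set p' := iter m Fi p.
have SG : S p' (L (eS p)) by exact: (hs_U_iter cM Hs m (SeS p)).
have UG : U p' (L (eU p)) by exact: (hs_S_iter cM Hs m (UeU p)).
have LE : L v = (cS p v * cS p' (L (eS p))) *: eS p' + (cU p v * cU p' (L (eU p))) *: eU p'.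
  have e1 : L v = cS p v *: L (eS p) + cU p v *: L (eU p).
    have e2 : L v = L (cS p v *: eS p + cU p v *: eU p) := congr1 _ (frameE p v).
    by apply: etrans e2 _; rewrite linearD !linearZ.
  by apply: etrans e1 _; congr (_ + _); rewrite -scalerA; congr (_ *: _);
    [exact: frame_S|exact: frame_U].
have D := frame_det p'.
split; [apply: etrans (congr1 (cS p') LE) _|apply: etrans (congr1 (cU p') LE) _].
  by rewrite /cS coord1_lin // mulrC.
by rewrite /cU coord2_lin // mulrC.
Qed.

Lemma frame_rate_bounds e : 0 < e -> exists2 m : nat, (0 < m)%N &
  forall p, e^-1 <= frame_rate m p /\
    `|cU (iter m Fi p) (lin (iter m Fi) p (iter m Fi p) (eU p))| <= e.
Proof.
move=> e0; have [C [l [C1 l01 hS hU]]] := hs_rate H.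
have e'0 : 0 < Num.min 1 (e / (Cn * Cn)) by rewrite lt_min ltr01 divr_gt0 // mulr_gt0.
have [m Hm] := geometric_lt C l01 e'0.
have l0 : 0 <= C * l ^+ m.
  by have /andP[? _] := l01; rewrite mulr_ge0 ?exprn_ge0 // ?ltW //; lra.
move: Hm; rewrite lt_min => /andP[Hm1 Hm2].
exists m.
  by rewrite lt0n; apply/eqP => m0; move: Hm1; rewrite m0 expr0 mulr1 ltNge C1.
rewrite ltr_pdivlMr ?mulr_gt0 // in Hm2.
move=> p; set p' := iter m Fi p.
have /andP[S1 S2] := unit_bounds (nuS p); have /andP[U1 U2] := unit_bounds (nuU p).
have /andP[S1' S2'] := unit_bounds (nuS p'); have /andP[U1' U2'] := unit_bounds (nuU p').
split.
  have h := hs_U_expand cM Hs m hS (SeS p).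
  have SG : S p' (lin (iter m Fi) p p' (eS p)) by exact: (hs_U_iter cM Hs m (SeS p)).
  have E : `|lin (iter m Fi) p p' (eS p)| = frame_rate m p * `|eS p'|.
    by rewrite -frame_rateE -normrZ; congr (`|_|); exact: frame_S.
  have {}h : `|eS p| <= C * l ^+ m * (frame_rate m p * `|eS p'|).
    by apply: le_trans h _; rewrite [X in _ * X]E.
  have a0 : 0 <= frame_rate m p by rewrite -frame_rateE.
  rewrite -(ler_pM2l e0) mulfV ?gt_eqF //.
  have h2 : Cn^-1 <= C * l ^+ m * (frame_rate m p * Cn).
    apply: le_trans S1 (le_trans h _); apply: ler_wpM2l => //.
    by apply: ler_wpM2l.
  rewrite -[Cn^-1]mul1r ler_pdivrMr // in h2; apply: le_trans h2 _.
  have -> : C * l ^+ m * (frame_rate m p * Cn) * Cn = C * l ^+ m * (Cn * Cn) * frame_rate m p.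
    by ring.
  by rewrite ler_wpM2r // ltW.
have UG : U p' (lin (iter m Fi) p p' (eU p)) by exact: (hs_S_iter cM Hs m (UeU p)).
have E : `|lin (iter m Fi) p p' (eU p)| = `|cU p' (lin (iter m Fi) p p' (eU p))| * `|eU p'|.
  by rewrite -normrZ; congr (`|_|); exact: frame_U.
have h : `|lin (iter m Fi) p p' (eU p)| <= C * l ^+ m * `|eU p| := hU m p _ (UeU p).
rewrite [X in X <= _]E in h.
set c := `|cU _ _| in h *; have c0 : 0 <= c by rewrite /c.
have : c * Cn^-1 <= C * l ^+ m * Cn.
  apply: le_trans (_ : c * `|eU p'| <= _); first by rewrite ler_wpM2l.
  by apply: le_trans h _; rewrite ler_wpM2l.
rewrite ler_pdivrMr // => /le_trans; apply.
by rewrite -(mulrA (C * _)) ltW.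
Qed.

Lemma frame_jump (x y x' : M) (J L : {linear 'rV[R]_2 -> 'rV[R]_2}) (al be : R) (v : 'rV[R]_2) :
  L (eS x) = al *: eS y -> L (eU x) = be *: eU y ->
  cS x' (J (L v)) - (al * cS x' (J (eS y))) * cS x v = be * cU x v * cS x' (J (eU y)) /\
  cU x' (J (L v)) - (be * cU x' (J (eU y))) * cU x v = al * cS x v * cU x' (J (eS y)).
Proof.
move=> E1 E2.
have E : J (L v) = (cS x v * al) *: J (eS y) + (cU x v * be) *: J (eU y).
  by rewrite {1}(frameE x v) linearD !linearZ /= E1 E2 !scalerA linearD !linearZ.
have Z1 a w : cS x' (a *: w) = a * cS x' w.
  by have := coord1D (eS x') (eU x') a w 0; rewrite addr0 /cS /coord1 /det2 !mxE !mul0r subrr mul0r addr0.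
have Z2 a w : cU x' (a *: w) = a * cU x' w.
  by have := coord2D (eS x') (eU x') a w 0; rewrite addr0 /cU /coord2 /det2 !mxE !mulr0 subrr mul0r addr0.
rewrite E; split.
  have Z3 a w b z : cS x' (a *: w + b *: z) = a * cS x' w + b * cS x' z.
    by rewrite [LHS]coord1D; congr (_ + _); exact: Z1.
  by rewrite Z3; ring.
have Z3 a w b z : cU x' (a *: w + b *: z) = a * cU x' w + b * cU x' z.
  by rewrite [LHS]coord2D; congr (_ + _); exact: Z2.
by rewrite Z3; ring.
Qed.

(** A change of frame [J] between nearby points is nearly diagonal, by continuity of the splitting.
    Its first diagonal entry is bounded below since [J] is bounded below and the off-diagonal part
    takes at most half of that bound, by the condition on [eta]. *)
Lemma jump_bounds (eta c Ki Cc : R) : 0 < eta -> 0 < c -> 2 * (eta * (Cn * Cn * (Cn * Cn))) <= c ->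
  (forall p v, [/\ `|cS p v| <= Cc * `|v|, `|cU p v| <= Cc * `|v| &
      `|v| <= Cc * Num.max `|cS p v| `|cU p v|]) ->
  forall (y x' : M) (J : 'rV[R]_2 -> 'rV[R]_2),
  (forall v, c * `|v| <= `|J v| <= Ki * `|v|) ->
  (forall v s u, S y v -> S x' s -> U x' u -> J v = s + u -> `|u| <= eta * `|v|) ->
  (forall v s u, U y v -> U x' s -> S x' u -> J v = s + u -> `|u| <= eta * `|v|) ->
  [/\ c / 2 / (Cn * Cn) <= `|cS x' (J (eS y))|, `|cU x' (J (eU y))| <= Cc * (Ki * Cn),
      `|cU x' (J (eS y))| <= eta * (Cn * Cn) & `|cS x' (J (eU y))| <= eta * (Cn * Cn)].
Proof.
move=> eta0 c0 hc hCc y x' J hJ hS hU.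
have Cn2 : 0 < Cn * Cn by rewrite mulr_gt0.
have [S1 S2] := andP (unit_bounds (nuS y)); have [U1 U2] := andP (unit_bounds (nuU y)).
have [S1' S2'] := andP (unit_bounds (nuS x')); have [U1' U2'] := andP (unit_bounds (nuU x')).
have small a (e w : 'rV[R]_2) : Cn^-1 <= `|e| -> `|w| <= Cn -> `|a *: e| <= eta * `|w| -> `|a| <= eta * (Cn * Cn).
  move=> h1 h2 h3; rewrite normrZ in h3.
  have h4 : `|a| * Cn^-1 <= eta * Cn.
    apply: le_trans (ler_wpM2l (normr_ge0 a) h1) (le_trans h3 _).
    by rewrite ler_wpM2l // ltW.
  by rewrite ler_pdivrMr // -mulrA in h4.
have sU : `|cU x' (J (eS y))| <= eta * (Cn * Cn).
  apply: (small _ (eU x') (eS y)) => //.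
  apply: (hS (eS y) (cS x' (J (eS y)) *: eS x')) => //; last exact: frameE.
    exact: (hs_SZ H).
  exact: (hs_SZ Hs).
have sS : `|cS x' (J (eU y))| <= eta * (Cn * Cn).
  apply: (small _ (eS x') (eU y)) => //.
  apply: (hU (eU y) (cU x' (J (eU y)) *: eU x')) => //; last by rewrite addrC; exact: frameE.
    exact: (hs_SZ Hs).
  exact: (hs_SZ H).
split=> //; last first.
  have [_ h _] := hCc x' (J (eU y)); apply: le_trans h _.
  have Cc0 : 0 <= Cc.
    have [h _ _] := hCc y (eS y); have := le_trans (normr_ge0 _) h.
    by rewrite pmulr_lge0 // (lt_le_trans _ S1) // invr_gt0.
  have /andP[_ h2] := hJ (eU y).
  have Ki0 : 0 <= Ki.
    by have := le_trans (normr_ge0 _) h2; rewrite pmulr_lge0 // (lt_le_trans _ U1) // invr_gt0.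
  by rewrite ler_wpM2l //; apply: (le_trans h2); rewrite ler_wpM2l.
have /andP[h _] := hJ (eS y).
have h1 : `|J (eS y)| <= `|cS x' (J (eS y))| * Cn + eta * (Cn * Cn) * Cn.
  rewrite {1}(frameE x' (J (eS y))); apply: le_trans (ler_normD _ _) _; rewrite normrZ [X in _ + X <= _]normrZ.
  by apply: lerD; [exact: (ler_wpM2l (normr_ge0 _) S2')|exact: (ler_pM (normr_ge0 _) (normr_ge0 _) sU U2')].
have h2 : c * Cn^-1 <= `|J (eS y)| by apply: le_trans h; rewrite ler_wpM2l // ltW.
have h3 := le_trans h2 h1; rewrite ler_pdivrMr // in h3.
have h4 : c <= `|cS x' (J (eS y))| * (Cn * Cn) + eta * (Cn * Cn) * (Cn * Cn).
  by apply: le_trans h3 _; rewrite le_eqVlt; apply/orP; left; apply/eqP; ring.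
rewrite ler_pdivrMr //.
have h5 : eta * (Cn * Cn) * (Cn * Cn) = eta * (Cn * Cn * (Cn * Cn)) by ring.
by rewrite h5 in h4; lra.
Qed.

(** For powers of [Fi] the roles are exchanged: [ku] is the coordinate along [S], which expands, and
    [ks] the one along [U]. The power [m] must be large enough that expansion survives the change of
    frame at a jump, not only along true orbits. *)
Lemma hyp_chart_exists : exists2 m : nat, (0 < m)%N & exists C : R,
  hyp_chart d (iter m Fi) (fun x q => cS x (loc x q)) (fun x q => cU x (loc x q))
    (frame_rate m) C.
Proof.
have [Cc Cc1 hc] := coord_bounds.
have [Cl Cl1 [_ locC surC]] := loc_dist A cM.
have [Ki Ki1 hKi] := lin_bound (Ck_C11 A cM (Ck_map_id X 2)).
have [c0 c00 hlow] := lin_id_lower A cM.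
have [Cc0 Cl0 Ki0] : [/\ 0 < Cc, 0 < Cl & 0 < Ki] by split; lra.
have CnCn : 0 < Cn * Cn by rewrite mulr_gt0.
(* [c1] and [c2] bound the diagonal entries of a change of frame from below and from above. [e1]
   forces rates at least 3 and contraction at most 1/3 both before and after multiplying by these
   entries. *)
pose c1 := c0 / 2 / (Cn * Cn); pose c2 := Cc * (Ki * Cn).
have c10 : 0 < c1 by rewrite !divr_gt0.
have c20 : 0 < c2 by rewrite !mulr_gt0.
pose e1 := Num.min (Num.min 1 c1 / 3) (1 / (3 * (1 + c2))).
have e10 : 0 < e1 by rewrite lt_min !divr_gt0 ?lt_min ?ltr01 //; lra.
have [m m0 Hm] := frame_rate_bounds e10.
exists m => //; pose G := iter m Fi.
have a_bd p : 3 <= frame_rate m p /\ 3 <= frame_rate m p * c1.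
  have [h _] := Hm p; have : e1 <= Num.min 1 c1 / 3 by rewrite ge_min lexx.
  have mm : 0 < Num.min 1 c1 by rewrite lt_min ltr01.
  rewrite -[_ / 3]invrK -lef_pV2 ?posrE ?invr_gt0 ?divr_gt0 // invrK invf_div => h2.
  have {h2}h : 3 <= frame_rate m p * Num.min 1 c1.
    by rewrite -ler_pdivrMr //; apply: le_trans h2 h.
  have a0 : 0 <= frame_rate m p by rewrite -frame_rateE.
  split; apply: le_trans h _; last by rewrite ler_wpM2l // ge_min lexx orbT.
  by rewrite -[leRHS]mulr1 ler_wpM2l // ge_min lexx.
have b_bd p : `|cU (G p) (lin G p (G p) (eU p))| <= 1 / 3 /\
     `|cU (G p) (lin G p (G p) (eU p))| * c2 <= 1 / 3.
  have [_ h] := Hm p; have h2 : e1 <= 1 / (3 * (1 + c2)) by rewrite ge_min lexx orbT.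
  have {h2}h := le_trans h h2; rewrite ler_pdivlMr in h; last by lra.
  move: h; rewrite -/G; set b := `|_|; have b0 : 0 <= b by rewrite /b.
  clearbody b; have := mulr_ge0 b0 (ltW c20) => bc h.
  have h' : b * (3 * (1 + c2)) = 3 * b + 3 * (b * c2) by ring.
  by rewrite h' in h; split; lra.
have CG := C11_iter cM m (hs_Fi H).
have [_ [KG KG1 [lipG _ dG estG]]] := CG.
have KG0 : 0 < KG by lra.
have [ef ef0 hfac] := lin_factor cM CG.
have p1 : 0 < Cc * Cl by rewrite mulr_gt0.
have p2 : 0 < Cn * Cl by rewrite mulr_gt0.
have p3 : 0 < Cn * Cn * KG by rewrite !mulr_gt0.
have p4 : 0 < Cc * KG by rewrite mulr_gt0.
pose C := Cc * Cl + 2 * (Cn * Cl) + 2 * Cn + Cn * Cn * KG + Cc * KG + KG + Cl + Cc.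
have [C1 CA CB CD [CE CF CK CL CM]] : [/\ 1 <= C, Cc * Cl <= C, 2 * (Cn * Cl) <= C,
   2 * Cn <= C & [/\ Cn * Cn * KG <= C, Cc * KG <= C, KG <= C, Cl <= C & Cc <= C]].
  by have Cn1' := Cn1; rewrite /C; split; [lra|lra|lra|lra|split; lra].
have C0 : 0 < C by lra.
have iC (u : R) : 0 < u -> u <= C -> C^-1 <= u^-1.
  by move=> u0 uC; rewrite lef_pV2 ?posrE.
have iCl := iC _ Cl0 CL; have iKG := iC _ KG0 CK.
have dx0 (x : M) (r : R) : 0 < r -> d x x < r by rewrite mdistxx.
have iKG0 : 0 < KG^-1 by rewrite invr_gt0.
have rate_le p : frame_rate m p <= Cn * Cn * KG.
  have /andP[_ h1] := nuE (G p) (lin G p (G p) (eS p)); apply: le_trans h1 _.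
  have h2 := dG p (G p) (eS p) (dx0 _ _ iKG0).
  have /andP[_ h3] := unit_bounds (nuS p).
  apply: le_trans (_ : Cn * (KG * Cn) <= _); last by rewrite mulrCA mulrC.
  rewrite ler_wpM2l ?(ltW Cn0) //; apply: le_trans h2 _; rewrite ler_wpM2l //; exact: ltW.
have cSB p v w : cS p (v - w) = cS p v - cS p w by exact: coord1B.
have cUB p v w : cU p (v - w) = cU p v - cU p w by exact: coord2B.
exists C; split=> //=.
- by move=> x; rewrite locxx /cS /coord1 /det2 !mxE !mul0r subrr mul0r.
- by move=> x; rewrite locxx /cU /coord2 /det2 !mxE !mulr0 subrr mul0r.
- by move=> x y; apply: le_trans (lipG _ _) _; rewrite ler_wpM2r // mdist_ge0.
- move=> x q q' xq xq'.
  have /andP[h1 h2] := locC x q q' (lt_le_trans xq iCl) (lt_le_trans xq' iCl).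
  rewrite /dmax /cS /cU -coord1B -coord2B.
  have [h3 h4 h5] := hc x (loc x q - loc x q').
  have D0 := mdist_ge0 A q q'; split.
    apply: le_trans h1 (le_trans h5 _).
    by apply: ler_wpM2r; [rewrite le_max normr_ge0|exact: CM].
  apply: le_trans (_ : Cc * (Cl * d q q') <= _); last by rewrite mulrA ler_wpM2r.
  by rewrite ge_max; apply/andP; split; [apply: le_trans h3 _|apply: le_trans h4 _];
    rewrite ler_wpM2l // ltW.
- move=> x u s uC sC; pose v := u *: eS x + s *: eU x.
  have /andP[_ S2] := unit_bounds (nuS x); have /andP[_ U2] := unit_bounds (nuU x).
  have mx0 : 0 <= Num.max `|u| `|s| by rewrite le_max normr_ge0.
  have hv : `|v| <= 2 * Cn * Num.max `|u| `|s|.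
    apply: le_trans (ler_normD _ _) _; rewrite !normrZ.
    have m1 : `|u| <= Num.max `|u| `|s| by rewrite le_max lexx.
    have m2 : `|s| <= Num.max `|u| `|s| by rewrite le_max lexx orbT.
    have := ler_pM (normr_ge0 _) (normr_ge0 _) m1 S2.
    have := ler_pM (normr_ge0 _) (normr_ge0 _) m2 U2.
    move: (`|u| * _) (`|s| * _) (Num.max _ _) => y z t; lra.
  have vC : `|v| < Cl^-1.
    apply: le_lt_trans hv _; apply: lt_le_trans (_ : 2 * Cn * C^-1 <= _).
      by rewrite ltr_pM2l ?mulr_gt0 // gt_max uC sC.
    rewrite ler_pdivrMr // -ler_pdivrMl ?invr_gt0 // invrK.
    by have -> : Cl * (2 * Cn) = 2 * (Cn * Cl) by ring.
  have [q qE xq] := surC x v vC; exists q.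
    by apply: le_trans xq (le_trans hv _); rewrite ler_wpM2r.
  by rewrite qE /cS /cU coord1_lin ?coord2_lin //; exact: frame_det.
- move=> x; rewrite (a_bd x).1 /=; exact: le_trans (rate_le x) CE.
- move=> x; exists (cS (G x) (lin G x (G x) (eS x))), (cU (G x) (lin G x (G x) (eU x))).
  split; [exact: frame_rateE|exact: (b_bd x).1|move=> q q' xq xq'].
  have h1 := estG x (G x) q q' (dx0 _ _ iKG0) (lt_le_trans xq iKG) (lt_le_trans xq' iKG).
  have [e2 e3] := coord_lin m x (loc x q - loc x q').
  have [h3 h4 _] := hc (G x) (loc (G x) (G q) - loc (G x) (G q') - lin G x (G x) (loc x q - loc x q')).
  have hh : Cc * `|loc (G x) (G q) - loc (G x) (G q') - lin G x (G x) (loc x q - loc x q')|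
       <= C * (d x q + d x q') * d q q'.
    apply: le_trans (_ : Cc * (KG * (d x q + d x q') * d q q') <= _).
      by rewrite ler_wpM2l // ltW.
    by rewrite !mulrA ler_wpM2r ?mdist_ge0 // ler_wpM2r // addr_ge0 ?mdist_ge0.
  split.
    have E : cS (G x) (loc (G x) (G q)) - cS (G x) (loc (G x) (G q')) -
       cS (G x) (lin G x (G x) (eS x)) * (cS x (loc x q) - cS x (loc x q')) =
       cS (G x) (loc (G x) (G q) - loc (G x) (G q') - lin G x (G x) (loc x q - loc x q')).
      apply: esym; apply: etrans (cSB _ _ _) _.
      apply: etrans (congr2 (fun a b => a - b) (cSB _ _ _) e2) _.
      by congr (_ - _ * _); exact: cSB.
    by rewrite [X in `|X| <= _]E; exact: le_trans h3 hh.
  have E : cU (G x) (loc (G x) (G q)) - cU (G x) (loc (G x) (G q')) -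
     cU (G x) (lin G x (G x) (eU x)) * (cU x (loc x q) - cU x (loc x q')) =
     cU (G x) (loc (G x) (G q) - loc (G x) (G q') - lin G x (G x) (loc x q - loc x q')).
    apply: esym; apply: etrans (cUB _ _ _) _.
    apply: etrans (congr2 (fun a b => a - b) (cUB _ _ _) e3) _.
    by congr (_ - _ * _); exact: cUB.
  by rewrite [X in `|X| <= _]E; exact: le_trans h4 hh.
- move=> eta eta_gt0.
  pose P := 1 + Cc * Cl * (Cn * Cn) * (1 + Cn * Cn * KG).
  have P0 : 0 < P.
    rewrite /P; apply: ltr_pwDl => //; rewrite !mulr_ge0 ?(ltW Cc0) ?(ltW Cl0) ?(ltW Cn0) //.
    by rewrite addr_ge0 // ltW.
  have Cn4 : 0 < Cn * Cn * (Cn * Cn) by rewrite mulr_gt0.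
  (* The first bound makes the off-diagonal terms, multiplied by the rate, at most half of [eta];
     the second is the condition of [jump_bounds]. *)
  pose et := Num.min (eta / (2 * P)) (c0 / (2 * (Cn * Cn * (Cn * Cn)))).
  have et0 : 0 < et by rewrite lt_min !divr_gt0 ?mulr_gt0.
  have etP : et * P <= eta / 2.
    have : et <= eta / (2 * P) by rewrite ge_min lexx.
    by rewrite ler_pdivlMr ?mulr_gt0 // => h; lra.
  have etc : 2 * (et * (Cn * Cn * (Cn * Cn))) <= c0.
    have : et <= c0 / (2 * (Cn * Cn * (Cn * Cn))) by rewrite ge_min lexx orbT.
    by rewrite ler_pdivlMr ?mulr_gt0 // => h; rewrite mulrCA.
  have [es es0 hs1] := splitting_cts cM H et0; have [eu eu0 hu1] := splitting_cts cM Hs et0.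
  pose e := Num.min (Num.min (Num.min es eu) (Num.min ef c0))
    (Num.min (Num.min Ki^-1 KG^-1) (Num.min Cl^-1 (eta / (4 * (Cc * KG))))).
  have e0 : 0 < e by rewrite !lt_min es0 eu0 ef0 c00 !invr_gt0 Ki0 KG0 Cl0 divr_gt0 ?mulr_gt0.
  exists e => // x x' xx'.
  have [xs xu xf xc] : [/\ d (G x) x' < es, d (G x) x' < eu, d (G x) x' < ef & d (G x) x' < c0].
    by move: xx'; rewrite !lt_min => /andP[/andP[/andP[? ?] /andP[? ?]] _].
  have xKi : d (G x) x' < Ki^-1 by move: xx'; rewrite !lt_min => /andP[_ /andP[/andP[? _] _]].
  have xKG : d (G x) x' < KG^-1 by move: xx'; rewrite !lt_min => /andP[_ /andP[/andP[_ ?] _]].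
  have [eKG eCl eE] : [/\ e <= KG^-1, e <= Cl^-1 & e <= eta / (4 * (Cc * KG))].
    by split; rewrite !ge_min lexx ?orbT.
  have {}eE : Cc * (KG * (2 * e)) <= eta / 2.
    by move: eE; rewrite ler_pdivlMr ?mulr_gt0 // => h; lra.
  have hJ v : c0 * `|v| <= `|lin id (G x) x' v| <= Ki * `|v|.
    by apply/andP; split; [exact: hlow|exact: hKi].
  have [J1 J2 J3 J4] := jump_bounds et0 c00 etc hc hJ (fun v s u => hs1 (G x) x' v s u xs)
     (fun v s u => hu1 (G x) x' v s u xu).
  pose al := cS (G x) (lin G x (G x) (eS x)); pose be := cU (G x) (lin G x (G x) (eU x)).
  have E1 : lin G x (G x) (eS x) = al *: eS (G x) by apply: frame_S; exact: (hs_U_iter cM Hs m (SeS x)).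
  have E2 : lin G x (G x) (eU x) = be *: eU (G x) by apply: frame_U; exact: (hs_S_iter cM Hs m (UeU x)).
  have alE : `|al| = frame_rate m x by exact: frame_rateE.
  have [be1 be2] := b_bd x; have [al1 al2] := a_bd x.
  have al3 := rate_le x.
  exists (al * cS x' (lin id (G x) x' (eS (G x)))), (be * cU x' (lin id (G x) x' (eU (G x)))).
  split.
  + rewrite normrM alE; apply: le_trans al2 _; apply: ler_wpM2l => //.
    by rewrite -alE.
  + rewrite normrM; apply: le_trans be2; exact: ler_wpM2l.
  move=> q q' xq xq'; pose v := loc x q - loc x q'.
  have [F1 F2] := @frame_jump x (G x) x' (lin id (G x) x') (lin G x (G x)) al be v E1 E2.
  have fac : lin G x x' v = lin id (G x) x' (lin G x (G x) v) by exact: hfac.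
  have h1 := estG x x' q q' xKG (lt_le_trans xq eKG) (lt_le_trans xq' eKG).
  have D0 := mdist_ge0 A q q'.
  have vq : `|v| <= Cl * d q q'.
    by have /andP[_ h] := locC x q q' (lt_le_trans xq eCl) (lt_le_trans xq' eCl).
  pose w := loc x' (G q) - loc x' (G q') - lin id (G x) x' (lin G x (G x) v).
  have hw : `|w| <= KG * (2 * e) * d q q'.
    have E : `|w| = `|loc x' (G q) - loc x' (G q') - lin G x x' v|.
      by exact: (congr1 (fun u => `|loc x' (G q) - loc x' (G q') - u|) (esym fac)).
    rewrite [X in X <= _]E; apply: le_trans h1 _; apply: ler_wpM2r => //; apply: ler_wpM2l; first exact: ltW.
    have -> : 2 * e = e + e by ring.
    by apply: lerD; exact: ltW.
  have [w1 w2 _] := hc x' w; have [v1 v2 _] := hc x v.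
  have cE2 : Cc * `|w| <= eta / 2 * d q q'.
    apply: le_trans (ler_wpM2l (ltW Cc0) hw) _.
    by rewrite mulrA; apply: ler_wpM2r.
  have vv : Cc * `|v| <= Cc * Cl * d q q' by rewrite -mulrA; exact: (ler_wpM2l (ltW Cc0)).
  have CCn : 0 <= Cc * Cl * (et * (Cn * Cn)) by rewrite !mulr_ge0 // ltW.
  have bnd (z y u k : R) : `|z| <= k -> 0 <= k -> k <= 1 + Cn * Cn * KG -> `|y| <= Cc * `|v| ->
      `|u| <= et * (Cn * Cn) -> `|z * y * u| <= eta / 2 * d q q'.
    move=> hz k0 hk hy hu; rewrite !normrM.
    apply: le_trans (_ : k * (Cc * Cl * d q q') * (et * (Cn * Cn)) <= _).
      apply: ler_pM => //.
      by apply: ler_pM => //; exact: (le_trans hy vv).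
    have -> : k * (Cc * Cl * d q q') * (et * (Cn * Cn)) = (k * (Cc * Cl * (et * (Cn * Cn)))) * d q q' by ring.
    apply: ler_wpM2r => //; apply: le_trans (ler_wpM2r CCn hk) _; apply: le_trans etP.
    by rewrite /P mulrDr mulr1 ler_wpDl ?(ltW et0) // le_eqVlt; apply/orP; left; apply/eqP; ring.
  have KCn : 0 <= Cn * Cn * KG by exact: ltW.
  have A1 : cS x' (lin id (G x) x' (lin G x (G x) v)) + cS x' w = cS x' (loc x' (G q)) - cS x' (loc x' (G q')).
    apply: etrans (congr1 (fun z => _ + z) (cSB x' (loc x' (G q) - loc x' (G q')) _)) _.
    apply: etrans (congr1 (fun z => _ + (z - _)) (cSB x' (loc x' (G q)) (loc x' (G q')))) _.
    exact: addrC_subK.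
  have A2 : cU x' (lin id (G x) x' (lin G x (G x) v)) + cU x' w = cU x' (loc x' (G q)) - cU x' (loc x' (G q')).
    apply: etrans (congr1 (fun z => _ + z) (cUB x' (loc x' (G q) - loc x' (G q')) _)) _.
    apply: etrans (congr1 (fun z => _ + (z - _)) (cUB x' (loc x' (G q)) (loc x' (G q')))) _.
    exact: addrC_subK.
  have etaD : eta * d q q' = eta / 2 * d q q' + eta / 2 * d q q' by field.
  have fin (a b t y z u : R) : t + u = a -> t - b * y = z -> `|z| <= eta / 2 * d q q' ->
      `|u| <= eta / 2 * d q q' -> `|a - b * y| <= eta * d q q'.
    move=> <- <- h2 h3; rewrite addrAC etaD; exact: le_trans (ler_normD _ _) (lerD h2 h3).
  split.
    apply: (fin _ _ (cS x' (lin id (G x) x' (lin G x (G x) v))) _ _ (cS x' w)).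
    + exact: A1.
    + rewrite -(cSB x); exact: F1.
    + by apply: (bnd _ _ _ 1) => //; [apply: le_trans be1 _; rewrite ler_pdivrMr // mul1r ler1n|rewrite lerDl].
    + exact: le_trans w1 cE2.
  apply: (fin _ _ (cU x' (lin id (G x) x' (lin G x (G x) v))) _ _ (cU x' w)).
  + exact: A2.
  + rewrite -(cUB x); exact: F2.
  + by apply: (bnd _ _ _ (Cn * Cn * KG)) => //; [rewrite alE|rewrite lerDr].
  + exact: le_trans w2 cE2.
Qed.
End HyperbolicCoordinates.

(** * Shadowing and the volume of Bowen balls *)

Lemma lipschitz_continuous (R : realType) (f : R -> R) (L : R) :
  (forall x y, `|f x - f y| <= L * `|x - y|) -> continuous f.
Proof.
move=> H x; apply/cvgrPdist_lt => e e0; near=> y.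
apply: le_lt_trans (H x y) _.
have L0 : 0 < `|L| + 1 by rewrite ltr_wpDl.
apply: le_lt_trans (_ : (`|L| + 1) * `|x - y| < _).
  by rewrite ler_wpM2r // (le_trans (ler_norm L)) // lerDl.
rewrite -ltr_pdivlMl // mulrC; near: y.
by apply: cvgr_dist_lt; [exact: cvg_id|rewrite divr_gt0].
Unshelve. all: by end_near. Qed.

Lemma clamp_itv (R : realFieldType) (rho t : R) : 0 <= rho ->
  `|Num.max (- rho) (Num.min rho t)| <= rho.
Proof.
move=> r0; rewrite ler_norml le_max lexx /= ge_max ge_min lexx /= andbT; lra.
Qed.

Lemma max_dist_le (R : realDomainType) (a u v : R) :
  `|Num.max a u - Num.max a v| <= `|u - v|.
Proof.
by rewrite /Num.max; case: ifPn => ?; case: ifPn => ?;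
  rewrite ler_norml; case: (ler0P (u - v)) => ?; apply/andP; split; lra.
Qed.

Lemma clamp_dist (R : realFieldType) (rho t t' : R) :
  `|Num.max (- rho) (Num.min rho t) - Num.max (- rho) (Num.min rho t')| <= `|t - t'|.
Proof. exact: le_trans (max_dist_le _ _ _) (min_dist_le _ _ _). Qed.

Lemma clamp_id (R : realFieldType) (rho t : R) : `|t| <= rho ->
  Num.max (- rho) (Num.min rho t) = t.
Proof. by rewrite ler_norml => /andP[h1 h2]; rewrite min_r // max_r. Qed.

Section Hyperbolic.
Variables (R : realType) (M : pointedType) (d : M -> M -> R) (G : M -> M).
Variables (ku ks : M -> M -> R) (a : M -> R) (C : R).
Hypothesis d_ge0 : forall x y, 0 <= d x y.
Hypothesis dxx : forall x, d x x = 0.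
Hypothesis dC : forall x y, d x y = d y x.
Hypothesis dT : forall y x z, d x z <= d x y + d y z.
Hypothesis H : hyp_chart d G ku ks a C.
Local Notation dm := (dmax ku ks).

Let C1 : 1 <= C := hc_C H.
Let C0 : 0 < C. Proof. exact: lt_le_trans ltr01 C1. Qed.
Let iC0 : 0 < C^-1. Proof. by rewrite invr_gt0. Qed.

Definition box (rho : R) (x q : M) :=
  [/\ d x q < C^-1, `|ku x q| <= rho & `|ks x q| <= rho].

Lemma dm_u x q q' : `|ku x q - ku x q'| <= dm x q q'.
Proof. by rewrite /dmax le_max lexx. Qed.

Lemma dm_ge0 x q q' : 0 <= dm x q q'.
Proof. exact: le_trans (normr_ge0 _) (dm_u x q q'). Qed.

Lemma dm_center x q : dm x q x = Num.max `|ku x q| `|ks x q|.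
Proof. by rewrite /dmax (hc_u0 H) (hc_s0 H) !subr0. Qed.

Lemma box_dist rho x q : box rho x q -> d x q <= C * rho.
Proof.
move=> [xq hu hs]; have dx : d x x < C^-1 by rewrite dxx.
have [h _] := hc_bilip H xq dx; rewrite dC; apply: le_trans h _.
by rewrite dm_center ler_wpM2l ?(ltW C0) // ge_max hu hs.
Qed.

Lemma box_of_dist rho x q : d x q < C^-1 -> C * d x q <= rho -> box rho x q.
Proof.
move=> xq xqr; have dx : d x x < C^-1 by rewrite dxx.
have [_ h] := hc_bilip H xq dx; rewrite dm_center dC in h.
by move: (le_trans h xqr); rewrite ge_max => /andP[hu hs].
Qed.

(** What a graph transform needs from one step of a pseudo-orbit: hyperbolic estimates on a box,
    with relative error 1/6, and a jump that shifts the new box by at most a sixth of its size. *)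
Definition step_ok (rho : R) (x x' : M) :=
  [/\ forall q, box rho x q -> d x' (G q) < C^-1,
      `|ku x' (G x)| <= rho / 6, `|ks x' (G x)| <= rho / 6 &
      exists al be : R, [/\ 3 <= `|al|, `|be| <= 1 / 3 &
      forall q q', box rho x q -> box rho x q' ->
      `|ku x' (G q) - ku x' (G q') - al * (ku x q - ku x q')| <= dm x q q' / 6 /\
      `|ks x' (G q) - ks x' (G q') - be * (ks x q - ks x q')| <= dm x q q' / 6]].

Lemma jump_step_ok : exists2 rho0 : R, 0 < rho0 & forall rho, 0 < rho <= rho0 ->
  exists2 e : R, 0 < e & forall x x', d (G x) x' < e -> step_ok rho x x'.
Proof.
have eta0 : 0 < (6 * C)^-1 by rewrite invr_gt0 mulr_gt0.
have [e e0 He] := hc_jump H eta0.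
exists (Num.min (e / (2 * C)) (C^-1 / (4 * (C * C)))).
  by rewrite lt_min !divr_gt0 ?mulr_gt0.
move=> rho /andP[rho0]; rewrite le_min => /andP[re rC].
exists (Num.min (Num.min e (C^-1 / 2)) (rho / (12 * C))).
  by rewrite !lt_min e0 !divr_gt0 ?mulr_gt0.
move=> x x'; rewrite !lt_min => /andP[/andP[xe xC] xr].
have d_box q : box rho x q -> d x q < e.
  move=> /box_dist/le_lt_trans; apply.
  rewrite ler_pdivlMr ?mulr_gt0 // in re.
  have h4 : rho * (2 * C) = 2 * (C * rho) by ring.
  by have Cr := mulr_gt0 C0 rho0; rewrite h4 in re; lra.
have d_boxC q : box rho x q -> d x' (G q) < C^-1.
  move=> bq; apply: le_lt_trans (dT (G x) _ _) _; rewrite dC.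
  have h1 := hc_lip H x q; have h2 := box_dist bq.
  have h3 : C * d x q <= C * (C * rho) by rewrite ler_wpM2l // ltW.
  rewrite ler_pdivlMr ?mulr_gt0 // in rC.
  have h4 : rho * (4 * (C * C)) = 4 * (C * (C * rho)) by ring.
  by rewrite h4 in rC; lra.
have dx' : d x' x' < C^-1 by rewrite dxx.
have x'x : d x' (G x) < C^-1 by rewrite dC; lra.
have off : dm x' (G x) x' <= rho / 6.
  have [_ h] := hc_bilip H x'x dx'; apply: le_trans h _.
  rewrite ltr_pdivlMr ?mulr_gt0 // in xr.
  have h4 : d (G x) x' * (12 * C) = 12 * (C * d (G x) x') by ring.
  by rewrite h4 in xr; lra.
rewrite dm_center ge_max in off; have /andP[off1 off2] := off.
split=> //; have [al [be [h1 h2 h3]]] := He x x' xe.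
exists al, be; split=> // q q' bq bq'.
have [h4 h5] := h3 q q' (d_box _ bq) (d_box _ bq').
have [qC _ _] := bq; have [q'C _ _] := bq'.
have [h6 _] := hc_bilip H qC q'C.
have h7 : (6 * C)^-1 * d q q' <= dm x q q' / 6.
  rewrite ler_pdivrMl ?mulr_gt0 //; apply: le_trans h6 _.
  by rewrite le_eqVlt; apply/orP; left; apply/eqP; field.
by split; apply: le_trans h7.
Qed.

(** A curve crossing the box in the expanding direction, encoded as a set of points: it meets every
    level of [ku] and is the graph of a 1-Lipschitz function over [ku]. *)
Definition crossing (rho : R) (x : M) (S : M -> Prop) :=
  [/\ forall q, S q -> box rho x q,
      forall t, `|t| <= rho -> exists2 q, S q & ku x q = t &
      forall q q', S q -> S q' -> `|ks x q - ks x q'| <= `|ku x q - ku x q'|].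

(** The relative error 1/6 degrades the factors 3 and 1/3 to 2 and 1/2, which leaves the horizontal
    cone invariant. *)
Lemma cone_step x x' al be q q' :
  3 <= `|al| -> `|be| <= 1 / 3 ->
  `|ku x' (G q) - ku x' (G q') - al * (ku x q - ku x q')| <= dm x q q' / 6 ->
  `|ks x' (G q) - ks x' (G q') - be * (ks x q - ks x q')| <= dm x q q' / 6 ->
  (`|ks x q - ks x q'| <= `|ku x q - ku x q'| ->
    2 * `|ku x q - ku x q'| <= `|ku x' (G q) - ku x' (G q')| /\
    `|ks x' (G q) - ks x' (G q')| <= `|ku x' (G q) - ku x' (G q')|) /\
  (`|ku x q - ku x q'| <= `|ks x q - ks x q'| ->
    `|ks x' (G q) - ks x' (G q')| <= 1 / 2 * `|ks x q - ks x q'|).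
Proof.
rewrite /dmax; set u := ku x q - ku x q'; set s := ks x q - ks x q'.
set u' := ku x' (G q) - _; set s' := ks x' (G q) - _.
move=> al3 be3 hu hs.
have us : `|al| * `|u| <= `|u'| + Num.max `|u| `|s| / 6.
  rewrite -normrM; apply: le_trans (lerD (lexx _) hu).
  by rewrite -[X in `|X| <= _](subKr u') ler_normB.
have ss : `|s'| <= `|be| * `|s| + Num.max `|u| `|s| / 6.
  rewrite -normrM; apply: le_trans (lerD (lexx _) hs).
  by rewrite addrC -{1}(subrK (be * s) s') ler_normD.
have h1 : 3 * `|u| <= `|al| * `|u| by rewrite ler_wpM2r.
have h2 : `|be| * `|s| <= 1 / 3 * `|s| by rewrite ler_wpM2r.
have u0 := normr_ge0 u; have s0 := normr_ge0 s.
clear al3 be3 hu hs.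
by split=> h; [rewrite max_l // in us ss; split|rewrite max_r // in us ss]; lra.
Qed.

(** The image of a crossing curve, cut to the new box, crosses again. Over [ku] it reaches at least
    (3 - 1/6) rho to both sides of a point within rho/3 of the centre, so the intermediate value
    theorem gives all levels. *)
Lemma crossing_step rho x x' S : 0 < rho -> step_ok rho x x' -> crossing rho x S ->
  crossing rho x' (fun y => exists2 q, S q & y = G q /\ box rho x' (G q)).
Proof.
move=> rho0 [hd offu offs [al [be [al3 be3 hst]]]] [Sb Su Sc].
split=> [_ [q Sq [-> bq]] //| |_ _ [q Sq [-> _]] [q' Sq' [-> _]]]; last first.
  have [h1 h2] := hst _ _ (Sb _ Sq) (Sb _ Sq').
  have [h3 _] := cone_step al3 be3 h1 h2.
  by case: (h3 (Sc _ _ Sq Sq')).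
(* The curve is parametrised by [ku]. Clamping the parameter extends the parametrisation to the
   whole line, where the function [f] below is Lipschitz without restriction. *)
have /choice[h hP] : forall t, exists q, S q /\ ku x q = Num.max (- rho) (Num.min rho t).
  move=> t; have [q Sq qE] := Su _ (clamp_itv t (ltW rho0)).
  by exists q.
pose f t := ku x' (G (h t)).
have hfd t t' : `|f t - f t' - al * (Num.max (- rho) (Num.min rho t)
      - Num.max (- rho) (Num.min rho t'))|
    <= `|Num.max (- rho) (Num.min rho t) - Num.max (- rho) (Num.min rho t')| / 6.
  have [St Et] := hP t; have [St' Et'] := hP t'.
  have [h1 _] := hst _ _ (Sb _ St) (Sb _ St').
  have E : dm x (h t) (h t') = `|ku x (h t) - ku x (h t')|.
    by rewrite /dmax max_l // Sc.
  by rewrite E Et Et' in h1.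
have cf : continuous f.
  apply: (@lipschitz_continuous _ _ (`|al| + 1 / 6)) => t t'.
  have hc := clamp_dist rho t t'; have := hfd t t'.
  set D := _ - Num.max _ _ in hc *.
  move=> h1; apply: le_trans (_ : (`|al| + 1 / 6) * `|D| <= _); last first.
    by rewrite ler_wpM2l // addr_ge0.
  rewrite -[X in `|X|](subrK (al * D)); apply: le_trans (ler_normD _ _) _.
  by rewrite normrM; lra.
have bx : box rho x x by split; rewrite ?dxx // ?(hc_u0 H) ?(hc_s0 H) normr0 ltW.
have [S0 E0] := hP 0.
have c0 : Num.max (- rho) (Num.min rho 0) = 0 by rewrite clamp_id // normr0 ltW.
have cr : Num.max (- rho) (Num.min rho rho) = rho by rewrite clamp_id // ger0_norm // ltW.
have cNr : Num.max (- rho) (Num.min rho (- rho)) = - rho.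
  by rewrite clamp_id // normrN ger0_norm // ltW.
have f0 : `|f 0| <= rho / 3.
  have [h1 _] := hst _ _ (Sb _ S0) bx.
  rewrite E0 c0 (hc_u0 H) subrr mulr0 subr0 dm_center E0 c0 normr0 in h1.
  have [_ _ sb] := Sb _ S0; rewrite max_r // in h1.
  have -> : f 0 = (ku x' (G (h 0)) - ku x' (G x)) + ku x' (G x) by rewrite subrK.
  by apply: le_trans (ler_normD _ _) _; lra.
have h1 := hfd rho 0; have h2 := hfd (- rho) 0.
rewrite cr c0 subr0 in h1; rewrite cNr c0 subr0 normrN in h2.
rewrite (ger0_norm (ltW rho0)) in h1 h2.
have cover t : `|t| <= rho -> exists c, f c = t.
  rewrite ler_norml => /andP[t1 t2].
  have lt : - rho <= rho by lra.
  have [] := @IVT R f (- rho) rho t lt (continuous_subspaceT cf).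
    rewrite ge_min le_max.
    move: h1 h2 f0; rewrite !ler_norml => /andP[a1 a2] /andP[b1 b2] /andP[e1 e2].
    have : 3 * rho <= `|al| * rho by rewrite ler_wpM2r // ltW.
    case: (ger0P al) => al0 h3; first by apply/andP; split; apply/orP; [left|right]; lra.
    by apply/andP; split; apply/orP; [right|left]; lra.
  by move=> c _ fc; exists c.
move=> t tr; have [c fc] := cover t tr.
have [Sc' Ec] := hP c; exists (G (h c)) => //; exists (h c) => //; split=> //.
have bc := Sb _ Sc'; split; [exact: hd|by rewrite -/(f c) fc|].
have [_ h3] := hst _ _ bc bx.
rewrite (hc_s0 H) subr0 dm_center in h3; have [_ ub sb] := bc.
have mr : Num.max `|ku x (h c)| `|ks x (h c)| <= rho by rewrite ge_max ub sb.
have h4 : `|be * ks x (h c)| <= 1 / 3 * rho by rewrite normrM ler_pM.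
have -> : ks x' (G (h c)) = (ks x' (G (h c)) - ks x' (G x) - be * ks x (h c))
    + be * ks x (h c) + ks x' (G x) by rewrite !subrK.
apply: le_trans (ler_normD _ _) _; apply: le_trans (lerD (ler_normD _ _) (lexx _)) _.
by move: (Num.max _ _) mr h3 => mx mr h3; lra.
Qed.

Lemma crossing_line rho x s : 0 < rho -> C * rho < C^-1 -> `|s| <= rho ->
  crossing rho x (fun q => box rho x q /\ ks x q = s).
Proof.
move=> r0 rC sr; split=> [q [] //|t tr|q q' [_ ->] [_ ->]]; last by rewrite subrr normr0.
have rC' : rho < C^-1 by apply: le_lt_trans rC; rewrite ler_peMl // ltW.
have [q xq [uE sE]] := hc_surj H x (le_lt_trans tr rC') (le_lt_trans sr rC').
exists q => //; split=> //; split; rewrite ?uE ?sE //.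
apply: le_lt_trans xq (le_lt_trans _ rC); rewrite ler_wpM2l ?(ltW C0) //.
by rewrite ge_max tr sr.
Qed.

(** Serves twice: along a pseudo-orbit it yields shadowing; along a true orbit it yields points with
    prescribed [ks] at the start and prescribed [ku] at the end, the grid used to measure Bowen
    balls. *)
Lemma crossing_orbit rho (xs : nat -> M) n S0 : 0 < rho ->
  (forall i, (i < n)%N -> step_ok rho (xs i) (xs i.+1)) ->
  crossing rho (xs 0%N) S0 ->
  exists2 Sn, crossing rho (xs n) Sn & forall y, Sn y ->
    exists q, [/\ S0 q, y = iter n G q &
      forall i, (i <= n)%N -> box rho (xs i) (iter i G q)].
Proof.
move=> r0; elim: n => [|n IH] hst S0c.
  exists S0 => // y Sy; exists y; split=> // i; rewrite leqn0 => /eqP ->.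
  by have [Sb _ _] := S0c; exact: Sb.
have [i ni|Sn Snc HSn] := IH _ S0c; first by apply: hst; rewrite ltnS ltnW.
exists (fun y => exists2 q, Sn q & y = G q /\ box rho (xs n.+1) (G q)).
  exact: (crossing_step r0 (hst n (ltnSn n)) Snc).
move=> _ [q Sq [-> bq]]; have [q0 [Sq0 qE Hq]] := HSn q Sq.
exists q0; split=> //; first by rewrite qE.
move=> i; rewrite leq_eqVlt => /orP[/eqP ->|]; last exact: Hq.
by rewrite iterS -qE.
Qed.

Lemma shadowing (e : R) : 0 < e -> exists2 del : R, 0 < del &
  forall n (xs : nat -> M), (forall i, (i < n)%N -> d (G (xs i)) (xs i.+1) < del) ->
  exists z, forall i, (i <= n)%N -> d (xs i) (iter i G z) <= e.
Proof.
move=> e0; have [rho0 rho00 Hr] := jump_step_ok.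
pose rho := Num.min rho0 (Num.min (e / C) (C^-1 / (2 * C))).
have r0 : 0 < rho by rewrite !lt_min rho00 !divr_gt0 ?mulr_gt0.
have re : C * rho <= e by rewrite mulrC -ler_pdivlMr // !ge_min lexx /= orbT.
have rC : C * rho < C^-1.
  rewrite mulrC -ltr_pdivlMr //; apply: le_lt_trans (_ : C^-1 / (2 * C) < _).
    by rewrite !ge_min lexx !orbT.
  by rewrite ltr_pM2l // ltf_pV2 ?posrE ?mulr_gt0 // ltr_pMl // ltr1n.
have [|del del0 Hd] := Hr rho; first by rewrite r0 ge_min lexx.
exists del => // n xs hxs.
have S0 : crossing rho (xs 0%N) (fun q => box rho (xs 0%N) q /\ ks (xs 0%N) q = 0).
  by apply: crossing_line => //; rewrite normr0 ltW.
have [|Sn [_ Snu _] HSn] := crossing_orbit r0 _ S0 (n := n).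
  by move=> i ni; apply: Hd; exact: hxs.
have [|y Sy _] := Snu 0; first by rewrite normr0 ltW.
have [q [_ _ Hq]] := HSn y Sy.
by exists q => i ni; apply: le_trans (box_dist (Hq i ni)) re.
Qed.

End Hyperbolic.

(** * Distortion along an orbit and the volume estimate *)

(** Once [V <= U] holds it persists and [U] doubles up to time [n], so an early [U] is small as seen
    from the end. As long as it fails, [V] halves, so it is small as seen from the start. *)
Lemma decay_seq (R : realFieldType) (U V : nat -> R) (n : nat) (rho : R) :
  (forall i, (i < n)%N ->
    (V i <= U i -> 2 * U i <= U i.+1 /\ V i.+1 <= U i.+1) /\
    (U i <= V i -> V i.+1 <= 1 / 2 * V i)) ->
  (forall i, (i <= n)%N -> 0 <= U i <= rho /\ 0 <= V i <= rho) ->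
  forall i, (i <= n)%N ->
    Num.max (U i) (V i) <= rho * (2^-1 ^+ i + 2^-1 ^+ (n - i)).
Proof.
move=> hst hb i ni.
have r0 : 0 <= rho by have [/andP[h1 h2] _] := hb 0%N (leq0n n); exact: le_trans h2.
have cone k j : (k + j <= n)%N -> V k <= U k -> 2 ^+ j * U k <= U (k + j)%N /\ V (k + j)%N <= U (k + j)%N.
  elim: j => [|j IH] kj c; first by rewrite addn0 expr0 mul1r.
  rewrite addnS in kj *; have [h1 h2] := IH (ltnW kj) c.
  have [h3 _] := hst _ kj; have [h4 h5] := h3 h2; split=> //.
  by apply: le_trans h4; rewrite exprS -mulrA ler_pM2l.
have [c|c] := leP (V i) (U i).
  have [h1 _] := cone i (n - i)%N ltac:(by rewrite subnKC) c.
  have [/andP[_ h2] _] := hb n (leqnn n).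
  have h3 : U i <= rho * 2^-1 ^+ (n - i).
    rewrite exprVn ler_pdivlMr ?exprn_gt0 // mulrC; apply: le_trans h1 _.
    by rewrite subnKC.
  by rewrite mulrDr; apply: le_trans h3 _; rewrite lerDr mulr_ge0 // exprn_ge0.
have anti j : (j <= i)%N -> U j <= V j.
  move=> ji; rewrite leNgt; apply/negP => /ltW h.
  have [_] := cone j (i - j)%N ltac:(by rewrite subnKC // (leq_trans ji)) h.
  by rewrite subnKC // leNgt c.
have {}anti j : (j <= i)%N -> V j <= 2^-1 ^+ j * V 0%N.
  elim: j => [|j IH] ji; first by rewrite expr0 mul1r.
  have [_ h] := hst j (leq_trans ji ni); apply: le_trans (h (anti _ (ltnW ji))) _.
  by rewrite exprS div1r -mulrA ler_pM2l // IH // ltnW.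
have [_ /andP[_ h2]] := hb 0%N (leq0n n).
rewrite mulrDr; apply: le_trans (_ : rho * 2^-1 ^+ i <= _).
  by apply: le_trans (anti i (leqnn i)) _; rewrite mulrC ler_wpM2r // exprn_ge0.
by rewrite lerDl mulr_ge0 // exprn_ge0.
Qed.

(** By induction [U i] and the product of the factors agree up to the factor 1 minus the sum of the
    errors so far; a total error of at most 1/2 gives the factor 2. *)
Lemma distort_seq (R : realFieldType) (U e a : nat -> R) (n : nat) :
  (forall i, (i < n)%N -> [/\ 1 <= a i, 0 <= e i, 0 <= U i,
     (a i - e i) * U i <= U i.+1 & U i.+1 <= (a i + e i) * U i]) ->
  0 <= U 0%N -> \sum_(i < n) e i <= 1 / 2 ->
  U 0%N * \prod_(i < n) a i <= 2 * U n /\ U n <= 2 * (U 0%N * \prod_(i < n) a i).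
Proof.
move=> hs U0 he.
have es i : (i <= n)%N -> 0 <= \sum_(k < i) e k <= 1 / 2.
  move=> ni; have e0 k : (k < n)%N -> 0 <= e k by move=> /hs[].
  apply/andP; split; first by apply: sumr_ge0 => k _; apply: e0; apply: leq_trans ni.
  apply: le_trans he; rewrite -(subnKC ni) big_split_ord /= lerDl.
  by apply: sumr_ge0 => k _; apply: e0; rewrite -ltn_subRL.
have key i : (i <= n)%N -> [/\ 0 <= \prod_(k < i) a k,
    U 0%N * \prod_(k < i) a k * (1 - \sum_(k < i) e k) <= U i &
    U i * (1 - \sum_(k < i) e k) <= U 0%N * \prod_(k < i) a k].
  elim: i => [|i IH] ni; first by rewrite !big_ord0 subr0 !mulr1 ler01.
  have [P0 h1 h2] := IH (ltnW ni); have [a1 e0 Ui h3 h4] := hs i ni.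
  have /andP[s0 s1] := es _ ni; have /andP[t0 t1] := es _ (ltnW ni).
  move: s0 s1; rewrite !big_ord_recr /=; move: P0 h1 h2 t0 t1.
  move: (\prod_(k < i) a k) (\sum_(k < i) e k) => P t P0 h1 h2 t0 t1 s0 s1.
  have UP : 0 <= U 0%N * P by rewrite mulr_ge0.
  split; first by rewrite mulr_ge0 //; lra.
    apply: le_trans h3; apply: le_trans (_ : (a i - e i) * (U 0%N * P * (1 - t)) <= _).
      have -> : U 0%N * (P * a i) * (1 - (t + e i)) =
        (a i - e i) * (U 0%N * P * (1 - t)) - (e i * (a i - 1 + t)) * (U 0%N * P) by ring.
      by rewrite gerBl mulr_ge0 // mulr_ge0 //; lra.
    by rewrite ler_wpM2l //; lra.
  apply: le_trans (_ : (a i + e i) * U i * (1 - (t + e i)) <= _).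
    by rewrite ler_wpM2r //; lra.
  have -> : (a i + e i) * U i * (1 - (t + e i)) =
     a i * (U i * (1 - t)) - e i * (a i - 1 + t + e i) * U i by ring.
  apply: le_trans (_ : a i * (U i * (1 - t)) <= _).
    by rewrite gerBl !mulr_ge0 //; lra.
  have -> : U 0%N * (P * a i) = a i * (U 0%N * P) by ring.
  by rewrite ler_wpM2l //; lra.
have [P0 h1 h2] := key n (leqnn n); have /andP[t0 t1] := es n (leqnn n).
have Un : 0 <= U n.
  by apply: le_trans h1; rewrite !mulr_ge0 //; lra.
move: P0 h1 h2 t0 t1; move: (\prod_(k < n) a k) (\sum_(k < n) e k) => P t P0 h1 h2 t0 t1.
have UP : 0 <= U 0%N * P by rewrite mulr_ge0.
by split; nra.
Qed.

Lemma two_sided_geometric_le (R : realFieldType) n :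
  \sum_(i < n) (2^-1 ^+ i + 2^-1 ^+ (n - i)) <= 3 :> R.
Proof.
have h m : \sum_(i < m) (2^-1 : R) ^+ i = 2 - 2 * 2^-1 ^+ m.
  elim: m => [|m IH]; first by rewrite big_ord0 expr0 mulr1 subrr.
  by rewrite big_ord_recr /= IH exprS; field.
rewrite big_split /= h (reindex_inj rev_ord_inj) /=.
have -> : \sum_(i < n) (2^-1 : R) ^+ (n - (n - i.+1)) = 2^-1 * \sum_(i < n) 2^-1 ^+ i.
  by rewrite mulr_sumr; apply: eq_bigr => i _; rewrite subKn // exprS.
have := exprn_ge0 n (ltac:(by rewrite invr_ge0) : 0 <= (2^-1 : R)).
by rewrite h => ?; lra.
Qed.

(** Each point is coded by the strip of width [r] containing [g x] and by the cell of [f x] modulo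
    [K]. Within one strip the values of [f] differ by at least [r], hence lie in different cells,
    and by at most [W], hence the cells differ by less than [K]; so the code is injective without a
    common range for [f]. *)
Lemma grid_count (R : realType) (T : eqType) (s : seq T) (f g : T -> R) (r rho W : R) :
  0 < r -> 0 <= rho -> 0 <= W -> uniq s -> (forall x, x \in s -> `|g x| <= rho) ->
  (forall x y, x \in s -> y \in s -> x != y -> `|g x - g y| < r ->
     r <= `|f x - f y| <= W) ->
  (size s)%:R <= (2 * rho / r + 1) * (W / r + 2).
Proof.
move=> r0 rho0 W0 us hg hf.
pose J := (Num.truncn (2 * rho / r)).+1; pose K := (Num.truncn (W / r)).+2.
pose j x : nat := Num.truncn ((g x + rho) / r).
pose k x : nat := `|(Num.floor (f x / r) %% K%:Z)%Z|%N.
have g0 x : x \in s -> 0 <= (g x + rho) / r.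
  by move=> /hg; rewrite ler_norml => /andP[h _]; apply: divr_ge0; [lra|exact: ltW].
have jJ x : x \in s -> (j x < J)%N.
  move=> xs; rewrite ltnS /j; apply: le_truncn.
  rewrite ler_pM2r ?invr_gt0 //; have := hg x xs; rewrite ler_norml => /andP[_ h]; lra.
have kK x : (k x < K)%N.
  by rewrite -ltz_nat gez0_abs ?modz_ge0 ?ltz_pmod.
have inj : {in s &, injective (fun x => (j x, k x))}.
  move=> x y xs ys [jE kE]; apply/eqP; apply: contraT => xy.
  have gxy : `|g x - g y| < r.
    have /andP[h1 h2] := truncn_itv (g0 x xs); have /andP[h3 h4] := truncn_itv (g0 y ys).
    rewrite -/(j _) jE in h1 h2; rewrite -/(j _) -natr1 in h3 h4; rewrite -natr1 in h2.
    rewrite ltr_pdivrMr // in h2; rewrite ltr_pdivrMr // in h4.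
    rewrite ler_pdivlMr // in h1; rewrite ler_pdivlMr // in h3.
    by rewrite ltr_norml; apply/andP; split; lra.
  have /andP[f1 f2] := hf x y xs ys xy gxy.
  have kE' : (Num.floor (f x / r) = Num.floor (f y / r) %[mod K%:Z])%Z.
    by move: kE; rewrite /k => /(congr1 (fun n : nat => n%:Z)); rewrite !gez0_abs ?modz_ge0.
  have /dvdzP[q qE] : (K%:Z %| Num.floor (f x / r) - Num.floor (f y / r))%Z.
    by rewrite -eqz_mod_dvd; apply/eqP.
  have /andP[a1 a2] := floor_itv (f x / r); have /andP[b1 b2] := floor_itv (f y / r).
  have fd : `|(Num.floor (f x / r) - Num.floor (f y / r))%:~R - (f x - f y) / r| < 1 :> R.
    rewrite intrB mulrBl ltr_norml; rewrite !intrD /= in a2 b2; apply/andP; split; lra.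
  have Wr : `|(f x - f y) / r| <= W / r.
    by rewrite normrM (gtr0_norm (x := r^-1)) ?invr_gt0 // ler_pM2r // invr_gt0.
  have f1' : 1 <= `|(f x - f y) / r|.
    by rewrite normrM (gtr0_norm (x := r^-1)) ?invr_gt0 // ler_pdivlMr ?mul1r.
  have Kb : W / r + 1 < K%:R :> R.
    have /andP[_] := truncn_itv (divr_ge0 W0 (ltW r0)).
    by rewrite /K -[in X in _ < X]natr1; lra.
  rewrite qE intrM in fd.
  have q0 : q != 0.
    apply/eqP => q0; move: fd; rewrite q0 mul0r sub0r normrN => fd; lra.
  have q1 : 1 <= `|q%:~R| :> R.
    by rewrite -intr_norm -[1]/(1%:~R) ler_int -gtz0_ge1 normr_gt0.
  have : K%:R <= `|q%:~R * K%:~R| :> R.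
    by rewrite normrM [`|K%:~R|]ger0_norm ?ler0z // ler_peMl ?ler0z.
  set z : R := q%:~R * _ in fd *; have := ler_normB ((f x - f y) / r) (((f x - f y) / r) - z).
  by rewrite subKr distrC; lra.
have us' : uniq [seq (j x, k x) | x <- s] by rewrite map_inj_in_uniq.
have sub : {subset [seq (j x, k x) | x <- s] <= [seq (x, y) | x <- iota 0 J, y <- iota 0 K]}.
  move=> _ /mapP[x xs ->]; apply/allpairsP; exists (j x, k x).
  by rewrite !mem_iota /= jJ.
have := uniq_leq_size us' sub; rewrite size_map size_allpairs !size_iota => h.
apply: le_trans (_ : (J * K)%:R <= _); first by rewrite ler_nat.
rewrite natrM; apply: ler_pM => //.
  rewrite /J -natr1 lerD2r.
  by have /andP[] := truncn_itv (divr_ge0 (mulr_ge0 (ltac:(by []) : 0 <= (2 : R)) rho0) (ltW r0)).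
rewrite /K -[X in X%:R]addn2 natrD lerD2r.
by have /andP[] := truncn_itv (divr_ge0 W0 (ltW r0)).
Qed.

Ltac pos := repeat first [assumption | by apply: ltW | exact: ltr01 | exact: ler01 | exact: ler0n
  | by rewrite ltr0n | apply: normr_ge0 | apply: expR_gt0 | apply: expR_ge0
  | apply: mulr_gt0 | apply: mulr_ge0 | apply: addr_gt0 | apply: addr_ge0
  | apply: exprn_gt0 | apply: exprn_ge0 | rewrite invr_gt0 | rewrite invr_ge0].

Record pseudo_metric (R : realType) (M : Type) (d : M -> M -> R) : Prop := PseudoMetric {
  pm_ge0 : forall x y, 0 <= d x y ;
  pm_xx : forall x, d x x = 0 ;
  pm_C : forall x y, d x y = d y x ;
  pm_T : forall y x z, d x z <= d x y + d y z }.

Section BowenBalls.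
Variables (R : realType) (M : Type) (d : M -> M -> R) (G : M -> M).

Definition bowen (n : nat) (x : M) (e : R) (y : M) : Prop :=
  forall i, (i <= n)%N -> d (iter i G x) (iter i G y) <= e.

(** Up to constants, the width of a Bowen ball in the expanding direction. In the contracting
    direction its width stays of order one, so this is also its area. *)
Definition wgt (a : M -> R) (n : nat) (x : M) : R := \prod_(i < n) (a (iter i G x))^-1.

Lemma wgtD a n m x : wgt a (n + m) x = wgt a n x * wgt a m (iter n G x).
Proof.
rewrite /wgt big_split_ord /=; congr (_ * _); apply: eq_bigr => i _.
by rewrite addnC iterD.
Qed.

End BowenBalls.

Section Volume.
Variables (R : realType) (M : pointedType) (d : M -> M -> R) (G : M -> M).
Variables (ku ks : M -> M -> R) (a : M -> R) (C : R).
Hypothesis Hd : pseudo_metric d.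
Hypothesis H : hyp_chart d G ku ks a C.
Local Notation dm := (dmax ku ks).
Local Notation box := (box d ku ks C).
Local Notation bowen := (bowen d G).
Local Notation wgt := (wgt G a).

Let C1 : 1 <= C := hc_C H.
Let C0 : 0 < C. Proof. exact: lt_le_trans ltr01 C1. Qed.

Lemma wgt_bounds n x : C^-1 ^+ n <= wgt n x <= 1.
Proof.
rewrite /wgt; elim: n x => [|n IH] x; first by rewrite big_ord0 expr0 lexx.
rewrite big_ord_recr /= exprSr; have /andP[h1 h2] := IH x.
have /andP[a3 aC] := hc_rate H (iter n G x).
have a0 : 0 < a (iter n G x) by apply: lt_le_trans a3.
have C0' : 0 <= C^-1 by rewrite invr_ge0 ltW.
apply/andP; split; last first.
  apply: mulr_ile1 => //; first by apply: le_trans h1; rewrite exprn_ge0.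
    by rewrite invr_ge0 ltW.
  by rewrite invf_le1 //; apply: le_trans a3; rewrite ler1n.
apply: ler_pM => //; first by rewrite exprn_ge0.
by rewrite lef_pV2 ?posrE.
Qed.

Lemma wgt_gt0 n x : 0 < wgt n x.
Proof.
by have /andP[h _] := wgt_bounds n x; apply: lt_le_trans h; rewrite exprn_gt0 // invr_gt0.
Qed.

(** Bounded distortion relative to the orbit of the centre [x]. The error in one step is
    proportional to the distances of the two points to that orbit; [decay_seq] bounds these by a
    two-sided geometric sequence, whose sum is bounded independently of [n]. *)
Lemma orbit_pair : exists2 rho0 : R, 0 < rho0 & forall rho x n q q', 0 < rho <= rho0 ->
  (forall i, (i <= n)%N -> box rho (iter i G x) (iter i G q) /\
                           box rho (iter i G x) (iter i G q')) ->
  `|ks x q - ks x q'| <= `|ku x q - ku x q'| ->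
  let un := `|ku (iter n G x) (iter n G q) - ku (iter n G x) (iter n G q')| in
  `|ku x q - ku x q'| <= 2 * (wgt n x * un) /\
  wgt n x * un <= 2 * `|ku x q - ku x q'|.
Proof.
have C3 : 0 < C * C * C by rewrite !mulr_gt0.
(* With this radius each relative error is at most 1/6, as the cone estimates need, and their sum at
   most 1/2, as [distort_seq] needs. *)
exists ((12 * (C * C * C))^-1); first by rewrite invr_gt0 mulr_gt0.
move=> rho x n q q' /andP[r0 rr] hb cone0 un.
have rC3 : 12 * (C * C * C * rho) <= 1.
  by rewrite mulrA -ler_pdivlMl ?mulr_gt0 // mulr1.
have dxC y : d y y < C^-1 by rewrite (pm_xx Hd) invr_gt0.
have bd := box_dist (pm_xx Hd) (pm_C Hd) H.
pose err i (p p' : M) := C * C * (d (iter i G x) (iter i G p) + d (iter i G x) (iter i G p')).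
have step i p p' : box rho (iter i G x) (iter i G p) -> box rho (iter i G x) (iter i G p') ->
    exists al be : R, [/\ `|al| = a (iter i G x), `|be| <= 1 / 3,
      0 <= err i p p' <= 1 / 6,
      `|ku (iter i.+1 G x) (iter i.+1 G p) - ku (iter i.+1 G x) (iter i.+1 G p')
        - al * (ku (iter i G x) (iter i G p) - ku (iter i G x) (iter i G p'))|
        <= err i p p' * dm (iter i G x) (iter i G p) (iter i G p') &
      `|ks (iter i.+1 G x) (iter i.+1 G p) - ks (iter i.+1 G x) (iter i.+1 G p')
        - be * (ks (iter i G x) (iter i G p) - ks (iter i G x) (iter i G p'))|
        <= err i p p' * dm (iter i G x) (iter i G p) (iter i G p')].
  move=> bp bp'; have [al [be [h1 h2 h3]]] := hc_step H (iter i G x).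
  have [pC _ _] := bp; have [p'C _ _] := bp'.
  have [h4 h5] := h3 _ _ pC p'C; have [h6 _] := hc_bilip H pC p'C.
  have e0 : 0 <= d (iter i G x) (iter i G p) + d (iter i G x) (iter i G p').
    by rewrite addr_ge0 ?(pm_ge0 Hd).
  have eE : C * (d (iter i G x) (iter i G p) + d (iter i G x) (iter i G p'))
      * d (iter i G p) (iter i G p') <= err i p p' * dm (iter i G x) (iter i G p) (iter i G p').
    rewrite /err; apply: le_trans (ler_wpM2l _ h6) _; first by rewrite mulr_ge0 // ltW.
    by rewrite le_eqVlt; apply/orP; left; apply/eqP; ring.
  exists al, be; split=> //.
  - apply/andP; split; first by rewrite /err !mulr_ge0 // ltW.
    have b1 := bd _ _ _ bp; have b2 := bd _ _ _ bp'.
    rewrite /err; apply: le_trans (_ : C * C * (C * rho + C * rho) <= _).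
      by rewrite ler_wpM2l ?mulr_ge0 ?(ltW C0) // lerD.
    have -> : C * C * (C * rho + C * rho) = 2 * (C * C * C * rho) by ring.
    lra.
  - exact: le_trans h4 eE.
  - exact: le_trans h5 eE.
have seqcone i p p' : box rho (iter i G x) (iter i G p) -> box rho (iter i G x) (iter i G p') ->
   (`|ks (iter i G x) (iter i G p) - ks (iter i G x) (iter i G p')|
      <= `|ku (iter i G x) (iter i G p) - ku (iter i G x) (iter i G p')| ->
    2 * `|ku (iter i G x) (iter i G p) - ku (iter i G x) (iter i G p')| <=
      `|ku (iter i.+1 G x) (iter i.+1 G p) - ku (iter i.+1 G x) (iter i.+1 G p')| /\
    `|ks (iter i.+1 G x) (iter i.+1 G p) - ks (iter i.+1 G x) (iter i.+1 G p')| <=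
    `|ku (iter i.+1 G x) (iter i.+1 G p) - ku (iter i.+1 G x) (iter i.+1 G p')|) /\
  (`|ku (iter i G x) (iter i G p) - ku (iter i G x) (iter i G p')|
     <= `|ks (iter i G x) (iter i G p) - ks (iter i G x) (iter i G p')| ->
    `|ks (iter i.+1 G x) (iter i.+1 G p) - ks (iter i.+1 G x) (iter i.+1 G p')| <=
    1 / 2 * `|ks (iter i G x) (iter i G p) - ks (iter i G x) (iter i G p')|).
  move=> bp bp'; have [al [be [h1 h2 /andP[h3 h3'] h4 h5]]] := step i p p' bp bp'.
  have dm0 := dm_ge0 ku ks (iter i G x) (iter i G p) (iter i G p').
  have h6 : err i p p' * dm (iter i G x) (iter i G p) (iter i G p') <=
     dm (iter i G x) (iter i G p) (iter i G p') / 6.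
    by rewrite mulrC ler_wpM2l // -div1r.
  have a3 : 3 <= `|al| by rewrite h1; have /andP[] := hc_rate H (iter i G x).
  exact: (@cone_step R M G ku ks (iter i G x) (iter i.+1 G x) al be
    (iter i G p) (iter i G p') a3 h2 (le_trans h4 h6) (le_trans h5 h6)).
have bx i : (i <= n)%N -> box rho (iter i G x) (iter i G x).
  by move=> _; split; rewrite ?(hc_u0 H) ?(hc_s0 H) ?normr0 ?(ltW r0).
have dec p : (forall i, (i <= n)%N -> box rho (iter i G x) (iter i G p)) ->
   forall i, (i <= n)%N -> d (iter i G x) (iter i G p) <= C * (rho * (2^-1 ^+ i + 2^-1 ^+ (n - i))).
  move=> hp i ni; have := @decay_seq R
     (fun i => `|ku (iter i G x) (iter i G p) - ku (iter i G x) (iter i G x)|)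
     (fun i => `|ks (iter i G x) (iter i G p) - ks (iter i G x) (iter i G x)|) n rho
     (fun j hj => seqcone j p x (hp j (ltnW hj)) (bx j (ltnW hj))).
  move=> /(_ _ i ni) h; have [pC _ _] := hp i ni.
  have [h1 _] := hc_bilip H pC (dxC _); rewrite (pm_C Hd); apply: le_trans h1 _.
  rewrite ler_wpM2l ?(ltW C0) //; apply: h => j nj.
  by have [_ h2 h3] := hp j nj; rewrite (hc_u0 H) (hc_s0 H) !subr0 !normr_ge0 h2 h3.
pose U i := `|ku (iter i G x) (iter i G q) - ku (iter i G x) (iter i G q')|.
have cone i : (i <= n)%N -> `|ks (iter i G x) (iter i G q) - ks (iter i G x) (iter i G q')| <= U i.
  elim: i => [//|i IH] ni; have [b1 b2] := hb i (ltnW ni).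
  by have [h _] := seqcone i q q' b1 b2; have [_] := h (IH (ltnW ni)).
have [|||h1 h2] := @distort_seq R U (fun i => err i q q') (fun i => a (iter i G x)) n.
- move=> i ni; have [b1 b2] := hb i (ltnW ni).
  have [al [be [e1 e2 /andP[e3 e4] e5 _]]] := step i q q' b1 b2.
  have /andP[a3 _] := hc_rate H (iter i G x).
  have dmE : dm (iter i G x) (iter i G q) (iter i G q') = U i.
    by rewrite /dmax max_l //; exact: cone i (ltnW ni).
  rewrite dmE in e5.
  have U0 : 0 <= U i by rewrite /U.
  have hU : `|al * (ku (iter i G x) (iter i G q) - ku (iter i G x) (iter i G q'))| = a (iter i G x) * U i.
    by rewrite normrM e1.
  split=> //; first lra.
    rewrite mulrBl -hU lerBlDr; apply: le_trans (lerD (lexx _) e5).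
    rewrite -/(U i.+1) /U; set w := ku (iter i.+1 G x) _ - _; set z := al * _.
    by rewrite -{1}(subKr w z) ler_normB.
  rewrite mulrDl -hU addrC; apply: le_trans (lerD e5 (lexx _)).
  rewrite /U; set w := ku (iter i.+1 G x) _ - _; set z := al * _.
  by rewrite -{1}(subrK z w) ler_normD.
- by rewrite /U.
- apply: le_trans (_ : \sum_(i < n) 2 * (C * C * C) * rho * (2^-1 ^+ i + 2^-1 ^+ (n - i)) <= _).
    apply: ler_sum => i _.
    have d1 := dec q (fun j nj => (hb j nj).1) i (ltnW (ltn_ord i)).
    have d2 := dec q' (fun j nj => (hb j nj).2) i (ltnW (ltn_ord i)).
    rewrite /err; apply: le_trans (ler_wpM2l _ (lerD d1 d2)) _; first by rewrite mulr_ge0 ?ltW.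
    by rewrite le_eqVlt; apply/orP; left; apply/eqP; ring.
  rewrite -mulr_sumr; apply: le_trans (ler_wpM2l _ (two_sided_geometric_le R n)) _.
    by rewrite !mulr_ge0 // ltW.
  have -> : 2 * (C * C * C) * rho * 3 = 6 * (C * C * C * rho) by ring.
  lra.
have wE : wgt n x * \prod_(i < n) a (iter i G x) = 1.
  rewrite /wgt -big_split /= big1 // => i _; rewrite mulVf // gt_eqF //.
  by have /andP[a3 _] := hc_rate H (iter i G x); apply: lt_le_trans a3.
have w0 := wgt_gt0 n x.
rewrite -(ler_pM2l w0) in h1; rewrite -(ler_pM2l w0) in h2; split.
  by move: h1; rewrite mulrCA wE mulr1 mulrCA.
by move: h2; rewrite mulrCA [wgt n x * (_ * _)]mulrCA wE mulr1.
Qed.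

Definition net (r : R) (Q : seq M) :=
  [/\ uniq Q, forall x y, x \in Q -> y \in Q -> x != y -> r <= d x y &
      forall z, exists2 q, q \in Q & d z q <= r].

(** Each point of an [r]-net stands for area r^2. The condition on [r] makes the mesh finer than
    every Bowen ball up to time [n], and keeps the orbits of a point and of its nearest net point
    close during that time. *)
Lemma volume_estimate : exists2 e0 : R, 0 < e0 & forall e1, 0 < e1 <= e0 ->
  exists2 K : R, 1 <= K & forall n (r : R) Q, 0 < r -> K * r * C ^+ n <= 1 -> net r Q ->
    forall j x, (j <= n)%N ->
    wgt j x <= K * (r ^+ 2 * (count (fun q => `[< bowen j x e1 q >]) Q)%:R) /\
    r ^+ 2 * (count (fun q => `[< bowen j x e0 q >]) Q)%:R <= K * wgt j x.
Proof.
have [rho1 rho10 hpair] := orbit_pair.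
have [rho2 rho20 hjump] := jump_step_ok (pm_xx Hd) (pm_C Hd) (pm_T Hd) H.
have iC0 : 0 < C^-1 by rewrite invr_gt0.
pose rho0 := Num.min (Num.min rho1 rho2) (C^-1 / (2 * C)).
have rho00 : 0 < rho0 by rewrite !lt_min rho10 rho20 divr_gt0 // mulr_gt0.
pose e0 := Num.min (rho0 / C) (C^-1 / 2).
have e00 : 0 < e0 by rewrite lt_min !divr_gt0.
exists e0 => // e1 /andP[e10 e1e0].
pose rho := e1 / (2 * C).
have r0 : 0 < rho by rewrite divr_gt0 // mulr_gt0.
have rhoC : C * rho = e1 / 2 by rewrite /rho; field; rewrite gt_eqF.
have e0C : C * e0 <= rho0 by rewrite mulrC -ler_pdivlMr // ge_min lexx.
have e0C' : e0 < C^-1.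
  apply: le_lt_trans (_ : C^-1 / 2 < _); first by rewrite ge_min lexx orbT.
  by rewrite ltr_pdivrMr // ltr_pMr // ltr1n.
have rr0 : rho <= rho0.
  apply: le_trans (_ : C * rho <= _); first by rewrite ler_peMl // ltW.
  rewrite rhoC; apply: le_trans (_ : C * e0 <= _) => //.
  apply: le_trans (_ : e0 <= _); last by rewrite ler_peMl // ltW.
  by have := e10; lra.
have [rr1 rr2] : rho0 <= rho1 /\ rho0 <= rho2 by rewrite !ge_min !lexx !orbT.
have rhoCC : C * rho < C^-1 by rewrite rhoC; lra.
pose K := 1 + (2 * rho0 * C + 1) * (4 * rho0 * C + 2) + 18 * C ^+ 2 / rho ^+ 2 + 2 / e1.
have k1 : 0 < (2 * rho0 * C + 1) * (4 * rho0 * C + 2).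
  by rewrite mulr_gt0 // addr_gt0 // !mulr_gt0.
have k2 : 0 < 18 * C ^+ 2 / rho ^+ 2.
  by apply: divr_gt0; [apply: mulr_gt0 => //; exact: exprn_gt0|exact: exprn_gt0].
have k3 : 0 < 2 / e1 by rewrite divr_gt0.
exists K; first by rewrite /K; lra.
move=> n r Q rpos Kr [uQ sepQ netQ] j x jn.
have K0 : 0 < K by rewrite /K; lra.
have Cn0 : 0 < C ^+ n by rewrite exprn_gt0.
have rCn : r * C ^+ n <= K^-1 by rewrite -(ler_pM2l K0) mulfV ?gt_eqF // mulrA.
have rw : r <= wgt j x.
  have /andP[h _] := wgt_bounds j x; apply: le_trans h.
  rewrite exprVn -div1r ler_pdivlMr ?exprn_gt0 //; apply: le_trans Kr.
  apply: le_trans (_ : r * C ^+ n <= _); first by rewrite ler_wpM2l ?(ltW rpos) // ler_weXn2l.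
  by rewrite -mulrA ler_peMl ?mulr_ge0 ?(ltW rpos) ?(ltW Cn0) // /K; lra.
have r_e1 : C ^+ n * r <= e1 / 2.
  have : K^-1 <= e1 / 2 by rewrite -invf_div lef_pV2 ?posrE // /K; lra.
  by move: rCn; rewrite mulrC => /le_trans; apply.
have w0 := wgt_gt0 j x; have /andP[_ w1] := wgt_bounds j x.
split; last first.
  (* Upper bound. If two net points of the ball are closer than [r / C] in [ks], their separation
     shows in [ku], where by distortion they differ by at most a multiple of the weight;
     [grid_count] applies. *)
  have eb q : bowen j x e0 q -> forall i, (i <= j)%N -> box rho0 (iter i G x) (iter i G q).
    move=> bq i ij; apply: (box_of_dist (pm_xx Hd) (pm_C Hd) H).
      exact: le_lt_trans (bq i ij) e0C'.
    by apply: le_trans e0C; rewrite ler_wpM2l ?(ltW C0) // bq.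
  rewrite -size_filter; set s := seq.filter _ Q.
  have rC' : 0 < r / C by rewrite divr_gt0.
  have sE q : q \in s -> bowen j x e0 q /\ q \in Q by rewrite mem_filter => /andP[/asboolP].
  have W0 : 0 <= 4 * rho0 * wgt j x by rewrite !mulr_ge0 // ltW.
  have := @grid_count R M s (ku x) (ks x) (r / C) rho0 (4 * rho0 * wgt j x) rC' (ltW rho00) W0.
  move=> /(_ (filter_uniq _ uQ)) hcount.
  have : (size s)%:R <= (2 * rho0 / (r / C) + 1) * (4 * rho0 * wgt j x / (r / C) + 2) :> R.
    apply: hcount => [q /sE[/eb bq _]|q q' /sE[bq qQ] /sE[bq' q'Q] qq' hs].
      by have [] := bq 0%N (leq0n j).
    have [qC _ _] := eb _ bq 0%N (leq0n j); have [q'C _ _] := eb _ bq' 0%N (leq0n j).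
    have [h1 _] := hc_bilip H qC q'C.
    have rd := sepQ _ _ qQ q'Q qq'.
    have dmr : r / C <= dm x q q' by rewrite ler_pdivrMr // mulrC; apply: le_trans h1.
    have ru : r / C <= `|ku x q - ku x q'|.
      by move: dmr; rewrite /dmax le_max => /orP[//|h]; move: (lt_le_trans hs h); rewrite ltxx.
    have cc : `|ks x q - ks x q'| <= `|ku x q - ku x q'| by apply: le_trans ru; exact: ltW.
    have [|h2 _] := hpair rho0 x j q q' _ (fun i ij => conj (eb _ bq i ij) (eb _ bq' i ij)) cc.
      by rewrite rho00.
    apply/andP; split => //; apply: le_trans h2 _.
    have [_ b1 _] := eb _ bq j (leqnn j); have [_ b2 _] := eb _ bq' j (leqnn j).
    have -> : 4 * rho0 * wgt j x = 2 * (wgt j x * (rho0 + rho0)) by ring.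
    rewrite ler_pM2l // ler_pM2l //; apply: le_trans (ler_normB _ _) (lerD b1 b2).
  move=> {}hcount.
  have r2 : 0 < r ^+ 2 by rewrite exprn_gt0.
  rewrite -(ler_pM2l r2) in hcount; apply: le_trans hcount _.
  have -> : r ^+ 2 * ((2 * rho0 / (r / C) + 1) * (4 * rho0 * wgt j x / (r / C) + 2)) =
     (2 * rho0 * C + r) * (4 * rho0 * C * wgt j x + 2 * r).
    by field; rewrite !gt_eqF.
  have r1 : r <= 1 by apply: le_trans w1.
  have A0 : 0 < rho0 * C by rewrite mulr_gt0.
  apply: le_trans (_ : (2 * rho0 * C + 1) * ((4 * rho0 * C + 2) * wgt j x) <= _).
    apply: ler_pM.
    - by rewrite addr_ge0 ?(ltW rpos) // -mulrA mulr_ge0 // ltW.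
    - by rewrite addr_ge0 ?mulr_ge0 ?(ltW rpos) // ltW.
    - by rewrite lerD2l.
    - by rewrite [leRHS]mulrDl lerD2l ler_pM2l.
  by rewrite mulrA ler_wpM2r ?(ltW w0) // /K; lra.
have [e2 e20 hst] : exists2 e : R, 0 < e & forall x x', d (G x) x' < e -> step_ok d G ku ks C rho x x'.
  by apply: hjump; rewrite r0; apply: le_trans rr2.
have hstep i : (i < j)%N -> step_ok d G ku ks C rho (iter i G x) (iter i.+1 G x).
  by move=> _; apply: hst; rewrite (pm_xx Hd).
(* Lower bound. The grid has spacing [3 * C * r] in the initial [ks] and [6 * C * r / wgt j x] in
   the final [ku]. In either case different grid points are at distance at least [3 * r], so their
   nearest net points are distinct. *)
pose J := (Num.truncn (rho / (3 * C * r))).+1.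
pose L := (Num.truncn (rho * wgt j x / (6 * C * r))).+1.
have Cr0 : 0 < C * r by rewrite mulr_gt0.
have grid (p : 'I_J * 'I_L) : exists z, [/\ ks x z = 3 * C * r * p.1%:R,
    ku (iter j G x) (iter j G z) = 6 * C * r / wgt j x * p.2%:R &
    forall i, (i <= j)%N -> box rho (iter i G x) (iter i G z)].
  case: p => p1 p2 /=.
  have h1 : `|3 * C * r * p1%:R| <= rho.
    rewrite ger0_norm; last by rewrite !mulr_ge0 // ltW.
    rewrite mulrC -ler_pdivlMr ?mulr_gt0 //.
    rewrite -truncn_ge_nat; first by rewrite -ltnS.
    by pos.
  have h2 : `|6 * C * r / wgt j x * p2%:R| <= rho.
    rewrite ger0_norm; last by rewrite !mulr_ge0 // ?invr_ge0 ltW.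
    rewrite mulrC -ler_pdivlMr; last by rewrite divr_gt0 ?mulr_gt0.
    rewrite invf_div mulrA -truncn_ge_nat; first by rewrite -ltnS.
    by pos.
  have cl := @crossing_line R M d G ku ks a C H rho x _ r0 rhoCC h1.
  have [Sn [_ Su _] Sq] := @crossing_orbit R M d G ku ks a C (pm_xx Hd) H rho (fun i => iter i G x) j _ r0 hstep cl.
  have [y /Sq[z [[_ sz] -> bz]] uy] := Su _ h2.
  by exists z.
have /choice[z zP] := grid.
have /choice[qq qqP] : forall p, exists q, q \in Q /\ d (z p) q <= r.
  by move=> p; have [q ? ?] := netQ (z p); exists q.
have zC p : d x (z p) < C^-1 by have [_ _ /(_ 0%N (leq0n j)) []] := zP p.
have sep p p' : p <> p' -> 3 * r <= d (z p) (z p').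
  move=> pp'; have [_ h] := hc_bilip H (zC p) (zC p').
  suff : 3 * C * r <= dm x (z p) (z p').
    by move=> /le_trans/(_ h); rewrite [3 * C]mulrC -mulrA ler_pM2l.
  have [s1 u1 b1] := zP p; have [s2 u2 b2] := zP p'.
  have natd (m m' : nat) : m != m' -> 1 <= `|m%:R - m'%:R| :> R.
    move=> mm; have : (1 <= `|m%:Z - m'%:Z|)%R.
      by rewrite -gtz0_ge1 normr_gt0 subr_eq0 eqz_nat.
    by rewrite -(ler_int R) intr_norm rmorphB /=.
  rewrite /dmax le_max; have [p1|p1] := eqVneq p.1 p'.1; last first.
    apply/orP; right; rewrite s1 s2 -mulrBr normrM (ger0_norm (_ : 0 <= 3 * C * r)).
      by rewrite ler_peMr ?natd // -mulrA mulr_ge0 // ltW.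
    by rewrite -mulrA mulr_ge0 // ltW.
  have p2 : p.2 != p'.2.
    apply/eqP => p2; apply: pp'; by rewrite (surjective_pairing p) p1 p2 -surjective_pairing.
  have sE : ks x (z p) - ks x (z p') = 0 by rewrite s1 s2 p1 subrr.
  have [||_ h2] := hpair rho x j (z p) (z p') _ (fun i ij => conj (b1 i ij) (b2 i ij)) _.
  - by rewrite r0; apply: le_trans rr1.
  - by rewrite sE normr0.
  apply/orP; left; move: h2; rewrite u1 u2 -mulrBr normrM ger0_norm; last first.
    by pos.
  move=> h2; have e6 : 6 * C * r <= 2 * `|ku x (z p) - ku x (z p')|.
    apply: le_trans (_ : 6 * C * r * `|p.2%:R - p'.2%:R| <= _).
      by rewrite ler_peMr ?natd //; pos.
    apply: le_trans h2; rewrite le_eqVlt; apply/orP; left; apply/eqP; field.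
    by rewrite gt_eqF.
  by lra.
have injq : injective qq.
  move=> p p' e; apply: contrapT => /sep h.
  have [_ h1] := qqP p; have [_ h2] := qqP p'; rewrite -e in h2.
  have := pm_T Hd (qq p) (z p) (z p'); rewrite (pm_C Hd (qq p)) => h3.
  by lra.
have bq p : bowen j x e1 (qq p).
  move=> i ij; have [_ _ /(_ i ij) bz] := zP p.
  have hz := box_dist (pm_xx Hd) (pm_C Hd) H bz.
  apply: le_trans (pm_T Hd (iter i G (z p)) _ _) _.
  have -> : e1 = e1 / 2 + e1 / 2 by field.
  apply: lerD; first by rewrite -rhoC.
  have lip k y y' : d (iter k G y) (iter k G y') <= C ^+ k * d y y'.
    elim: k => [|k IH]; first by rewrite expr0 mul1r.
    rewrite exprS -mulrA !iterS; apply: le_trans (hc_lip H _ _) _.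
    by rewrite ler_wpM2l ?(ltW C0).
  apply: le_trans (lip _ _ _) (le_trans _ r_e1); have [_ h] := qqP p.
  apply: ler_pM => //; rewrite ?exprn_ge0 ?(ltW C0) ?(pm_ge0 Hd) //.
  by rewrite ler_weXn2l // (leq_trans ij).
have cnt : (J * L <= count (fun q => `[< bowen j x e1 q >]) Q)%N.
  rewrite -size_filter.
  have -> : (J * L)%N = size (map qq (enum {: 'I_J * 'I_L})).
    by rewrite size_map -cardE card_prod !card_ord.
  apply: uniq_leq_size; first by rewrite map_inj_uniq ?enum_uniq.
  move=> q /mapP[p _ ->]; rewrite mem_filter; have [-> _] := qqP p.
  by rewrite andbT; apply/asboolP.
have hJ : rho / (3 * C * r) <= J%:R by rewrite ltW // truncnS_gt.
have hL : rho * wgt j x / (6 * C * r) <= L%:R by rewrite ltW // truncnS_gt.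
have hJL : rho / (3 * C * r) * (rho * wgt j x / (6 * C * r)) <=
   (count (fun q => `[< bowen j x e1 q >]) Q)%:R.
  apply: le_trans (_ : (J * L)%:R <= _); last by rewrite ler_nat.
  by rewrite natrM; apply: ler_pM => //; pos.
have r2 : 0 < r ^+ 2 by rewrite exprn_gt0.
rewrite -(ler_pM2l r2) in hJL.
apply: le_trans (ler_wpM2l (ltW K0) hJL).
have -> : r ^+ 2 * (rho / (3 * C * r) * (rho * wgt j x / (6 * C * r))) =
  wgt j x / (18 * C ^+ 2 / rho ^+ 2) by field; rewrite !gt_eqF.
rewrite mulrCA ler_peMr ?(ltW w0) // ler_pdivlMr // mul1r /K; lra.
Qed.
End Volume.

(** * Separated sets, nets, and sums of weights *)

Lemma sum_count_disjoint (T I : eqType) (E : seq I) (Q : seq T) (P : I -> pred T) (P0 : pred T) :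
  uniq E -> (forall x q, x \in E -> P x q -> P0 q) ->
  (forall x y q, x \in E -> y \in E -> P x q -> P y q -> x = y) ->
  (\sum_(x <- E) count (P x) Q <= count P0 Q)%N.
Proof.
move=> uE h0 hd; elim: Q => [|q Q IH] /=; first by rewrite big1.
rewrite big_split /= leq_add //.
have cE s : (\sum_(x <- s) P x q = count (P^~ q) s)%N.
  by elim: s => [|x s IHs]; rewrite ?big_nil // big_cons IHs.
rewrite cE.
have [/hasP[x xE Pxq]|] := boolP (has (P^~ q) E); last by rewrite has_count -leqNgt leqn0 => /eqP ->.
rewrite (h0 _ _ xE Pxq); apply: leq_trans (_ : count_mem x E <= 1)%N; last by rewrite count_uniq_mem // leq_b1.
rewrite -!size_filter; apply: uniq_leq_size; first exact: filter_uniq.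
move=> y; rewrite !mem_filter => /andP[Pyq yE]; rewrite yE andbT /=.
by apply/eqP; exact: hd Pyq Pxq.
Qed.

Lemma max_size_seq (T : Type) (P : seq T -> Prop) (B : nat) :
  P [::] -> (forall s, P s -> (size s <= B)%N) ->
  exists2 s, P s & forall s', P s' -> (size s' <= size s)%N.
Proof.
move=> P0 PB.
suff H m s : P s -> (B - size s <= m)%N -> exists2 s, P s & forall s', P s' -> (size s' <= size s)%N.
  exact: (H B [::] P0 (leq_subr _ _)).
elim: m s => [|m IH] s Ps.
  by rewrite leqn0 subn_eq0 => Bs; exists s => // s' /PB /leq_trans; apply.
move=> sm; have [|/existsNP[s' /not_implyP[Ps' ns']]] := pselect (forall s', P s' -> (size s' <= size s)%N).
  by exists s.
by apply: (IH s' Ps'); move/negP: ns'; rewrite -ltnNge => ?; have := PB _ Ps'; lia.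
Qed.

Section Separated.
Variables (R : realType) (M : pointedType) (d : M -> M -> R) (G : M -> M).
Hypothesis Hd : pseudo_metric d.
Local Notation bowen := (bowen d G).

Definition separated (n : nat) (e : R) (E : seq M) : Prop :=
  uniq E /\ forall x y, x \in E -> y \in E -> x != y -> ~ bowen n x e y.

Definition totally_bounded : Prop :=
  forall e : R, 0 < e -> exists s : seq M, forall x, exists2 y, y \in s & d x y <= e.

Lemma bowenC n x e y : bowen n x e y -> bowen n y e x.
Proof. by move=> h i ni; rewrite (pm_C Hd) h. Qed.

Lemma bowenxx n x e : 0 <= e -> bowen n x e x.
Proof. by move=> e0 i ni; rewrite (pm_xx Hd). Qed.

Lemma bowenT n x e y e' z : bowen n x e y -> bowen n y e' z -> bowen n x (e + e') z.
Proof.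
by move=> h h' i ni; apply: le_trans (pm_T Hd _ _ _) (lerD (h i ni) (h' i ni)).
Qed.

Lemma bowenW n x e e' y : e <= e' -> bowen n x e y -> bowen n x e' y.
Proof. by move=> ee h i ni; apply: le_trans ee; exact: h. Qed.

Lemma maximal_separated n e B (A : M -> Prop) : 0 <= e ->
  (forall E, separated n e E -> (forall x, x \in E -> A x) -> (size E <= B)%N) ->
  exists E, [/\ separated n e E, forall x, x \in E -> A x &
    forall z, A z -> exists2 x, x \in E & bowen n x e z].
Proof.
move=> e0 HB.
have [||E [sE AE] mE] := @max_size_seq M (fun E => separated n e E /\ forall x, x \in E -> A x) B.
- by split => //; split.
- by move=> s [? ?]; apply: HB.
exists E; split=> // z Az; apply: contrapT => hz.
have zE x : x \in E -> ~ bowen n x e z by move=> xE h; apply: hz; exists x.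
have zNE : z \notin E by apply/negP => /zE; apply; apply: bowenxx.
have : (size (z :: E) <= size E)%N; last by rewrite /= ltnn.
apply: mE; split; last by move=> x; rewrite inE => /orP[/eqP ->//|/AE].
case: sE => uE hE; split; first by rewrite /= zNE.
move=> x y; rewrite !inE => /orP[/eqP ->|xE] /orP[/eqP ->|yE] xy; first by rewrite eqxx in xy.
- by move=> /bowenC; exact: zE.
- exact: zE.
- exact: hE.
Qed.

End Separated.

Section AdaptedNets.
Variables (R : realType) (M : pointedType) (d : M -> M -> R).
Hypothesis Hd : pseudo_metric d.
Hypothesis tb : totally_bounded d.

Definition spaced (r : R) (Q : seq M) : Prop :=
  uniq Q /\ forall x y, x \in Q -> y \in Q -> x != y -> r <= d x y.

Lemma spaced_bounded (r : R) : 0 < r -> exists B, forall Q, spaced r Q -> (size Q <= B)%N.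
Proof.
move=> r0; have r3 : 0 < r / 3 by rewrite divr_gt0.
have [s Hs] := tb r3; exists (size s) => Q [uQ sQ].
have /choice[f fP] : forall x, exists y, y \in s /\ d x y <= r / 3.
  by move=> x; have [y ? ?] := Hs x; exists y.
have -> : size Q = size (map f Q) by rewrite size_map.
apply: uniq_leq_size; last by move=> _ /mapP[x _ ->]; exact: (fP x).1.
rewrite map_inj_in_uniq // => x y xQ yQ fxy; apply/eqP/negP => /negP xy.
have := sQ _ _ xQ yQ xy; have := pm_T Hd (f x) x y.
have [_ h1] := fP x; have [_ h2] := fP y; rewrite -fxy in h2.
by rewrite (pm_C Hd (f x)); lra.
Qed.

Lemma spaced_extension (r : R) (A : M -> Prop) (s0 : seq M) : 0 < r -> spaced r s0 ->
  exists Q, [/\ spaced r Q, {subset s0 <= Q}, forall x, x \in Q -> x \in s0 \/ A x &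
    forall z, A z -> exists2 q, q \in Q & d z q <= r].
Proof.
move=> r0 s0r; have [B HB] := spaced_bounded r0.
have [||s [sr sA] mx] := @max_size_seq M (fun s => spaced r (s ++ s0) /\ forall x, x \in s -> A x) B.
- by split.
- by move=> s [/HB + _]; apply: leq_trans; rewrite size_cat leq_addr.
exists (s ++ s0); split=> //.
- by move=> x; rewrite mem_cat orbC => ->.
- by move=> x; rewrite mem_cat => /orP[/sA|]; [right|left].
move=> z Az; apply: contrapT => hz.
have zQ x : x \in s ++ s0 -> r < d z x.
  by move=> xQ; rewrite ltNge; apply/negP => h; apply: hz; exists x.
have zN : z \notin s ++ s0 by apply/negP => /zQ; rewrite (pm_xx Hd) ltNge ltW.
have : (size (z :: s) <= size s)%N; last by rewrite /= ltnn.
apply: mx; split; last by move=> x; rewrite inE => /orP[/eqP ->|/sA].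
case: sr => uQ hQ; split; first by rewrite cat_cons cons_uniq zN.
move=> x y; rewrite cat_cons !inE => /orP[/eqP ->|xQ] /orP[/eqP ->|yQ] xy.
- by rewrite eqxx in xy.
- by rewrite ltW // zQ.
- by rewrite (pm_C Hd) ltW // zQ.
- exact: hQ.
Qed.

(** A maximal spaced subset of [A] is completed to a net of the whole space. Points of [A] are then
    approximated by net points in [A], so covering a Bowen ball costs no more net points than the
    ball contains. *)
Lemma net_adapted (r : R) (A : M -> Prop) : 0 < r ->
  exists2 Q, net d r Q & forall z, A z -> exists q, [/\ q \in Q, A q & d z q <= r].
Proof.
move=> r0; have [|s [sr _ sA cs]] := @spaced_extension r A [::] r0; first by split.
have [Q [[uQ hQ] sQ _ cQ]] := @spaced_extension r (fun=> True) s r0 sr.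
exists Q; first by split=> // z; exact: cQ.
move=> z /cs[q qs zq]; exists q; split=> //; first exact: sQ.
by have [|//] := sA q qs.
Qed.

Lemma net_exists (r : R) : 0 < r -> exists Q, net d r Q.
Proof. by move=> r0; have [Q nQ _] := net_adapted (fun=> True) r0; exists Q. Qed.

End AdaptedNets.

(* Weighted form of the volume lemma: rho times counting measure on Q plays the
   role of Lebesgue measure up to time n. *)
Definition bowen_mass (R : realType) (M : pointedType) (d : M -> M -> R) (G : M -> M)
    (w : nat -> M -> R) (e0 e1 K : R) : Prop :=
  [/\ 0 < e1 <= e0, 1 <= K & forall n, exists Q rho, [/\ 0 < rho,
    forall j x, (j <= n)%N ->
      w j x <= K * (rho * (count (fun q => `[< bowen d G j x e1 q >]) Q)%:R) /\
      rho * (count (fun q => `[< bowen d G j x e0 q >]) Q)%:R <= K * w j x &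
    rho * (size Q)%:R <= K]].

Section Mass.
Variables (R : realType) (M : pointedType) (d : M -> M -> R) (G : M -> M).
Hypothesis Hd : pseudo_metric d.

Lemma bowen_mass_exists ku ks a C : hyp_chart d G ku ks a C -> totally_bounded d ->
  exists2 e0 : R, 0 < e0 & forall e1, 0 < e1 <= e0 ->
    exists K, bowen_mass d G (wgt G a) e0 e1 K.
Proof.
move=> H tb; have [e0 e00 He] := volume_estimate Hd H.
exists e0 => // e1 he1; have [K K1 HK] := He e1 he1.
have [s Hs] := tb e0 e00.
exists (K * (size s).+1%:R); split=> // [|n].
  by rewrite mulr_ege1 // ler1n.
have C1 := hc_C H; have C0 : 0 < C by apply: lt_le_trans C1.
have K0 : 0 < K by apply: lt_le_trans K1.
pose r := (K * C ^+ n)^-1.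
have r0 : 0 < r by rewrite /r; pos.
have [Q nQ] := net_exists Hd tb r0.
exists Q, (r ^+ 2).
have Kr : K * r * C ^+ n <= 1.
  by rewrite mulrAC /r mulfV // gt_eqF //; pos.
have r2 : 0 < r ^+ 2 by pos.
have KK : K <= K * (size s).+1%:R by rewrite ler_peMr ?(ltW K0) // ler1n.
split => // [j x jn|].
  have [h1 h2] := HK n r Q r0 Kr nQ j x jn; split.
    by apply: le_trans h1 _; apply: ler_wpM2r => //; rewrite mulr_ge0 ?ler0n ?(ltW r2).
  by apply: le_trans h2 _; apply: ler_wpM2r => //; apply: ltW; exact: (wgt_gt0 H).
have cov : (size Q <= \sum_(y <- s) count (fun q => `[< bowen d G 0 y e0 q >]) Q)%N.
  elim: Q {nQ} => [//|q Q IH] /=; rewrite big_split /=.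
  rewrite -[X in (X < _)%N]add0n -addSn leq_add //.
  have [y ys dy] := Hs q; rewrite (big_rem y) //=.
  suff -> : `[< bowen d G 0 y e0 q >] by [].
  by apply/asboolP => i; rewrite leqn0 => /eqP -> /=; rewrite (pm_C Hd).
apply: le_trans (_ : r ^+ 2 * (\sum_(y <- s) count (fun q => `[< bowen d G 0 y e0 q >]) Q)%:R <= _).
  by rewrite ler_pM2l // ler_nat.
rewrite natr_sum mulr_sumr.
apply: le_trans (_ : \sum_(y <- s) K <= _).
  apply: ler_sum => y _; have [_] := HK n r Q r0 Kr nQ 0%N y (leq0n n).
  by rewrite /wgt big_ord0 mulr1.
by rewrite big_const_seq count_predT iter_addr_0 -[K *+ _]mulr_natr ler_pM2l // ler_nat.
Qed.

End Mass.

Section MassConsequences.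
Variables (R : realType) (M : pointedType) (d : M -> M -> R) (G : M -> M) (w : nat -> M -> R).
Hypothesis Hd : pseudo_metric d.
Hypothesis w0 : forall n x, 0 < w n x.
Local Notation bowen := (bowen d G).
Local Notation sep := (separated d G).

(** The Bowen balls of radius [e] around separated points are disjoint and contained in one ball of
    radius [e0]; their masses add up to at most the mass of that ball. *)
Lemma separated_sum_in (e0 e K : R) n (r : R) z E : bowen_mass d G w e0 e K -> 0 <= r ->
  r + e <= e0 -> sep n (2 * e) E -> (forall x, x \in E -> bowen n z r x) ->
  \sum_(x <- E) w n x <= K * K * w n z.
Proof.
move=> [/andP[e_gt0 ee0] K1 Hm] r0 re [uE sE] Er; have [Q [rho [rho0 HQ HZ]]] := Hm n.
have K0 : 0 < K by apply: lt_le_trans K1.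
apply: le_trans (_ : \sum_(x <- E) K * (rho * (count (fun q => `[< bowen n x e q >]) Q)%:R) <= _).
  by apply: ler_sum => x _; have [] := HQ n x (leqnn n).
rewrite -mulr_sumr -mulrA ler_pM2l // -mulr_sumr -natr_sum.
have [_ h] := HQ n z (leqnn n); apply: le_trans h; rewrite ler_pM2l // ler_nat.
apply: sum_count_disjoint => // [x q xE /asboolP xq|x y q xE yE /asboolP xq /asboolP yq].
  by apply/asboolP; apply: (bowenW re); exact: (bowenT Hd (Er _ xE) xq).
apply/eqP/negP => /negP xy; apply: (sE _ _ xE yE xy).
by rewrite mulr_natl mulr2n; exact: (bowenT Hd xq (bowenC Hd yq)).
Qed.

Lemma separated_sum (e0 e K : R) n E : bowen_mass d G w e0 e K ->
  sep n (2 * e) E -> \sum_(x <- E) w n x <= K * K.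
Proof.
move=> [/andP[e_gt0 ee0] K1 Hm] [uE sE]; have [Q [rho [rho0 HQ HZ]]] := Hm n.
have K0 : 0 < K by apply: lt_le_trans K1.
apply: le_trans (_ : \sum_(x <- E) K * (rho * (count (fun q => `[< bowen n x e q >]) Q)%:R) <= _).
  by apply: ler_sum => x _; have [] := HQ n x (leqnn n).
rewrite -mulr_sumr ler_pM2l // -mulr_sumr -natr_sum.
apply: le_trans HZ; rewrite ler_pM2l // ler_nat -(count_predT Q).
apply: sum_count_disjoint => // x y q xE yE /asboolP xq /asboolP yq.
apply/eqP/negP => /negP xy; apply: (sE _ _ xE yE xy).
by rewrite mulr_natl mulr2n; exact: (bowenT Hd xq (bowenC Hd yq)).
Qed.

(** Bounded distortion read off from the mass: the ball of radius [e] around [y] lies in the ball of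
    radius [e0] around [x]. *)
Lemma wgt_comparable (e0 e K : R) n x y : bowen_mass d G w e0 e K -> 2 * e <= e0 ->
  bowen n x e y -> w n y <= K * K * w n x.
Proof.
move=> [/andP[e_gt0 ee0] K1 Hm] ee xy; have [Q [rho [rho0 HQ HZ]]] := Hm n.
have K0 : 0 < K by apply: lt_le_trans K1.
have [h _] := HQ n y (leqnn n); have [_ h'] := HQ n x (leqnn n).
apply: le_trans h _; rewrite -mulrA ler_pM2l //; apply: le_trans h'.
rewrite ler_pM2l // ler_nat; apply: sub_count => q /asboolP yq; apply/asboolP.
by apply: (bowenW ee); rewrite mulr_natl mulr2n; exact: (bowenT Hd xy yq).
Qed.

Lemma spanning_sum (e0 e K : R) n E : bowen_mass d G w e0 e K -> w 0%N = (fun=> 1) ->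
  (forall z, exists2 x, x \in E & bowen n x e0 z) -> 1 <= K * K * \sum_(x <- E) w n x.
Proof.
move=> [/andP[e_gt0 ee0] K1 Hm] w01 HE; have [Q [rho [rho0 HQ HZ]]] := Hm n.
have K0 : 0 < K by apply: lt_le_trans K1.
have [x0 _ _] := HE point.
have [h _] := HQ 0%N point (leq0n n); rewrite w01 in h.
apply: le_trans h _; rewrite -mulrA ler_pM2l //.
rewrite mulr_sumr; apply: le_trans (_ : \sum_(x <- E) rho * (count (fun q => `[< bowen n x e0 q >]) Q)%:R <= _).
  rewrite -mulr_sumr ler_pM2l // -natr_sum ler_nat.
  apply: leq_trans (count_size _ _) _.
  elim: {HQ HZ} Q => [//|q Q IH] /=; rewrite big_split /= -[X in (X < _)%N]add0n -addSn leq_add //.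
  have [y yE dy] := HE q; rewrite (big_rem y) //=.
  by have -> : `[< bowen n y e0 q >] by exact/asboolP.
by apply: ler_sum => x _; have [] := HQ n x (leqnn n).
Qed.

Lemma separated_size (e0 e K L : R) n E : bowen_mass d G w e0 e K -> 0 < L ->
  (forall x, L <= w n x) ->
  sep n (2 * e) E -> (size E)%:R <= K * K / L.
Proof.
move=> Hm L0 HL sE; rewrite ler_pdivlMr //; apply: le_trans (separated_sum Hm sE).
apply: le_trans (_ : \sum_(x <- E) L <= _); last by apply: ler_sum.
by rewrite big_const_seq count_predT iter_addr_0 mulr_natl.
Qed.

Lemma maximal_separated_mass (e0 e K L : R) n (A : M -> Prop) : bowen_mass d G w e0 e K -> 0 < L ->
  (forall x, L <= w n x) ->
  exists E, [/\ sep n (2 * e) E, forall x, x \in E -> A x &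
    forall z, A z -> exists2 x, x \in E & bowen n x (2 * e) z].
Proof.
move=> Hm L0 HL; have [/andP[e_gt0 _] K1 _] := Hm.
apply: (@maximal_separated _ _ _ _ Hd _ _ (Num.truncn (K * K / L))).
  by rewrite mulr_ge0 // ltW.
move=> E sE _; rewrite truncn_ge_nat; first exact: separated_size Hm L0 HL sE.
by rewrite divr_ge0 ?mulr_ge0 ?(ltW L0) // (le_trans ler01).
Qed.

End MassConsequences.

(** * Large deviations of Birkhoff sums *)

Section Words.
Variables (R : realType) (M : pointedType) (d : M -> M -> R) (G : M -> M) (w : nat -> M -> R).
Hypothesis Hd : pseudo_metric d.
Hypothesis w0 : forall n x, 0 < w n x.
Hypothesis wM : forall n m x, w (n + m)%N x = w n x * w m (iter n G x).
Hypothesis w1 : w 0%N = (fun=> 1).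
Local Notation bowen := (bowen d G).
Local Notation sep := (separated d G).

Definition birkhoff (phi : M -> R) (n : nat) (x : M) : R := \sum_(i < n) phi (iter i G x).

Lemma birkhoffD phi n m x : birkhoff phi (n + m) x = birkhoff phi n x + birkhoff phi m (iter n G x).
Proof.
rewrite /birkhoff big_split_ord /=; congr (_ + _).
by apply: eq_bigr => i _; rewrite addnC iterD.
Qed.

Lemma birkhoff_norm (phi : M -> R) (B : R) n x : (forall y, `|phi y| <= B) -> `|birkhoff phi n x| <= n%:R * B.
Proof.
move=> h; apply: le_trans (ler_norm_sum _ _ _) _.
apply: le_trans (_ : \sum_(i < n) B <= _); first exact: ler_sum.
by rewrite sumr_const card_ord mulr_natl.
Qed.

Lemma birkhoff_near (phi : M -> R) (kap e : R) n x y : (forall p q, d p q <= e -> `|phi p - phi q| <= kap) ->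
  bowen n x e y -> `|birkhoff phi n x - birkhoff phi n y| <= n%:R * kap.
Proof.
move=> h xy; rewrite -sumrB; apply: le_trans (ler_norm_sum _ _ _) _.
apply: le_trans (_ : \sum_(i < n) kap <= _); last by rewrite sumr_const card_ord mulr_natl.
by apply: ler_sum => i _; apply: h; apply: xy; rewrite ltnW.
Qed.

Lemma wgt_blocks k N x : w (k * N)%N x = \prod_(i < k) w N (iter (i * N) G x).
Proof.
elim: k => [|k IH]; first by rewrite mul0n big_ord0 w1.
by rewrite mulSn addnC wM IH big_ord_recr.
Qed.

Lemma birkhoff_blocks phi k N x :
  birkhoff phi (k * N) x = \sum_(i < k) birkhoff phi N (iter (i * N) G x).
Proof.
elim: k => [|k IH]; first by rewrite mul0n /birkhoff !big_ord0.
by rewrite mulSn addnC birkhoffD IH big_ord_recr.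
Qed.

(* Words in the alphabet of a Bowen net code the points of a separated set
   injectively, so weighted sums are dominated by a k-th power. *)
Lemma word_bound (phi : M -> R) (c lam kap e Cw : R) N k (A E : seq M) :
  0 <= lam -> 0 <= Cw -> (0 < k)%N ->
  (forall p q, d p q <= e -> `|phi p - phi q| <= kap) ->
  (forall x y, bowen N x e y -> w N y <= Cw * w N x) ->
  (forall z, exists2 x, x \in A & bowen N x e z) ->
  sep (k * N) (2 * e) E -> (forall x, x \in E -> birkhoff phi (k * N) x <= c * (k * N)%:R) ->

  \sum_(x <- E) w (k * N)%N x <=
   (\sum_(y <- A) Cw * w N y * expR (- lam * (birkhoff phi N y - c * N%:R) + lam * kap * N%:R)) ^+ k.
Proof.
move=> lam0 Cw0 k0 hphi hw hA [uE sE] Ec.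
have /choice[f fP] : forall z, exists j : 'I_(size A), bowen N (nth point A j) e z.
  move=> z; have [x xA xz] := hA z.
  have xi : (index x A < size A)%N by rewrite index_mem.
  by exists (Ordinal xi); rewrite /= nth_index.
pose T y := Cw * w N y * expR (- lam * (birkhoff phi N y - c * N%:R) + lam * kap * N%:R).
have T0 y : 0 <= T y by rewrite /T; pos.
have -> : (\sum_(y <- A) T y) ^+ k =
    \sum_(v : {ffun 'I_k -> 'I_(size A)}) \prod_(i < k) T (nth point A (v i)).
  rewrite -(bigA_distr_bigA (fun (_ : 'I_k) (j : 'I_(size A)) => T (nth point A j))) /=.
  by rewrite (big_nth point) big_mkord prodr_const card_ord.
pose code x : {ffun 'I_k -> 'I_(size A)} := [ffun i : 'I_k => f (iter (i * N) G x)].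
have codeinj : {in E &, injective code}.
  move=> x x' xE x'E cc; apply/eqP/negP => /negP xx'; apply: (sE _ _ xE x'E xx') => i ik.
  have [j [r [jk rN ->]]] : exists j r, [/\ (j < k)%N, (r <= N)%N & i = (j * N + r)%N].
    have [ilt|ige] := ltnP i (k * N).
      exists (i %/ N)%N, (i %% N)%N; rewrite -divn_eq; split => //.
        by rewrite ltn_divLR //; case: (N) ilt => //; rewrite muln0.
      by rewrite ltnW // ltn_mod; case: (N) ilt => //; rewrite muln0.
    (* The final time [k * N] is the right end of the last block; Bowen balls include both end
       times. *)
    exists k.-1, N; split; [by rewrite prednK|by []|].
    by rewrite -mulSnr prednK //; apply/eqP; rewrite eqn_leq ik ige.
  rewrite addnC !iterD; move/ffunP/(_ (Ordinal jk)) : cc; rewrite !ffunE /= => cc.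
  have h1 := fP (iter (j * N) G x) r rN; have h2 := fP (iter (j * N) G x') r rN.
  rewrite -cc in h2; apply: le_trans (pm_T Hd _ _ _) _; last first.
    by rewrite mulr_natl mulr2n; apply: lerD h2; rewrite (pm_C Hd); exact: h1.
have wT x : x \in E -> w (k * N)%N x <= \prod_(i < k) T (nth point A (code x i)).
  move=> xE; have hx := Ec x xE.
  (* Exponential Chebyshev inequality: on [E] the exponent is nonnegative, so inserting the factor
     does not decrease the weight, and the tilted weight splits over blocks. *)
  apply: le_trans (_ : w (k * N)%N x * expR (- lam * (birkhoff phi (k * N) x - c * (k * N)%:R)) <= _).
    rewrite ler_peMr ?(ltW (w0 _ _)) // -[X in X <= expR _]expR0 ler_expR mulNr -mulrN mulr_ge0 // opprB subr_ge0 //.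
  have -> : - lam * (birkhoff phi (k * N) x - c * (k * N)%:R) =
     \sum_(i < k) (- lam * (birkhoff phi N (iter (i * N) G x) - c * N%:R)).
    rewrite -mulr_sumr sumrB -birkhoff_blocks sumr_const card_ord natrM.
    by rewrite -[_ *+ k]mulr_natl; congr (_ * (_ - _)); ring.
  rewrite wgt_blocks expR_sum -big_split /=; apply: ler_prod => i _.
  rewrite mulr_ge0 ?expR_ge0 ?(ltW (w0 _ _)) //= ffunE.
  have h := fP (iter (i * N) G x); set y := nth point A _ in h *.
  rewrite /T; apply: ler_pM; rewrite ?expR_ge0 ?(ltW (w0 _ _)) //; first exact: hw.
  rewrite ler_expR; have := birkhoff_near hphi h; rewrite ler_norml => /andP[h1 h2].
  have : lam * (birkhoff phi N y - birkhoff phi N (iter (i * N) G x)) <= lam * (N%:R * kap).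
    by rewrite ler_wpM2l.
  by move=> h3; lra.
apply: le_trans (_ : \sum_(x <- E) \prod_(i < k) T (nth point A (code x i)) <= _).
  by rewrite [leLHS]big_seq [leRHS]big_seq; apply: ler_sum => x /wT.
have P0 v : 0 <= \prod_(i < k) T (nth point A (v i)) by apply: prodr_ge0.
rewrite -(big_map code predT (fun v => \prod_(i < k) T (nth point A (v i)))).
rewrite big_uniq /=; last by rewrite map_inj_in_uniq.
by rewrite [leRHS](bigID (fun v => v \in map code E)) /= lerDl sumr_ge0.
Qed.

End Words.

(** All that the large deviation argument uses about the weights; coordinates and the manifold are
    not mentioned. *)
Record weighted_system (R : realType) (M : pointedType) (d : M -> M -> R) (G : M -> M)
    (w : nat -> M -> R) (e0 : R) : Prop := WeightedSystem {
  ws_pm : pseudo_metric d ;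
  ws_gt0 : forall n x, 0 < w n x ;
  ws_mul : forall n m x, w (n + m)%N x = w n x * w m (iter n G x) ;
  ws_1 : w 0%N = (fun=> 1) ;
  ws_low : exists2 L : R, 0 < L & forall n x, L ^+ n <= w n x ;
  ws_e0 : 0 < e0 ;
  ws_mass : forall e1, 0 < e1 <= e0 -> exists K, bowen_mass d G w e0 e1 K }.

Definition specification (R : realType) (M : Type) (d : M -> M -> R) (G : M -> M) : Prop :=
  forall eta : R, 0 < eta -> exists2 g : nat, (0 < g)%N & forall x y n m,
    exists2 z, bowen d G n x eta z & bowen d G m y eta (iter (n + g) G z).

Definition window_mean (R : realType) (F : nat -> R) (n k : nat) : R :=
  (\sum_(i < n) F (k + i)%N) / n%:R.

(** The mean over a doubled window is the average of the means over its halves, and averaging two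
    numbers loses a quarter of the square of their difference. The last term pays for the positions
    where the shifted window leaves the range. *)
Lemma block_average_sqr (R : realType) (F : nat -> R) (B : R) (K N : nat) :
  (forall i, `|F i| <= B) -> (0 < N)%N ->
  \sum_(k < K) window_mean F (2 * N)%N k ^+ 2 + 4^-1 * \sum_(k < K) (window_mean F N k - window_mean F N (k + N)%N) ^+ 2
    <= \sum_(k < K) window_mean F N k ^+ 2 + N%:R * B ^+ 2.
Proof.
move=> FB N0; set s := window_mean F.
have Nr : 0 < N%:R :> R by rewrite ltr0n.
have sB k : s N k ^+ 2 <= B ^+ 2.
  have B0 : 0 <= B by apply: le_trans (FB 0%N).
  rewrite -real_normK ?num_real // ler_sqr ?nnegrE //.
  rewrite /s /window_mean normrM (ger0_norm (_ : 0 <= N%:R^-1)) ?invr_ge0 // ler_pdivrMr //.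
  apply: le_trans (ler_norm_sum _ _ _) _.
  apply: le_trans (_ : \sum_(i < N) B <= _); first exact: ler_sum.
  by rewrite sumr_const card_ord mulr_natr.
have s2 k : s (2 * N)%N k = (s N k + s N (k + N)%N) / 2.
  rewrite /s /window_mean mul2n -addnn big_split_ord /= natrD.
  under [X in _ + X]eq_bigr => i _ do rewrite addnA.
  have -> : N%:R + N%:R = 2 * N%:R :> R by ring.
  by field; rewrite gt_eqF.
have shift m : \sum_(k < m) s N (k + N)%N ^+ 2 <= \sum_(k < m) s N k ^+ 2 + N%:R * B ^+ 2.
  have -> : \sum_(k < m) s N (k + N)%N ^+ 2 = \sum_(k < N + m) s N k ^+ 2 - \sum_(k < N) s N k ^+ 2.
    rewrite big_split_ord /= addrAC subrr add0r; apply: eq_bigr => i _; by rewrite addnC.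
  rewrite addnC big_split_ord /= -addrA lerD2l.
  apply: le_trans (_ : \sum_(i < N) s N (m + i)%N ^+ 2 <= _).
    by rewrite lerBlDr lerDl sumr_ge0 // => i _; rewrite sqr_ge0.
  apply: le_trans (_ : \sum_(i < N) B ^+ 2 <= _); first by apply: ler_sum.
  by rewrite sumr_const card_ord mulr_natl.
have -> : \sum_(k < K) s (2 * N)%N k ^+ 2 + 4^-1 * \sum_(k < K) (s N k - s N (k + N)%N) ^+ 2
   = 2^-1 * (\sum_(k < K) s N k ^+ 2 + \sum_(k < K) s N (k + N)%N ^+ 2).
  rewrite mulrDr !mulr_sumr -!big_split /=; by apply: eq_bigr => k _; rewrite s2; field.
have := shift K; set X := \sum_(k < K) s N k ^+ 2; have : 0 <= N%:R * B ^+ 2 by rewrite mulr_ge0 ?sqr_ge0 ?(ltW Nr).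
have : 0 <= X by apply: sumr_ge0 => i _; rewrite sqr_ge0.
by lra.
Qed.

(** Telescoping over the scales: the squared differences of neighbouring window means, summed over
    all scales, are bounded by a constant per position, whatever the number [J] of scales. *)
Lemma dyadic_oscillation (R : realType) (F : nat -> R) (B : R) (j0 J : nat) :
  (forall i, `|F i| <= B) ->
  \sum_(j < J) \sum_(k < 2 ^ (j0 + J)) (window_mean F (2 ^ (j0 + j))%N k - window_mean F (2 ^ (j0 + j))%N (k + 2 ^ (j0 + j))%N) ^+ 2
   <= 8 * (2 ^ (j0 + J))%:R * B ^+ 2.
Proof.
move=> FB; set s := window_mean F; pose K := (2 ^ (j0 + J))%N.
pose D j := \sum_(k < K) (s (2 ^ (j0 + j))%N k - s (2 ^ (j0 + j))%N (k + 2 ^ (j0 + j))%N) ^+ 2.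
pose V j := \sum_(k < K) s (2 ^ (j0 + j))%N k ^+ 2.
have V0 j : 0 <= V j by apply: sumr_ge0 => i _; rewrite sqr_ge0.
have B0 : 0 <= B by apply: le_trans (FB 0%N).
have st j : V j.+1 + 4^-1 * D j <= V j + (2 ^ (j0 + j))%:R * B ^+ 2.
  have := @block_average_sqr R F B K (2 ^ (j0 + j))%N FB; rewrite expn_gt0 /= => /(_ isT).
  by rewrite /V addnS expnS.
have tel j : V j + 4^-1 * \sum_(i < j) D i + (2 ^ j0)%:R * B ^+ 2 <= V 0%N + (2 ^ (j0 + j))%:R * B ^+ 2.
  elim: j => [|j IH]; first by rewrite big_ord0 mulr0 !addr0 addn0.
  rewrite big_ord_recr /= mulrDr; have := st j; rewrite addnS expnS mul2n -addnn natrD mulrDl.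
  by lra.
have VK : V 0%N <= K%:R * B ^+ 2.
  apply: le_trans (_ : \sum_(k < K) B ^+ 2 <= _); last by rewrite sumr_const card_ord mulr_natl.
  apply: ler_sum => k _; rewrite -real_normK ?num_real // ler_sqr ?nnegrE //.
  have Nr : 0 < (2 ^ (j0 + 0))%:R :> R by rewrite ltr0n expn_gt0.
  rewrite /s /window_mean normrM (ger0_norm (_ : 0 <= (2 ^ (j0 + 0))%:R^-1)) ?invr_ge0 ?ler0n // ler_pdivrMr //.
  apply: le_trans (ler_norm_sum _ _ _) _.
  apply: le_trans (_ : \sum_(i < 2 ^ (j0 + 0)) B <= _); first exact: ler_sum.
  by rewrite sumr_const card_ord mulr_natr.
have := tel J; have := V0 J.
have : 0 <= (2 ^ j0)%:R * B ^+ 2 by rewrite mulr_ge0 ?sqr_ge0.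
rewrite -/K -/(D _) /=; set S := \sum_(i < J) D i; rewrite -mulrA; lra.
Qed.

Section LargeDeviations.
Variables (R : realType) (M : pointedType) (d : M -> M -> R) (G : M -> M).
Variables (w : nat -> M -> R) (e0 : R).
Hypothesis W : weighted_system d G w e0.
Local Notation bowen := (bowen d G).
Local Notation sep := (separated d G).
Let Hd := ws_pm W.
Let w0 := ws_gt0 W.

Lemma sub_separated n e E (p : pred M) : sep n e E -> sep n e (seq.filter p E).
Proof.
move=> [uE sE]; split; first exact: filter_uniq.
by move=> x y; rewrite !mem_filter => /andP[_ xE] /andP[_ yE]; exact: sE.
Qed.

Lemma separated_exists n (e : R) (A : M -> Prop) : 0 < e -> e <= e0 ->
  exists E, [/\ sep n e E, forall x, x \in E -> A x &
    forall z, A z -> exists2 x, x \in E & bowen n x e z].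
Proof.
move=> e_gt0 ee0; have [|K HK] := ws_mass W (e1 := e / 2).
  by apply/andP; split; lra.
have [L L0 HL] := ws_low W.
have := maximal_separated_mass Hd A HK (exprn_gt0 n L0) (HL n).
by have -> : 2 * (e / 2) = e by field.
Qed.

(** Self-improvement: weight below a threshold at a single time [N] forces exponential decay at
    multiples of [N]. Words of a Bowen net are tilted by [Lam / N]; those with sum above (c + sig) N
    are damped by the tilt, the others have small weight by assumption, and each class contributes
    at most 1/4. *)
Lemma low_decay (phi : M -> R) (B c sig e : R) : 0 < e -> 2 * e <= e0 -> 0 < sig ->
  (forall x, `|phi x| <= B) -> `|c| <= B ->
  (forall p q, d p q <= e -> `|phi p - phi q| <= sig / 2) ->
  exists2 kap : R, 0 < kap & forall N, (0 < N)%N ->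
    (forall E, sep N e E -> (forall x, x \in E -> birkhoff G phi N x <= (c + sig) * N%:R) ->
       \sum_(x <- E) w N x <= kap) ->
    forall k E, (0 < k)%N -> sep (k * N) (2 * e) E ->
      (forall x, x \in E -> birkhoff G phi (k * N) x <= c * (k * N)%:R) ->
      \sum_(x <- E) w (k * N)%N x <= 2^-1 ^+ k.
Proof.
move=> e_gt0 ee0 s0 phiB cB hphi.
have B0 : 0 <= B by apply: le_trans (phiB point).
have [|K HK] := ws_mass W (e1 := e); first by apply/andP; split; lra.
have [|K' HK'] := ws_mass W (e1 := e / 2); first by apply/andP; split; lra.
have [_ K1 _] := HK; have [_ K'1 _] := HK'.
pose Cw := K * K; pose Z := K' * K'.
have Cw1 : 1 <= Cw by rewrite /Cw mulr_ege1.
have Z1 : 1 <= Z by rewrite /Z mulr_ege1.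
have Cw0 : 0 < Cw by apply: lt_le_trans Cw1.
have Z0 : 0 < Z by apply: lt_le_trans Z1.
(* [y] is the damping wanted: expR y >= 1 + y makes it beat [4 * Cw * Z]. [Lam] produces it from
   [sig / 2], the other half of [sig] being lost to the oscillation of [phi]; [kap] compensates the
   largest tilt of the remaining words. *)
pose y := 4 * Cw * Z; have y0 : 0 < y by rewrite /y; pos.
pose Lam := 2 * y / sig; have Lam0 : 0 < Lam by rewrite /Lam divr_gt0 // mulr_gt0.
have ey : expR (- y) <= (4 * Cw * Z)^-1.
  rewrite expRN -/y lef_pV2 ?posrE ?expR_gt0 //.
  by have := expR_ge1Dx y; lra.
pose kap := (4 * Cw * expR (Lam * (2 * B + sig)))^-1.
have kap0 : 0 < kap by rewrite /kap; pos.
exists kap => // N N0 HD k E k0 sE Ec.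
have Nr : 0 < N%:R :> R by rewrite ltr0n.
have [A [sA _ mA]] := separated_exists N (fun=> True) e_gt0 (ltac:(lra) : e <= e0).
have lam0 : 0 <= Lam / N%:R by rewrite divr_ge0 // ltW.
apply: le_trans (word_bound Hd w0 (ws_mul W) (ws_1 W) (lam := Lam / N%:R) (Cw := Cw) (A := A)
    lam0 (ltW Cw0) k0 hphi _ _ sE Ec) _.
- by move=> p q pq; exact: (wgt_comparable Hd HK).
- by move=> z; exact: mA.
apply: lerXn2r; rewrite ?nnegrE ?invr_ge0 //.
  by apply: sumr_ge0 => p _; have := w0 N p => ?; pos.
rewrite (bigID (fun p => birkhoff G phi N p <= (c + sig) * N%:R)) /=.
have LN z : Lam / N%:R * (z * N%:R) = Lam * z by field; rewrite gt_eqF.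
have -> : 2^-1 = 4^-1 + 4^-1 :> R by field.
apply: lerD.
  apply: le_trans (_ : \sum_(p <- A | birkhoff G phi N p <= (c + sig) * N%:R)
     (Cw * expR (Lam * (2 * B + sig))) * w N p <= _).
    apply: ler_sum => p _; rewrite mulrAC ler_wpM2r ?(ltW (w0 _ _)) // ler_wpM2l ?(ltW Cw0) //.
    rewrite ler_expR -(LN (2 * B + sig)) -mulrA mulNr -mulrN -mulrDr ler_wpM2l //.
    have h1 := birkhoff_norm G N p phiB.
    have h1' := ler_normlW (_ : `|- birkhoff G phi N p| <= N%:R * B).
    rewrite normrN in h1'; move: (h1' h1) => {}h1'.
    have h2 : c * N%:R <= B * N%:R by rewrite ler_wpM2r ?(ltW Nr) //; exact: le_trans (ler_norm _) cB.
    have h3 : 0 <= sig * N%:R by rewrite mulr_ge0 // ltW.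
    by lra.
  rewrite -mulr_sumr -big_filter.
  apply: le_trans (ler_wpM2l _ (HD _ (sub_separated _ sA) _)) _; first by pos.
    by move=> x; rewrite mem_filter => /andP[].
  rewrite /kap; set ex := expR _; have ex0 : 0 < ex by exact: expR_gt0.
  rewrite le_eqVlt; apply/orP; left; apply/eqP; field.
  by rewrite !gt_eqF.
apply: le_trans (_ : \sum_(p <- A | ~~ (birkhoff G phi N p <= (c + sig) * N%:R))
     (Cw * expR (- y)) * w N p <= _).
  apply: ler_sum => p; rewrite -ltNge => hp.
  rewrite mulrAC ler_wpM2r ?(ltW (w0 _ _)) // ler_wpM2l ?(ltW Cw0) // ler_expR.
  have -> : y = Lam / N%:R * (sig / 2 * N%:R) by rewrite LN /Lam; field; rewrite gt_eqF.
  rewrite -mulrA mulNr -!mulrN -mulrDr ler_wpM2l //.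
  by lra.
rewrite -mulr_sumr -big_filter.
have sA' : sep N (2 * (e / 2)) A by have -> : 2 * (e / 2) = e by field.
have hZ := separated_sum Hd HK' (sub_separated (fun p => ~~ (birkhoff G phi N p <= (c + sig) * N%:R)) sA').
apply: le_trans (ler_wpM2l _ hZ) _; first by pos.
apply: le_trans (_ : Cw * (4 * Cw * Z)^-1 * Z <= _).
  by rewrite ler_wpM2r ?(ltW Z0) // ler_wpM2l // ltW.
by rewrite le_eqVlt; apply/orP; left; apply/eqP; field; rewrite !gt_eqF.
Qed.

(** Passes to a different separation scale: each point of the new set lies in the Bowen ball of a
    point of a maximal [e]-separated set in [A k], and one such ball holds at most a constant times
    its own weight. *)
Lemma decay_rescale N (A : nat -> M -> Prop) (e e1 : R) : 0 < e -> 0 < e1 -> e + e1 <= e0 ->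
  (forall k E, (0 < k)%N -> sep (k * N) e E -> (forall x, x \in E -> A k x) ->
     \sum_(x <- E) w (k * N)%N x <= 2^-1 ^+ k) ->
  exists2 C : R, 1 <= C & forall k E, (0 < k)%N -> sep (k * N) (2 * e1) E ->
    (forall x, x \in E -> A k x) -> \sum_(x <- E) w (k * N)%N x <= C * 2^-1 ^+ k.
Proof.
move=> e_gt0 e1_gt0 ee0 HA.
have [|K HK] := ws_mass W (e1 := e1); first by apply/andP; split; lra.
have [_ K1 _] := HK.
exists (K * K); first by rewrite mulr_ege1.
move=> k E k0 sE EA.
have [E' [sE' E'A mE']] := separated_exists (k * N) (A k) e_gt0 (ltac:(lra) : e <= e0).
apply: le_trans (_ : \sum_(y <- E') \sum_(x <- [seq x <- E | `[< bowen (k * N) y e x >]]) w (k * N)%N x <= _).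
  under [leRHS]eq_bigr => y _ do rewrite big_filter big_mkcond.
  rewrite exchange_big /= big_seq [leRHS]big_seq; apply: ler_sum => x /EA/mE'[y yE' yx].
  rewrite (big_rem y) //= asboolT // lerDl sumr_ge0 // => z _.
  by case: ifP => // _; rewrite ltW.
apply: le_trans (ler_wpM2l _ (HA k E' k0 sE' E'A)); last by rewrite mulr_ge0 // (le_trans ler01).
rewrite mulr_sumr; apply: ler_sum => y _.
apply: (separated_sum_in Hd HK (ltW e_gt0) ee0); first exact: sub_separated.
by move=> x; rewrite mem_filter => /andP[/asboolP].
Qed.

End LargeDeviations.

(** * Specification and the impossibility of two phases *)

Section Specification.
Variables (R : realType) (M : pointedType) (d : M -> M -> R) (G : M -> M).
Variables (ku ks : M -> M -> R) (a : M -> R) (C : R).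
Hypothesis Hd : pseudo_metric d.
Hypothesis H : hyp_chart d G ku ks a C.

Lemma uniform_mixing (del : R) : totally_bounded d -> mixes d G -> 0 < del ->
  exists2 g : nat, (0 < g)%N & forall p q, exists2 y, d p y < del & d q (iter g G y) < del.
Proof.
move=> tb mx del0; have d2 : 0 < del / 2 by rewrite divr_gt0.
have [|s Hs] := tb (del / 2); first by rewrite divr_gt0.
have /choice[N NP] : forall pq : M * M, exists N : nat, forall k, (N <= k)%N ->
    exists2 q, d pq.1 q < del / 2 & d pq.2 (iter k G q) < del / 2.
  by move=> [p q]; exact: mx.
exists (\max_(p <- s) \max_(q <- s) N (p, q)).+1 => // p q.
have [p' p's pp'] := Hs p; have [q' q's qq'] := Hs q.
have Ng : (N (p', q') <= (\max_(p <- s) \max_(q <- s) N (p, q)).+1)%N.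
  apply: leqW; rewrite (big_rem p') //= [X in maxn X _](big_rem q') //=.
  by rewrite -maxnA leq_maxl.
have [y py qy] := NP (p', q') _ Ng; exists y.
  by apply: le_lt_trans (pm_T Hd p' _ _) _; rewrite /= in py; lra.
by apply: le_lt_trans (pm_T Hd q' _ _) _; rewrite /= in qy; lra.
Qed.

(** Shadows the pseudo-orbit that follows [x], then a connecting orbit of fixed length [g] found by
    mixing, then [y]. *)
Lemma mixing_specification : totally_bounded d -> mixes d G -> specification d G.
Proof.
move=> tb mx eta eta0; have e0 : 0 < eta / 2 by rewrite divr_gt0.
have [del del0 Hsh] := shadowing (pm_xx Hd) (pm_C Hd) (pm_T Hd) H e0.
(* The bound [eta / 2] is for the end time [n], at which the pseudo-orbit has already jumped to the
   connecting orbit. *)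
have [|g g0 Hg] := @uniform_mixing (Num.min del (eta / 2)) tb mx.
  by rewrite lt_min del0.
exists g => // x y n m; have [u] := Hg (iter n G x) y.
rewrite !lt_min => /andP[u1 u2] /andP[u3 u4].
pose xs i := if (i < n)%N then iter i G x else if (i < n + g)%N then iter (i - n) G u
  else iter (i - (n + g)) G y.
have hxs i : (i < n + g + m)%N -> d (G (xs i)) (xs i.+1) < del.
  rewrite /xs => inm; case: (ltnP i n) => [lin|nin].
    case: (ltnP i.+1 n) => [lin1|nin1]; first by rewrite (pm_xx Hd).
    have -> : i.+1 = n by lia.
    have -> : (n < n + g)%N by lia.
    by rewrite subnn /= -iterS (_ : i.+1 = n) //; lia.
  have -> : (i.+1 < n)%N = false by lia.
  case: (ltnP i (n + g)) => [lig|gig].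
    case: (ltnP i.+1 (n + g)) => [lig1|gig1].
      by rewrite subSn // (pm_xx Hd).
    have -> : (i.+1 - (n + g))%N = 0%N by lia.
    have := iterS (i - n) G u; have -> : (i - n).+1 = g by lia.
    by move=> <- /=; rewrite (pm_C Hd).
  have -> : (i.+1 < n + g)%N = false by lia.
  by rewrite subSn // (pm_xx Hd).
have [z Hz] := Hsh (n + g + m)%N xs hxs.
exists z => i im.
  have := Hz i (leq_trans im (leq_trans (leq_addr g n) (leq_addr m _))).
  rewrite /xs; case: (ltnP i n) => [_|ni]; first by move=> h; lra.
  have -> : i = n by lia.
  rewrite ifT; last by lia.
  rewrite subnn /= => h; apply: le_trans (pm_T Hd u _ _) _; lra.
have := Hz (n + g + i)%N; rewrite leq_add2l => /(_ im).
have n1 : (n + g + i < n)%N = false by lia.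
have n2 : (n + g + i < n + g)%N = false by lia.
rewrite /xs n1 n2.
by rewrite addKn -iterD [(i + _)%N]addnC => h; lra.
Qed.

End Specification.

Section PhaseTransition.
Variables (R : realType) (M : pointedType) (d : M -> M -> R) (G : M -> M).
Variables (w : nat -> M -> R) (e0 : R).
Hypothesis W : weighted_system d G w e0.
Hypothesis spec : specification d G.
Local Notation bowen := (bowen d G).
Local Notation sep := (separated d G).
Let Hd := ws_pm W.
Let w0 := ws_gt0 W.

(** Specification twice. The gaps are cut from the ends of the first two blocks, so that the windows
    of length [N] start exactly at [k] and [k + N]. *)
Lemma spec_three (eta : R) : 0 < eta -> exists2 g : nat, (0 < g)%N &
  forall x0 x1 x2 k N, (g <= k)%N -> (g <= N)%N -> exists z,
    [/\ bowen (k - g) x0 eta z, bowen (N - g) x1 (2 * eta) (iter k G z) &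
        bowen N x2 (2 * eta) (iter (k + N) G z)].
Proof.
move=> eta0; have [g g0 Hg] := spec eta0; exists g => // x0 x1 x2 k N gk gN.
have [z' z1 z2] := Hg x1 x2 (N - g)%N N; rewrite subnK // in z2.
have [z y1 y2] := Hg x0 z' (k - g)%N (2 * N)%N; rewrite subnK // in y2.
exists z; split=> //; rewrite mulr_natl mulr2n.
  by apply: (bowenT Hd z1) => i ni; apply: y2; lia.
apply: (bowenT Hd z2) => i ni.
have E1 : iter i G (iter (k + N) G z) = iter (N + i) G (iter k G z).
  by rewrite -!iterD; congr iter; lia.
have E2 : iter i G (iter N G z') = iter (N + i) G z' by rewrite -iterD addnC.
by rewrite E1 E2; apply: y2; lia.
Qed.

(** Arbitrary histories up to time [k], low blocks and high blocks are concatenated by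
    specification. Distinct triples give disjoint Bowen balls and weights multiply up to constants,
    so a jump of the window mean at [k + N] has mass at least [th], uniformly in the position [k]
    and the scale [N]. *)
Lemma event_mass (phi : M -> R) (B c1 c2 e kap0 : R) : 0 < e -> e <= e0 -> 0 < kap0 ->
  (forall x, `|phi x| <= B) -> `|c1| <= B -> c1 < c2 ->
  (forall kap : R, 0 < kap -> exists2 r : R, 0 < r & forall p q, d p q <= r -> `|phi p - phi q| <= kap) ->
  (forall N, (0 < N)%N -> exists E, [/\ sep N e E,
     forall x, x \in E -> birkhoff G phi N x <= c1 * N%:R & kap0 < \sum_(x <- E) w N x]) ->
  (forall N, (0 < N)%N -> exists E, [/\ sep N e E,
     forall x, x \in E -> c2 * N%:R <= birkhoff G phi N x & kap0 < \sum_(x <- E) w N x]) ->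
  exists (g N1 : nat) (th K : R), [/\ (0 < N1)%N, 0 < th, 0 < K &
    forall n, exists Q rho, [/\ 0 < rho, rho * (size Q)%:R <= K &
      forall N k, (N1 <= N)%N -> (g <= k)%N -> (k + 2 * N <= n)%N ->
      th <= rho * (count (fun q => (c2 - c1) / 2 * N%:R <=
         birkhoff G phi N (iter (k + N) G q) - birkhoff G phi N (iter k G q)) Q)%:R]].
Proof.
move=> e_gt0 ee0 kap00 phiB c1B c12 phic ED EG.
have B0 : 0 <= B by apply: le_trans (phiB point).
pose del := (c2 - c1) / 16.
have del0 : 0 < del by rewrite divr_gt0 // subr_gt0.
have [r r0 Hr] := phic _ del0.
pose eta := Num.min (r / 3) (e / 8).
have eta0 : 0 < eta by rewrite lt_min !divr_gt0.
have eta_r : 3 * eta <= r.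
  have : eta <= r / 3 by rewrite ge_min lexx.
  lra.
have eta_e : 8 * eta <= e.
  have : eta <= e / 8 by rewrite ge_min lexx orbT.
  lra.
have phi3 p q : d p q <= 3 * eta -> `|phi p - phi q| <= del.
  by move=> h; apply: Hr; apply: le_trans eta_r.
have [g g0 Hg] := spec_three eta0.
have [|K HK] := ws_mass W (e1 := eta); first by apply/andP; split; lra.
have [|K2 HK2] := ws_mass W (e1 := 2 * eta); first by apply/andP; split; lra.
have [|K3 HK3] := ws_mass W (e1 := e); first by apply/andP; split.
have [_ K1 Hm] := HK; have [_ K21 _] := HK2; have [_ K31 _] := HK3.
have K0 : 0 < K by apply: lt_le_trans K1.
have K30 : 0 < K3 by apply: lt_le_trans K31.
have [L L0 HL] := ws_low W.
pose Cw := K2 * K2; have Cw0 : 0 < Cw by rewrite mulr_gt0 // (lt_le_trans ltr01).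
have cmp n x y : bowen n x (2 * eta) y -> w n x <= Cw * w n y.
  by move=> /(bowenC Hd) h; apply: (wgt_comparable Hd HK2 _ h); lra.
pose al := L ^+ g / Cw; have al0 : 0 < al by rewrite /al; pos.
(* Long enough that the sum over the gap of length [g] is negligible against [del * N]. *)
pose N1 := (g + (Num.truncn (g%:R * (2 * B + del) / del)).+1)%N.
have gN1 : (g < N1)%N by rewrite /N1 addnS ltnS leq_addr.
have tN1 : ((Num.truncn (g%:R * (2 * B + del) / del)).+1 <= N1)%N by rewrite leq_addl.
pose th := K^-1 * (al * al * Cw^-1) * ((K3 * K3)^-1 * kap0 * kap0).
exists g, N1, th, K; split => //; first exact: leq_trans gN1.
  by rewrite /th; pos.
move=> n; have [Q [rho [rho0 HQ HZ]]] := Hm n; exists Q, rho; split=> // N k N1N gk kn.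
have Nr : 0 < N%:R :> R by rewrite ltr0n; exact: leq_trans (leq_ltn_trans (leq0n g) gN1) N1N.
have gN : (g < N)%N by exact: leq_trans gN1 N1N.
have hN : g%:R * (2 * B + del) <= del * N%:R.
  have h : g%:R * (2 * B + del) / del <= N%:R.
    by apply: le_trans (ltW (truncnS_gt _)) _; rewrite ler_nat; exact: leq_trans tN1 N1N.
  by rewrite ler_pdivrMr // in h; rewrite [del * _]mulrC.
(* The history is unconstrained: a maximal separated set spans, so its total weight is bounded below
   by [spanning_sum]. *)
have [E0 [sE0 _ mE0]] := separated_exists W (k - g) (fun=> True) e_gt0 ee0.
have [E1 [sE1 E1c w1]] := ED (N - g)%N (ltac:(by rewrite subn_gt0)).
have [E2 [sE2 E2c w2]] := EG N (leq_ltn_trans (leq0n g) gN).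
have /choice[z zP] : forall t : M * M * M, exists z, [/\ bowen (k - g) t.1.1 eta z,
    bowen (N - g) t.1.2 (2 * eta) (iter k G z) & bowen N t.2 (2 * eta) (iter (k + N) G z)].
  by move=> [[x0 x1] x2] /=; apply: Hg => //; exact: ltnW.
pose E := [seq (p, x2) | p <- [seq (x0, x1) | x0 <- E0, x1 <- E1], x2 <- E2].
pose P (t : M * M * M) q := `[< bowen (k + 2 * N) (z t) eta q >].
have PE t q : P t q -> [/\ bowen (k - g) t.1.1 (2 * eta) q,
    bowen (N - g) t.1.2 (3 * eta) (iter k G q) & bowen N t.2 (3 * eta) (iter (k + N) G q)].
  move=> /asboolP zq; have [z1 z2 z3] := zP t.
  have e2 : 2 * eta = eta + eta by ring.
  have e3 : 3 * eta = 2 * eta + eta by ring.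
  split.
  - by rewrite e2; apply: (bowenT Hd z1) => i ni; apply: zq; clear -ni; lia.
  - by rewrite e3; apply: (bowenT Hd z2) => i ni; rewrite -!iterD; apply: zq; clear -ni gk gN; lia.
  - by rewrite e3; apply: (bowenT Hd z3) => i ni; rewrite -!iterD; apply: zq; clear -ni gk gN; lia.
pose P0 q := (c2 - c1) / 2 * N%:R <= birkhoff G phi N (iter (k + N) G q) - birkhoff G phi N (iter k G q).
have EP t : t \in E -> [/\ t.1.1 \in E0, t.1.2 \in E1 & t.2 \in E2].
  by move=> /allpairsP[[p x2] /= [/allpairsP[[x0 x1] /= [h1 h2 ->]] h3 ->]].
have hP0 t q : t \in E -> P t q -> P0 q.
  move=> /EP[_ /E1c h1 /E2c h2] /PE[_ q1 q2].
  have b1 := birkhoff_near phi3 q1; have b2 := birkhoff_near phi3 q2.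
  move: b1; rewrite ler_norml => /andP[b1 _]; move: b2; rewrite ler_norml => /andP[_ b2].
  rewrite /P0; have -> : birkhoff G phi N (iter k G q) =
     birkhoff G phi (N - g) (iter k G q) + birkhoff G phi g (iter (N - g) G (iter k G q)).
    by rewrite -birkhoffD subnK // ltnW.
  have b3 := ler_normlW (birkhoff_norm G g (iter (N - g) G (iter k G q)) phiB).
  rewrite natrB ?(ltnW gN) // in h1 b1.
  have gr : 0 <= g%:R :> R by [].
  have h3 : - c1 * g%:R <= B * g%:R.
    by rewrite ler_wpM2r // (le_trans (ler_norm _)) // normrN.
  have h4 : 0 <= g%:R * del by rewrite mulr_ge0 // ltW.
  have h5 : 0 <= del * N%:R by rewrite mulr_ge0 // ltW.
  have delE : c2 = c1 + 16 * del by rewrite /del; field.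
  rewrite delE in h2 *; lra.
have hdis t t' q : t \in E -> t' \in E -> P t q -> P t' q -> t = t'.
  move=> /EP[a0 a1 a2] /EP[b0 b1 b2] /PE[p0 p1 p2] /PE[q0 q1 q2].
  have aux m x y v E' : sep m e E' -> x \in E' -> y \in E' -> bowen m x (3 * eta) v ->
      bowen m y (3 * eta) v -> x = y.
    move=> [_ sE'] xE yE xv yv; apply/eqP/negP => /negP xy; apply: (sE' _ _ xE yE xy).
    have le6 : 3 * eta + 3 * eta <= e by lra.
    by apply: (bowenW le6); exact: (bowenT Hd xv (bowenC Hd yv)).
  have le3 : 2 * eta <= 3 * eta by lra.
  have e0' := aux _ _ _ _ _ sE0 a0 b0 (bowenW le3 p0) (bowenW le3 q0).
  have e1' := aux _ _ _ _ _ sE1 a1 b1 p1 q1.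
  have e2' := aux _ _ _ _ _ sE2 a2 b2 p2 q2.
  by case: t t' e0' e1' e2' {a0 a1 a2 b0 b1 b2 p0 p1 p2 q0 q1 q2} => [[? ?] ?] [[? ?] ?] /= -> -> ->.
have uE : uniq E.
  have [uE0 _] := sE0; have [uE1 _] := sE1; have [uE2 _] := sE2.
  have u01 : uniq [seq (x0, x1) | x0 <- E0, x1 <- E1].
    by apply: allpairs_uniq => // -[? ?] [? ?].
  by apply: allpairs_uniq => // -[? ?] [? ?].
have wE t : t \in E -> al * al * Cw^-1 * (w (k - g)%N t.1.1 * w (N - g)%N t.1.2 * w N t.2) <=
     w (k + 2 * N)%N (z t).
  move=> tE; have [z1 z2 z3] := zP t.
  have le2 : eta <= 2 * eta by lra.
  have h0 := cmp _ _ _ (bowenW le2 z1); have h1 := cmp _ _ _ z2; have h2 := cmp _ _ _ z3.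
  have -> : w (k + 2 * N)%N (z t) = w (k - g)%N (z t) * w g (iter (k - g) G (z t)) *
     (w (N - g)%N (iter k G (z t)) * w g (iter (N - g) G (iter k G (z t)))) * w N (iter (k + N) G (z t)).
    have -> : (k + 2 * N = k + N + N)%N by rewrite mul2n -addnn addnA.
    rewrite (ws_mul W) (ws_mul W k N).
    have -> : w k (z t) = w (k - g)%N (z t) * w g (iter (k - g) G (z t)) by rewrite -(ws_mul W) subnK.
    by rewrite -[w (N - g)%N _ * _](ws_mul W) subnK // ltnW.
  have hL m y : L ^+ m <= w m y := HL m y.
  have -> : al * al * Cw^-1 * (w (k - g)%N t.1.1 * w (N - g)%N t.1.2 * w N t.2) =
     (w (k - g)%N t.1.1 / Cw * L ^+ g) * (w (N - g)%N t.1.2 / Cw * L ^+ g) * (w N t.2 / Cw).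
    by rewrite /al; field; rewrite gt_eqF.
  have w0' := w0; have Lg : 0 <= L ^+ g by pos.
  have q0 m y : 0 <= w m y / Cw by rewrite divr_ge0 ?ltW.
  apply: ler_pM; [by pos|by pos| |by rewrite ler_pdivrMr // mulrC].
  apply: ler_pM; [by pos|by pos| |].
    by apply: ler_pM => //; rewrite ler_pdivrMr // mulrC.
  by apply: ler_pM => //; rewrite ler_pdivrMr // mulrC.
rewrite -(ler_pM2l K0).
apply: le_trans (_ : \sum_(t <- E) w (k + 2 * N)%N (z t) <= _); last first.
  apply: le_trans (_ : \sum_(t <- E) K * (rho * (count (P t) Q)%:R) <= _).
    by apply: ler_sum => t _; have [] := HQ (k + 2 * N)%N (z t) kn.
  rewrite -mulr_sumr ler_pM2l // -mulr_sumr ler_pM2l // -natr_sum ler_nat.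
  exact: sum_count_disjoint.
apply: le_trans (_ : \sum_(t <- E) al * al * Cw^-1 * (w (k - g)%N t.1.1 * w (N - g)%N t.1.2 * w N t.2) <= _); last first.
  by rewrite big_seq [leRHS]big_seq; apply: ler_sum.
have -> : \sum_(t <- E) al * al * Cw^-1 * (w (k - g)%N t.1.1 * w (N - g)%N t.1.2 * w N t.2) =
  al * al * Cw^-1 * ((\sum_(x <- E0) w (k - g)%N x) * (\sum_(x <- E1) w (N - g)%N x) * (\sum_(x <- E2) w N x)).
  rewrite -mulr_sumr; congr (_ * _); rewrite big_allpairs big_allpairs /=.
  rewrite -mulrA mulr_suml; apply: eq_bigr => x0 _.
  rewrite mulr_suml mulr_sumr; apply: eq_bigr => x1 _.
  by rewrite !mulr_sumr; apply: eq_bigr => x2 _; rewrite mulrA.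
have -> : K * th = al * al * Cw^-1 * ((K3 * K3)^-1 * kap0 * kap0).
  by rewrite /th -mulrA mulVKf // gt_eqF.
rewrite ler_pM2l; last by pos.
have w01 : (K3 * K3)^-1 <= \sum_(x <- E0) w (k - g)%N x.
  rewrite -[leLHS]mulr1 ler_pdivrMl ?mulr_gt0 //.
  apply: (spanning_sum HK3 (ws_1 W)) => v; have [x xE0 xv] := mE0 v I; exists x => //.
  exact: bowenW ee0 xv.
by rewrite !ler_pM ?mulr_ge0 ?invr_ge0 ?mulr_ge0 ?(ltW kap00) ?(ltW K30) ?(ltW w1) ?(ltW w2).
Qed.

(** Averaged over the net, every scale contributes at least [th * de ^+ 2] per position to the
    oscillation, while [dyadic_oscillation] bounds the sum over all scales. *)
Lemma no_two_phases (phi : M -> R) (B c1 c2 e kap0 : R) : 0 < e -> e <= e0 -> 0 < kap0 ->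
  (forall x, `|phi x| <= B) -> `|c1| <= B -> c1 < c2 ->
  (forall kap : R, 0 < kap -> exists2 r : R, 0 < r & forall p q, d p q <= r -> `|phi p - phi q| <= kap) ->
  (forall N, (0 < N)%N -> exists E, [/\ sep N e E,
     forall x, x \in E -> birkhoff G phi N x <= c1 * N%:R & kap0 < \sum_(x <- E) w N x]) ->
  (forall N, (0 < N)%N -> exists E, [/\ sep N e E,
     forall x, x \in E -> c2 * N%:R <= birkhoff G phi N x & kap0 < \sum_(x <- E) w N x]) -> False.
Proof.
move=> e_gt0 ee0 kap00 phiB c1B c12 phic ED EG.
have [g [N1 [th [K [N10 th0 K0 HQ]]]]] := event_mass e_gt0 ee0 kap00 phiB c1B c12 phic ED EG.
pose de := (c2 - c1) / 2; have de0 : 0 < de by rewrite divr_gt0 // subr_gt0.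
(* Number of scales for which the lower bounds exceed the total allowed. *)
pose J := (Num.truncn (8 * B ^+ 2 * K / (th * de ^+ 2))).+1.
have JB : 8 * B ^+ 2 * K < J%:R * (th * de ^+ 2).
  have h := truncnS_gt (8 * B ^+ 2 * K / (th * de ^+ 2)).
  by rewrite -/J ltr_pdivrMr // in h; rewrite mulr_gt0 // exprn_gt0.
pose T := (2 ^ (N1 + J))%N.
have [Q [rho [rho0 QK HE]]] := HQ (g + T + 2 * T)%N.
pose F q i := phi (iter (g + i) G q).
pose D j k q := window_mean (F q) (2 ^ (N1 + j)) k - window_mean (F q) (2 ^ (N1 + j)) (k + 2 ^ (N1 + j)).
have Fs q n k : window_mean (F q) n k = birkhoff G phi n (iter (g + k) G q) / n%:R.
  rewrite /window_mean /birkhoff; congr (_ / _); apply: eq_bigr => i _.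
  by rewrite /F -iterD; congr (phi (iter _ G q)); clear; lia.
have upper : \sum_(q <- Q) \sum_(j < J) \sum_(k < T) D j k q ^+ 2 <= (size Q)%:R * (8 * T%:R * B ^+ 2).
  apply: le_trans (_ : \sum_(q <- Q) (8 * T%:R * B ^+ 2) <= _).
    by apply: ler_sum => q _; apply: dyadic_oscillation => i; exact: phiB.
  by rewrite big_const_seq count_predT iter_addr_0 [leRHS]mulr_natl.
have lower (j : 'I_J) (k : 'I_T) : th * de ^+ 2 <= rho * \sum_(q <- Q) D j k q ^+ 2.
  pose N := (2 ^ (N1 + j))%N.
  have N1N : (N1 <= N)%N by apply: leq_trans (leq_addr j N1) (ltnW (ltn_expl _ _)).
  have Nr : 0 < N%:R :> R by rewrite ltr0n expn_gt0.
  have NT : (N <= T)%N by rewrite leq_exp2l // leq_add2l ltnW.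
  have kn : (g + k + 2 * N <= g + T + 2 * T)%N by rewrite leq_add ?leq_add2l ?leq_mul2l ?NT ?orbT // ltnW.
  have := HE N (g + k)%N N1N (leq_addr _ _) kn; set cnt := count _ _ => hc.
  apply: le_trans (_ : rho * cnt%:R * de ^+ 2 <= _); first by rewrite ler_wpM2r // sqr_ge0.
  rewrite -mulrA ler_pM2l // /cnt -sum1_count natr_sum mulr_suml big_mkcond /=.
  apply: ler_sum => q _; case: ifP => [hq|_]; last by rewrite sqr_ge0.
  rewrite mul1r /D -/N !Fs addnA -[leRHS]sqrrN opprB -mulrBl.
  rewrite ler_sqr ?nnegrE ?(ltW de0) //; first by rewrite ler_pdivlMr.
  by rewrite divr_ge0 ?ler0n // (le_trans _ hq) // mulr_ge0 // ltW.
have : J%:R * T%:R * (th * de ^+ 2) <= 8 * T%:R * B ^+ 2 * K.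
  apply: le_trans (_ : \sum_(j < J) \sum_(k < T) rho * \sum_(q <- Q) D j k q ^+ 2 <= _).
    apply: le_trans (_ : \sum_(j < J) \sum_(k < T) th * de ^+ 2 <= _).
      rewrite !sumr_const !card_ord -mulrnA -[leRHS]mulr_natr natrM.
      by rewrite le_eqVlt; apply/orP; left; apply/eqP; ring.
    by apply: ler_sum => j _; apply: ler_sum => k _; exact: lower.
  have -> : \sum_(j < J) \sum_(k < T) rho * \sum_(q <- Q) D j k q ^+ 2 =
      rho * \sum_(q <- Q) \sum_(j < J) \sum_(k < T) D j k q ^+ 2.
    rewrite [in RHS]exchange_big /= mulr_sumr; apply: eq_bigr => j _.
    by rewrite [in RHS]exchange_big /= mulr_sumr.
  apply: le_trans (ler_wpM2l (ltW rho0) upper) _.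
  have X0 : 0 <= 8 * T%:R * B ^+ 2.
    by apply: mulr_ge0; [apply: mulr_ge0|exact: sqr_ge0].
  have h := ler_wpM2r X0 QK; rewrite -(mulrA rho) in h; apply: le_trans h _.
  by rewrite mulrC.
have T0 : 0 < T%:R :> R by rewrite ltr0n expn_gt0.
rewrite -[8 * _]mulrC -!mulrA mulrCA ler_pM2l // => h.
by have := lt_le_trans JB h; rewrite -!mulrA ltxx.
Qed.

Definition low_decays (phi : M -> R) (c e : R) : Prop := exists2 N, (0 < N)%N &
  forall k E, (0 < k)%N -> sep (k * N) e E ->
    (forall x, x \in E -> birkhoff G phi (k * N) x <= c * (k * N)%:R) ->
    \sum_(x <- E) w (k * N)%N x <= 2^-1 ^+ k.

Definition high_decays (phi : M -> R) (c e : R) : Prop := exists2 N, (0 < N)%N &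
  forall k E, (0 < k)%N -> sep (k * N) e E ->
    (forall x, x \in E -> c * (k * N)%:R <= birkhoff G phi (k * N) x) ->
    \sum_(x <- E) w (k * N)%N x <= 2^-1 ^+ k.

(** If neither decay held, [low_decay], applied to [phi] and to [- phi], would give weight above a
    fixed threshold in both events at every time, contradicting [no_two_phases]. Each application
    spends a third of the gap between [c] and [c']. *)
Theorem decay_dichotomy (phi : M -> R) (B c c' : R) :
  (forall x, `|phi x| <= B) -> `|c| <= B -> `|c'| <= B -> c < c' ->
  (forall kap : R, 0 < kap -> exists2 r : R, 0 < r & forall p q, d p q <= r -> `|phi p - phi q| <= kap) ->
  exists2 e : R, 0 < e & 2 * e <= e0 /\ (low_decays phi c e \/ high_decays phi c' e).
Proof.
move=> phiB cB c'B cc phic.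
pose sig := (c' - c) / 3; have sig0 : 0 < sig by rewrite divr_gt0 // subr_gt0.
have [r r0 Hr] := phic (sig / 2) (ltac:(by rewrite divr_gt0)).
pose e := Num.min r (e0 / 4); have E0 := ws_e0 W.
have e_gt0 : 0 < e by rewrite lt_min r0 divr_gt0.
have e4 : 4 * e <= e0.
  have : e <= e0 / 4 by rewrite ge_min lexx orbT.
  lra.
have phie p q : d p q <= e -> `|phi p - phi q| <= sig / 2.
  by move=> h; apply: Hr; apply: le_trans h _; rewrite ge_min lexx.
have phie' p q : d p q <= e -> `|- phi p - - phi q| <= sig / 2.
  by move=> /phie; rewrite -opprD normrN.
have [k1 k10 H1] := low_decay W e_gt0 (ltac:(lra) : 2 * e <= e0) sig0 phiB cB phie.
have [||k2 k20 H2] := @low_decay R M d G w e0 W (fun x => - phi x) B (- c') sig e e_gt0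
  (ltac:(lra) : 2 * e <= e0) sig0 _ _ phie'.
- by move=> x; rewrite normrN.
- by rewrite normrN.
have bN n x : birkhoff G (fun x => - phi x) n x = - birkhoff G phi n x by rewrite /birkhoff sumrN.
exists (2 * e); first by rewrite mulr_gt0.
split; first lra.
apply: contrapT => /not_orP[nlow nhigh].
pose kap := Num.min k1 k2; have kap0 : 0 < kap by rewrite lt_min k10.
apply: (@no_two_phases phi B (c + sig) (c' - sig) e kap e_gt0 _ kap0 phiB _ _ phic).
- lra.
- move: cB c'B; rewrite !ler_norml /sig => /andP[? ?] /andP[? ?]; apply/andP; split; lra.
- by rewrite /sig; lra.
- move=> N N0; apply: contrapT => hE; apply: nlow; exists N => //.
  apply: H1 => // E sE Ec; rewrite leNgt; apply/negP => lt; apply: hE; exists E; split=> //.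
  by apply: le_lt_trans lt; rewrite ge_min lexx.
- move=> N N0; apply: contrapT => hE; apply: nhigh; exists N => // k E kk sE Ec.
  apply: (H2 N N0 _ k E kk sE) => [E' sE' E'c|x /Ec]; last by rewrite bN mulNr lerN2.
  rewrite leNgt; apply/negP => lt; apply: hE; exists E'; split=> //.
    by move=> x /E'c; rewrite bN; lra.
  by apply: le_lt_trans lt; rewrite ge_min lexx orbT.
Qed.

End PhaseTransition.

(** * Entropy and the variational inequality *)

Section Means.
Variables (R : realType) (M : ptopologicalType) (mu : probability (borel M) R).

(** Bounded Borel functions: integrable for every probability, and stable under the operations to
    which [mean] is applied below. *)
Definition tame (f : M -> R) : Prop :=
  measurable_fun [set: borel M] f /\ exists B : R, forall x, `|f x| <= B.

Lemma tame_integrable f : tame f -> mu.-integrable [set: borel M] (EFin \o f).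
Proof.
move=> [mf [B fB]]; apply: measurable_bounded_integrable => //.
  by apply: le_lt_trans (probability_le1 mu measurableT) _; rewrite ltry.
exists B; split; first exact: num_real.
by move=> x Bx y _; apply: le_trans (ltW Bx); exact: fB.
Qed.

Lemma borel_preimage (F : M -> M) (A : set M) : continuous F ->
  measurable (A : set (borel M)) -> measurable (F @^-1` A : set (borel M)).
Proof.
move=> cF mA; have mF : measurable_fun [set: borel M] (F : borel M -> borel M).
  apply: (@measurability _ _ (borel M) (borel M) setT F (@open M) erefl).
  move=> _ [B oB <-]; rewrite setTI; apply: sub_gen_smallest.
  by apply: open_comp => // x _; exact: cF.
by rewrite -[X in measurable X]setTI; exact: mF.
Qed.

Lemma borel_measurable_fun (F : M -> M) : continuous F ->
  measurable_fun [set: borel M] (F : borel M -> borel M).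
Proof. by move=> cF _ A mA; rewrite setTI; exact: borel_preimage. Qed.

Lemma continuous_tame (f : M -> R) : compact [set: M] -> continuous f -> tame f.
Proof.
move=> cM cf; split.
  apply: (@measurability _ _ (borel M) R setT f _ (RGenOpens.measurableE R)).
  move=> _ [_ [a [b ->]] <-]; rewrite setTI; apply: sub_gen_smallest.
  by apply: open_comp; [move=> x _; exact: cf|exact: interval_open].
have /compact_bounded[B [_ HB]] : compact (f @` [set: M]).
  by apply: continuous_compact => //; apply: continuous_subspaceT.
exists (B + 1) => x; apply: (HB (B + 1)); first by rewrite ltrDl.
by exists x.
Qed.

Lemma tame_cst (c : R) : tame (cst c).
Proof. by split; [exact: measurable_cst|exists `|c|]. Qed.

Lemma tame_indic (A : set M) : measurable (A : set (borel M)) -> tame (\1_A : M -> R).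
Proof.
move=> mA; split; first exact: measurable_indic.
by exists 1 => x; rewrite indicE; case: (x \in A); rewrite ?normr1 ?normr0.
Qed.

Lemma tameD f h : tame f -> tame h -> tame (fun x => f x + h x).
Proof.
move=> [mf [B fB]] [mh [B' hB]]; split; first exact: measurable_funD.
by exists (B + B') => x; apply: le_trans (ler_normD _ _) (lerD _ _).
Qed.

Lemma tameZ (c : R) f : tame f -> tame (fun x => c * f x).
Proof.
move=> [mf [B fB]]; split; first by apply: measurable_funM => //; exact: measurable_cst.
by exists (`|c| * B) => x; rewrite normrM ler_wpM2l.
Qed.

Lemma tame_sum (I : Type) (s : seq I) (f : I -> M -> R) : (forall i, tame (f i)) ->
  tame (fun x => \sum_(i <- s) f i x).
Proof.
move=> hf; elim: s => [|i s IH].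
  by have -> : (fun x => \sum_(i <- [::]) f i x) = cst 0; [apply/funext => x; rewrite big_nil|exact: tame_cst].
have -> : (fun x => \sum_(j <- i :: s) f j x) = (fun x => f i x + \sum_(j <- s) f j x).
  by apply/funext => x; rewrite big_cons.
exact: tameD.
Qed.

Lemma tame_comp f (F : M -> M) : tame f -> continuous F -> tame (f \o F).
Proof.
move=> [mf [B fB]] cF; split; last by exists B => x; exact: fB.
exact: (measurableT_comp mf (borel_measurable_fun cF)).
Qed.

Lemma meanD f h : tame f -> tame h -> mean (fun x => f x + h x) mu = mean f mu + mean h mu.
Proof. by move=> tf th; rewrite /mean RintegralD //; exact: tame_integrable. Qed.

Lemma meanZ (c : R) f : tame f -> mean (fun x => c * f x) mu = c * mean f mu.
Proof. by move=> tf; rewrite /mean RintegralZl //; exact: tame_integrable. Qed.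

Lemma mean_cst (c : R) : mean (cst c) mu = c.
Proof. rewrite /mean Rintegral_cst // [X in fine X](_ : _ = 1%E) ?mulr1 //.
exact: probability_setT. Qed.

Lemma le_mean f h : tame f -> tame h -> (forall x, f x <= h x) -> mean f mu <= mean h mu.
Proof. by move=> tf th fh; apply: le_Rintegral => //; exact: tame_integrable. Qed.

Lemma mean_sum (I : Type) (s : seq I) (f : I -> M -> R) : (forall i, tame (f i)) ->
  mean (fun x => \sum_(i <- s) f i x) mu = \sum_(i <- s) mean (f i) mu.
Proof.
move=> hf; elim: s => [|i s IH].
  rewrite big_nil -[RHS](mean_cst 0); congr (mean _ mu).
  by apply/funext => x; rewrite big_nil.
rewrite big_cons -IH -meanD //; last exact: tame_sum.
by congr (mean _ mu); apply/funext => x; rewrite big_cons.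
Qed.

Lemma mean_indic (A : set M) : measurable (A : set (borel M)) ->
  mean (\1_A : M -> R) mu = fine (mu A).
Proof. by move=> mA; rewrite /mean /Rintegral integral_indic // setIT. Qed.

Lemma mean_invariant f (F : M -> M) : tame f -> continuous F ->
  (forall A : set (borel M), measurable A -> mu (F @^-1` A) = mu A) ->
  mean (f \o F) mu = mean f mu.
Proof.
move=> tf cF inv; rewrite /mean /Rintegral; congr fine.
have mF := borel_measurable_fun cF.
have := @integral_pushforward _ _ _ _ R (F : borel M -> borel M) mF mu setT (EFin \o f).
rewrite preimage_setT => <- //.
- by apply: eq_measure_integral => A mA _; exact: inv.
- by apply/measurable_EFinP; exact: tf.1.
- by have := tame_integrable (tame_comp tf cF).
Qed.

End Means.

(** * Approximation of Borel sets by closed sets *)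

Section Regularity.
Variables (R : realType) (M : ptopologicalType) (mu : probability (borel M) R).
Variable d : M -> M -> R.
Hypothesis Hd : pseudo_metric d.
Hypothesis Hnb : forall p (P : M -> Prop), (\forall q \near p, P q) <->
  exists2 e : R, 0 < e & forall q, d p q < e -> P q.

Let open_measurable (A : set M) : open A -> measurable (A : set (borel M)).
Proof. by move=> oA; exact: sub_gen_smallest. Qed.

Let closed_measurable (A : set M) : closed A -> measurable (A : set (borel M)).
Proof.
move=> cA; rewrite -[A]setCK; apply: measurableC; apply: open_measurable.
by rewrite openC.
Qed.

(** Closed approximation of [A] and of its complement at once, which makes the class stable under
    complement by symmetry. *)
Definition regular (A : set M) : Prop := forall eta : R, 0 < eta ->
  exists K K' : set M, [/\ closed K, closed K', K `<=` A, K' `<=` ~` A &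
    (mu (~` (K `|` K')) <= eta%:E)%E].

Lemma increasing_tail (F : nat -> set M) (eta : R) : 0 < eta ->
  (forall n, measurable (F n : set (borel M))) -> (forall n m, (n <= m)%N -> F n `<=` F m) ->
  exists n, (mu ((\bigcup_i F i) `\` F n) <= eta%:E)%E.
Proof.
move=> eta0 mF hF; pose D n : set (borel M) := (\bigcup_i F i) `\` F n.
have mU : measurable (\bigcup_i F i : set (borel M)) by apply: bigcup_measurable.
have mD n : measurable (D n) by apply: measurableD.
have : (mu \o D) x @[x --> \oo] --> mu (\bigcap_n D n).
  apply: nonincreasing_cvg_mu => //.
  - by apply: le_lt_trans (probability_le1 mu (mD 0%N)) _; rewrite ltry.
  - by apply: bigcap_measurable.
  - by move=> n m nm; apply/subsetPset => x [Ux nF]; split=> // /(hF _ _ nm).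
have -> : \bigcap_n D n = set0.
  by apply/seteqP; split=> // x h; have [[i _ Fi] _] := h 0%N I; have [_] := h i I; apply.
rewrite measure0 => /fine_cvgP[_ /cvgrPdist_lt/(_ eta eta0)] [n _ /(_ n (leqnn n))] /=.
rewrite sub0r normrN => h; exists n; rewrite -/(D n).
have fin : mu (D n) \is a fin_num by rewrite fin_num_measure.
by rewrite -(fineK fin) lee_fin ltW // (le_lt_trans (ler_norm _)).
Qed.

Lemma regular_setC A : regular A -> regular (~` A).
Proof.
move=> rA eta eta0; have [K [K' [c1 c2 s1 s2 h]]] := rA eta eta0.
by exists K', K; split; rewrite ?setCK // setUC.
Qed.

Lemma regular_open A : open A -> regular A.
Proof.
move=> oA eta eta0.
pose K n : set M := [set x | forall y, ~ A y -> n.+1%:R^-1 <= d x y].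
have cK n : closed (K n).
  rewrite -openC openE => x /existsNP[y /not_implyP[nAy /negP]]; rewrite -ltNge => xy.
  apply/Hnb; exists (n.+1%:R^-1 - d x y); first by rewrite subr_gt0.
  move=> z xz; apply/existsNP; exists y; apply/not_implyP; split=> //; apply/negP.
  rewrite -ltNge; apply: le_lt_trans (pm_T Hd x _ _) _; by rewrite (pm_C Hd z) -ltrBrDr.
have KA : \bigcup_n K n = A.
  apply/seteqP; split=> [x [n _ Kx]|x Ax].
    by apply: contrapT => /Kx; rewrite (pm_xx Hd) leNgt invr_gt0 ltr0n.
  have /Hnb[e e0 He] : \forall q \near x, A q by apply: open_nbhs_nbhs.
  have [n ne] : exists n : nat, n.+1%:R^-1 < e.
    exists (Num.truncn e^-1); rewrite -[ltRHS]invrK ltf_pV2 ?posrE ?invr_gt0 ?ltr0n //.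
    exact: truncnS_gt.
  exists n => // y nAy; rewrite leNgt; apply/negP => xy; apply: nAy; apply: He.
  exact: lt_trans ne.
have hK n m : (n <= m)%N -> K n `<=` K m.
  move=> nm x Kx y /Kx; apply: le_trans.
  by rewrite lef_pV2 ?posrE ?ltr0n // ler_nat.
have [n hn] := increasing_tail eta0 (fun n => closed_measurable (cK n)) hK.
exists (K n), (~` A); split=> //; first by rewrite closedC.
  by rewrite -KA => x Kx; exists n.
by apply: le_trans hn; rewrite KA setCU setCK setIC.
Qed.

(** Inside, a finite union of the closed sets suffices up to half of [eta]; outside, the
    intersection of closed sets is closed. The errors of the single sets sum geometrically to the
    other half. *)
Lemma regular_bigcup (A : nat -> set M) : (forall i, regular (A i)) ->
  (forall i, measurable (A i : set (borel M))) -> regular (\bigcup_i A i).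
Proof.
move=> rA mA eta eta0.
have e2 (i : nat) : 0 < eta / 2 * (2^-1) ^+ i.+1 by rewrite mulr_gt0 ?divr_gt0 ?exprn_gt0.
have /choice[KK KP] : forall i, exists KK : set M * set M, [/\ closed KK.1, closed KK.2, KK.1 `<=` A i,
    KK.2 `<=` ~` A i & (mu (~` (KK.1 `|` KK.2)) <= (eta / 2 * (2^-1) ^+ i.+1)%:E)%E].
  by move=> i; have [K [K' H]] := rA i _ (e2 i); exists (K, K').
pose F n : set M := \bigcup_(i < n) (KK i).1.
have mK i : measurable ((KK i).1 : set (borel M)) by have [h _ _ _ _] := KP i; exact: closed_measurable.
have mK' i : measurable ((KK i).2 : set (borel M)) by have [_ h _ _ _] := KP i; exact: closed_measurable.
have cF n : closed (F n).
  rewrite /F bigcup_mkord; apply: closed_bigsetU => i _; by have [] := KP i.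
have FU : \bigcup_n F n = \bigcup_i (KK i).1.
  apply/seteqP; split=> [x [n _ [i _ Kx]]|x [i _ Kx]]; first by exists i.
  by exists i.+1 => //; exists i => //=.
have hF n m : (n <= m)%N -> F n `<=` F m.
  by move=> nm x [i /= im Kx]; exists i => //=; exact: leq_trans nm.
have eta2 : 0 < eta / 2 by rewrite divr_gt0.
have [n hn] := increasing_tail eta2 (fun n => closed_measurable (cF n)) hF.
pose K' : set M := \bigcap_i (KK i).2.
have cK' : closed K' by apply: closed_bigI => i _; have [] := KP i.
exists (F n), K'; split=> //.
- by move=> x [i _ Kx]; exists i => //; have [_ _ h _ _] := KP i; exact: h.
- move=> x K'x [i _ Ax]; have [_ _ _ h _] := KP i; exact: (h x (K'x i I)).
pose Bad i : set (borel M) := ~` ((KK i).1 `|` (KK i).2).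
have mBad i : measurable (Bad i) by apply: measurableC; apply: measurableU.
have mB : measurable (\bigcup_i Bad i) by apply: bigcup_measurable.
have mFU : measurable ((\bigcup_n F n) `\` F n : set (borel M)).
  by apply: measurableD; [rewrite FU; apply: bigcup_measurable|exact: closed_measurable].
apply: (@le_trans _ _ (mu ((\bigcup_i Bad i) `|` ((\bigcup_n F n) `\` F n)))).
  apply: le_measure; rewrite ?inE //.
  - by apply: measurableC; apply: measurableU; exact: closed_measurable.
  - by apply: measurableU.
  move=> x /not_orP[nF nK'].
  have [h|nh] := pselect ((\bigcup_i Bad i) x); [by left|right; split=> //].
  rewrite FU; apply: contrapT => nU; apply: nK' => i _.
  apply: contrapT => nK2; apply: nh; exists i => // -[h|//]; apply: nU; by exists i.
apply: le_trans (measureU2 _ _ _) _ => //.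
have -> : eta%:E = ((eta / 2)%:E + (eta / 2)%:E)%E by rewrite -EFinD; congr EFin; field.
apply: leeD => //.
apply: (@le_trans _ _ (\sum_(0 <= i <oo) mu (Bad i))%E).
  exact: measure_sigma_subadditive.
apply: le_trans (_ : (\sum_(0 <= i <oo) ((eta / 2 * (2^-1) ^+ i.+1)%:E) <= _)%E).
  by apply: lee_nneseries => [i _ _|i _]; [exact: measure_ge0|have [] := KP i].
have := epsilon_trick0 xpredT (ltW eta2).
apply: le_trans; apply: lee_nneseries => [i _ _|i _].
  by rewrite lee_fin ltW.
by rewrite lee_fin exprVn natrX.
Qed.

Lemma borel_regular A : measurable (A : set (borel M)) -> regular A.
Proof.
have reg_m : sigma_algebra setT [set A | regular A /\ measurable (A : set (borel M))].
  split.
  - split => //; exact: regular_open open0.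
  - move=> B [rB mB]; rewrite setTD; split; [exact: regular_setC|exact: measurableC].
  - move=> B HA; split; first by apply: regular_bigcup => i; have [] := HA i.
    by apply: bigcup_measurable => i _; have [] := HA i.
move=> mA; suff : [set A | regular A /\ measurable (A : set (borel M))] A by case.
apply: (smallest_sub reg_m _ mA) => B oB; split; [exact: regular_open|exact: open_measurable].
Qed.

End Regularity.

(** Nonnegativity of relative entropy, termwise from ln y <= y - 1; [q] is a subprobability. *)
Lemma gibbs_inequality (R : realType) (I : finType) (p q : I -> R) :
  (forall i, 0 <= p i) -> (forall i, 0 < q i) -> \sum_i p i = 1 -> \sum_i q i <= 1 ->
  - \sum_i p i * ln (p i) <= \sum_i p i * - ln (q i).
Proof.
move=> p0 q0 p1 q1; rewrite -subr_ge0 opprK -big_split /=.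
apply: le_trans (_ : \sum_i (p i - q i) <= _).
  by rewrite sumrB p1 subr_ge0.
apply: ler_sum => i _; have [->|pn0] := eqVneq (p i) 0.
  by rewrite !mul0r addr0 sub0r oppr_le0 ltW.
have pi0 : 0 < p i by rewrite lt_neqAle eq_sym pn0 p0.
rewrite -mulrDr [- _ + _]addrC -[X in _ * X]opprB -ln_div ?posrE //.
have := le_ln1Dx (x := q i / p i - 1); rewrite addrCA subrr addr0.
have qp : 0 < q i / p i by rewrite divr_gt0.
move=> /(_ (ltac:(by rewrite ltrBrDr addrC subrr))) => h.
have -> : p i - q i = p i * - (q i / p i - 1) by field; rewrite gt_eqF.
by rewrite ler_pM2l // lerN2.
Qed.

Lemma measure_bigU_le (R : realType) (M : ptopologicalType) (mu : probability (borel M) R)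
    (I : Type) (s : seq I) (A : I -> set (borel M)) : (forall i, measurable (A i)) ->
  (mu (\big[setU/set0]_(i <- s) A i) <= \sum_(i <- s) mu (A i))%E.
Proof.
move=> mA; elim: s => [|i s IH]; first by rewrite !big_nil measure0.
rewrite !big_cons; apply: le_trans (measureU2 _ _ _) _ => //.
  by apply: bigsetU_measurable.
by apply: leeD.
Qed.

(** * Metric entropy bounded by sums over spanning sets *)

Section EntropyBound.
Variables (R : realType) (M : ptopologicalType) (mu : probability (borel M) R).
Variables (d : M -> M -> R) (T F : M -> M).
Hypothesis Hd : pseudo_metric d.
Hypothesis Hnb : forall p (P : M -> Prop), (\forall q \near p, P q) <->
  exists2 e : R, 0 < e & forall q, d p q < e -> P q.
Hypothesis Hcpt : forall P : R -> M -> Prop,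
  (forall x, exists2 e : R, 0 < e & forall y r, d x y < e -> 0 < r < e -> P r y) ->
  exists2 r : R, 0 < r & forall x, P r x.
Hypothesis cM : compact [set: M].
Hypotheses (KT : cancel T F) (KF : cancel F T) (cT : continuous T) (cF : continuous F).
Hypothesis inv : invariant_probability T mu.

Lemma continuous_iter (H : M -> M) n : continuous H -> continuous (iter n H).
Proof.
move=> cH; elim: n => [|n IH] x; first exact: cvg_id.
by apply: continuous_comp; [exact: IH|exact: cH].
Qed.

Lemma invariant_inverse n (A : set M) : measurable (A : set (borel M)) ->
  mu ((iter n F) @^-1` A) = mu A.
Proof.
move=> mA; elim: n => [|n IH]; first by [].
rewrite -IH; set B := _ @^-1` A in IH *; rewrite -/B.
have mB : measurable (B : set (borel M)) by apply: borel_preimage => //; exact: continuous_iter.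
have -> : (iter n.+1 F) @^-1` A = F @^-1` B by apply/seteqP; split=> x; rewrite /B /preimage /= -iterSr.
have mFB : measurable (F @^-1` B : set (borel M)) by exact: borel_preimage.
rewrite -(inv mFB); congr (mu _).
by apply/seteqP; split=> x; rewrite /preimage /= KT.
Qed.

(** The cells of the partition are replaced by disjoint closed subsets of nearly full measure. By
    compactness no small ball meets two of them, so nearby points of the cores carry the same
    label. *)
Lemma closed_cores (k : nat) (xi : M -> 'I_k) (eta : R) : 0 < eta ->
  (forall i, measurable (xi @^-1` [set i] : set (borel M))) ->
  exists (K : 'I_k -> set M) (r : R), [/\ 0 < r, forall a x, K a x -> xi x = a,
    forall x a b y z, K a y -> K b z -> d x y < r -> d x z < r -> a = b,
    measurable (~` (\bigcup_a K a) : set (borel M)) &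
    fine (mu (~` (\bigcup_a K a))) <= eta].
Proof.
move=> eta0 mxi; have e0 : 0 < eta / k.+1%:R by rewrite divr_gt0.
have /choice[KK KP] : forall a : 'I_k, exists KK : set M * set M, [/\ closed KK.1, closed KK.2,
    KK.1 `<=` xi @^-1` [set a], KK.2 `<=` ~` (xi @^-1` [set a]) & (mu (~` (KK.1 `|` KK.2)) <= (eta / k.+1%:R)%:E)%E].
  by move=> a; have [K [K' H]] := borel_regular mu Hd Hnb (mxi a) e0; exists (K, K').
have cU : closed (\bigcup_a (KK a).1).
  have -> : \bigcup_a (KK a).1 = \big[setU/set0]_(a <- enum 'I_k) (KK a).1.
    rewrite -bigcup_seq; apply: eq_bigcupl; split=> a //= _.
    by rewrite mem_enum.
  by apply: closed_bigsetU => a _; have [] := KP a.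
have cm A : closed A -> measurable (A : set (borel M)).
  move=> cA; rewrite -[A]setCK; apply: measurableC; apply: sub_gen_smallest.
  by rewrite /= openC.
have KE a x : (KK a).1 x -> xi x = a by have [_ _ h _ _] := KP a; exact: h.
have [r r0 Hr] : exists2 r : R, 0 < r & forall x, forall a b y z, (KK a).1 y -> (KK b).1 z ->
    d x y < r -> d x z < r -> a = b.
  apply: Hcpt => x.
  have /choice[e eP] : forall a, exists e : R, 0 < e /\ (~ (KK a).1 x -> forall y, d x y < e -> ~ (KK a).1 y).
    move=> a; have [h|h] := pselect ((KK a).1 x); first by exists 1.
    have [cK _ _ _ _] := KP a.
    have /Hnb[e e1 He] : \forall q \near x, ~ (KK a).1 q.
      by apply: open_nbhs_nbhs; split=> //; rewrite -/(~` _) openC.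
    by exists e.
  pose e' := \big[Num.min/1]_a e a.
  have e'0 : 0 < e' by rewrite /e' lt_bigmin // => a _; have [] := eP a.
  have e'e a : e' <= e a by exact: bigmin_le.
  exists (e' / 2) => [|y r xy /andP[r0 re] a b z z' Kz Kz' yz yz']; first by rewrite divr_gt0.
  have aux c u : (KK c).1 u -> d y u < r -> (KK c).1 x.
    move=> Ku yu; apply: contrapT => nK; have [_ /(_ nK u)] := eP c.
    apply => //; apply: le_lt_trans (pm_T Hd y _ _) _; have := e'e c; lra.
  by rewrite -(KE _ _ (aux _ _ Kz yz)) -(KE _ _ (aux _ _ Kz' yz')).
have mb : measurable (~` (\bigcup_a (KK a).1) : set (borel M)) by apply: measurableC; exact: cm.
exists (fun a => (KK a).1), r; split => //.
pose D a : set (borel M) := ~` ((KK a).1 `|` (KK a).2).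
have mD a : measurable (D a).
  by have [c1 c2 _ _ _] := KP a; apply: measurableC; apply: measurableU; exact: cm.
rewrite -lee_fin fineK ?fin_num_measure //.
apply: (@le_trans _ _ (mu (\big[setU/set0]_(a <- enum 'I_k) D a))).
  apply: le_measure; rewrite ?inE //; first exact: bigsetU_measurable.
  move=> x nK; rewrite -bigcup_seq; exists (xi x); first by rewrite /= mem_enum.
  move=> [h|h]; first by apply: nK; exists (xi x).
  by have [_ _ _ hh _] := KP (xi x); exact: (hh x h erefl).
apply: le_trans (measure_bigU_le _ _ mD) _.
apply: le_trans (_ : (\sum_(a <- enum 'I_k) (eta / k.+1%:R)%:E <= _)%E).
  by apply: lee_sum => a _; have [] := KP a.
rewrite sumEFin lee_fin big_const_seq count_predT iter_addr_0 size_enum_ord -[_ *+ k]mulr_natr.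
by rewrite mulrAC ler_pdivrMr // ler_pM2l // ler_nat.
Qed.

(** Gibbs' inequality for words against a mixture: draw [x] in [E] with probability proportional to
    the exponential of its Birkhoff sum, then guess each letter from the core near the orbit of [x],
    right with probability 1 - eps. A point in the Bowen ball of [x] is guessed well except while it
    is outside the cores, and such visits are rare in the mean by invariance. *)
Lemma join_entropy_bound (k m n : nat) (xi : M -> 'I_k) (f : M -> R) (K : 'I_k -> set M)
    (r e eps eta kap : R) (E : seq M) :
  continuous f -> (0 < m)%N -> 0 < eps < 1 ->
  (forall i, measurable (xi @^-1` [set i] : set (borel M))) ->
  (forall a x, K a x -> xi x = a) ->
  (forall x a b y z, K a y -> K b z -> d x y < r -> d x z < r -> a = b) ->
  measurable (~` (\bigcup_a K a) : set (borel M)) -> fine (mu (~` (\bigcup_a K a))) <= eta ->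
  (forall p q s, d p q <= e -> (s <= m)%N -> d (iter s F p) (iter s F q) < r /\
     `|f (iter s F p) - f (iter s F q)| <= kap) ->
  (forall z, exists2 x, x \in E & bowen d (iter m F) n x e z) ->
  join_entropy T mu xi (n * m) <=
    ln (\sum_(x <- E) expR (\sum_(j < n * m) f (iter j.+1 F x)))
    + (n * m)%:R * (kap - mean f mu + - ln (1 - eps) + eta * (ln k%:R - ln eps)).
Proof.
move=> cf m0 /andP[eps0 eps1] mxi KE Kr mbad bad_eta He HE.
pose L := (n * m)%N; rewrite -/L.
have k0 : (0 < k)%N by apply: leq_ltn_trans (ltn_ord (xi point)).
have kr : 1 <= k%:R :> R by rewrite ler1n.
have kr0 : 0 < k%:R :> R by rewrite ltr0n.
pose S x := \sum_(j < L) f (iter j.+1 F x).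
pose Z := \sum_(x <- E) expR (S x); rewrite -/Z.
(* Words of the partition are read along [T] but the spanning set along [F]. After moving by
   [iter L F], under which [mu] is invariant, the letter at time [i] is read at
   [iter (L - i) F y]. *)
pose fl i y := iter (rev_ord i : 'I_L).+1 F y.
have Srev x : S x = \sum_(i < L) f (fl i x) by rewrite /S (reindex_inj rev_ord_inj).
have [x0 x0E _] := HE point.
have Z0 : 0 < Z.
  rewrite /Z (big_rem x0) //= ltr_pwDl ?expR_gt0 // sumr_ge0 // => x _; exact: expR_ge0.
(* The guessed letter; an arbitrary label when no core is near. *)
pose b i x : 'I_k := odflt (xi point) [pick a | `[< exists2 z, K a z & d (fl i x) z < r >]].
pose Rr (a c : 'I_k) : R := if a == c then 1 - eps else eps / k%:R.
have R0 a c : 0 < Rr a c by rewrite /Rr; case: ifP => _; rewrite ?subr_gt0 // divr_gt0.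
have R1 c : \sum_a Rr a c <= 1.
  rewrite (bigD1 c) //= {1}/Rr eqxx.
  apply: le_trans (_ : 1 - eps + \sum_(a < k) eps / k%:R <= _).
    rewrite lerD2l [leRHS](bigD1 c) //= ler_wpDl ?divr_ge0 ?(ltW eps0) //.
    by apply: ler_sum => a ac; rewrite /Rr (negPf ac).
  by rewrite sumr_const card_ord -[_ *+ k]mulr_natr divfK ?gt_eqF // subrK.
pose V := ln k%:R - ln eps.
have V0 : 0 <= V by rewrite /V subr_ge0 ler_ln ?posrE //; apply: le_trans kr; exact: ltW.
have lneps : 0 <= - ln (1 - eps) by rewrite oppr_ge0 ln_le0 // lerBlDr lerDl ltW.
have Rln a c : - ln (Rr a c) <= - ln (1 - eps) + (a != c)%:R * V.
  rewrite /Rr; case: eqP => _ /=; first by rewrite mul0r addr0.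
  by rewrite mul1r ln_div ?posrE // opprB lerDr.
pose Q (v : {ffun 'I_L -> 'I_k}) := \sum_(x <- E) expR (S x) / Z * \prod_(i < L) Rr (v i) (b i x).
have term0 x v : 0 < expR (S x) / Z * \prod_(i < L) Rr (v i) (b i x).
  by rewrite mulr_gt0 ?divr_gt0 ?expR_gt0 //; apply: prodr_gt0.
have Q0 v : 0 < Q v.
  rewrite /Q (big_rem x0) //= ltr_pwDl // sumr_ge0 // => x _; exact: ltW.
have Q1 : \sum_v Q v <= 1.
  rewrite /Q exchange_big /=; apply: le_trans (_ : \sum_(x <- E) expR (S x) / Z <= _); last first.
    by rewrite -mulr_suml mulfV // gt_eqF.
  apply: ler_sum => x _; rewrite -mulr_sumr ler_piMr //; first by rewrite divr_ge0 ?expR_ge0 // ltW.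
  rewrite -(bigA_distr_bigA (fun (i : 'I_L) (a : 'I_k) => Rr a (b i x))) /=.
  by apply: prodr_ile1 => i _; rewrite R1 sumr_ge0 // => a _; exact: ltW.
pose word y : {ffun 'I_L -> 'I_k} := [ffun i => xi (fl i y)].
pose Bw v : set M := [set y | word y = v].
pose bad i y : R := \1_(~` (\bigcup_a K a)) (fl i y).
have point_bound y : - ln (Q (word y)) <= ln Z + L%:R * (kap + - ln (1 - eps))
    + (- 1) * (\sum_(i < L) f (fl i y)) + V * (\sum_(i < L) bad i y).
  have [x xE xy] := HE y.
  have orb i : d (fl i x) (fl i y) < r /\ `|f (fl i x) - f (fl i y)| <= kap.
    pose j := (rev_ord i : nat); have jL : (j < n * m)%N by exact: ltn_ord.
    have E1 z : fl i z = iter (j %% m).+1 F (iter (j %/ m) (iter m F) z).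
      by rewrite /fl -/j -iterM -iterD addSn [(_ %% _ + _)%N]addnC -divn_eq.
    rewrite !E1; apply: He; last exact: ltn_pmod.
    by apply: xy; rewrite ltnW // ltn_divLR.
  have bb i : ((word y) i != b i x)%:R <= bad i y.
    rewrite /bad indicE; have [h|h] := pselect ((\bigcup_a K a) (fl i y)); last first.
      by rewrite mem_set //; case: (_ != _) => /=.
    have [a _ Ka] := h; rewrite memNset; last by move=> nh; exact: nh.
    have [dr _] := orb i.
    suff -> : (word y) i = b i x by rewrite eqxx.
    rewrite ffunE (KE _ _ Ka) /b; case: pickP => [c /asboolP[z Kz xz]|/(_ a)] /=.
      exact: Kr Ka Kz dr xz.
    by move=> /asboolP; case; exists (fl i y).
  have -> : ln Z + L%:R * (kap + - ln (1 - eps)) + -1 * \sum_(i < L) f (fl i y) + V * \sum_(i < L) bad i y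
     = (ln Z - S x) + (\sum_(i < L) (f (fl i x) - f (fl i y) + kap) + \sum_(i < L) (- ln (1 - eps) + bad i y * V)).
    rewrite Srev !big_split /= !sumr_const !card_ord sumrN -mulr_suml mulN1r mulrDr !mulr_natl.
    set X := \sum_(i < L) f (fl i x); set Y := \sum_(i < L) f (fl i y).
    rewrite [V * _]mulrC; ring.
  apply: le_trans (_ : ln Z - S x + \sum_(i < L) - ln (Rr ((word y) i) (b i x)) <= _); last first.
    rewrite lerD2l -[leLHS]add0r; apply: lerD.
      apply: sumr_ge0 => i _; have [_] := orb i; rewrite ler_norml => /andP[h _].
      by rewrite -lerBlDr sub0r.
    apply: ler_sum => i _; apply: le_trans (Rln _ _) _; rewrite lerD2l ler_wpM2r //.
  rewrite sumrN; suff h : S x - ln Z + \sum_(i < L) ln (Rr ((word y) i) (b i x)) <= ln (Q (word y)) by lra.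
  have lnprod (s : seq 'I_L) : ln (\prod_(i <- s) Rr ((word y) i) (b i x)) = \sum_(i <- s) ln (Rr ((word y) i) (b i x)).
    elim: s => [|i s IH]; first by rewrite !big_nil ln1.
    by rewrite !big_cons lnM ?posrE ?IH //; apply: prodr_gt0.
  rewrite -lnprod -[X in X - _](expRK (S x)) -ln_div ?posrE ?expR_gt0 //.
  have P0 : 0 < \prod_(i < L) Rr ((word y) i) (b i x) by apply: prodr_gt0.
  rewrite -lnM ?posrE ?divr_gt0 ?expR_gt0 // ler_ln ?posrE //.
  by rewrite /Q (big_rem x) //= lerDl sumr_ge0 // => z _; exact: ltW.
have cfl i : continuous (fl i) by apply: continuous_iter.
have mBw v : measurable (Bw v : set (borel M)).
  have -> : Bw v = \bigcap_(i in [set: 'I_L]) ((fl i) @^-1` (xi @^-1` [set v i])).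
    apply/seteqP; split=> [y <- i _|y h]; first by rewrite /= ffunE.
    by apply/ffunP => i; rewrite ffunE; exact: (h i I).
  apply: fin_bigcap_measurable; first exact: finite_finset.
  by move=> i _; apply: borel_preimage.
pose p v := fine (mu (Bw v)).
have pE (v : {ffun 'I_L -> 'I_k}) : fine (mu [set x : M | forall i : 'I_L, xi (iter i T x) = v i]) = p v.
  rewrite /p; congr fine.
  have mA : measurable ([set x : M | forall i : 'I_L, xi (iter i T x) = v i] : set (borel M)).
    have -> : [set x : M | forall i : 'I_L, xi (iter i T x) = v i] =
       \bigcap_(i in [set: 'I_L]) ((iter i T) @^-1` (xi @^-1` [set v i])).
      by apply/seteqP; split=> [y h i _|y h i]; [exact: h|exact: (h i I)].
    apply: fin_bigcap_measurable; first exact: finite_finset.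
    by move=> i _; apply: borel_preimage => //; exact: continuous_iter.
  rewrite -(invariant_inverse L mA); congr (mu _).
  have E1 (i : 'I_L) y : iter i T (iter L F y) = fl i y.
    have EL : (i + (rev_ord i).+1 = L)%N by rewrite /= subnSK // subnKC // ltnW.
    have -> : iter L F y = iter i F (fl i y) by rewrite /fl -iterD EL.
    elim: (nat_of_ord i) (fl i y) => [//|q IH] z.
    by rewrite iterSr iterS KF.
  apply/seteqP; split=> y; rewrite /Bw /preimage /=.
    by move=> h; apply/ffunP => i; rewrite ffunE -E1.
  by move=> <- i; rewrite ffunE E1.
have ind_sum (c : {ffun 'I_L -> 'I_k} -> R) y : \sum_v c v * \1_(Bw v) y = c (word y).
  rewrite (bigD1 (word y)) //= indicE mem_set // mulr1 big1 ?addr0 // => v vy.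
  rewrite indicE memNset ?mulr0 // /Bw /= => E1; by rewrite E1 eqxx in vy.
have tB v : tame (\1_(Bw v) : M -> R) by exact: tame_indic.
have mean_word (c : {ffun 'I_L -> 'I_k} -> R) : mean (fun y => c (word y)) mu = \sum_v p v * c v.
  have -> : (fun y => c (word y)) = (fun y => \sum_v c v * \1_(Bw v) y).
    by apply/funext => y; rewrite ind_sum.
  rewrite mean_sum; last by move=> v; exact: tameZ.
  by apply: eq_bigr => v _; rewrite meanZ // mean_indic // mulrC.
have tword (c : {ffun 'I_L -> 'I_k} -> R) : tame (fun y => c (word y)).
  have -> : (fun y => c (word y)) = (fun y => \sum_v c v * \1_(Bw v) y).
    by apply/funext => y; rewrite ind_sum.
  by apply: tame_sum => v; exact: tameZ.
have p1 : \sum_v p v = 1.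
  have := mean_word (fun=> 1); rewrite (mean_cst mu 1) => ->.
  by apply: eq_bigr => v _; rewrite mulr1.
have -> : join_entropy T mu xi L = - \sum_v p v * ln (p v).
  by rewrite /join_entropy; congr (- _); apply: eq_bigr => v _; rewrite /= pE.
apply: le_trans (gibbs_inequality _ Q0 p1 Q1) _.
  by move=> v; rewrite /p fine_ge0.
rewrite -(mean_word (fun v => - ln (Q v))).
have tf : tame f by exact: continuous_tame.
have tfl i : tame (fun y => f (fl i y)) by exact: (tame_comp tf (cfl i)).
have tbad i : tame (bad i) by exact: (tame_comp (tame_indic R mbad) (cfl i)).
have tS : tame (fun y => \sum_(i < L) f (fl i y)) by exact: tame_sum.
have tbs : tame (fun y => \sum_(i < L) bad i y) by exact: tame_sum.
have mfl h i : tame h -> mean (fun y => h (fl i y)) mu = mean h mu.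
  move=> th; apply: (mean_invariant th (cfl i)) => A mA; exact: invariant_inverse.
have t1 := tame_cst M (ln Z + L%:R * (kap + - ln (1 - eps))).
have t2 := tameD t1 (tameZ (-1) tS).
apply: le_trans (le_mean mu (tword (fun v => - ln (Q v))) (tameD t2 (tameZ V tbs)) point_bound) _.
rewrite (meanD _ t2) ?(meanD _ t1) ?mean_cst ?meanZ //; try exact: tameZ.
rewrite !mean_sum //.
under eq_bigr => i _ do rewrite mfl //.
under [X in _ + V * X]eq_bigr => i _ do rewrite (mfl _ _ (tame_indic R mbad)) mean_indic //.
have sc (c : R) : \sum_(i < L) c = L%:R * c by rewrite sumr_const card_ord mulr_natl.
rewrite !sc.
have : L%:R * (V * fine (mu (~` \bigcup_a K a))) <= L%:R * (V * eta).
  by rewrite ler_wpM2l // ler_wpM2l.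
rewrite -/V; set mb := fine _; set lz := ln Z; lra.
Qed.

Lemma uniform_orbit_control (f : M -> R) (m : nat) (r kap : R) : continuous f -> 0 < r -> 0 < kap ->
  exists2 e : R, 0 < e & forall p q s, d p q <= e -> (s <= m)%N ->
    d (iter s F p) (iter s F q) < r /\ `|f (iter s F p) - f (iter s F q)| <= kap.
Proof.
move=> cf r0 kap0.
have [e e0 He] : exists2 e : R, 0 < e & forall p, forall q, d p q < e -> forall s : 'I_m.+1,
    d (iter s F p) (iter s F q) < r /\ `|f (iter s F p) - f (iter s F q)| <= kap.
  apply: Hcpt => x.
  have nx (s : 'I_m.+1) : \forall y \near x, d (iter s F x) (iter s F y) < r / 2 /\
      `|f (iter s F x) - f (iter s F y)| < kap / 2.
    apply: filterI.
      have hc : iter s F y @[y --> x] --> iter s F x by exact: continuous_iter.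
      apply: (hc (fun y => d (iter s F x) y < r / 2)); apply/Hnb; exists (r / 2) => //; exact: divr_gt0.
    have cfs : continuous (f \o iter s F).
      by move=> y; apply: continuous_comp; [exact: continuous_iter|exact: cf].
    by have /cvgrPdist_lt := cfs x; apply; rewrite divr_gt0.
  have hall := @filter_forall _ _ (fun (s : 'I_m.+1) y => d (iter s F x) (iter s F y) < r / 2 /\
      `|f (iter s F x) - f (iter s F y)| < kap / 2) (nbhs x) _ nx.
  have [e e0 He] := (Hnb x _).1 (hall _).
  exists (e / 2) => [|y t xy /andP[t0 te] z yz s]; first by rewrite divr_gt0.
  have xy' : d x y < e by lra.
  have xz' : d x z < e by apply: le_lt_trans (pm_T Hd y _ _) _; lra.
  have [a1 a2] := He y xy' s; have [b1 b2] := He z xz' s.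
  split.
    by apply: le_lt_trans (pm_T Hd (iter s F x) _ _) _; rewrite (pm_C Hd (iter s F y)); lra.
  move: a2 b2; rewrite !ltr_norml ler_norml => /andP[? ?] /andP[? ?]; apply/andP; split; lra.
exists (e / 2) => [|p q s pq sm]; first by rewrite divr_gt0.
have sm' : (s < m.+1)%N by [].
by apply: (He p q _ (Ordinal sm')); lra.
Qed.

Lemma join_entropy_ge0 k (xi : M -> 'I_k) n :
  (forall i, measurable (xi @^-1` [set i] : set (borel M))) -> 0 <= join_entropy T mu xi n.
Proof.
move=> mxi; rewrite /join_entropy oppr_ge0; apply: sumr_le0 => v _ /=.
set A := [set x | _]; have mA : measurable (A : set (borel M)).
  have -> : A = \bigcap_(i in [set: 'I_n]) ((iter i T) @^-1` (xi @^-1` [set v i])).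
    by apply/seteqP; split=> [y h i _|y h i]; [exact: h|exact: (h i I)].
  apply: fin_bigcap_measurable; first exact: finite_finset.
  by move=> i _; apply: borel_preimage => //; exact: continuous_iter.
apply: mulr_ge0_le0; first by rewrite fine_ge0.
apply: ln_le0; have -> : 1 = fine (1%E : \bar R) by [].
by rewrite fine_le ?fin_num_measure // probability_le1.
Qed.

(** It suffices to bound the join entropies along the multiples of [N * m], with arbitrarily small
    loss [del]; the constant [C] disappears after division by the length. *)
Lemma entropy_le (m N : nat) (f : M -> R) (a : R) : continuous f -> (0 < m)%N -> (0 < N)%N ->
  (forall e : R, 0 < e -> exists2 C : R, 0 < C & forall k, (0 < k)%N -> exists2 E : seq M,
    forall z, exists2 x, x \in E & bowen d (iter m F) (k * N) x e z &
    \sum_(x <- E) expR (\sum_(j < k * N * m) f (iter j.+1 F x)) <= C * expR (a * (k * N * m)%:R)) ->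
  (metric_entropy T mu <= (a - mean f mu)%:E)%E.
Proof.
move=> cf m0 N0 HE; set b := a - mean f mu.
apply: ge_ereal_sup => _ [k [xi [mxi ->]]].
apply/lee_addgt0Pr => del2 del20; rewrite -EFinD.
pose del := del2 / 2; have del0 : 0 < del by rewrite divr_gt0.
have d3 : 0 < del / 3 by rewrite divr_gt0.
(* The three losses in [join_entropy_bound], from the oscillation of [f], from - ln (1 - eps), and
   from the visits outside the cores, each take a third of [del]. *)
pose eps := 1 - expR (- (del / 3)).
have eps01 : 0 < eps < 1.
  by rewrite /eps subr_gt0 expR_lt1 oppr_lt0 d3 /= ltrBlDr ltrDl expR_gt0.
have k0 : (0 < k)%N by apply: leq_ltn_trans (ltn_ord (xi point)).
pose V := ln k%:R - ln eps.
have V0 : 0 <= V.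
  have /andP[e0 e1] := eps01.
  rewrite /V subr_ge0 ler_ln ?posrE ?ltr0n //; apply: le_trans (ltW e1) _; by rewrite ler1n.
pose eta := del / 3 / (V + 1); have V1 : 0 < V + 1 by rewrite ltr_wpDl.
have eta0 : 0 < eta by rewrite divr_gt0.
have [K [r [r0 KE Kr mbad bad_eta]]] := closed_cores eta0 mxi.
have [e e0 He] := uniform_orbit_control m cf r0 d3.
have [C C0 HC] := HE e e0.
have main j : (0 < j)%N -> join_entropy T mu xi (j * N * m) <= ln C + (j * N * m)%:R * (b + del).
  move=> j0; have [E spanE sumE] := HC j j0.
  have h := join_entropy_bound cf m0 eps01 mxi KE Kr mbad bad_eta He spanE.
  apply: le_trans h _; rewrite -/V.
  have [x0 x0E _] := spanE point.
  have Z0 : 0 < \sum_(x <- E) expR (\sum_(j < j * N * m) f (iter j.+1 F x)).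
    by rewrite (big_rem x0) //= ltr_pwDl ?expR_gt0 // sumr_ge0 // => x _; exact: expR_ge0.
  have CE0 : 0 < C * expR (a * (j * N * m)%:R) by rewrite mulr_gt0 // expR_gt0.
  rewrite -ler_ln ?posrE // lnM ?posrE ?expR_gt0 // expRK in sumE.
  have l1 : - ln (1 - eps) = del / 3 by rewrite /eps opprB addrC subrK expRK opprK.
  have l2 : eta * V <= del / 3.
    by rewrite /eta mulrAC ler_pdivrMr // ler_pM2l // lerDl.
  rewrite l1; have L0 : 0 <= (j * N * m)%:R :> R by [].
  have := ler_wpM2l L0 l2; move: sumE; rewrite /b; set Lr := (j * N * m)%:R.
  set lz := ln (\sum_(_ <- _) _); set mf := mean f mu; lra.
pose u n := (join_entropy T mu xi n.+1 / n.+1%:R)%:E.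
pose th j := (j.+1 * N * m).-1.
have thE j : (th j).+1 = (j.+1 * N * m)%N by rewrite prednK // !muln_gt0 N0 m0.
have jth j : (j <= th j)%N.
  rewrite -ltnS thE -mulnA; apply: leq_pmulr; by rewrite muln_gt0 N0 m0.
have ev : \forall j \near \oo, (u (th j) <= (b + del2)%:E)%E.
  exists (Num.truncn (`|ln C| / del)) => // j /= Cj.
  rewrite /u lee_fin thE; have L0 : 0 < (j.+1 * N * m)%:R :> R by rewrite ltr0n !muln_gt0 N0 m0.
  rewrite ler_pdivrMr //; apply: le_trans (main j.+1 isT) _.
  rewrite [leRHS]mulrC (_ : b + del2 = (b + del) + del); last by rewrite /del; field.
  rewrite [leRHS]mulrDr addrC lerD2l.
  apply: le_trans (ler_norm _) _; rewrite -ler_pdivrMr //.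
  apply: le_trans (ltW (truncnS_gt _)) _; rewrite ler_nat.
  by apply: leq_trans (_ : j.+1 <= _)%N; [rewrite ltnS|rewrite -thE ltnS].
rewrite /partition_entropy -/u.
have [cu|ncu] := pselect (cvgn u); last first.
  (* A divergent sequence has the default limit 0, which is below the bound because join entropies
     are nonnegative. *)
  rewrite (dvgP ncu); have [j _ /(_ j (leqnn j)) hj] := ev.
  apply: le_trans hj; rewrite lee_fin divr_ge0 //; exact: join_entropy_ge0.
have cth : th j @[j --> \oo] --> \oo.
  by apply/cvgnyPge => A; exists A => // j /= Aj; exact: leq_trans (jth j).
have cuth : (u \o th) j @[j --> \oo] --> limn u by apply: cvg_comp cth cu.
rewrite -(cvg_lim _ cuth) //; apply: lime_le ev.
by apply/cvg_ex; exists (limn u).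
Qed.

End EntropyBound.

Lemma sum_iter_blocks (R : realType) (M : pointedType) (F : M -> M) (phi : M -> R) (m n : nat) (x : M) :
  \sum_(j < n * m) phi (iter j.+1 F x) =
  birkhoff (iter m F) (fun y => \sum_(s < m) phi (iter s.+1 F y)) n x.
Proof.
elim: n => [|n IH]; first by rewrite mul0n /birkhoff !big_ord0.
rewrite mulSn addnC big_split_ord /= IH /birkhoff big_ord_recr /=; congr (_ + _).
by apply: eq_bigr => s _; rewrite -iterM -iterD [(s + _)%N]addnC.
Qed.

Section HighDecay.
Variables (R : realType) (M : ptopologicalType) (mu : probability (borel M) R).
Variables (d : M -> M -> R) (T F : M -> M).
Hypothesis Hnb : forall p (P : M -> Prop), (\forall q \near p, P q) <->
  exists2 e : R, 0 < e & forall q, d p q < e -> P q.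
Hypothesis Hcpt : forall P : R -> M -> Prop,
  (forall x, exists2 e : R, 0 < e & forall y r, d x y < e -> 0 < r < e -> P r y) ->
  exists2 r : R, 0 < r & forall x, P r x.
Hypothesis cM : compact [set: M].
Hypotheses (KT : cancel T F) (KF : cancel F T) (cT : continuous T) (cF : continuous F).
Hypothesis inv : invariant_probability T mu.
Variables (m : nat) (w : nat -> M -> R) (e0 : R) (psi phi : M -> R).
Hypothesis m0 : (0 < m)%N.
Hypothesis W : weighted_system d (iter m F) w e0.
Hypothesis wE : forall n x, w n x = expR (\sum_(j < n * m) psi (iter j.+1 F x)).
Hypotheses (cpsi : continuous psi) (cphi : continuous phi).

Local Notation phiG := (fun y => \sum_(s < m) phi (iter s.+1 F y)).

(** For f = psi + q phi with small q > 0 the sums over separated sets grow at most like the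
    exponential of q c per unit of time. The entropy bound gives h(mu) + mu(psi) + q mu(phi) <= q c,
    and the first two terms cancel. *)
Lemma high_decay_mean (B c e : R) : (forall x, `|phi x| <= B) -> 0 < e -> 2 * e <= e0 ->
  high_decays d (iter m F) w phiG (c * m%:R) e ->
  free_energy T psi mu = 0%E -> mean phi mu <= c.
Proof.
move=> phiB e_gt0 ee0 [N N0 HN] fe.
have B0 : 0 <= B by apply: le_trans (phiB point).
have mr : 0 < m%:R :> R by rewrite ltr0n.
have Nr : 0 < N%:R :> R by rewrite ltr0n.
pose D := (B + `|c|) * (N%:R * m%:R) + 1.
have D0 : 0 < D by rewrite ltr_wpDl // !mulr_ge0 ?addr_ge0.
(* So small that the tilt of the high points, at most the exponential of q (B - c) N m per block, is
   absorbed by their decay by 1/2 per block. *)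
pose q := ln 2 / D; have q0 : 0 < q by rewrite divr_gt0 // ln_gt0 // ltr1n.
pose f x := psi x + q * phi x.
have cf : continuous f.
  move=> x; apply: (@cvgD _ _ _ (nbhs x) _ psi (fun y => q * phi y)); first exact: cpsi.
  by apply: (@cvgM _ _ (nbhs x) _ (cst q) phi); [exact: cvg_cst|exact: cphi].
have Sf n x : \sum_(j < n * m) f (iter j.+1 F x) =
    \sum_(j < n * m) psi (iter j.+1 F x) + q * birkhoff (iter m F) phiG n x.
  by rewrite big_split /= -mulr_sumr (sum_iter_blocks F phi).
have SB n x : birkhoff (iter m F) phiG n x <= B * (n * m)%:R.
  rewrite -sum_iter_blocks; apply: le_trans (_ : \sum_(j < n * m) B <= _).
    by apply: ler_sum => j _; exact: le_trans (ler_norm _) (phiB _).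
  by rewrite sumr_const card_ord -[_ *+ (n * m)]mulr_natr.
have key k : 2^-1 ^+ k * expR (q * (B * (k * N * m)%:R)) <= expR (q * c * (k * N * m)%:R).
  have -> : expR (q * (B * (k * N * m)%:R)) = expR (q * (B - c) * (N * m)%:R) ^+ k * expR (q * c * (k * N * m)%:R).
    rewrite -expRM_natl -expRD; congr expR; rewrite !natrM; ring.
  rewrite mulrA -exprMn ler_piMl ?expR_ge0 // exprn_ile1 // ?mulr_ge0 ?expR_ge0 //.
  rewrite ler_pdivrMl // mulr1 -[leRHS](@lnK R) ?posrE // ler_expR.
  have -> : q * (B - c) * (N * m)%:R = ln 2 * ((B - c) * (N%:R * m%:R) / D).
    by rewrite /q natrM; ring.
  rewrite ler_piMr ?ln_ge0 ?ler1n // ler_pdivrMr // mul1r /D.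
  have NM : 0 <= N%:R * m%:R :> R by rewrite mulr_ge0.
  have : (B - c) * (N%:R * m%:R) <= (B + `|c|) * (N%:R * m%:R).
    by rewrite ler_wpM2r // lerD2l -normrN ler_norm.
  by lra.
have bnd : (metric_entropy T mu <= (q * c - mean f mu)%:E)%E.
  apply: (entropy_le (ws_pm W) Hnb Hcpt cM KT KF cT cF inv (m := m) (N := N)) => // e2 e20.
  pose e1 := Num.min (e2 / 2) (e0 / 4); have E0 := ws_e0 W.
  have e1_gt0 : 0 < e1 by rewrite lt_min !divr_gt0.
  have e1e0 : 4 * e1 <= e0.
    have : e1 <= e0 / 4 by rewrite ge_min lexx orbT.
    lra.
  have e1e2 : 2 * e1 <= e2.
    have : e1 <= e2 / 2 by rewrite ge_min lexx.
    lra.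
  have [C C1 HC] := decay_rescale W (A := fun k x => c * m%:R * (k * N)%:R <= birkhoff (iter m F) phiG (k * N) x)
    e_gt0 e1_gt0 (ltac:(lra) : e + e1 <= e0) HN.
  have [|K HK] := ws_mass W (e1 := e1); first by apply/andP; split; lra.
  have [_ K1 _] := HK.
  exists (K * K + C); first by rewrite ltr_wpDl ?mulr_ge0 ?(le_trans ler01) // (lt_le_trans ltr01).
  move=> k k0; have e10 : 0 < 2 * e1 by rewrite mulr_gt0.
  have [E [sE _ mE]] := separated_exists W (k * N) (fun=> True) e10 (ltac:(lra) : 2 * e1 <= e0).
  exists E.
    by move=> z; have [x xE xz] := mE z I; exists x => //; exact: bowenW xz.
  have -> : \sum_(x <- E) expR (\sum_(j < k * N * m) f (iter j.+1 F x)) =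
     \sum_(x <- E) w (k * N)%N x * expR (q * birkhoff (iter m F) phiG (k * N) x).
    by apply: eq_bigr => x _; rewrite Sf expRD wE.
  rewrite (bigID (fun x => c * m%:R * (k * N)%:R <= birkhoff (iter m F) phiG (k * N) x)) /= addrC mulrDl.
  have w0 := ws_gt0 W; apply: lerD.
    apply: le_trans (_ : \sum_(x <- E | ~~ (c * m%:R * (k * N)%:R <= birkhoff (iter m F) phiG (k * N) x))
       w (k * N)%N x * expR (q * c * (k * N * m)%:R) <= _).
      apply: ler_sum => x; rewrite -ltNge => hx; rewrite ler_wpM2l ?(ltW (w0 _ _)) // ler_expR.
      rewrite -mulrA ler_pM2l //; apply: le_trans (ltW hx) _.
      by rewrite le_eqVlt; apply/orP; left; apply/eqP; rewrite !natrM; ring.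
    rewrite -mulr_suml ler_wpM2r ?expR_ge0 // -big_filter.
    exact: (separated_sum (ws_pm W) HK (sub_separated _ sE)).
  apply: le_trans (_ : \sum_(x <- E | c * m%:R * (k * N)%:R <= birkhoff (iter m F) phiG (k * N) x)
       w (k * N)%N x * expR (q * (B * (k * N * m)%:R)) <= _).
    by apply: ler_sum => x _; rewrite ler_wpM2l ?(ltW (w0 _ _)) // ler_expR ler_pM2l.
  rewrite -mulr_suml -big_filter.
  apply: le_trans (ler_wpM2r (expR_ge0 _) (HC k _ k0 (sub_separated _ sE) _)) _.
    by move=> x; rewrite mem_filter => /andP[].
  have h := ler_wpM2l (le_trans ler01 C1) (key k).
  by rewrite -[X in X <= _]mulrA; exact: h.
have mf : mean f mu = mean psi mu + q * mean phi mu.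
  have tp := continuous_tame cM cphi; have ts := continuous_tame cM cpsi.
  by rewrite (meanD mu ts (tameZ q tp)) meanZ.
move: fe bnd; rewrite /free_energy; case: (metric_entropy T mu) => [r| |] //= [fe].
rewrite lee_fin mf => h; have qq : q * mean phi mu <= q * c by lra.
by rewrite ler_pM2l in qq.
Qed.

End HighDecay.

(** * The rate of contraction along the stable direction *)

Lemma sqrtr_dist_le (R : rcfType) (a b r : R) : 0 <= a -> 0 <= b -> 0 <= r -> `|a - b| <= r ^+ 2 ->
  `|Num.sqrt a - Num.sqrt b| <= r.
Proof.
have key x y : 0 <= x -> 0 <= y -> 0 <= r -> x - y <= r ^+ 2 -> Num.sqrt x <= Num.sqrt y + r.
  move=> x0 y0 r0 xy; have sy := sqrtr_ge0 y.
  rewrite -(@ler_sqr _ (Num.sqrt x)) ?nnegrE ?sqrtr_ge0 ?addr_ge0 // sqrrD !sqr_sqrtr //.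
  have : 0 <= Num.sqrt y * r by rewrite mulr_ge0.
  by rewrite -mulr_natl => h; lra.
move=> a0 b0 r0; rewrite ler_norml => /andP[h1 h2].
have h3 := key a b a0 b0 r0 h2; have h4 := key b a b0 a0 r0 (ltac:(lra)).
by rewrite ler_norml; apply/andP; split; lra.
Qed.

Section RiemannianNormContinuity.
Variables (R : realType) (n : nat) (M : ptopologicalType).
Variables (X : riemannian_manifold R n M).

Lemma rnormZ p a v : rnorm X p (a *: v) = `|a| * rnorm X p v.
Proof.
rewrite /rnorm -scalemxAl -scalemxAl linearZ /= -scalemxAr !mxE mulrA.
by rewrite -expr2 sqrtrM ?sqr_ge0 // sqrtr_sqr.
Qed.

Lemma rnorm_triangle p v w : rnorm X p (v + w) <= rnorm X p v + rnorm X p w.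
Proof.
pose b (x y : 'rV[R]_n) := (x *m gram X p *m y^T) 0 0.
have bC x y : b x y = b y x.
  rewrite /b -[RHS](_ : ((y *m gram X p *m x^T)^T) 0 0 = _); last by rewrite mxE.
  by rewrite !trmx_mul trmxK (gram_sym X) mulmxA.
have bD x y z : b (x + y) z = b x z + b y z by rewrite /b !mulmxDl mxE.
have bZ a x z : b (a *: x) z = a * b x z by rewrite /b -!scalemxAl mxE.
have b0 x : 0 <= b x x.
  have [->|x0] := eqVneq x 0; last by rewrite ltW // gram_pos.
  by rewrite /b !mul0mx mxE.
have cs : b v w ^+ 2 <= b v v * b w w.
  have [w0|w0] := eqVneq w 0.
    have -> : b v w = 0 by rewrite bC w0 /b !mul0mx mxE.
    by rewrite expr0n /= mulr_ge0.
  have Q0 : 0 < b w w by exact: gram_pos.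
  have := b0 (b w w *: v + (- b v w) *: w).
  rewrite bD !bZ ![b _ (_ + _)]bC !bD !bZ (bC w v) => h.
  have : 0 <= b w w * (b w w * b v v - b v w ^+ 2).
    have -> : b w w * (b w w * b v v - b v w ^+ 2) =
       b w w * (b w w * b v v + - b v w * b v w) + - b v w * (b w w * b v w + - b v w * b w w) by ring.
    exact: h.
  by rewrite pmulr_rge0 // subr_ge0 mulrC.
have sv := sqrtr_ge0 (b v v); have sw := sqrtr_ge0 (b w w).
have E x : rnorm X p x = Num.sqrt (b x x) by [].
rewrite !E -(@ler_sqr _ (Num.sqrt (b (v + w) (v + w)))) ?nnegrE ?sqrtr_ge0 ?addr_ge0 //.
rewrite sqrrD !sqr_sqrtr // bD ![b _ (v + w)]bC !bD (bC w v).
have : b v w <= Num.sqrt (b v v) * Num.sqrt (b w w).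
  rewrite -sqrtrM //; apply: le_trans (ler_norm _) _.
  by rewrite -sqrtr_sqr ler_sqrt ?mulr_ge0.
by rewrite -mulr_natl; lra.
Qed.

Variable A : finite_charts X.
Hypothesis cM : compact [set: M].
Local Notation d := (mdist A).
Local Notation lin := (lin A).
Local Notation loc := (loc A).

Definition nu (p : M) (v : 'rV[R]_n) : R := rnorm X p (deconv A p v).

Lemma deconvD p v w : deconv A p (v + w) = deconv A p v + deconv A p w.
Proof. exact: linearD. Qed.

Lemma deconvZ p a v : deconv A p (a *: v) = a *: deconv A p v.
Proof. exact: linearZ. Qed.

Lemma nuZ p a v : nu p (a *: v) = `|a| * nu p v.
Proof. by rewrite /nu -rnormZ deconvZ. Qed.

Lemma nuE : exists2 C : R, 1 <= C & forall p v, C^-1 * `|v| <= nu p v <= C * `|v|.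
Proof.
have [C C1 H] := rnorm_conv_bounds A cM; exists C => // p v.
exact: (eq_ind _ (fun u => C^-1 * `|u| <= nu p v <= C * `|u|) (H p (deconv A p v)) _ (deconvK A p v)).
Qed.

Lemma nu_lip : exists2 C : R, 1 <= C & forall p v w, `|nu p v - nu p w| <= C * `|v - w|.
Proof.
have [C C1 H] := nuE; exists C => // p v w.
have tri x y : nu p x <= nu p y + C * `|x - y|.
  have -> : nu p x = nu p (y + (x - y)) by rewrite addrC subrK.
  rewrite /nu deconvD; apply: le_trans (rnorm_triangle _ _ _) _; rewrite lerD2l.
  by have /andP[] := H p (x - y).
have h1 := tri v w; have h2 := tri w v; rewrite distrC in h2.
by rewrite ler_norml; apply/andP; split; lra.
Qed.

(** The two transition derivatives are taken at different points, so they are inverse to each other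
    only up to an error proportional to the distance. *)
Lemma lin_id_back : exists2 K : R, 1 <= K & forall e x x' v, 0 < e < K^-1 -> d x x' < e ->
  `|lin id x' x (lin id x x' v) - v| <= K * e * `|v|.
Proof.
have [ci [K2 K21 [_ _ di esti]]] := Ck_C11 A cM (Ck_map_id X 2).
have [C C1 [_ locC surC]] := loc_dist A cM.
have K20 : 0 < K2 by lra.
have C0 : 0 < C by lra.
pose K := 3 * K2 + K2 * K2 + 2 * C.
have K22 : 0 < K2 * K2 by rewrite mulr_gt0.
have KK : 3 * K2 + K2 * K2 <= K by rewrite /K; lra.
exists K; first by rewrite /K; lra.
move=> e x x' v /andP[e0 eK] xx'.
have iK (u : R) : 0 < u -> u <= K -> K^-1 <= u^-1.
  by move=> u0 uK; rewrite lef_pV2 ?posrE // /K; lra.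
have [v0|v0] := eqVneq v 0.
  have z1 : lin id x x' v = 0 by rewrite v0; exact: linear0.
  have z2 : lin id x' x (lin id x x' v) = 0.
    by apply: etrans (congr1 _ z1) _; exact: linear0.
  have -> : `|lin id x' x (lin id x x' v) - v| = 0.
    by apply: etrans (congr2 (fun a b => `|a - b|) z2 v0) _; rewrite subrr normr0.
  by rewrite !mulr_ge0 // ltW // /K; lra.
have nv0 : 0 < `|v| by rewrite normr_gt0.
have [e3 e4] : e < (2 * K2)^-1 /\ e < (2 * C)^-1.
  by split; apply: lt_le_trans eK _; apply: iK; rewrite ?mulr_gt0 // /K; lra.
have tE : `|(e / `|v|) *: v| = e.
  by rewrite normrZ ger0_norm ?divfK ?gt_eqF // divr_ge0 // ltW.
have e5 : e < C^-1 by apply: lt_le_trans e4 _; rewrite lef_pV2 ?posrE ?mulr_gt0 //; lra.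
have e6 : e < K2^-1 by apply: lt_le_trans e3 _; rewrite lef_pV2 ?posrE ?mulr_gt0 //; lra.
have e7 : 2 * e < K2^-1 by move: e3; rewrite invfM -ltr_pdivlMl ?invr_gt0 // invrK.
have [|q qE xq] := surC x ((e / `|v|) *: v); first by rewrite tE.
rewrite tE in xq.
have x'q : d x' q <= 2 * e.
  by apply: le_trans (mdist_triangle A x x' q) _; rewrite mdistC; lra.
have dxx y : d y y < K2^-1 by rewrite mdistxx invr_gt0.
have x'x : d x' x < K2^-1 by rewrite mdistC; lra.
have h3 := esti x x' q x (lt_trans xx' e6) (le_lt_trans xq e6) (dxx x).
have h2 := esti x' x q x x'x (le_lt_trans x'q e7) x'x.
have qxE : loc x q - loc x x = (e / `|v|) *: v by rewrite locxx subr0.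
rewrite qxE in h2; rewrite qxE in h3.
have t0 : 0 < e / `|v| by rewrite divr_gt0.
have dd : d x q * d q x <= e * e by rewrite [d q x]mdistC ler_pM ?mdist_ge0.
have b3 : K2 * (d x q + d x x) * d q x <= K2 * (e * e).
  by rewrite mdistxx addr0 -mulrA ler_wpM2l // ltW.
have b2 : K2 * (d x' q + d x' x) * d q x <= K2 * (3 * (e * e)).
  rewrite -mulrA ler_wpM2l ?(ltW K20) //.
  apply: le_trans (_ : (3 * e) * e <= _); last by rewrite mulrA.
  apply: ler_pM; rewrite ?addr_ge0 ?mdist_ge0 //; last by rewrite mdistC.
  by rewrite [d x' x]mdistC; lra.
pose I0 := lin id x x; have II u : I0 u = u by exact: lin_id.
have h1 : `|(e / `|v|) *: v - I0 ((e / `|v|) *: v)| <= 0 by rewrite II subrr normr0.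
have hd := @linear_comp_dist _ _ I0 (lin id x' x) (lin id x x') _ _ v _ _ _ _ K2 t0 (ltW K20) h1
   (le_trans h2 b2) (le_trans h3 b3) (fun u => di x' x u x'x).
have E : `|lin id x' x (lin id x x' v) - v| = `|I0 v - lin id x' x (lin id x x' v)|.
  exact: etrans (distrC _ _) (congr1 (fun u => `|u - lin id x' x (lin id x x' v)|) (esym (II v))).
rewrite [X in X <= _]E; apply: le_trans hd _.
rewrite add0r invf_div.
apply: le_trans (_ : `|v| / e * (K * (e * e)) <= _).
  rewrite ler_wpM2l ?divr_ge0 ?(ltW e0) //.
  have -> : K2 * (3 * (e * e)) + K2 * (K2 * (e * e)) = (3 * K2 + K2 * K2) * (e * e) by ring.
  by rewrite ler_wpM2r ?mulr_ge0 ?(ltW e0).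
by rewrite le_eqVlt; apply/orP; left; apply/eqP; field; rewrite gt_eqF.
Qed.

Lemma nu_chart x x' y : reg (A := A) (idx A x) 2 x' ->
  nu x' y = Num.sqrt (chart_form X (fc (idx A x)) x' (lin id x' x y) (lin id x' x y)).
Proof.
move=> [cx _]; rewrite /nu (rnorm_chart_form _ (fc_atlas (idx A x)) cx).
have E : chart_diff (chart_at X x') (fc (idx A x)) id x' (deconv A x' y) = lin id x' x y.
  apply: chart_diff_trans => //; [exact: fc_atlas|exact: chart_at_atlas|exact: fc_atlas| |].
    exact: idx_dom.
  exact: chart_at_dom.
by congr (Num.sqrt _); exact: (congr2 (chart_form X (fc (idx A x)) x') E E).
Qed.

(** Both norms are read as quadratic forms in the chart of [x], whose finitely many coefficients are
    continuous; carrying [v] to [x'] and back changes it little. *)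
Lemma nu_cts x (eta : R) : 0 < eta -> exists2 e : R, 0 < e & forall x' v, d x x' < e ->
  `|nu x' (lin id x x' v) - nu x v| <= eta * `|v|.
Proof.
move=> eta0; have aux : eta / 2 + eta / 4 <= eta by lra.
have [L L1 HL] := nu_lip; have [K K1 HK] := lin_id_back.
have [C C1 [regC _ _]] := loc_dist A cM.
have L0 : 0 < L by lra.
have K0 : 0 < K by lra.
pose c := fc (idx A x); have cx : cdom c x := idx_dom A x.
pose r := eta / (4 * (n%:R + 1)).
have n1 : 0 < n%:R + 1 :> R by rewrite ltr_wpDl.
have r0 : 0 < r by rewrite divr_gt0 // mulr_gt0.
have r2 : 0 < r ^+ 2 by rewrite exprn_gt0.
have near_form : \forall x' \near x, forall ij : 'I_n * 'I_n,
    `|chart_form X c x' (delta_mx 0 ij.1) (delta_mx 0 ij.2) -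
      chart_form X c x (delta_mx 0 ij.1) (delta_mx 0 ij.2)| < r ^+ 2.
  apply: (@filter_forall _ _ (fun (ij : 'I_n * 'I_n) x' => `|chart_form X c x' (delta_mx 0 ij.1) (delta_mx 0 ij.2) -
      chart_form X c x (delta_mx 0 ij.1) (delta_mx 0 ij.2)| < r ^+ 2) (nbhs x) _) => ij.
  exact: (chart_form_cts _ _ (fc_atlas (idx A x)) cx r2).
have [e1 e10 He1] := (mdist_nbhs A cM x _).1 near_form.
pose e := Num.min (Num.min e1 (C^-1)) (Num.min (K^-1 / 2) (eta / (4 * L * K))).
have e0 : 0 < e by rewrite !lt_min e10 !divr_gt0 ?invr_gt0 ?mulr_gt0 //; lra.
have eK : 0 < e < K^-1.
  rewrite e0 /=; apply: le_lt_trans (_ : K^-1 / 2 < _); first by rewrite !ge_min lexx !orbT.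
  by rewrite ltr_pdivrMr // ltr_pMr ?invr_gt0 // ltr1n.
have eLK : L * (K * e) <= eta / 4.
  have : e <= eta / (4 * L * K) by rewrite !ge_min lexx !orbT.
  rewrite ler_pdivlMr ?mulr_gt0 // => h; rewrite ler_pdivlMr //.
  by apply: le_trans h; rewrite le_eqVlt; apply/orP; left; apply/eqP; ring.
exists e => // x' v xx'; have [xx1 xxC] : d x x' < e1 /\ d x x' < C^-1.
  by move: xx'; rewrite !lt_min => /andP[/andP[-> ->] _].
pose z := lin id x' x (lin id x x' v).
have hz : `|z - v| <= K * e * `|v| by exact: HK.
have Ke1 : K * e <= 1.
  by have /andP[_ h] := eK; rewrite -ler_pdivlMl // mulr1 ltW.
have z2 : `|z| <= 2 * `|v|.
  rewrite -(subrK v z); apply: le_trans (ler_normD _ _) _.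
  rewrite [leRHS]mulr_natl mulr2n lerD2r; apply: le_trans hz _.
  by rewrite ler_piMl.
have E1 : nu x' (lin id x x' v) = Num.sqrt (chart_form X c x' z z) by apply: nu_chart; exact: regC.
have regx : reg (A := A) (idx A x) 2 x by apply: regC; rewrite mdistxx invr_gt0; lra.
have E2 : nu x z = Num.sqrt (chart_form X c x z z).
  by rewrite (nu_chart _ regx); congr Num.sqrt; apply: congr2; exact: lin_id.
have h1 : `|nu x' (lin id x x' v) - nu x z| <= n%:R * r * `|z|.
  rewrite E1 E2; apply: sqrtr_dist_le.
  - have [->|zn0] := eqVneq z 0; last first.
      by apply: ltW; apply: chart_form_gt0 => //; [exact: fc_atlas|have [] := regC _ _ xxC].
    by rewrite chart_form_sum big1 // => i _; rewrite big1 // => j _; rewrite mxE !mul0r.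
  - have [->|zn0] := eqVneq z 0; last by apply: ltW; apply: chart_form_gt0 => //; exact: fc_atlas.
    by rewrite chart_form_sum big1 // => i _; rewrite big1 // => j _; rewrite mxE !mul0r.
  - by rewrite !mulr_ge0 // ltW.
  have -> : (n%:R * r * `|z|) ^+ 2 = n%:R ^+ 2 * r ^+ 2 * `|z| ^+ 2 by ring.
  rewrite !(chart_form_sum X c).
  apply: (quad_dist_le z (a := fun i j => chart_form X c x' (delta_mx 0 i) (delta_mx 0 j))
    (b := fun i j => chart_form X c x (delta_mx 0 i) (delta_mx 0 j))) => i j.
  by apply: ltW; exact: (He1 x' xx1 (i, j)).
have h2 : `|nu x z - nu x v| <= L * (K * e * `|v|).
  by apply: le_trans (HL _ _ _) _; rewrite ler_wpM2l // ltW.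
have nv := normr_ge0 v.
have h3 : n%:R * r * `|z| <= eta / 2 * `|v|.
  apply: le_trans (_ : n%:R * r * (2 * `|v|) <= _); first by rewrite ler_wpM2l // mulr_ge0 // ltW.
  rewrite mulrCA mulrA mulrA; apply: ler_wpM2r => //.
  have -> : eta = r * (4 * (n%:R + 1)) by rewrite /r divfK // gt_eqF // mulr_gt0.
  have : 0 <= r * n%:R by rewrite mulr_ge0 // ltW.
  by clear -r0; lra.
have h4 : L * (K * e * `|v|) <= eta / 4 * `|v| by rewrite mulrA ler_wpM2r.
have -> : nu x' (lin id x x' v) - nu x v = (nu x' (lin id x x' v) - nu x z) + (nu x z - nu x v).
  by rewrite addrA subrK.
apply: le_trans (ler_normD _ _) (le_trans (lerD (le_trans h1 h3) (le_trans h2 h4)) _).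
by rewrite -mulrDl; exact: ler_wpM2r.
Qed.

End RiemannianNormContinuity.

Section AnosovCoordinates.
Variables (R : realType) (n : nat) (M : ptopologicalType).
Variables (X : riemannian_manifold R n M) (A : finite_charts X).
Hypothesis cM : compact [set: M].
Variables (T Tinv : M -> M) (Es Eu : M -> {vspace 'rV[R]_n}).
Hypothesis HT : Ck_diffeomorphism X 2 T Tinv.
Hypothesis HA : anosov_splitting X T Tinv Es Eu.
Hypothesis HM : topologically_mixing T.
Local Notation d := (mdist A).
Local Notation lin := (lin A).

Definition stable (p : M) (v : 'rV[R]_n) : Prop := deconv A p v \in Es p.
Definition unstable (p : M) (v : 'rV[R]_n) : Prop := deconv A p v \in Eu p.

Lemma mdist_ball_open p (r : R) : open [set q | d p q < r].
Proof.
rewrite openE => q /= pq; apply/(mdist_nbhs A cM); exists (r - d p q); first by rewrite subr_gt0.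
by move=> z qz; apply: le_lt_trans (mdist_triangle A q _ _) _; rewrite -ltrBrDl.
Qed.

Lemma mixes_forward : mixes d T.
Proof.
move=> p y r r0; have xx z : d z z < r by rewrite mdistxx.
have [|N HN] := HM (mdist_ball_open p r) (mdist_ball_open y r) _ (ex_intro _ y (xx y)).
  by exists p; exact: xx.
exists N => k Nk; have [z [[q pq <-] yz]] := HN k Nk.
by exists q.
Qed.

Lemma iter_cancel_inv (F Fi : M -> M) k : cancel F Fi -> cancel (iter k F) (iter k Fi).
Proof. by move=> K; elim: k => [//|k IH] x; rewrite iterSr /= K IH. Qed.

Lemma mixes_backward : mixes d Tinv.
Proof.
have [KT _ _ _] := HT.
move=> p y r r0; have xx z : d z z < r by rewrite mdistxx.
have [|N HN] := HM (mdist_ball_open y r) (mdist_ball_open p r) _ (ex_intro _ p (xx p)).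
  by exists y; exact: xx.
exists N => k Nk; have [z [[q yq <-] pz]] := HN k Nk.
by exists (iter k T q) => //; rewrite iter_cancel_inv.
Qed.

Lemma mixes_iter (F : M -> M) m : (0 < m)%N -> mixes d F -> mixes d (iter m F).
Proof.
move=> m0 mF p y r r0; have [N HN] := mF p y r r0; exists N => k Nk.
have [|q pq yq] := HN (k * m)%N; first by apply: leq_trans Nk _; rewrite leq_pmulr.
by exists q => //; rewrite iterM in yq.
Qed.

Lemma lin_deconv (F : M -> M) p v : smooth_map X F ->
  lin F p (F p) v = conv A (F p) (tangent_map X F p (deconv A p v)).
Proof.
move=> sF; exact: (eq_ind _ (fun u => lin F p (F p) u = conv A (F p) (tangent_map X F p (deconv A p v)))
  (lin_conv A p (deconv A p v) sF) _ (deconvK A p v)).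
Qed.

Lemma invariant_step (F Fi : M -> M) (E : M -> {vspace 'rV[R]_n}) : Ck_map X 2 F -> Ck_map X 2 Fi ->
  cancel F Fi -> cancel Fi F ->
  (forall p, tangent_map X F p @` [set` E p] = [set` E (F p)]) ->
  (forall p v, deconv A p v \in E p -> deconv A (F p) (lin F p (F p) v) \in E (F p)) /\
  (forall p v, deconv A p v \in E p -> deconv A (Fi p) (lin Fi p (Fi p) v) \in E (Fi p)).
Proof.
move=> CF CFi KF KFi HE; have sF := Ck_smooth CF.
have fwd p v : deconv A p v \in E p -> deconv A (F p) (lin F p (F p) v) \in E (F p).
  move=> vE; have h : [set` E (F p)] (tangent_map X F p (deconv A p v)) by rewrite -HE; exists (deconv A p v).
  have E1 : lin F p (F p) v = conv A (F p) (tangent_map X F p (deconv A p v)).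
    exact: lin_deconv.
  have E2 : deconv A (F p) (lin F p (F p) v) = tangent_map X F p (deconv A p v).
    exact: etrans (congr1 _ E1) (convK A _ _).
  exact: (eq_ind_r (fun u => u \in E (F p)) h E2).
split=> // p; rewrite -[p]KFi; move: (Fi p) => q {p} v vE.
have : [set` E (F q)] (deconv A (F q) v) by [].
rewrite -HE => -[u uE uv].
have E1 : v = lin F q (F q) (conv A q u).
  apply: etrans (esym (deconvK A (F q) v)) (etrans (congr1 _ (esym uv)) _).
  exact: esym (lin_conv A q u sF).
have E2 := lin_cancel q (conv A q u) (Ck_C11 A cM CF) (Ck_C11 A cM CFi) KF.
have E3 : lin Fi (F q) q v = conv A q u by exact: etrans (congr1 _ E1) E2.
have E4 : deconv A q (lin Fi (F q) q v) = u by exact: etrans (congr1 _ E3) (convK A _ _).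
rewrite KF; exact: (eq_ind_r (fun z => z \in E q) uE E4).
Qed.

Lemma rate_transfer (F : M -> M) (E : M -> {vspace 'rV[R]_n}) (C l : R) : Ck_map X 2 F -> 0 < C ->
  0 < l < 1 ->
  (forall k p v, v \in E p -> rnorm X (iter k F p) (tangent_map X (iter k F) p v) <= C * l ^+ k * rnorm X p v) ->
  exists2 C' : R, 1 <= C' & forall k p v, deconv A p v \in E p ->
    `|lin (iter k F) p (iter k F p) v| <= C' * l ^+ k * `|v|.
Proof.
move=> CF C0 /andP[l0 l1] H; have [D D1 HD] := rnorm_conv_bounds A cM.
have D0 : 0 < D by lra.
exists (D * C * D + 1); first by rewrite lerDr !mulr_ge0 // ltW.
move=> k p v vE; have sF := smooth_iter k (Ck_smooth CF).
have E1 : lin (iter k F) p (iter k F p) v = conv A (iter k F p) (tangent_map X (iter k F) p (deconv A p v)).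
  exact: lin_deconv.
have /andP[h1 _] := HD (iter k F p) (tangent_map X (iter k F) p (deconv A p v)).
have h2 := H k p _ vE; have /andP[_ h3] := HD p (deconv A p v).
have h3' : rnorm X p (deconv A p v) <= D * `|v|.
  exact: (eq_ind _ (fun u => rnorm X p (deconv A p v) <= D * `|u|) h3 _ (deconvK A p v)).
rewrite [X in `|X| <= _]E1; have := le_trans h1 h2; rewrite ler_pdivrMl // => h4.
apply: le_trans h4 _.
have lk : 0 <= C * l ^+ k by rewrite mulr_ge0 ?exprn_ge0 // ltW.
have h5 := ler_wpM2l (ltW D0) (ler_wpM2l lk h3'); apply: le_trans h5 _.
have -> : D * (C * l ^+ k * (D * `|v|)) = D * C * D * (l ^+ k * `|v|) by ring.
rewrite -[leRHS]mulrA; apply: ler_wpM2r; last by rewrite lerDl.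
by rewrite mulr_ge0 // exprn_ge0 // ltW.
Qed.

Lemma anosov_hyp_splitting : hyp_splitting A T Tinv stable unstable.
Proof.
have [KT KF CT CF] := HT; have [dec HEs HEu [C [l [C0 l01 rs ru]]]] := HA.
have [s1 s2] := invariant_step CT CF KT KF HEs.
have [u1 u2] := invariant_step CT CF KT KF HEu.
have [Cs Cs1 hs] := rate_transfer CT C0 l01 rs.
have [Cu Cu1 hu] := rate_transfer CF C0 l01 ru.
have lc (E : M -> {vspace 'rV[R]_n}) p a v w : deconv A p v \in E p -> deconv A p w \in E p ->
    deconv A p (a *: v + w) \in E p.
  move=> vE wE; have E1 : deconv A p (a *: v + w) = a *: deconv A p v + deconv A p w by exact: linearP.
  by apply: (eq_ind_r (fun z => z \in E p) _ E1); rewrite memvD // memvZ.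
have dE p (u : 'rV[R]_n) (E : {vspace 'rV[R]_n}) : u \in E -> deconv A p (conv A p u) \in E.
  by move=> uE; exact: (eq_ind_r (fun z => z \in E) uE (convK A p u)).
split=> //.
- exact: Ck_C11.
- exact: Ck_C11.
- by move=> p a v w; exact: lc.
- by move=> p a v w; exact: lc.
- move=> p v; have [full _] := dec p.
  have : deconv A p v \in (Es p + Eu p)%VS by rewrite full memvf.
  move=> /memv_addP[s sE [u uE suE]].
  exists (conv A p s), (conv A p u); split; [exact: dE|exact: dE|].
  have E1 : conv A p (s + u) = conv A p s + conv A p u by exact: linearD.
  exact: etrans (esym (deconvK A p v)) (etrans (congr1 _ suE) E1).
- move=> p v vS vU; have [_ cap] := dec p.
  have : deconv A p v \in (Es p :&: Eu p)%VS by rewrite memv_cap vS vU.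
  rewrite cap memv0 => /eqP E1.
  have E2 : conv A p 0 = 0 by exact: linear0.
  exact: etrans (esym (deconvK A p v)) (etrans (congr1 _ E1) E2).
- exists (Num.max Cs Cu), l; split=> //.
  + by rewrite le_max Cs1.
  + move=> k p v vE; apply: le_trans (hs k p v vE) _.
    have /andP[l0 _] := l01.
    by rewrite !ler_wpM2r ?exprn_ge0 ?(ltW l0) // le_max lexx.
  + move=> k p v vE; apply: le_trans (hu k p v vE) _.
    have /andP[l0 _] := l01.
    by rewrite !ler_wpM2r ?exprn_ge0 ?(ltW l0) // le_max lexx orbT.
Qed.

Hypothesis n0 : (0 < n)%N.

(** Both subspaces are nonzero because, by mixing, neither [T] nor its inverse contracts a
    neighbourhood along an orbit. The unit vectors are chosen pointwise, with no continuity. *)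
Lemma unit_frames : exists eS eU : M -> 'rV[R]_n,
  [/\ forall p, stable p (eS p), forall p, unstable p (eU p),
      forall p, nu A p (eS p) = 1 & forall p, nu A p (eU p) = 1].
Proof.
have H := anosov_hyp_splitting.
have [C C1 HC] := nuE A cM; have C0 : 0 < C by lra.
have norm1 (S : M -> 'rV[R]_n -> Prop) : (forall p a v, S p v -> S p (a *: v)) ->
    (forall p, exists2 v, S p v & v != 0) -> exists e : M -> 'rV[R]_n, forall p, S p (e p) /\ nu A p (e p) = 1.
  move=> SZ nt; suff /choice[e he] : forall p, exists e : 'rV[R]_n, S p e /\ nu A p e = 1 by exists e.
  move=> p; have [v Sv v0] := nt p; exists ((nu A p v)^-1 *: v); split; first exact: SZ.
  have nv0 : 0 < nu A p v.
    by have /andP[h _] := HC p v; apply: lt_le_trans h; rewrite mulr_gt0 ?invr_gt0 ?normr_gt0.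
  by rewrite nuZ ger0_norm ?invr_ge0 ?(ltW nv0) // mulVf // gt_eqF.
have [eS heS] := norm1 stable (fun p a v Sv => hs_SZ H a Sv) (stable_nontrivial cM n0 H mixes_backward).
have H' := hyp_splitting_sym H.
have [eU heU] := norm1 unstable (fun p a v Sv => hs_SZ H' a Sv) (stable_nontrivial cM n0 H' mixes_forward).
by exists eS, eU; split=> p; [case: (heS p)|case: (heU p)|case: (heS p)|case: (heU p)].
Qed.

End AnosovCoordinates.

Section StableRate.
Variables (R : realType) (M : ptopologicalType).
Variables (X : riemannian_manifold R 2 M) (A : finite_charts X).
Hypothesis cM : compact [set: M].
Variables (T Tinv : M -> M) (Es Eu : M -> {vspace 'rV[R]_2}).
Hypothesis HT : Ck_diffeomorphism X 2 T Tinv.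
Hypothesis HA : anosov_splitting X T Tinv Es Eu.
Variables (eS eU : M -> 'rV[R]_2).
Hypothesis SeS : forall p, stable A Es p (eS p).
Hypothesis UeU : forall p, unstable A Eu p (eU p).
Hypothesis nuS : forall p, nu A p (eS p) = 1.
Hypothesis nuU : forall p, nu A p (eU p) = 1.
Local Notation d := (mdist A).
Local Notation lin := (lin A).
Local Notation rho := (norm_dT_on X T Es).
Let H := anosov_hyp_splitting A cM HT HA.

Lemma stable_line p v : stable A Es p v -> exists a : R, v = a *: eS p.
Proof.
have [C C1 HC] := nuE A cM => Sv; eexists.
exact: (frame_S H C1 HC SeS UeU nuS nuU Sv).
Qed.

Lemma nu_tangent p v : nu A (T p) (lin T p (T p) v) = rnorm X (T p) (tangent_map X T p (deconv A p v)).
Proof.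
have [_ _ CT _] := HT; have sT := Ck_smooth CT.
have E2 : deconv A (T p) (lin T p (T p) v) = tangent_map X T p (deconv A p v).
  have E1 := lin_deconv A p v sT.
  exact: etrans (congr1 (fun u => deconv A (T p) u) E1) (convK A (T p) (tangent_map X T p (deconv A p v))).
exact: (congr1 (fun u => rnorm X (T p) u) E2).
Qed.

Lemma nu_linZ p a : nu A (T p) (lin T p (T p) (a *: eS p)) = `|a| * nu A (T p) (lin T p (T p) (eS p)).
Proof.
have E : lin T p (T p) (a *: eS p) = a *: lin T p (T p) (eS p) by exact: linearZ.
exact: etrans (congr1 (fun u => nu A (T p) u) E) (nuZ A (T p) a (lin T p (T p) (eS p))).
Qed.

(** The stable space is a line, so the supremum is attained at its unit vector. *)
Lemma rho_frame p : rho p = nu A (T p) (lin T p (T p) (eS p)).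
Proof.
set r := nu A (T p) _; have r0 : 0 <= r by exact: sqrtr_ge0.
apply/eqP; rewrite eq_le; apply/andP; split.
  apply: ge_sup.
    exists (rnorm X (T p) (tangent_map X T p (deconv A p (eS p)))), (deconv A p (eS p)) => //=.
    by split; [exact: SeS|have := nuS p; rewrite /nu => ->].
  move=> _ [v [vE v1] <-].
  have vS : stable A Es p (conv A p v) by exact: (eq_ind_r (fun z => z \in Es p) vE (convK A p v)).
  have [a aE] := stable_line vS.
  have E1 : rnorm X (T p) (tangent_map X T p v) = nu A (T p) (lin T p (T p) (conv A p v)).
    apply: esym; apply: etrans (nu_tangent p (conv A p v)) _.
    exact: (congr1 (fun u => rnorm X (T p) (tangent_map X T p u)) (convK A p v)).
  have E2 : nu A (T p) (lin T p (T p) (conv A p v)) = `|a| * r.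
    exact: etrans (congr1 (fun u => nu A (T p) (lin T p (T p) u)) aE) (nu_linZ p a).
  have E3 : `|a| = rnorm X p v.
    apply: etrans (_ : nu A p (conv A p v) = _); last first.
      exact: (congr1 (fun u => rnorm X p u) (convK A p v)).
    by rewrite aE nuZ nuS mulr1.
  rewrite [X in X <= _](etrans E1 E2) E3 ler_piMl //.
have E0 := nu_tangent p (eS p).
apply: ub_le_sup.
  exists r => _ [v [vE v1] <-].
  have vS : stable A Es p (conv A p v) by exact: (eq_ind_r (fun z => z \in Es p) vE (convK A p v)).
  have [a aE] := stable_line vS.
  have E1 : rnorm X (T p) (tangent_map X T p v) = nu A (T p) (lin T p (T p) (conv A p v)).
    apply: esym; apply: etrans (nu_tangent p (conv A p v)) _.
    exact: (congr1 (fun u => rnorm X (T p) (tangent_map X T p u)) (convK A p v)).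
  have E2 : nu A (T p) (lin T p (T p) (conv A p v)) = `|a| * r.
    exact: etrans (congr1 (fun u => nu A (T p) (lin T p (T p) u)) aE) (nu_linZ p a).
  have E3 : `|a| = rnorm X p v.
    apply: etrans (_ : nu A p (conv A p v) = _); last first.
      exact: (congr1 (fun u => rnorm X p u) (convK A p v)).
    by rewrite aE nuZ nuS mulr1.
  by rewrite [X in X <= _](etrans E1 E2) E3 ler_piMl.
exists (deconv A p (eS p)); last exact: esym E0.
by split; [exact: SeS|have := nuS p; rewrite /nu => ->].
Qed.

Lemma rho_step p v : stable A Es p v -> nu A (T p) (lin T p (T p) v) = rho p * nu A p v.
Proof.
move=> /stable_line[a ->]; rewrite nuZ nuS mulr1 rho_frame mulrC; exact: nu_linZ.
Qed.

Lemma rho_gt0 p : 0 < rho p.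
Proof.
have [C C1 HC] := nuE A cM; have C0 : 0 < C by lra.
have r0 : 0 <= rho p by rewrite rho_frame; exact: sqrtr_ge0.
rewrite lt_neqAle r0 andbT; apply/negP => /eqP rp.
have /andP[h _] := HC (T p) (lin T p (T p) (eS p)).
rewrite -rho_frame -rp pmulr_rle0 ?invr_gt0 // normr_le0 in h.
have z : lin T p (T p) (eS p) = 0 by apply/eqP.
have [KT _ CT CF] := HT.
have z2 := lin_cancel p (eS p) (Ck_C11 A cM CT) (Ck_C11 A cM CF) KT.
have z3 : eS p = 0.
  have l0 : lin Tinv (T p) p 0 = 0 by exact: linear0.
  by apply: etrans (esym z2) (etrans (congr1 (fun u => lin Tinv (T p) p u) z) l0).
have := nuS p; rewrite z3 -(scale0r 0) nuZ normr0 mul0r => /eqP.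
by rewrite eq_sym oner_eq0.
Qed.

Lemma nu_backward q v : stable A Es q v ->
  nu A (Tinv q) (lin Tinv q (Tinv q) v) = (rho (Tinv q))^-1 * nu A q v.
Proof.
have [KT KF CT CF] := HT; move=> Sv.
have S' := hs_SFi H Sv.
have h := rho_step S'; apply: (@mulfI _ (rho (Tinv q))); first by rewrite gt_eqF // rho_gt0.
rewrite mulVKf ?gt_eqF ?rho_gt0 // -h.
have z := lin_cancel q v (Ck_C11 A cM CF) (Ck_C11 A cM CT) KF.
by rewrite KF; exact: (congr1 (fun u => nu A q u) z).
Qed.

Lemma frame_rate_prod m p : frame_rate A Tinv (nu A) eS m p = \prod_(j < m) (rho (iter j.+1 Tinv p))^-1.
Proof.
have [KT KF CT CF] := HT; rewrite /frame_rate.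
elim: m => [|m IH]; first by rewrite big_ord0 /= -[RHS](nuS p); exact: (congr1 (fun u => nu A p u) (lin_id A p (eS p))).
rewrite big_ord_recr /= -IH mulrC.
have E := lin_iterS cM m p (eS p) (Ck_C11 A cM CF).
apply: etrans (congr1 (fun u => nu A (iter m.+1 Tinv p) u) E) _.
apply: nu_backward; exact: (hs_U_iter cM (hyp_splitting_sym H) m (SeS p)).
Qed.

(** The frame [eS] need not be continuous. Instead [eS x] is carried to [x'] and projected to the
    stable line there; continuity of the splitting makes the discarded part small, so the projection
    has norm near 1 and is stretched nearly as [eS x] is. *)
Lemma rho_cts : continuous rho.
Proof.
have [KT KF CT CF] := HT; have C11T := Ck_C11 A cM CT.
have [C C1 HC] := nuE A cM; have C0 : 0 < C by lra.
have [L L1 HL] := nu_lip A cM; have L0 : 0 < L by lra.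
have [K K1 HK] := lin_bound C11T; have K0 : 0 < K by lra.
have [K' K'1 hnear] := lin_near cM C11T; have K'0 : 0 < K' by lra.
have [ef ef0 hfac] := lin_factor cM C11T.
have [cT [KL KL1 [lipT _ _ _]]] := C11T; have KL0 : 0 < KL by lra.
have bS p : `|eS p| <= C.
  by have /andP[h _] := HC p (eS p); rewrite nuS ler_pdivrMl // mulr1 in h.
have rhoB p : rho p <= C * (K * C).
  rewrite rho_frame; have /andP[_ h] := HC (T p) (lin T p (T p) (eS p)); apply: le_trans h _.
  rewrite ler_wpM2l ?(ltW C0) //; apply: le_trans (HK _ _ _ _) _; first by rewrite mdistxx invr_gt0.
  by rewrite ler_wpM2l // ltW.
have KC0 : 0 < K * C by rewrite mulr_gt0.
move=> x; apply/cvgrPdist_lt => eps eps0.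
pose Z := C * (K * C) * (C + L * C) + L * (K * C) + K' * C * L + K * C + 1.
have Z0 : 0 < Z by rewrite /Z; pos.
pose eta := eps / (2 * Z); have eta0 : 0 < eta by rewrite divr_gt0 // mulr_gt0.
have etaZ : eta * Z < eps.
  have -> : eta * Z = eps / 2 by rewrite /eta; field; rewrite gt_eqF.
  by lra.
have [e1 e10 h1] := splitting_cts cM H eta0.
have [e2 e20 h2] := nu_cts A cM x eta0.
have [e3 e30 h3] := nu_cts A cM (T x) eta0.
pose e := Num.min (Num.min e1 e2) (Num.min (Num.min (e3 / KL) (ef / KL)) (Num.min eta (K'^-1 / 2))).
have e0 : 0 < e by rewrite !lt_min e10 e20 eta0 !divr_gt0 ?invr_gt0.
apply/(mdist_nbhs A cM); exists e => // x' xx'.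
have [x1 x2 x3 x4] : [/\ d x x' < e1, d x x' < e2, d x x' < e3 / KL & d x x' < ef / KL].
  by move: xx'; rewrite !lt_min => /andP[/andP[? ?] /andP[/andP[? ?] _]].
have eK : 0 < e < K'^-1.
  rewrite e0 /=; apply: le_lt_trans (_ : K'^-1 / 2 < _); first by rewrite !ge_min lexx !orbT.
  by rewrite ltr_pdivrMr // ltr_pMr ?invr_gt0 // ltr1n.
have ee : e <= eta by rewrite !ge_min lexx !orbT.
have TT : d (T x) (T x') <= KL * d x x' by exact: lipT.
have T3 : d (T x) (T x') < e3 by apply: le_lt_trans TT _; rewrite mulrC -ltr_pdivlMr.
have Tf : d (T x) (T x') < ef by apply: le_lt_trans TT _; rewrite mulrC -ltr_pdivlMr.
pose y := lin id x x' (eS x).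
have [s [u [Ss Uu yE]]] := hs_dec H x' y.
have ub : `|u| <= eta * `|eS x| by apply: (h1 x x' (eS x) s u).
have ub' : `|u| <= eta * C by apply: le_trans ub _; rewrite ler_wpM2l // ltW.
have ny : `|nu A x' y - 1| <= eta * C.
  by rewrite -(nuS x); apply: le_trans (h2 x' (eS x) x2) _; rewrite ler_wpM2l // ltW.
have ns : `|nu A x' s - 1| <= eta * C + L * (eta * C).
  have -> : nu A x' s - 1 = (nu A x' y - 1) + (nu A x' s - nu A x' y) by ring.
  apply: le_trans (ler_normD _ _) (lerD ny _); apply: le_trans (HL _ _ _) _.
  by rewrite ler_wpM2l ?(ltW L0) // yE opprD addrA subrr sub0r normrN.
have E1 : nu A (T x') (lin T x' (T x') s) = rho x' * nu A x' s by exact: rho_step.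
have dTT : d (T x') (T x') < K^-1 by rewrite mdistxx invr_gt0.
have Eu1 : lin T x' (T x') s = lin T x' (T x') y - lin T x' (T x') u.
  apply: etrans (congr1 (fun z => lin T x' (T x') z) (_ : s = y - u)) _; first by rewrite yE addrK.
  exact: linearB.
have n1 : `|nu A (T x') (lin T x' (T x') s) - nu A (T x') (lin T x' (T x') y)| <= L * (K * (eta * C)).
  apply: le_trans (HL _ _ _) _; rewrite ler_wpM2l ?(ltW L0) //.
  have E : `|lin T x' (T x') s - lin T x' (T x') y| = `|lin T x' (T x') u|.
    apply: etrans (congr1 (fun z => `|z - lin T x' (T x') y|) Eu1) _.
    by rewrite addrAC subrr sub0r normrN.
  rewrite [X in X <= _]E; apply: le_trans (HK _ _ _ dTT) _; by rewrite ler_wpM2l // ltW.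
have n2 : `|nu A (T x') (lin T x (T x') (eS x)) - nu A (T x') (lin T x' (T x') y)| <= L * (K' * eta * C).
  apply: le_trans (HL _ _ _) _; rewrite ler_wpM2l ?(ltW L0) //.
  apply: le_trans (hnear e x x' (eS x) eK xx') _.
  by apply: ler_pM => //; rewrite ?mulr_ge0 ?(ltW e0) ?(ltW K'0) // ler_wpM2l // ltW.
have n3 : `|nu A (T x') (lin T x (T x') (eS x)) - rho x| <= eta * (K * C).
  have E := hfac x (T x') (eS x) Tf.
  have E' : nu A (T x') (lin T x (T x') (eS x)) = nu A (T x') (lin id (T x) (T x') (lin T x (T x) (eS x))).
    exact: (congr1 (fun z => nu A (T x') z) E).
  rewrite [X in `|X - _|]E' rho_frame; apply: le_trans (h3 _ _ T3) _.
  rewrite ler_wpM2l ?(ltW eta0) //; apply: le_trans (HK _ _ _ _) _; first by rewrite mdistxx invr_gt0.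
  by rewrite ler_wpM2l // ltW.
rewrite E1 in n1; move: n1 n2 n3 ns (rhoB x') (rho_gt0 x') etaZ.
set a := nu A (T x') _; set b := nu A (T x') _; set c := nu A x' s.
set rx := rho x; set rx' := rho x'; move=> n1 n2 n3 n4 rB r0 hZ.
apply: le_lt_trans hZ.
have -> : rx - rx' = (rx - b) + (b - a) + (a - rx' * c) + rx' * (c - 1) by ring.
have m4 : `|rx' * (c - 1)| <= C * (K * C) * (eta * C + L * (eta * C)).
  by rewrite normrM gtr0_norm // ler_pM // ltW.
rewrite distrC in n1; rewrite distrC in n3.
apply: le_trans (ler_normD _ _) (le_trans (lerD (le_trans (ler_normD _ _) (lerD (le_trans (ler_normD _ _) (lerD n3 n2)) n1)) m4) _).
rewrite /Z; have -> : eta * (K * C) + L * (K' * eta * C) + L * (K * (eta * C)) + C * (K * C) * (eta * C + L * (eta * C))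
  = eta * (C * (K * C) * (C + L * C) + L * (K * C) + K' * C * L + K * C) by ring.
by rewrite ler_wpM2l ?(ltW eta0) // lerDl.
Qed.

(** Identifies the area weights with exponentials of Birkhoff sums of ln of the stable norm, the
    potential in the definition of the SRB measure of the inverse. *)
Lemma wgt_psi m n x : wgt (iter m Tinv) (frame_rate A Tinv (nu A) eS m) n x =
  expR (\sum_(j < n * m) ln (rho (iter j.+1 Tinv x))).
Proof.
rewrite (sum_iter_blocks Tinv (fun y => ln (rho y))) /birkhoff expR_sum; apply: eq_bigr => i _.
rewrite frame_rate_prod expR_sum -prodfV; apply: eq_bigr => j _.
by rewrite invrK lnK // posrE rho_gt0.
Qed.

End StableRate.

(** * The Riemannian distance *)

(** Continuous induction: the supremum of the times up to which the inequality holds with slack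
    [e * t] satisfies it and cannot be less than 1. *)
Lemma dini_le (R : realType) (D Psi : R -> R) :
  (forall t, 0 <= t <= 1 -> forall e : R, 0 < e -> exists2 del : R, 0 < del &
    forall s, `|s - t| < del -> `|D s - D t| <= `|Psi s - Psi t| + e * `|s - t|) ->
  (forall s t, s <= t -> Psi s <= Psi t) -> D 1 - D 0 <= Psi 1 - Psi 0.
Proof.
move=> H mono; apply/ler_addgt0Pr => e e0.
pose S := [set t : R | 0 <= t <= 1 /\ D t - D 0 <= Psi t - Psi 0 + e * t].
have S0 : S 0 by split; [rewrite lexx ler01|rewrite !subrr mulr0 addr0].
have ubS : ubound S 1 by move=> t [/andP[_ ?] _].
have hsS : has_sup S by split; [exists 0|exists 1].
pose tau := sup S.
have tau0 : 0 <= tau by apply: ub_le_sup => //; exists 1.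
have tau1 : tau <= 1 by apply: ge_sup => //; exists 0.
have [|del del0 Hd] := H tau _ e e0; first by rewrite tau0.
have step s t : s <= t -> `|D s - D t| <= `|Psi s - Psi t| + e * `|s - t| ->
    D s - D 0 <= Psi s - Psi 0 + e * s -> D t - D 0 <= Psi t - Psi 0 + e * t.
  move=> st h1 h2; have h3 := mono _ _ st.
  rewrite distrC [`|Psi s - _|]distrC [`|s - t|]distrC in h1.
  rewrite (ger0_norm (_ : 0 <= Psi t - Psi s)) ?subr_ge0 // (ger0_norm (_ : 0 <= t - s)) ?subr_ge0 // in h1.
  have := le_trans (ler_norm _) h1; lra.
have Stau : S tau.
  split; first by rewrite tau0.
  have [s Ss st] := sup_adherent del0 hsS.
  have sS : s <= tau by apply: ub_le_sup => //; exists 1.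
  have [_ h] := Ss; apply: (step s) => //; apply: Hd.
  by rewrite ler0_norm ?subr_le0 // opprB ltrBlDl -ltrBlDr.
suff t1 : tau = 1 by have [_ h] := Stau; rewrite t1 mulr1 in h.
apply/eqP; rewrite eq_le tau1 leNgt; apply/negP => lt1.
pose s := Num.min 1 (tau + del / 2).
have ts : tau < s by rewrite lt_min lt1 ltrDl divr_gt0.
have : s <= tau; last by rewrite leNgt ts.
apply: ub_le_sup; first by exists 1.
split; first by rewrite (le_trans tau0 (ltW ts)) ge_min lexx.
have [_ h] := Stau; apply: (step tau) h; first exact: ltW.
rewrite distrC [`|Psi tau - _|]distrC [`|tau - s|]distrC; apply: Hd.
rewrite gtr0_norm ?subr_gt0 // ltrBlDl; apply: le_lt_trans (_ : tau + del / 2 < _).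
  by rewrite ge_min lexx orbT.
by rewrite ltrD2l ltr_pdivrMr // ltr_pMr // ltr1n.
Qed.

Lemma continuous_at_sum (R : realType) (T : topologicalType) (I : Type) (r : seq I)
    (F : I -> T -> R) (x : T) : (forall i, {for x, continuous (F i)}) ->
  {for x, continuous (fun y => \sum_(i <- r) F i y)}.
Proof.
move=> cF; elim: r => [|i r IH].
  by rewrite (_ : (fun y => _) = cst 0); [exact: cvg_cst|apply/funext => y; rewrite big_nil].
rewrite (_ : (fun y => _) = (fun y => F i y + \sum_(j <- r) F j y)).
  by apply: (@cvgD _ _ _ (nbhs x) _ (F i)); [exact: cF|exact: IH].
by apply/funext => y; rewrite big_cons.
Qed.

Section RiemannianDistance.
Variables (R : realType) (n : nat) (M : ptopologicalType).
Variables (X : riemannian_manifold R n M) (A : finite_charts X).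
Hypothesis cM : compact [set: M].
Local Notation d := (mdist A).
Local Notation mu := (@lebesgue_measure R).

Lemma curve_diff (a : R -> M) c c' s : C1_curve X a -> atlas X c -> atlas X c' ->
  cdom c (a s) -> cdom c' (a s) ->
  'D_1 (cfun c' \o a : R -> 'rV[R]_n) s = chart_diff c c' id (a s) ('D_1 (cfun c \o a : R -> 'rV[R]_n) s).
Proof.
move=> [ca Ca] ac ac' cas c'as; have hc := atlas_chart ac.
have [dc _] := Ca c ac; have {}dc := dc s cas.
have [dc' _] := Ca c' ac'; have {}dc' := dc' s c'as.
have [_ di] := Ck_smooth (Ck_map_id X 2).
have dtr : differentiable (cfun c' \o id \o cinv c) ((cfun c \o a : R -> 'rV[R]_n) s) by exact: (di _ _ _ ac ac' cas c'as).
have dcomp := differentiable_comp dc dtr.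
have nearE : \forall y \near s, ((cfun c' \o id \o cinv c) \o (cfun c \o a)) y = (cfun c' \o a) y.
  have : \forall y \near s, cdom c (a y).
    by apply: (ca s); apply: open_nbhs_nbhs; split=> //; exact: chart_dom_open hc.
  by apply: filterS => y cy /=; have [_ ->] := chart_domK hc cy.
have [d1 E1] := near_eq_diff nearE dcomp.
have E2 := diff_comp dc dtr.
apply: etrans (deriveE _ dc') (etrans (congr1 (fun L => L 1) E1) (etrans (congr1 (fun L => L 1) E2) _)).
exact: (congr1 (fun u => chart_diff c c' id (a s) u) (esym (deriveE _ dc))).
Qed.

Lemma speed_chart (a : R -> M) c s : C1_curve X a -> atlas X c -> cdom c (a s) ->
  speed X a s = Num.sqrt (chart_form X c (a s) ('D_1 (cfun c \o a : R -> 'rV[R]_n) s)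
     ('D_1 (cfun c \o a : R -> 'rV[R]_n) s)).
Proof.
move=> Ha ac cas; rewrite /speed (rnorm_chart_form _ ac cas).
have E := curve_diff Ha (chart_at_atlas X (a s)) ac (chart_at_dom X (a s)) cas.
congr Num.sqrt; exact: (congr2 (chart_form X c (a s)) (esym E) (esym E)).
Qed.

(** [speed] is defined with the preferred chart at each point of the curve, an erratic choice. Near
    a given time it is rewritten in one fixed chart, where every ingredient is continuous. *)
Lemma speed_cts (a : R -> M) : C1_curve X a -> continuous (speed X a).
Proof.
move=> Ha t; have [ca Ca] := Ha.
pose c := fc (idx A (a t)); have ac : atlas X c := fc_atlas (idx A (a t)).
have hc := atlas_chart ac; have cat : cdom c (a t) := idx_dom A (a t).
pose w s := 'D_1 (cfun c \o a : R -> 'rV[R]_n) s.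
pose f s := Num.sqrt (\sum_i \sum_j w s 0 i * w s 0 j * chart_form X c (a s) (delta_mx 0 i) (delta_mx 0 j)).
have nearE : \forall s \near t, speed X a s = f s.
  have : \forall y \near t, cdom c (a y).
    by apply: (ca t); apply: open_nbhs_nbhs; split=> //; exact: chart_dom_open hc.
  by apply: filterS => s cs; rewrite (speed_chart Ha ac cs) chart_form_sum.
have cw i : {for t, continuous (fun s => w s 0 i)}.
  have [_ /(_ 1) h] := Ca c ac; have {}h := h t cat.
  by apply: (@continuous_comp _ _ _ w (fun v : 'rV[R]_n => v 0 i)); [exact: h|exact: coord_continuous].
have cphi i j : {for t, continuous (fun s => chart_form X c (a s) (delta_mx 0 i) (delta_mx 0 j))}.
  apply/cvgrPdist_lt => e e0.
  have h := chart_form_cts (delta_mx 0 i) (delta_mx 0 j) ac cat e0.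
  have h2 : \forall s \near t, `|chart_form X c (a s) (delta_mx 0 i) (delta_mx 0 j) -
     chart_form X c (a t) (delta_mx 0 i) (delta_mx 0 j)| < e := ca t _ h.
  have sym (F : R -> R) : (\forall s \near t, `|F s - F t| < e) -> \forall s \near t, `|F t - F s| < e.
    by apply: filterS => s; rewrite distrC.
  exact: (sym (fun s => chart_form X c (a s) (delta_mx 0 i) (delta_mx 0 j)) h2).
have cf : {for t, continuous f}.
  apply: (@continuous_comp _ _ _ (fun s => \sum_i \sum_j w s 0 i * w s 0 j *
     chart_form X c (a s) (delta_mx 0 i) (delta_mx 0 j)) Num.sqrt); last exact: sqrt_continuous.
  apply: continuous_at_sum => i; apply: continuous_at_sum => j.
  apply: (@cvgM _ _ (nbhs t) _ (fun s => w s 0 i * w s 0 j)); last exact: cphi.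
  by apply: (@cvgM _ _ (nbhs t) _ (fun s => w s 0 i)); exact: cw.
have ft : f t = speed X a t by rewrite (nbhs_singleton nearE).
rewrite /continuous_at -ft; apply: cvg_trans cf; apply: near_eq_cvg.
by apply: filterS nearE => s ->.
Qed.

Lemma speed_ge0 (a : R -> M) s : 0 <= speed X a s.
Proof. exact: sqrtr_ge0. Qed.

Lemma speed_lower : exists2 C : R, 1 <= C & forall a t, C1_curve X a ->
  `|'D_1 (cfun (fc (idx A (a t))) \o a : R -> 'rV[R]_n) t| <= C * speed X a t.
Proof.
have [C C1 HC] := rnorm_conv_bounds A cM; exists C => // a t Ha.
have C0 : 0 < C by lra.
have E := curve_diff Ha (chart_at_atlas X (a t)) (fc_atlas (idx A (a t))) (chart_at_dom X (a t)) (idx_dom A (a t)).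
have /andP[h _] := HC (a t) ('D_1 (cfun (chart_at X (a t)) \o a : R -> 'rV[R]_n) t).
rewrite ler_pdivrMl // in h.
by apply: le_trans h; rewrite [X in `|X| <= _]E.
Qed.

Lemma local_increment : exists2 C : R, 1 <= C & forall a t (e : R), C1_curve X a -> 0 < e ->
  exists2 del : R, 0 < del & forall s, `|s - t| < del ->
    d (a s) (a t) <= (C * speed X a t + e) * `|s - t|.
Proof.
have [C C1 HC] := speed_lower; have [Cl Cl1 [regC locC _]] := loc_dist A cM.
exists C => // a t e Ha e0; have [ca Ca] := Ha.
pose c := fc (idx A (a t)); have ac : atlas X c := fc_atlas (idx A (a t)).
have cat : cdom c (a t) := idx_dom A (a t).
have [dc _] := Ca c ac; have {}dc := dc t cat.
have := differentiable_dist dc e0; move=> /nbhs_normr[r r0 Hr].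
have iC : 0 < Cl^-1 by rewrite invr_gt0; lra.
have near_t : \forall s \near t, d (a t) (a s) < Cl^-1.
  by apply: (ca t (fun y => d (a t) y < Cl^-1)); apply/(mdist_nbhs A cM); exists Cl^-1.
have [r' r'0 Hr'] := (nbhs_normr _ _).1 near_t.
exists (Num.min r r'); first by rewrite lt_min r0.
move=> s; rewrite lt_min => /andP[sr sr'].
have hs := Hr' s sr'; have ht : d (a t) (a t) < Cl^-1 by rewrite mdistxx.
have /andP[h1 _] := locC (a t) (a s) (a t) hs ht; apply: le_trans h1 _.
have E : loc A (a t) (a s) - loc A (a t) (a t) = cfun c (a s) - cfun c (a t).
  by rewrite /loc opprB addrA subrK.
rewrite E.
have := Hr (s - t); rewrite subr0 => /(_ sr) /=; rewrite subrK => h.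
have dE : 'd (cfun c \o a : R -> 'rV[R]_n) t (s - t) = (s - t) *: 'D_1 (cfun c \o a : R -> 'rV[R]_n) t.
  rewrite deriveE // -linearZ; congr ('d _ _ _); by rewrite /GRing.scale /= mulr1.
rewrite dE in h; rewrite mulrDl.
have h2 : `|(s - t) *: 'D_1 (cfun c \o a : R -> 'rV[R]_n) t| <= C * speed X a t * `|s - t|.
  by rewrite normrZ mulrC ler_wpM2r //; exact: HC.
rewrite [leRHS]addrC; apply: le_trans (_ : e * `|s - t| + `|(s - t) *: 'D_1 (cfun c \o a : R -> 'rV[R]_n) t| <= _).
  apply: le_trans (lerD h (lexx _)).
  rewrite -[X in `|X| <= _](subrK ((s - t) *: 'D_1 (cfun c \o a : R -> 'rV[R]_n) t)).
  exact: ler_normD.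
by rewrite lerD2l.
Qed.

Lemma speed_integrable (a : R -> M) (x y : R) : C1_curve X a ->
  mu.-integrable `[x, y] (EFin \o speed X a).
Proof.
move=> Ha; apply: continuous_compact_integrable; first exact: segment_compact.
by apply: continuous_subspaceT; exact: speed_cts.
Qed.

(** The distance from the starting point need not be differentiable along the curve, but its
    increments are locally at most the speed times the elapsed time, up to a constant; [dini_le]
    integrates this. *)
Lemma mdist_le_length : exists2 C : R, 1 <= C & forall a, C1_curve X a ->
  ((d (a 0) (a 1))%:E <= C%:E * curve_length X a)%E.
Proof.
have [C C1 HC] := local_increment; exists C => // a Ha.
have C0 : 0 < C by lra.
(* Starting at -1 makes 0 an interior point for the fundamental theorem of calculus. *)
pose Phi t : R := \int[mu]_(s in `[-1, t]) speed X a s.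
have cs := speed_cts Ha.
have dPhi t : 0 <= t <= 1 -> derivable Phi t 1 /\ derive1 Phi t = speed X a t.
  move=> /andP[t0 t1]; apply: (@continuous_FTC1 R (speed X a) (BLeft (-1)) t 2).
  - by apply: le_lt_trans t1 _; rewrite ltr1n.
  - exact: speed_integrable.
  - by rewrite /= lte_fin (lt_le_trans _ t0) // ltrN10.
  - exact: cs.
have mono s t : s <= t -> Phi s <= Phi t.
  move=> st; rewrite /Phi /Rintegral; apply: fine_le.
  - by apply: integrable_fin_num => //; exact: speed_integrable.
  - by apply: integrable_fin_num => //; exact: speed_integrable.
  apply: ge0_subset_integral => //.
  - by apply/measurable_EFinP; apply: measurable_funTS; exact: continuous_measurable_fun.
  - by move=> x _; rewrite lee_fin speed_ge0.
  - by apply: subset_itvl; rewrite bnd_simp.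
have key : d (a 0) (a 1) <= C * Phi 1 - C * Phi 0.
  have := @dini_le R (fun t => d (a 0) (a t)) (fun t => C * Phi t).
  rewrite mdistxx subr0; apply; last by move=> s t st; rewrite ler_pM2l //; exact: mono.
  move=> t t01 e e0; have e20 : 0 < e / 2 by rewrite divr_gt0.
  have [del del0 Hd] := HC a t _ Ha e20.
  have [dP PE] := dPhi t t01.
  have eC : 0 < e / (2 * C) by rewrite divr_gt0 // mulr_gt0.
  have dP' : differentiable Phi t by apply/derivable1_diffP.
  have := differentiable_dist dP' eC; move=> /nbhs_normr[r r0 Hr].
  exists (Num.min del r); first by rewrite lt_min del0.
  move=> s; rewrite lt_min => /andP[sd sr].
  have h1 : `|d (a 0) (a s) - d (a 0) (a t)| <= d (a s) (a t).
    rewrite ler_norml; apply/andP; split.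
      by rewrite lerBrDr addrC lerBlDr; apply: le_trans (mdist_triangle A (a s) _ _) _; rewrite addrC.
    by rewrite lerBlDr addrC; apply: le_trans (mdist_triangle A (a t) _ _) _; rewrite lerD2l mdistC.
  apply: le_trans h1 (le_trans (Hd s sd) _).
  have := Hr (s - t); rewrite subr0 => /(_ sr) /=; rewrite subrK.
  have -> : 'd Phi t (s - t) = (s - t) * speed X a t.
    by rewrite -PE derive1E deriveE // -[RHS]linearZ; congr ('d _ _ _); rewrite /GRing.scale /= mulr1.
  move=> h2; have h3 : `|s - t| * speed X a t <= `|Phi s - Phi t| + e / (2 * C) * `|s - t|.
    have -> : `|s - t| * speed X a t = `|(s - t) * speed X a t|.
      by rewrite normrM (ger0_norm (speed_ge0 a t)).
    rewrite -(subrK (Phi s - Phi t) ((s - t) * speed X a t)) addrC.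
    by apply: le_trans (ler_normD _ _) _; rewrite lerD2l distrC.
  have h4 := ler_wpM2l (ltW C0) h3; rewrite -mulrBr normrM (gtr0_norm C0).
  have h5 : C * (e / (2 * C) * `|s - t|) = e / 2 * `|s - t| by field; rewrite gt_eqF.
  by rewrite mulrDr h5 in h4; lra.
have PhiE : Phi 1 - Phi 0 = \int[mu]_(s in `]0, 1]) speed X a s.
  rewrite /Phi Rintegral_itvB //.
  - exact: speed_integrable.
  - by rewrite bnd_simp ltW // ltrN10.
  - by rewrite bnd_simp ler01.
have -> : curve_length X a = (\int[mu]_(s in `[0%R, 1%R]) speed X a s)%:E.
  rewrite /curve_length /Rintegral fineK //; apply: integrable_fin_num => //; exact: speed_integrable.
rewrite -EFinM lee_fin; apply: le_trans key _; rewrite -mulrBr PhiE ler_pM2l //.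
by rewrite Rintegral_itv_obnd_cbnd //; apply: integrableS (speed_integrable 0 1 Ha) => //; apply: subset_itvr; rewrite bnd_simp.
Qed.

Lemma mdist_le_rdist : exists2 C : R, 1 <= C & forall p q, ((d p q)%:E <= C%:E * rdist X p q)%E.
Proof.
have [C C1 HC] := mdist_le_length; exists C => // p q.
have C0 : 0 < C by lra.
rewrite muleC -lee_pdivrMr //; apply: le_ereal_inf_tmp => _ [a [Ca a0 a1] <-].
by rewrite lee_pdivrMr // muleC -a0 -a1; exact: HC.
Qed.

End RiemannianDistance.

(** * Segments in a chart as short curves *)

Section StraightCurves.
Variables (R : realType) (n : nat) (M : ptopologicalType).
Variables (X : riemannian_manifold R n M) (A : finite_charts X).
Hypothesis cM : compact [set: M].
Local Notation d := (mdist A).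
Local Notation mu := (@lebesgue_measure R).

(* The parameter sin^2 stays in [0, 1] for all times, so that the curve is
   defined on the whole line. *)
Definition ramp (s : R) : R := sin (pi / 2 * s) ^+ 2.

Lemma ramp_bounds s : 0 <= ramp s <= 1.
Proof.
rewrite /ramp sqr_ge0 /=; have := cos2Dsin2 (pi / 2 * s : R).
by have := sqr_ge0 (cos (pi / 2 * s : R)); lra.
Qed.

Lemma ramp0 : ramp 0 = 0. Proof. by rewrite /ramp mulr0 sin0 expr0n. Qed.

Lemma ramp1 : ramp 1 = 1. Proof. by rewrite /ramp mulr1 sin_pihalf expr1n. Qed.

Definition dramp (s : R) : R := pi * (sin (pi / 2 * s) * cos (pi / 2 * s)).

Lemma ramp_derive s : is_derive s (1 : R) ramp (dramp s).
Proof.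
have h0 : is_derive s (1 : R) ((pi / 2) *: (id : R -> R)) ((pi / 2) *: 1).
  by apply: is_deriveZ; exact: is_derive_id.
have h1 : is_derive s (1 : R) (fun s => pi / 2 * s : R) (pi / 2).
  by apply: is_derive_eq h0 _; rewrite /GRing.scale /= mulr1.
have h2 := is_derive1_comp (is_derive_sin (pi / 2 * s)) h1.
have h3 := is_deriveM h2 h2.
have -> : ramp = (sin \o *%R (pi / 2)) * (sin \o *%R (pi / 2)).
  by apply/funext => u; rewrite /ramp expr2.
apply: is_derive_eq h3 _.
by rewrite /dramp /= /GRing.scale /=; field.
Qed.

Lemma dramp_continuous : continuous dramp.
Proof.
have c1 : continuous (fun s : R => pi / 2 * s).
  by move=> s; apply: (@cvgM _ _ (nbhs s) _ (cst (pi / 2)) id); [exact: cvg_cst|exact: cvg_id].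
move=> s; apply: (@cvgM _ _ (nbhs s) _ (cst pi)); first exact: cvg_cst.
apply: (@cvgM _ _ (nbhs s) _ (fun s => sin (pi / 2 * s)) (fun s => cos (pi / 2 * s))).
  by apply: (@continuous_comp _ _ _ (fun s : R => pi / 2 * s) sin); [exact: c1|exact: continuous_sin].
by apply: (@continuous_comp _ _ _ (fun s : R => pi / 2 * s) cos); [exact: c1|exact: continuous_cos].
Qed.

Lemma dramp_le s : `|dramp s| <= 4.
Proof.
rewrite /dramp !normrM (ger0_norm (pi_ge0 R)).
have h1 : `|sin (pi / 2 * s : R)| <= 1 by rewrite ler_norml sin_geN1 sin_le1.
have h2 : `|cos (pi / 2 * s : R)| <= 1 by rewrite ler_norml cos_geN1 cos_le1.
have p4 : (pi : R) <= 4 by have := pihalf_lt2 R; lra.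
apply: le_trans (ler_wpM2l (pi_ge0 R) (_ : _ <= 1)) _; last by rewrite mulr1.
by apply: mulr_ile1.
Qed.

Variables (k : 'I_(fc_size A)) (x0 x1 : 'rV[R]_n).
Local Notation c := (fc k).
Hypothesis hx0 : `|x0 - fc_ctr k| <= 2 * fc_rad k.
Hypothesis hx1 : `|x1 - fc_ctr k| <= 2 * fc_rad k.

Definition ell (s : R) : 'rV[R]_n := x0 + ramp s *: (x1 - x0).

Lemma ell_ball s : `|ell s - fc_ctr k| <= 2 * fc_rad k.
Proof.
have /andP[r0 r1] := ramp_bounds s.
have -> : ell s - fc_ctr k = (1 - ramp s) *: (x0 - fc_ctr k) + ramp s *: (x1 - fc_ctr k).
  rewrite /ell !scalerBr !scalerBl !scale1r; set u := ramp s *: x0; set v := ramp s *: x1.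
  set w := ramp s *: fc_ctr k.
  apply/rowP => j; rewrite !mxE; ring.
have hZ (b : R) (v : 'rV[R]_n) : 0 <= b -> `|v| <= 2 * fc_rad k -> `|b *: v| <= b * (2 * fc_rad k).
  by move=> b0 hv; rewrite normrZ ger0_norm // ler_wpM2l.
have h1 := hZ _ _ (eq_ind_r is_true r1 (subr_ge0 _ _)) hx0.
apply: le_trans (ler_normD _ _) (le_trans (lerD h1 (hZ _ _ r0 hx1)) _).
by rewrite -mulrDl subrK mul1r.
Qed.

Lemma ell_img s : cimg c (ell s).
Proof.
apply: fc_img; apply: le_trans (ell_ball s) _.
by rewrite ler_pM2r ?fc_rad_gt0 // ler_nat.
Qed.

Lemma cfunK y : cimg c y -> cdom c (cinv c y) /\ cfun c (cinv c y) = y.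
Proof. by move=> [p cp <-]; have [_ ->] := chart_domK (fc_chart k) cp. Qed.

Lemma ell_diff s : differentiable (ell : R -> 'rV[R]_n) s /\
  forall v, 'd (ell : R -> 'rV[R]_n) s v = (v * dramp s) *: (x1 - x0).
Proof.
have dR := ramp_derive s.
have dr : derivable ramp s 1 by case: dR.
have rE : 'D_1 ramp s = dramp s by case: dR.
have dr' : differentiable ramp s by apply/derivable1_diffP.
have dE v : 'd ramp s v = v * dramp s.
  rewrite -rE deriveE // -[RHS]linearZ; congr ('d _ _ _); by rewrite /GRing.scale /= mulr1.
have ellE : (ell : R -> 'rV[R]_n) = cst x0 + (fun z => ramp z *: (x1 - x0)).
  by apply/funext.
have d2 : differentiable (fun z => ramp z *: (x1 - x0)) s by exact: differentiableZl.
split; first by rewrite ellE; apply: differentiableD.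
move=> v; have dc : differentiable (cst x0 : R -> 'rV[R]_n) s by exact: differentiable_cst.
rewrite [in LHS]ellE; apply: etrans (congr1 (fun L => L v) (diffD dc d2)) _.
apply: etrans (congr2 +%R (congr1 (fun L => L v) (diff_cst x0 s)) (congr1 (fun L => L v) (diffZl (x1 - x0) dr'))) _.
by rewrite /= add0r dE.
Qed.

Definition arc (s : R) : M := cinv c (ell s).

Lemma ell_continuous : continuous ell.
Proof. by move=> s; apply: differentiable_continuous; exact: (ell_diff s).1. Qed.

Lemma arc_continuous : continuous arc.
Proof.
move=> s; apply: (@continuous_comp _ _ _ ell (cinv c)); first exact: ell_continuous.
have [_ oi _ _ ci] := fc_chart k.
by have := ci; rewrite continuous_open_subspace // => /(_ (ell s)); rewrite inE; apply; exact: ell_img.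
Qed.

Lemma arcE s : cdom c (arc s) /\ cfun c (arc s) = ell s.
Proof. exact: cfunK (ell_img s). Qed.

Lemma arc_reg s : reg k 2 (arc s).
Proof. by have [h E] := arcE s; split=> //; rewrite E; exact: ell_ball. Qed.

Lemma arc_C1 : C1_curve X arc.
Proof.
split=> [|c' ac']; first exact: arc_continuous.
have ac := fc_atlas k; have hc' := atlas_chart ac'.
have [_ di] := Ck_smooth (Ck_map_id X 2).
pose tr := cfun c' \o id \o cinv c.
have dtr s : cdom c' (arc s) -> differentiable tr (ell s).
  move=> h; have [as_ E] := arcE s.
  have := di _ _ _ ac ac' as_ h; rewrite /chart_smooth => -[]; rewrite E //.
have dcomp s : cdom c' (arc s) -> differentiable (cfun c' \o arc : R -> 'rV[R]_n) s /\
    forall v, 'D_v (cfun c' \o arc : R -> 'rV[R]_n) s = (v * dramp s) *: 'D_(x1 - x0) tr (ell s).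
  move=> h; have [de dE] := ell_diff s.
  have dc := differentiable_comp de (dtr s h).
  split; first exact: dc.
  move=> v; apply: etrans (deriveE _ dc) _.
  apply: etrans (congr1 (fun L => L v) (diff_comp de (dtr s h))) _ => /=.
  apply: etrans (congr1 (fun u => 'd tr (ell s) u) (dE v)) _.
  apply: etrans (linearZ _ _) _; apply: (congr1 (fun u => (v * dramp s) *: u)).
  by rewrite deriveE //; exact: dtr.
have key v (s : R) : cdom c' (arc s) -> {for s, continuous (fun u : R => 'D_v (cfun c' \o arc : R -> 'rV[R]_n) u)}.
  move=> h; have [_ /(_ (x1 - x0)) cD] := atlas_compatible 1 ac ac'.
  have [as_ E] := arcE s.
  have cDs : {for ell s, continuous (fun x => 'D_(x1 - x0) tr x)}.
    by apply: cD; exists (arc s).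
  pose f s := (v * dramp s) *: 'D_(x1 - x0) tr (ell s).
  have cf : {for s, continuous f}.
    apply: (@cvgZ _ _ _ (nbhs s) _ (fun s => v * dramp s) (fun s => 'D_(x1 - x0) tr (ell s))).
      by apply: (@cvgM _ _ (nbhs s) _ (cst v)); [exact: cvg_cst|exact: dramp_continuous].
    by apply: (@continuous_comp _ _ _ ell (fun x => 'D_(x1 - x0) tr x)); [exact: ell_continuous|].
  have nearE : \forall y \near s, 'D_v (cfun c' \o arc : R -> 'rV[R]_n) y = f y.
    have ho : nbhs (arc s) (cdom c') by apply: open_nbhs_nbhs; split=> //; exact: chart_dom_open hc'.
    have : \forall y \near s, cdom c' (arc y) := arc_continuous ho.
    by apply: filterS => y cy; exact: (dcomp y cy).2.
  have ft : f s = 'D_v (cfun c' \o arc : R -> 'rV[R]_n) s by rewrite (nbhs_singleton nearE).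
  have hc : (fun u : R => 'D_v (cfun c' \o arc : R -> 'rV[R]_n) u) @ s --> f s.
    by apply: cvg_trans cf; apply: near_eq_cvg; apply: filterS nearE => y ->.
  exact: (eq_ind _ (fun y => (fun u : R => 'D_v (cfun c' \o arc : R -> 'rV[R]_n) u) @ s --> y) hc _ ft).
by split=> [s h|v s h]; [exact: (dcomp s h).1|exact: key].
Qed.

Lemma arc_speed (r : R) : 0 < r ->
  (forall p, reg k 2 p -> forall v, r * `|v| ^+ 2 <= chart_form X c p v v <= r^-1 * `|v| ^+ 2) ->
  forall s, speed X arc s <= Num.sqrt r^-1 * (4 * `|x1 - x0|).
Proof.
move=> r0 H s; rewrite (speed_chart arc_C1 (fc_atlas k) (arcE s).1).
have -> : (cfun c \o arc : R -> 'rV[R]_n) = ell by apply/funext => y; exact: (arcE y).2.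
set w := 'D_1 ell s.
have wE : w = dramp s *: (x1 - x0).
  by rewrite /w deriveE; [rewrite (ell_diff s).2 mul1r|exact: (ell_diff s).1].
have /andP[_ h] := H _ (arc_reg s) w.
apply: le_trans (ler_wsqrtr h) _; rewrite sqrtrM ?invr_ge0 ?(ltW r0) // sqrtr_sqr normr_id.
by rewrite ler_wpM2l ?sqrtr_ge0 // wE normrZ ler_wpM2r // dramp_le.
Qed.

Lemma arc_length (r : R) : 0 < r ->
  (forall p, reg k 2 p -> forall v, r * `|v| ^+ 2 <= chart_form X c p v v <= r^-1 * `|v| ^+ 2) ->
  (curve_length X arc <= (Num.sqrt r^-1 * (4 * `|x1 - x0|))%:E)%E.
Proof.
move=> r0 H; have h := arc_speed r0 H; set K := Num.sqrt _ * _ in h *.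
have -> : K%:E = (\int[mu]_(s in `[0%R, 1%R]) (cst K%:E) s)%E.
  rewrite integral_cst //= lebesgue_measure_itv /= lte_fin ltr01 oppr0 adde0 mule1 //.
apply: ge0_le_integral => //.
- by move=> x _; rewrite lee_fin speed_ge0.
- by apply/measurable_EFinP; apply: measurable_funTS; apply: continuous_measurable_fun; exact: speed_cts arc_C1.
- by move=> x _; rewrite lee_fin.
Qed.

End StraightCurves.

(** The coordinate segment from [p] to [q] is a competitor. The bound is local: on a disconnected
    manifold [rdist] is infinite between components while [mdist] is at most 1. *)
Lemma rdist_le (R : realType) (n : nat) (M : ptopologicalType) (X : riemannian_manifold R n M)
  (A : finite_charts X) : compact [set: M] ->
  exists C c : R, [/\ 1 <= C, 0 < c & forall p q, mdist A p q < c ->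
    (rdist X p q <= (C * mdist A p q)%:E)%E].
Proof.
move=> cM; have [Cl Cl1 [regC locC _]] := loc_dist A cM.
have [r r0 Hr] := chart_form_unif A cM.
pose K := Num.sqrt r^-1 * (4 * Cl).
have K0 : 0 <= K by rewrite mulr_ge0 ?sqrtr_ge0 // mulr_ge0 //; lra.
exists (1 + K), Cl^-1; split; first by lra.
  by rewrite invr_gt0; lra.
move=> p q pq; have iC : 0 < Cl^-1 by rewrite invr_gt0; lra.
have [cp [_ rp]] := idx_reg A p; have [cq rq] := regC p q pq.
set k := idx A p in cp rp cq rq.
have rp2 : `|cfun (fc k) p - fc_ctr k| <= 2 * fc_rad k.
  by apply: le_trans rp _; rewrite ler_pM2r ?fc_rad_gt0 // ler1n.
have L := arc_length rp2 rq r0 (fun p => Hr p k).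
have E0 : arc k (cfun (fc k) p) (cfun (fc k) q) 0 = p.
  by rewrite /arc /ell ramp0 scale0r addr0; have [_ ->] := chart_domK (fc_chart k) cp.
have E1 : arc k (cfun (fc k) p) (cfun (fc k) q) 1 = q.
  by rewrite /arc /ell ramp1 scale1r addrC subrK; have [_ ->] := chart_domK (fc_chart k) cq.
apply: le_trans (_ : curve_length X (arc k (cfun (fc k) p) (cfun (fc k) q)) <= _)%E.
  by apply: ereal_inf_lbound; exists (arc k (cfun (fc k) p) (cfun (fc k) q)) => //; split=> //; exact: arc_C1 _ _.
apply: le_trans L _; rewrite lee_fin.
have /andP[_ h] := locC p q p pq (eq_ind_r (fun z => z < Cl^-1) iC (mdistxx A p)).
have {}h : `|cfun (fc k) q - cfun (fc k) p| <= Cl * mdist A p q.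
  by move: h; rewrite /loc -/k subrr subr0 mdistC.
apply: le_trans (_ : K * mdist A p q <= _).
  by rewrite /K -(mulrA (Num.sqrt r^-1)) ler_wpM2l ?sqrtr_ge0 // -mulrA ler_wpM2l.
by rewrite ler_wpM2r ?mdist_ge0 // lerDr.
Qed.

(** * Fibre maps and the zero set *)

Section FibreProfile.
Variables (R : realType) (h dh : R -> R).
Hypothesis Hh : fibre_profile h dh.

Lemma profile_chord x y z : 0 <= x -> x < y -> y < z ->
  (z - y) * h x + (y - x) * h z < (z - x) * h y.
Proof.
move=> x0 xy yz; have [_ [sc _]] := Hh.
have xz : 0 < z - x by lra.
have zx : z - x != 0 by rewrite gt_eqF.
have a0 : 0 < (z - y) / (z - x) by rewrite divr_gt0 // subr_gt0.
have a1 : (z - y) / (z - x) < 1 by rewrite ltr_pdivrMr // mul1r ltrD2l ltrN2.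
have := sc x z ((z - y) / (z - x)) x0 _ _ _.
have -> : (z - y) / (z - x) * x + (1 - (z - y) / (z - x)) * z = y by field.
rewrite a0 a1 lt_eqF ?(lt_trans xy) // => /(_ _ isT isT) /=.
have z0 : 0 <= z by lra.
move=> /(_ z0); rewrite -(ltr_pM2l xz); apply: le_lt_trans.
rewrite le_eqVlt; apply/orP; left; apply/eqP; by field.
Qed.

Lemma profile_quotient x (e : R) : 0 <= x -> 0 < e -> exists2 del : R, 0 < del &
  forall y, 0 <= y -> y != x -> `|y - x| < del -> `|(h y - h x) / (y - x) - dh x| < e.
Proof.
move=> x0 e0; have [[hd _] _] := Hh.
have /cvgrPdist_lt /(_ e e0) H := hd x x0.
have {}H : nbhs x [set y | y != x -> 0 <= y -> `|dh x - (h y - h x) / (y - x)| < e] := H.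
move: H => /nbhs_ballP[del /= del0 Hd]; exists del => // y y0 yx yd.
by rewrite distrC; apply: Hd => //; rewrite /ball /= distrC.
Qed.

(** The positive derivative at [y] gives a slightly larger argument with larger value; by concavity
    the chord from [x] to [y] is at least as steep. *)
Lemma profile_mono x y : 0 <= x -> x < y -> h x < h y.
Proof.
move=> x0 xy; have [_ [_ [_ dh0 _ _]]] := Hh.
have y0 : 0 < y by lra.
have [del del0 Hd] := profile_quotient (ltW y0) (dh0 y y0).
pose z := y + del / 2; have zy : z - y = del / 2 by rewrite /z; ring.
have d2 : 0 < del / 2 by rewrite divr_gt0.
have yz : y < z by lra.
have hz : h y < h z.
  have := Hd z _ _ _; rewrite zy gtr0_norm // ltr_pdivrMr // ltr_pMr // ltr1n => /(_ _ _ isT).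
  rewrite gt_eqF // => /(_ _ isT) H; have {}H := H (ltW (lt_trans y0 yz)).
  have : 0 < (h z - h y) / (del / 2) by move: H; rewrite ltr_norml => /andP[H1 _]; lra.
  by rewrite pmulr_lgt0 ?invr_gt0 // subr_gt0.
have := profile_chord x0 xy yz; rewrite -subr_gt0 => H.
have H2 : 0 < (y - x) * (h z - h y) by rewrite mulr_gt0 // subr_gt0.
have : 0 < (z - y) * (h y - h x).
  have -> : (z - y) * (h y - h x) = (z - x) * h y - ((z - y) * h x + (y - x) * h z) +
    (y - x) * (h z - h y) by ring.
  by rewrite addr_gt0.
by rewrite pmulr_rgt0 ?subr_gt0.
Qed.

Lemma profile_le x y : 0 <= x -> x <= y -> h x <= h y.
Proof. by move=> x0; rewrite le_eqVlt => /orP[/eqP ->//|xy]; rewrite ltW // profile_mono. Qed.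

Lemma profile_gt0 x : 0 < x -> 0 < h x.
Proof. by have [_ [_ [h0 _ _ _]]] := Hh; move=> x0; rewrite -h0 profile_mono. Qed.

(** Chords from 0 get flatter, and their slopes tend to h'(0) = 1. *)
Lemma profile_le_id x : 0 <= x -> h x <= x.
Proof.
have [_ [_ [h0 _ dh0 _]]] := Hh.
rewrite le_eqVlt => /orP[/eqP <-|x0]; first by rewrite h0.
apply/ler_addgt0Pr => e e0.
have ex : 0 < e / x by rewrite divr_gt0.
have [del del0 Hd] := profile_quotient (lexx 0) ex.
pose y := Num.min (del / 2) (x / 2).
have y0 : 0 < y by rewrite lt_min !divr_gt0.
have yd : y < del.
  by apply: le_lt_trans (_ : del / 2 < _); [rewrite ge_min lexx|rewrite ltr_pdivrMr // ltr_pMr // ltr1n].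
have yx : y < x.
  by apply: le_lt_trans (_ : x / 2 < _); [rewrite ge_min lexx orbT|rewrite ltr_pdivrMr // ltr_pMr // ltr1n].
have := Hd y (ltW y0) _ _; rewrite gt_eqF // subr0 gtr0_norm // h0 subr0 dh0 => /(_ isT yd) H.
have hy : h y <= (1 + e / x) * y.
  by rewrite -ler_pdivrMr //; move: H; rewrite ltr_norml => /andP[_]; lra.
have := profile_chord (lexx 0) y0 yx; rewrite h0 mulr0 add0r !subr0 => H2.
have H3 : y * h x <= y * (x + e).
  apply: le_trans (ltW H2) _.
  have -> : y * (x + e) = x * ((1 + e / x) * y) by field; rewrite gt_eqF.
  by rewrite ler_pM2l.
by rewrite ler_pM2l in H3.
Qed.

Lemma profile_lower (lam : R) : lam < 1 -> exists2 del : R, 0 < del &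
  forall x, 0 <= x -> x <= del -> lam * x <= h x.
Proof.
move=> lam1; have [_ [_ [h0 _ dh0 _]]] := Hh.
have l0 : 0 < 1 - lam by rewrite subr_gt0.
have [del del0 Hd] := profile_quotient (lexx 0) l0.
exists (del / 2); first by rewrite divr_gt0.
move=> x; rewrite le_eqVlt => /orP[/eqP <- _|x0 xd]; first by rewrite h0 mulr0.
have xdel : x < del by apply: le_lt_trans xd _; rewrite ltr_pdivrMr // ltr_pMr // ltr1n.
have := Hd x (ltW x0) _ _; rewrite gt_eqF // subr0 gtr0_norm // h0 subr0 dh0 => /(_ isT xdel).
by rewrite ltr_norml => /andP[H _]; rewrite -ler_pdivlMr //; lra.
Qed.

End FibreProfile.

Section FibreIterates.
Variables (R : realType) (M : pointedType) (T Tinv : M -> M) (g : M -> R) (h dh : R -> R).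
Variables (B : R -> R) (t : R).
Hypothesis KT : cancel Tinv T.
Hypothesis g0 : forall p, 0 < g p.
Hypothesis Hh : fibre_profile h dh.
Hypothesis HB : 0 < B t /\ forall p, fibre_map g h t p (B t) < B t.

Definition pullback_iterate k p := fibre_iter T g h t k (iter k Tinv p) (B t).
Local Notation phi := pullback_iterate.

Lemma pullback_iterateS k p : phi k.+1 p = expR (- t) * g (Tinv p) * h (phi k (Tinv p)).
Proof.
rewrite /phi iterSr /= /fibre_map; do 2 congr (_ * _); congr g.
by elim: k (Tinv p) => [//|k IH] q; rewrite iterSr /= KT IH.
Qed.

Lemma pullback_iterate_gt0 k p : 0 < phi k p.
Proof.
elim: k p => [|k IH] p; first by have [] := HB.
by rewrite pullback_iterateS !mulr_gt0 ?expR_gt0 // (profile_gt0 Hh).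
Qed.

Lemma pullback_iterate_decr k p : phi k.+1 p <= phi k p.
Proof.
elim: k p => [|k IH] p; first by rewrite pullback_iterateS ltW //; have [_] := HB; exact.
rewrite pullback_iterateS [leRHS]pullback_iterateS ler_pM2l ?mulr_gt0 ?expR_gt0 //.
by apply: (profile_le Hh) => //; rewrite ltW // pullback_iterate_gt0.
Qed.

Local Notation S n p := (\sum_(i < n) ln (g (iter i.+1 Tinv p))).

Lemma orbit_sumS n p : S n.+1 p = ln (g (Tinv p)) + S n (Tinv p).
Proof. by rewrite big_ord_recl /=; congr (_ + _); apply: eq_bigr => i _; rewrite /= -iterSr. Qed.

Lemma pullback_iterate_upper k p : phi k p <= B t * expR (S k p - k%:R * t).
Proof.
elim: k p => [|k IH] p; first by rewrite big_ord0 mul0r subrr expR0 mulr1.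
rewrite pullback_iterateS orbit_sumS.
have -> : B t * expR (ln (g (Tinv p)) + S k (Tinv p) - k.+1%:R * t) =
    expR (- t) * g (Tinv p) * (B t * expR (S k (Tinv p) - k%:R * t)).
  have -> : ln (g (Tinv p)) + S k (Tinv p) - k.+1%:R * t =
    - t + ln (g (Tinv p)) + (S k (Tinv p) - k%:R * t) by rewrite -natr1; ring.
  by rewrite !expRD lnK ?posrE //; ring.
rewrite ler_pM2l ?mulr_gt0 ?expR_gt0 //; apply: le_trans (IH _).
by apply: (profile_le_id Hh); rewrite ltW // pullback_iterate_gt0.
Qed.

(** Below [del] the map [h] is at least the linear map with factor expR (t - t'). So, counting from
    the last time the iterate was at least [del], it shrinks no faster than the linear cocycle with
    parameter [t']; [n] is the number of steps since then. *)
Lemma pullback_iterate_lower (t' : R) : t < t' -> exists2 del : R, 0 < del &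
  forall k p, exists2 n, (n <= k)%N & del * expR (S n p - n%:R * t') <= phi k p.
Proof.
move=> tt'; have lam1 : expR (t - t') < 1 by rewrite expR_lt1 subr_lt0.
have [del0 d0 Hd] := profile_lower Hh lam1; have [b0 _] := HB.
pose del := Num.min del0 (B t).
have del_gt0 : 0 < del by rewrite lt_min d0.
exists del => // k; elim: k => [|k IH] p.
  by exists 0%N => //; rewrite big_ord0 mul0r subrr expR0 mulr1 ge_min lexx orbT.
have hmin x : 0 <= x -> expR (t - t') * Num.min x del <= h x.
  move=> x0; have m0 : 0 <= Num.min x del by rewrite le_min x0 ltW.
  apply: le_trans (Hd _ m0 _) _; first by rewrite !ge_min lexx !orbT.
  by apply: (profile_le Hh) => //; rewrite ge_min lexx.
have := hmin _ (ltW (pullback_iterate_gt0 k (Tinv p))).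
have E n : del * expR (S n.+1 p - n.+1%:R * t') =
    expR (- t) * g (Tinv p) * (expR (t - t') * (del * expR (S n (Tinv p) - n%:R * t'))).
  have -> : S n.+1 p - n.+1%:R * t' =
    - t + ln (g (Tinv p)) + (t - t') + (S n (Tinv p) - n%:R * t').
    by rewrite orbit_sumS -natr1; ring.
  by rewrite !expRD lnK ?posrE //; ring.
have step n : del * expR (S n (Tinv p) - n%:R * t') <= Num.min (phi k (Tinv p)) del ->
    del * expR (S n.+1 p - n.+1%:R * t') <= phi k.+1 p.
  move=> hn; rewrite E pullback_iterateS ler_pM2l ?mulr_gt0 ?expR_gt0 //.
  apply: le_trans (hmin _ (ltW (pullback_iterate_gt0 k (Tinv p)))).
  by rewrite ler_pM2l ?expR_gt0.
move=> _; have [hp|hp] := leP del (phi k (Tinv p)).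
  by exists 1%N => //; apply: step; rewrite big_ord0 mul0r subrr expR0 mulr1 le_min hp lexx.
have [n nk hn] := IH (Tinv p); exists n.+1 => //; apply: step.
by rewrite le_min hn (le_trans hn) // ltW.
Qed.

Lemma zero_setP p : zero_set T Tinv g h B t p <-> forall e : R, 0 < e -> exists k, phi k p < e.
Proof.
have ni : nonincreasing_seq (fun k => phi k p).
  by apply/nonincreasing_seqP => k; exact: pullback_iterate_decr.
have lb : has_lbound (range (fun k => phi k p)).
  by exists 0 => _ [k _ <-]; rewrite ltW // pullback_iterate_gt0.
have cv := nonincreasing_cvgn ni lb.
have E : invariant_function T Tinv g h B t p = inf (range (fun k => phi k p)) by apply/cvg_lim.
have hi : has_inf (range (fun k => phi k p)) by split=> //; exists (phi 0%N p); exists 0%N.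
rewrite /zero_set /= E; split=> [i0 e e0|H].
  by have [_ [k _ <-]] := inf_adherent e0 hi; rewrite i0 add0r; exists k.
apply/eqP; rewrite eq_le; apply/andP; split; last first.
  by apply: lb_le_inf => [|_ [k _ <-]]; [exists (phi 0%N p); exists 0%N|rewrite ltW // pullback_iterate_gt0].
apply/ler_addgt0Pr => e e0; have [k hk] := H e e0.
rewrite add0r; apply: le_trans (ltW hk); apply: ge_inf => //; by exists k.
Qed.

(** If the sums exceeded n t' from [n0] on, the lower bound would keep all iterates above a positive
    constant. *)
Lemma zero_set_low (t' : R) p : t < t' -> zero_set T Tinv g h B t p ->
  forall n0, exists2 n, (n0 <= n)%N & S n p <= n%:R * t'.
Proof.
move=> tt' /zero_setP H n0; apply: contrapT => hn.
have {}hn n : (n0 <= n)%N -> n%:R * t' < S n p.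
  by move=> nn; rewrite ltNge; apply/negP => h1; apply: hn; exists n.
have [del del0 Hd] := pullback_iterate_lower tt'.
(* Covers the finitely many early [n]; for the later ones the exponent is positive and 1 is a lower
   bound. *)
pose c := \big[Num.min/1]_(n < n0) expR (S n p - n%:R * t').
have c0 : 0 < c by apply: lt_bigmin => [|i _]; rewrite ?expR_gt0.
have [k hk] := H (del * c) (mulr_gt0 del0 c0).
have [n _ hn2] := Hd k p; have : del * c <= phi k p; last by rewrite leNgt hk.
apply: le_trans hn2; rewrite ler_pM2l //.
have [nn|nn] := leqP n0 n; last exact: (@bigmin_le_cond _ _ _ _ (Ordinal nn) xpredT (fun n => expR (S n p - n%:R * t')) isT).
apply: le_trans (bigmin_le_id _ _ _ _) _.
apply: le_trans (_ : expR 0 <= _); [by rewrite expR0|rewrite ler_expR subr_ge0; exact: ltW (hn _ nn)].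
Qed.

Lemma zero_set_high p :
  (forall k : nat, exists n, S n p - n%:R * t < - k%:R) -> zero_set T Tinv g h B t p.
Proof.
move=> H; apply/zero_setP => e e0; have [b0 _] := HB.
have be : 0 < e / B t by rewrite divr_gt0.
pose k := (Num.truncn `|ln (e / B t)|).+1.
have hk : `|ln (e / B t)| < k%:R.
  by have := truncnS_gt `|ln (e / B t)|; exact.
have [n hn] := H k; exists n; apply: le_lt_trans (pullback_iterate_upper n p) _.
rewrite mulrC -ltr_pdivlMr // -(@lnK _ (e / B t)) ?posrE // ltr_expR.
apply: lt_trans hn _; have := ler_norm (- ln (e / B t)); rewrite normrN; lra.
Qed.

End FibreIterates.

(** * Hausdorff and packing dimension *)

Section BallCounts.
Variables (R : realType) (M : pointedType) (d : M -> M -> R) (G : M -> M).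
Variables (ku ks : M -> M -> R) (a : M -> R) (C : R).
Hypothesis Hd : pseudo_metric d.
Hypothesis tb : totally_bounded d.
Hypothesis H : hyp_chart d G ku ks a C.

(** A square grid in the coordinates at [x], with spacing [3 * C * r], has about (b / r)^2 points in
    the ball, and their nearest net points are distinct. *)
Lemma ball_count_lower (x : M) (b r : R) Q : 0 < r -> 2 * r <= b -> b < C^-1 -> net d r Q ->
  b ^+ 2 <= 36 * C ^+ 4 * (r ^+ 2 * (count (fun q => `[< d x q <= b >]) Q)%:R).
Proof.
move=> r0 rb bC [uQ sQ nQ]; have C1 := hc_C H; have C0 : 0 < C by lra.
have b0 : 0 < b by lra.
pose J := (Num.truncn (b / (6 * C ^+ 2 * r))).+1.
have D0 : 0 < 6 * C ^+ 2 * r by rewrite mulr_gt0 // mulr_gt0 // exprn_gt0.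
have hb : 0 <= b / (6 * C ^+ 2 * r) by rewrite divr_ge0 // ltW.
have hJ : b <= 6 * C ^+ 2 * r * J%:R.
  by rewrite mulrC -ler_pdivrMr // ltW // truncnS_gt.
have hj (j : 'I_J) : 0 <= 3 * C * r * j%:R <= b / (2 * C).
  rewrite !mulr_ge0 ?(ltW r0) ?(ltW C0) //=.
  have : j%:R <= b / (6 * C ^+ 2 * r) by rewrite -truncn_ge_nat // -ltnS.
  rewrite ler_pdivlMr // => h; rewrite ler_pdivlMr ?mulr_gt0 //; apply: le_trans h.
  by rewrite le_eqVlt; apply/orP; left; apply/eqP; ring.
have bC' : b / (2 * C) < C^-1.
  rewrite ltr_pdivrMr ?mulr_gt0 // mulrCA mulVf ?gt_eqF // mulr1.
  by apply: lt_trans bC _; apply: le_lt_trans (_ : 1 < _); rewrite ?invf_le1 ?ltr1n.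
have Hp (p : 'I_J * 'I_J) : exists z q, [/\ ku x z = 3 * C * r * p.1%:R /\ ks x z = 3 * C * r * p.2%:R,
    d x z <= b / 2, q \in Q & d z q <= r].
  have /andP[u0 u1] := hj p.1; have /andP[s0 s1] := hj p.2.
  have hu : `|3 * C * r * p.1%:R| < C^-1 by rewrite ger0_norm //; exact: le_lt_trans u1 _.
  have hs : `|3 * C * r * p.2%:R| < C^-1 by rewrite ger0_norm //; exact: le_lt_trans s1 _.
  have [z xz [uz sz]] := hc_surj H x hu hs.
  have [q qQ zq] := nQ z; exists z, q; split=> //.
  apply: le_trans xz _; have -> : b / 2 = C * (b / (2 * C)) by field; rewrite gt_eqF.
  by rewrite ler_pM2l // ge_max !ger0_norm // u1.
have /choice[z /choice[q Hq]] := Hp.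
have xz p : d x (z p) < C^-1 by have [_ h _ _] := Hq p; apply: le_lt_trans h _; lra.
have inj : injective q.
  move=> p p' qq; apply/eqP/negP => /negP pp'.
  have [[u s] _ _ zq] := Hq p; have [[u' s'] _ _ zq'] := Hq p'.
  have [_ h] := hc_bilip H (xz p) (xz p').
  have : d (z p) (z p') <= 2 * r.
    by apply: le_trans (pm_T Hd (q p) _ _) _; rewrite [X in _ + d X _]qq (pm_C Hd (q p')); lra.
  have : 3 * (C * r) <= dmax ku ks x (z p) (z p').
    have e1 (i j : nat) : i != j -> 3 * (C * r) <= `|3 * C * r * i%:R - 3 * C * r * j%:R|.
      move=> ij; rewrite -mulrBr normrM ger0_norm ?mulr_ge0 ?(ltW C0) ?(ltW r0) //.
      have h1 : (1 : R) <= `|i%:R - j%:R|.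
        by case: (ltngtP i j) ij => // lt _; [rewrite distrC|]; rewrite -natrB ?(ltnW lt) // ger0_norm ?ler0n // ler1n subn_gt0.
      rewrite mulrA -[leLHS]mulr1; apply: ler_wpM2l => //.
      by rewrite !mulr_ge0 ?(ltW C0) ?(ltW r0).
    have : (p.1 != p'.1) || (p.2 != p'.2).
      by rewrite -negb_and; apply: contra pp' => /andP[/eqP h1 /eqP h2]; rewrite (surjective_pairing p) (surjective_pairing p') h1 h2.
    rewrite /dmax le_max u u' s s' => /orP[h1|h1]; apply/orP; [left|right]; exact: e1.
  move=> h1 h2; have h3 := ler_wpM2l (ltW C0) h2.
  have h4 : 0 < C * r by rewrite mulr_gt0.
  have h5 : C * (2 * r) = 2 * (C * r) by ring.
  lra.
have cnt : (J * J <= count (fun q => `[< (d x q <= b)%R >]) Q)%N.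
  have -> : (J * J = size (map q (enum {: 'I_J * 'I_J})))%N.
    by rewrite size_map -cardE card_prod card_ord.
  rewrite -size_filter; apply: uniq_leq_size; first by rewrite map_inj_uniq // enum_uniq.
  move=> _ /mapP[p _ ->]; have [_ xzp qQ zq] := Hq p; rewrite mem_filter qQ andbT; apply/asboolP.
  by apply: le_trans (pm_T Hd (z p) _ _) _; lra.
have cnt' : (J%:R * J%:R : R) <= (count (fun q => `[< d x q <= b >]) Q)%:R by rewrite -natrM ler_nat.
apply: le_trans (_ : (6 * C ^+ 2 * r * J%:R) ^+ 2 <= _).
  by rewrite ler_sqr ?nnegrE ?(ltW b0) // mulr_ge0 // ltW.
have -> : (6 * C ^+ 2 * r * J%:R) ^+ 2 = 36 * C ^+ 4 * (r ^+ 2 * (J%:R * J%:R)) by ring.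
by rewrite ler_wpM2l ?mulr_ge0 ?exprn_ge0 ?(ltW C0) // ler_wpM2l // exprn_ge0 // ltW.
Qed.

Lemma net_size_upper : exists2 K : R, 1 <= K & forall r Q, 0 < r -> K * r <= 1 -> net d r Q ->
  r ^+ 2 * (size Q)%:R <= K.
Proof.
have [e0 e00 He] := volume_estimate Hd H.
have [|K K1 HK] := He e0; first by rewrite e00 lexx.
have [s Hs] := tb e00; exists (K * (size s).+1%:R); first by rewrite mulr_ege1 // ler1n.
move=> r Q r0 Kr nQ; have K0 : 0 < K by lra.
have Kr' : K * r * C ^+ 0 <= 1.
  rewrite expr0 mulr1; apply: le_trans Kr; rewrite ler_pM2r // ler_peMr ?ler1n // ltW //.
have cov : (size Q <= \sum_(x <- s) count (fun q => `[< bowen d G 0 x e0 q >]) Q)%N.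
  have E (T : Type) (P : pred T) (u : seq T) : count P u = (\sum_(q <- u) P q)%N.
    by rewrite -sum1_count big_mkcond /=; apply: eq_bigr => q _; case: (P q).
  rewrite -sum1_size (eq_bigr _ (fun x _ => E _ _ _)) exchange_big /= big_seq_cond [X in (_ <= X)%N]big_seq_cond.
  apply: leq_sum => q /andP[qQ _]; have [y ys qy] := Hs q.
  rewrite -(E _ (fun x => `[< bowen d G 0 x e0 q >])) -has_count; apply/hasP; exists y => //; apply/asboolP => i.
  by rewrite leqn0 => /eqP -> /=; rewrite (pm_C Hd).
have : r ^+ 2 * (size Q)%:R <= r ^+ 2 * (\sum_(x <- s) count (fun q => `[< bowen d G 0 x e0 q >]) Q)%:R.
  by rewrite ler_wpM2l ?ler_nat // exprn_ge0 // ltW.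
move=> h; apply: le_trans h _; rewrite natr_sum mulr_sumr.
apply: le_trans (_ : \sum_(x <- s) K <= _).
  apply: ler_sum => x _; have [_ h] := HK 0%N r Q r0 Kr' nQ 0%N x (leqnn _).
  by apply: le_trans h _; rewrite /wgt big_ord0 mulr1.
rewrite big_const_seq count_predT iter_addr_0 -[K *+ _]mulr_natr.
by apply: ler_wpM2l; [exact: ltW|rewrite ler_nat].
Qed.

Lemma bowen_cover : exists2 e0 : R, 0 < e0 & exists2 K : R, 1 <= K & forall e n (r : R) x,
  e <= e0 -> 0 < r -> K * r * C ^+ n <= 1 -> exists2 s : seq M,
    forall y, bowen d G n x e y -> exists2 q, q \in s & d q y <= r &
    r ^+ 2 * (size s)%:R <= K * wgt G a n x.
Proof.
have [e0 e00 He] := volume_estimate Hd H; exists e0 => //.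
have [|K K1 HK] := He e0; first by rewrite e00 lexx.
exists K => // e n r x ee r0 Kr.
have [Q nQ cQ] := net_adapted Hd tb (fun q => bowen d G n x e q) r0.
exists (seq.filter (fun q => `[< bowen d G n x e q >]) Q).
  move=> y /cQ[q [qQ bq yq]]; exists q; last by rewrite (pm_C Hd).
  by rewrite mem_filter qQ andbT; apply/asboolP.
have [_ h] := HK n r Q r0 Kr nQ n x (leqnn _); apply: le_trans h.
rewrite size_filter ler_wpM2l ?exprn_ge0 ?(ltW r0) // ler_nat.
by apply: sub_count => q /asboolP h; apply/asboolP; exact: bowenW h.
Qed.

End BallCounts.

Lemma geometric_small (R : realType) (x e : R) : 0 <= x < 1 -> 0 < e -> exists k0 : nat, x ^+ k0 <= e.
Proof.
move=> /andP[x0 x1] e0; have /cvgrPdist_lt /(_ e e0) : (fun n => x ^+ n) @ \oo --> (0 : R).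
  by apply: cvg_expr; rewrite ger0_norm.
move=> [N _ HN]; exists N; have := HN N (leqnn N) => /=.
by rewrite sub0r normrN ger0_norm ?exprn_ge0 // => /ltW.
Qed.

Lemma geometric_series_le (R : realType) (x : R) n : 0 <= x < 1 -> \sum_(k < n) x ^+ k <= (1 - x)^-1.
Proof.
move=> /andP[x0 x1]; have y0 : 0 < 1 - x by rewrite subr_gt0.
rewrite -[leRHS]mul1r ler_pdivlMr // mulrC.
have := subrX1 x n; rewrite -[x - 1]opprB -[x ^+ n - 1]opprB mulNr => /oppr_inj <-.
by rewrite gerBl exprn_ge0.
Qed.

(** Turns a sequence of finite families into one sequence. Nonempty families guarantee that the
    concatenation of the first n has at least n entries, so that every index is reached. *)
Lemma flatten_enum (T : eqType) (x0 : T) (L : nat -> seq T) : (forall k, (0 < size (L k))%N) ->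
  exists U : nat -> T, (forall n, exists s, flatten [seq L k | k <- iota 0 n] = [seq U i | i <- iota 0 n] ++ s) /\
    forall k c, c \in L k -> exists i, U i = c.
Proof.
move=> L0; pose fl n := flatten [seq L k | k <- iota 0 n].
have flS n : fl n.+1 = fl n ++ L n by rewrite /fl -addn1 iotaD map_cat flatten_cat /= cats0.
have sz n : (n <= size (fl n))%N.
  by elim: n => [//|n IH]; rewrite flS size_cat -addn1 leq_add.
have pre m n : (m <= n)%N -> exists s, fl n = fl m ++ s.
  elim: n => [|n IH]; first by rewrite leqn0 => /eqP ->; exists [::]; rewrite cats0.
  rewrite leq_eqVlt => /orP[/eqP ->|/IH[s E]]; first by exists [::]; rewrite cats0.
  by exists (s ++ L n); rewrite flS E catA.
have nthE m n i : (i < size (fl m))%N -> (i < size (fl n))%N -> nth x0 (fl m) i = nth x0 (fl n) i.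
  wlog mn : m n / (m <= n)%N.
    move=> W; case/orP: (leq_total m n) => h; first exact: W.
    by move=> h1 h2; symmetry; apply: W.
  by have [s ->] := pre m n mn; rewrite nth_cat => ->.
pose U i := nth x0 (fl i.+1) i; exists U; split=> [n|k c ck].
  exists (drop n (fl n)); rewrite -/(fl n) -[LHS](cat_take_drop n); congr (_ ++ _).
  apply: (@eq_from_nth _ x0); first by rewrite size_takel // size_map size_iota.
  move=> i; rewrite size_takel // => ni; rewrite nth_take // (nth_map 0%N) ?size_iota // nth_iota // add0n.
  by apply: nthE; [exact: leq_trans ni (sz n)|exact: sz].
have cf : c \in fl k.+1 by rewrite flS mem_cat ck orbT.
exists (index c (fl k.+1)); rewrite /U (nthE _ k.+1) ?index_mem //; first exact: nth_index.
Qed.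

Section DimensionEstimates.
Variables (R : realType) (M : pointedType) (d : M -> M -> R) (rd : M -> M -> \bar R).
Hypothesis Hd : pseudo_metric d.
Variables (C c0 : R).
Hypothesis C1 : 1 <= C.
Hypothesis c00 : 0 < c0.
Hypothesis d_le : forall p q, ((d p q)%:E <= C%:E * rd p q)%E.
Hypothesis le_d : forall p q, d p q < c0 -> (rd p q <= (C * d p q)%:E)%E.

Lemma diam_ball x (r : R) : 0 <= r -> 2 * r < c0 -> (diam rd [set y | (d x y <= r)%R] <= (2 * C * r)%:E)%E.
Proof.
move=> r0 rc; apply: ge_ereal_sup => _ [->|[[y z] [/= xy xz] <-]].
  by rewrite lee_fin !mulr_ge0 // (le_trans ler01).
have yz : d y z <= 2 * r by have := pm_T Hd x y z; rewrite (pm_C Hd y x); lra.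
apply: le_trans (le_d (le_lt_trans yz rc)) _; rewrite lee_fin.
by rewrite (_ : 2 * C * r = C * (2 * r)); [rewrite ler_wpM2l // (le_trans ler01)|ring].
Qed.

Lemma diam_ge0 (U : set M) : (0 <= diam rd U)%E.
Proof. by apply: ereal_sup_ubound; left. Qed.

Lemma diam_empty x (r : R) : (forall p q, 0 <= d p q) -> r < 0 -> diam rd [set y | (d x y <= r)%R] = 0%E.
Proof.
move=> d0 r0; apply/eqP; rewrite eq_le diam_ge0 andbT; apply: ge_ereal_sup => _ [->|[[y z] [/= xy _] <-]]; first by [].
by have := le_lt_trans (le_trans (d0 x y) xy) r0; rewrite ltxx.
Qed.

(** Covers come as finite families of balls with geometrically decaying sums, one family for each
    time; the total is at most four times [eps], up to constants. *)
Lemma hausdorff_null (s : R) (A : set M) : 0 < s ->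
  (forall eps rho : R, 0 < eps -> 0 < rho -> exists L : nat -> seq (M * R),
    [/\ forall k c, c \in L k -> 0 <= c.2 <= rho,
        forall p, A p -> exists k c, c \in L k /\ d c.1 p <= c.2 &
        forall k, \sum_(c <- L k) c.2 `^ s <= eps * (3 / 4) ^+ k]) ->
  hausdorff_measure rd s A = 0%E.
Proof.
move=> s0 H.
have pre0 delta : (0 <= hausdorff_premeasure rd s delta A)%E.
  by apply: le_ereal_inf_tmp => _ [U _ <-]; apply: nneseries_ge0 => i _ _; exact: poweR_ge0.
apply/eqP; rewrite eq_le; apply/andP; split; last first.
  apply: le_trans (pre0 1) _; apply: ereal_sup_ubound; exists 1 => //=; exact: ltr01.
apply: ge_ereal_sup => _ [delta /= delta0 <-].
apply/lee_addgt0Pr => e e0; rewrite add0e.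
have d0 := pm_ge0 Hd; have C0 : 0 < C by have := C1; lra.
pose K := (2 * C) `^ s.
have K0 : 0 < K by rewrite powR_gt0 // mulr_gt0.
have eps0 : 0 < e / (4 * K) by rewrite divr_gt0 // mulr_gt0.
pose rho := Num.min (c0 / 4) (delta / (2 * C)).
have rho0 : 0 < rho by rewrite lt_min !divr_gt0 // mulr_gt0.
have rhoc : 2 * rho < c0.
  apply: le_lt_trans (_ : 2 * (c0 / 4) < _); first by rewrite ler_pM2l // ge_min lexx.
  by have := c00; lra.
have rhod : 2 * C * rho <= delta.
  by rewrite mulrC -ler_pdivlMr ?mulr_gt0 // ge_min lexx orbT.
have [L [L1 L2 L3]] := H _ _ eps0 rho0.
(* A ball of negative radius is empty and has diameter 0; it makes each family nonempty at no
   cost. *)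
pose L' k := (point, -1 : R) :: L k.
have [U [U1 U2]] := @flatten_enum _ (point, -1 : R) L' (fun=> isT).
pose V (c : M * R) : set M := [set y | (d c.1 y <= c.2)%R].
have UL i : exists k, U i \in L' k.
  have [t Et] := U1 i.+1.
  have : U i \in flatten [seq L' k | k <- iota 0 i.+1].
    by rewrite Et mem_cat map_f // mem_iota /=.
  by move=> /flattenP[_ /mapP[k _ ->] h]; exists k.
have dV k c : c \in L' k -> (diam rd (V c) <= (2 * C * Num.max 0 c.2)%:E)%E.
  rewrite inE => /orP[/eqP ->|/L1/andP[r0 r1]] /=.
    by rewrite /V diam_empty //= ?ltrN10 // lee_fin !mulr_ge0 ?(ltW C0) // le_max lexx.
  have -> : Num.max 0 c.2 = c.2 by apply/max_idPr.
  by apply: diam_ball => //; apply: le_lt_trans rhoc; rewrite ler_pM2l.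
have VF k : (\sum_(c <- L' k) poweR (diam rd (V c)) s <= (e / 4 * (3 / 4) ^+ k)%:E)%E.
  rewrite big_cons {1}/V (@diam_empty point (-1)) ?ltrN10 // poweR_EFin powR0 ?gt_eqF // add0e.
  apply: le_trans (_ : (\sum_(c <- L k) K * c.2 `^ s)%:E <= _)%E.
    rewrite -sumEFin big_seq_cond [X in (_ <= X)%E]big_seq_cond.
    apply: lee_sum => c /andP[cL _]; have /andP[r0 r1] := L1 k c cL.
    have cc : (2 * C * c.2) `^ s = K * c.2 `^ s by rewrite powRM // mulr_ge0 // ltW.
    rewrite -cc -poweR_EFin; apply: gt0_ler_poweR; rewrite ?(ltW s0) //.
    - by rewrite in_itv /= diam_ge0 leey.
    - by rewrite in_itv /= lee_fin leey andbT !mulr_ge0 // ltW.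
    by apply: diam_ball => //; apply: le_lt_trans rhoc; rewrite ler_pM2l.
  rewrite lee_fin -mulr_sumr; apply: le_trans (ler_wpM2l (ltW K0) (L3 k)) _.
  by rewrite le_eqVlt; apply/orP; left; apply/eqP; field; rewrite gt_eqF.
apply: le_trans (_ : (\sum_(0 <= i <oo) poweR (diam rd (V (U i))) s <= _)%E).
  apply: ereal_inf_lbound; exists (fun i => V (U i)) => //; split.
    move=> p /L2[k [c [cL cp]]]; have [|i Ui] := U2 k c; first by rewrite inE cL orbT.
    by exists i => //; rewrite /V Ui.
  move=> i; have [k /[dup] Uk /dV h] := UL i; apply: le_trans h _; rewrite lee_fin.
  apply: le_trans rhod; rewrite ler_wpM2l ?mulr_ge0 ?(ltW C0) // ge_max (ltW rho0) /=.
  move: Uk; rewrite inE => /orP[/eqP -> /=|/L1/andP[]//].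
  by apply: le_trans (ltW rho0); rewrite lerN10.
apply: lime_le; first by apply: is_cvg_nneseries => i _ _; exact: poweR_ge0.
apply: nearW => n /=.
have [t Et] := U1 n.
apply: le_trans (_ : (\sum_(c <- flatten [seq L' k | k <- iota 0 n]) poweR (diam rd (V c)) s <= _)%E).
  rewrite Et big_cat big_map /index_iota subn0 /=.
  by rewrite leeDl // sume_ge0 // => c _; exact: poweR_ge0.
rewrite big_flatten /= big_map.
apply: le_trans (_ : (\sum_(k <- iota 0 n) (e / 4 * (3 / 4) ^+ k)%:E <= _)%E).
  by apply: lee_sum => k _; exact: VF.
rewrite sumEFin lee_fin -mulr_sumr.
have -> : \sum_(i <- iota 0 n) (3 / 4 : R) ^+ i = \sum_(i < n) (3 / 4) ^+ i.
  by rewrite -(big_mkord xpredT (fun i => (3 / 4 : R) ^+ i)) /index_iota subn0.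
have h := @geometric_series_le R (3 / 4) n (ltac:(apply/andP; split; lra)).
have e4 : 0 <= e / 4 by rewrite divr_ge0 // ltW.
apply: le_trans (ler_wpM2l e4 h) _; rewrite le_eqVlt; apply/orP; left; apply/eqP.
have -> : 1 - 3 / 4 = (4^-1 : R) by lra.
by rewrite invrK divfK.
Qed.

Lemma powR_small (t e r1 : R) : 0 < t -> 0 < e -> 0 < r1 -> exists2 r : R, 0 < r <= r1 & r `^ t <= e.
Proof.
move=> t0 e0 r10; exists (Num.min r1 (e `^ t^-1)).
  by rewrite lt_min r10 powR_gt0 //= ge_min lexx.
have {2}-> : e = (e `^ t^-1) `^ t by rewrite -powRrM mulVf ?gt_eqF // powRr1 // ltW.
apply: ge0_ler_powR; rewrite ?nnegrE ?powR_ge0 ?(ltW t0) //.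
  by rewrite le_min powR_ge0 ltW.
by rewrite ge_min lexx orbT.
Qed.

(** For s > 2 the s-sum of a packing is at most delta^(s - 2) times its 2-sum, and the 2-sum is
    bounded since disjoint balls have bounded total area. *)
Lemma packing_null (s b0 K K' : R) (A : set M) : totally_bounded d -> 2 < s -> 0 < b0 -> 0 < K -> 1 <= K' ->
  (forall x b r Q, 0 < r -> 2 * r <= b -> b < b0 -> net d r Q ->
    b ^+ 2 <= K * (r ^+ 2 * (count (fun q => `[< d x q <= b >]) Q)%:R)) ->
  (forall r Q, 0 < r -> K' * r <= 1 -> net d r Q -> r ^+ 2 * (size Q)%:R <= K') ->
  packing_measure rd s A = 0%E.
Proof.
move=> tb s2 b00 K0 K'1 Hb Hs; have K'0 : 0 < K' by lra.
have C0 : 0 < C by have := C1; lra.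
pose K2 := 4 * C ^+ 2 * (K * K').
have K20 : 0 < K2 by rewrite !mulr_gt0 // exprn_gt0.
have bound delta (F : set M) y : 0 < delta -> delta <= Num.min c0 b0 -> packing_sums rd s delta F y ->
    (y <= (delta `^ (s - 2) * K2)%:E)%E.
  rewrite le_min => delta0 /andP[dc db] [m [c [r [Hr tr ->]]]]; rewrite lee_fin.
  pose b i := r i / C.
  have b_gt0 i : 0 < b i by rewrite divr_gt0 //; have [_] := Hr i.
  have rC i : r i = C * b i by rewrite /b; field; rewrite gt_eqF.
  have br i : b i <= r i by rewrite rC ler_peMl // ltW.
  have r_lt i : r i < delta by have [_ h1 h2] := Hr i; lra.
  (* The packing is finite, so one net is finer than all its balls. *)
  pose rr := \big[Num.min/K'^-1]_(i < m) (b i / 2).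
  have rr0 : 0 < rr by apply: lt_bigmin => [|i _]; rewrite ?invr_gt0 // divr_gt0.
  have [Q nQ] := net_exists Hd tb rr0.
  have rrb i : 2 * rr <= b i.
    rewrite mulrC -ler_pdivlMr //.
    exact: (@bigmin_le_cond _ _ _ _ i xpredT (fun i => b i / 2) isT).
  have rrK : K' * rr <= 1.
    by rewrite mulrC -ler_pdivlMr // div1r; exact: bigmin_le_id.
  have sQ := Hs rr Q rr0 rrK nQ.
  have cnt : (\sum_(i <- enum 'I_m) count (fun q => `[< (d (c i) q <= b i)%R >]) Q <= count predT Q)%N.
    apply: sum_count_disjoint => //; first exact: enum_uniq.
    move=> i j q _ _ /asboolP qi /asboolP qj; apply: tr => //; exists q; split=> /=.
      by rewrite rC; apply: le_trans (le_d _) _; [rewrite (le_lt_trans qi) // (le_lt_trans (br i)) // (lt_le_trans (r_lt i))|rewrite lee_fin ler_pM2l].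
    by rewrite rC; apply: le_trans (le_d _) _; [rewrite (le_lt_trans qj) // (le_lt_trans (br j)) // (lt_le_trans (r_lt j))|rewrite lee_fin ler_pM2l].
  rewrite big_enum /= count_predT in cnt.
  have sumb : \sum_(i < m) b i ^+ 2 <= K * K'.
    apply: le_trans (_ : \sum_(i < m) K * (rr ^+ 2 * (count (fun q => `[< d (c i) q <= b i >]) Q)%:R) <= _).
      apply: ler_sum => i _; apply: Hb => //.
      exact: le_lt_trans (br i) (lt_le_trans (r_lt i) db).
    rewrite -mulr_sumr ler_pM2l // -mulr_sumr; apply: le_trans sQ.
    by rewrite ler_pM2l ?exprn_gt0 // -natr_sum ler_nat.
  apply: le_trans (_ : \sum_(i < m) delta `^ (s - 2) * (4 * C ^+ 2 * b i ^+ 2) <= _).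
    apply: ler_sum => i _; have [_ ri0 rid] := Hr i.
    have r2 : 0 < 2 * r i by rewrite mulr_gt0.
    have sE : s = (s - 2) + 2%:R by rewrite subrK.
    rewrite {1}sE powRD; last by rewrite (gt_eqF r2) implybT.
    rewrite powR_mulrn ?(ltW r2) //.
    have -> : (2 * r i) ^+ 2 = 4 * C ^+ 2 * b i ^+ 2 by rewrite rC; ring.
    have b2 : 0 <= 4 * C ^+ 2 * b i ^+ 2.
      by apply: mulr_ge0; [rewrite mulr_ge0 // exprn_ge0 // ltW|apply: exprn_ge0; exact: ltW].
    apply: ler_wpM2r => //.
    by apply: ge0_ler_powR; rewrite ?nnegrE ?(ltW r2) ?(ltW delta0) // subr_ge0 ltW.
  rewrite -mulr_sumr ler_wpM2l ?powR_ge0 // -mulr_sumr ler_wpM2l // mulr_ge0 ?exprn_ge0 // ltW //.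
have pre_ge0 F : (0 <= packing_premeasure rd s F)%E.
  apply: le_ereal_inf_tmp => _ [delta _ <-]; apply: ereal_sup_ubound.
  exists 0%N, (fun=> point), (fun=> 1); split; [by case|by case|by rewrite big_ord0].
have pre0 F : packing_premeasure rd s F = 0%E.
  apply/eqP; rewrite eq_le pre_ge0 andbT; apply/lee_addgt0Pr => e e0; rewrite add0e.
  have [|||delta /andP[del0 del1] hdel] := @powR_small (s - 2) (e / K2) (Num.min c0 b0).
  - by rewrite subr_gt0.
  - by rewrite divr_gt0.
  - by rewrite lt_min c00.
  apply: le_trans (_ : ereal_sup (packing_sums rd s delta F) <= _)%E.
    by apply: ereal_inf_lbound; exists delta.
  apply: ge_ereal_sup => y /(bound _ _ _ del0 del1) h; apply: le_trans h _.
  by rewrite lee_fin -ler_pdivlMr.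
apply/eqP; rewrite eq_le; apply/andP; split; last first.
  by apply: le_ereal_inf_tmp => _ [F _ <-]; apply: nneseries_ge0.
apply: ereal_inf_lbound; exists (fun=> setT); first by move=> x _; exists 0%N.
by apply: eseries0 => i _ _; exact: pre0.
Qed.

(** About r^(-2) points of an [r]-net lie in the half ball. Each is moved by less than r/4 into [F],
    and the balls of radius r/(8C) around the new centres are disjoint; for s < 2 their s-sum, of
    order r^(s - 2), exceeds 1 for small [r]. *)
Lemma packing_premeasure_ge1 (s a K : R) (F : set M) x : totally_bounded d -> 0 < s < 2 -> 0 < a -> 1 <= K ->
  (forall y, d x y < a -> forall eta : R, 0 < eta -> exists2 z, F z & d y z < eta) ->
  (forall r Q, 0 < r -> K * r <= 1 -> net d r Q ->
     1 <= K * (r ^+ 2 * (count (fun q => `[< d x q <= a / 2 >]) Q)%:R)) ->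
  (1 <= packing_premeasure rd s F)%E.
Proof.
move=> tb /andP[s0 s2] a0 K1 dF HK; have K0 : 0 < K by lra.
have C0 : 0 < C by have := C1; lra.
apply: le_ereal_inf_tmp => _ [delta /= delta0 <-].
pose K3 := (4 * C) `^ s; have K30 : 0 < K3 by rewrite powR_gt0 // mulr_gt0.
have [|||r /andP[r0 r1] hr] := @powR_small (2 - s) (K * K3)^-1 (Num.min K^-1 delta).
- by rewrite subr_gt0.
- by rewrite invr_gt0 mulr_gt0.
- by rewrite lt_min invr_gt0 K0.
move: r1; rewrite le_min => /andP[rK rdel].
have Kr : K * r <= 1 by rewrite mulrC -ler_pdivlMr // div1r.
have [Q [uQ sQ nQ]] := net_exists Hd tb r0.
have h1 := HK r Q r0 Kr (And3 uQ sQ nQ).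
set P := fun q => `[< d x q <= a / 2 >] in h1.
have r4 : 0 < r / 4 by rewrite divr_gt0.
have /choice[z zP] : forall q, exists z, d x q <= a / 2 -> F z /\ d q z < r / 4.
  move=> q; have [qa|qa] := leP (d x q) (a / 2); last by exists point.
  by have [|z Fz qz] := dF q _ (r / 4) r4; [lra|exists z].
pose E := seq.filter P Q; have uE : uniq E by rewrite filter_uniq.
pose c (i : 'I_(size E)) := z (nth point E i).
have Ei (i : 'I_(size E)) : d x (nth point E i) <= a / 2 /\ nth point E i \in Q.
  have : nth point E i \in E by rewrite mem_nth.
  by rewrite mem_filter => /andP[/asboolP].
pose rho := r / (8 * C); have rho0 : 0 < rho by rewrite divr_gt0 // mulr_gt0.
have rhoE : 2 * rho = r / (4 * C) by rewrite /rho; field; rewrite gt_eqF.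
have Crho : C * rho = r / 8 by rewrite /rho; field; rewrite gt_eqF.
apply: le_trans (_ : (\sum_(i < size E) (2 * rho) `^ s)%:E <= _)%E; last first.
  apply: ereal_sup_ubound; exists (size E), c, (fun=> rho); split => //.
    move=> i; have [h _] := Ei i; have [Fz _] := zP _ h; split=> //.
    rewrite rhoE; apply: le_trans rdel; rewrite ler_pdivrMr ?mulr_gt0 // ler_peMr ?(ltW r0) //.
    by have := C1; lra.
  move=> i j _ _ [p [/= pi pj]].
  have near k : (rd (c k) p <= rho%:E)%E -> d (c k) p <= r / 8.
    move=> h; rewrite -Crho -lee_fin EFinM; apply: le_trans (d_le _ _) _.
    by apply: lee_wpmul2l => //; rewrite lee_fin ltW.
  have [hi qi] := Ei i; have [hj qj] := Ei j.
  have [_ zi] := zP _ hi; have [_ zj] := zP _ hj.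
  have ni := near i pi; have nj := near j pj.
  apply: val_inj; apply/eqP; rewrite -(nth_uniq point (ltn_ord i) (ltn_ord j) uE); apply/negPn/negP => ne.
  have := sQ _ _ qi qj ne.
  have t1 := pm_T Hd (c i) (nth point E i) (nth point E j).
  have t2 := pm_T Hd p (c i) (nth point E j).
  have t3 := pm_T Hd (c j) p (nth point E j).
  rewrite (pm_C Hd p (c j)) (pm_C Hd (c j) (nth _ _ _)) in t3.
  rewrite -/(c i) in zi; rewrite -/(c j) in zj; lra.
apply: le_trans (_ : (1%R)%:E <= _)%E; first by [].
rewrite lee_fin rhoE sumr_const card_ord -[_ *+ size E]mulr_natl.
have eq1 : (r / (4 * C)) `^ s = r `^ s / K3.
  rewrite powRM ?invr_ge0 ?(ltW r0) ?mulr_ge0 ?(ltW C0) //; congr (_ * _).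
  have C40 : 0 < 4 * C by rewrite mulr_gt0.
  by rewrite /K3 /powR invr_eq0 (gt_eqF C40) lnV ?posrE // mulrN expRN.
have eq2 : r `^ s * r `^ (2 - s) = r ^+ 2.
  rewrite -powRD; last by rewrite (gt_eqF r0) implybT.
  by rewrite addrC subrK powR_mulrn // ltW.
rewrite eq1 mulrA ler_pdivlMr // mul1r.
have rs0 : 0 < r `^ s by rewrite powR_gt0.
have m0 : 0 <= (size E)%:R * r `^ s :> R by rewrite mulr_ge0 // ltW.
have h2 : r `^ (2 - s) * (K * K3) <= 1 by rewrite -ler_pdivlMr ?mulr_gt0 // div1r.
apply: le_trans (_ : (size E)%:R * r `^ s * (r `^ (2 - s) * (K * K3)) <= _); last by rewrite ler_piMr.
have -> : (size E)%:R * r `^ s * (r `^ (2 - s) * (K * K3)) = K * (r ^+ 2 * (size E)%:R) * K3.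
  by rewrite -eq2; ring.
by rewrite -[leLHS]mul1r ler_wpM2r ?(ltW K30) // /E size_filter.
Qed.

(** Baire category: were every [F i] nowhere dense, nested closed balls could be chosen with the
    k-th inside [U k] and off [F k], and a common point would contradict the covering. *)
Lemma baire_somewhere_dense (U F : nat -> set M) :
  (forall P : R -> M -> Prop, (forall x, exists2 e : R, 0 < e & forall y (r : R), d x y < e -> 0 < r < e -> P r y) ->
     exists2 r : R, 0 < r & forall x, P r x) ->
  (forall k x, U k x -> exists2 e : R, 0 < e & forall y, d x y < e -> U k y) ->
  (forall k x (a : R), 0 < a -> exists2 y, U k y & d x y < a) ->
  \bigcap_k U k `<=` \bigcup_k F k ->
  exists i x, exists2 a : R, 0 < a &
    forall y, d x y < a -> forall eta : R, 0 < eta -> exists2 z, F i z & d y z < eta.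
Proof.
move=> cpt oU dU UF; apply: contrapT => N.
have {}N i x (a : R) : 0 < a -> exists2 y, d x y < a & exists2 eta : R, 0 < eta & forall z, F i z -> eta <= d y z.
  move=> a0; apply: contrapT => h; apply: N; exists i, x; exists a => // y xy eta eta0.
  apply: contrapT => h2; apply: h; exists y => //; exists eta => // z Fz.
  by rewrite leNgt; apply/negP => yz; apply: h2; exists z.
have step k (p : M * R) : exists p' : M * R, 0 < p.2 -> 0 < p'.2 /\
    forall y, d p'.1 y <= p'.2 -> [/\ d p.1 y <= p.2, U k y & ~ F k y].
  case: p => x a /=; have [a0|] := ltP 0 a; last by exists (x, a).
  have a2 : 0 < a / 2 by rewrite divr_gt0.
  have [y1 Uy1 xy1] := dU k x _ a2; have [e1 e10 He1] := oU k y1 Uy1.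
  pose m := Num.min e1 (a / 2); have m0 : 0 < m by rewrite lt_min e10.
  have [me ma] : m <= e1 /\ m <= a / 2 by rewrite !ge_min !lexx orbT.
  have m2 : 0 < m / 2 by rewrite divr_gt0.
  have [y2 y12 [eta eta0 Heta]] := N k y1 _ m2.
  exists (y2, Num.min (m / 4) (eta / 2)) => _ /=; split; first by rewrite lt_min !divr_gt0.
  move=> y; rewrite le_min => /andP[h1 h2].
  have t1 := pm_T Hd y2 y1 y; have t2 := pm_T Hd y1 x y.
  split; [lra|apply: He1; lra|].
  by move=> /Heta; lra.
have /choice[f fP] : forall k, exists f : M * R -> M * R, forall p, 0 < p.2 -> 0 < (f p).2 /\
    forall y, d (f p).1 y <= (f p).2 -> [/\ d p.1 y <= p.2, U k y & ~ F k y].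
  by move=> k; have /choice[f fP] := step k; exists f.
pose P := fix P k := if k is k'.+1 then f k' (P k') else (point, 1 : R).
have P0 k : 0 < (P k).2 by elim: k => [|k IH] /=; [exact: ltr01|have [] := fP k _ IH].
pose B k y := d (P k).1 y <= (P k).2.
have BS k y : B k.+1 y -> [/\ B k y, U k y & ~ F k y] by have [_] := fP k _ (P0 k); exact.
have Bm m k y : (m <= k)%N -> B k y -> B m y.
  elim: k => [|k IH]; first by rewrite leqn0 => /eqP ->.
  by rewrite leq_eqVlt => /orP[/eqP -> //|/IH h /BS[/h Bmy _ _]].
have [y yB] : exists y, forall n, B n y.
  apply: contrapT => nB; have {}nB y : exists n, ~ B n y.
    by apply: contrapT => h; apply: nB; exists y => n; apply: contrapT => h2; apply: h; exists n.
  (* Nonempty intersection from [cpt]: a scale [r] stands for all indices at least r^-1. If every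
     point left some ball, one index would be left by all points, including the centre of that
     ball. *)
  have [x|r r0 Hr] := cpt (fun r y => forall n : nat, r^-1 <= n%:R -> ~ B n y).
    have [n /negP] := nB x; rewrite -ltNge => hn.
    exists (Num.min (d (P n).1 x - (P n).2) n.+1%:R^-1); first by rewrite lt_min subr_gt0 hn invr_gt0 ltr0n.
    move=> y r; rewrite !lt_min => /andP[xy _] /andP[r0 /andP[_ rn]] n' hn' /(Bm n) h.
    have nn : (n <= n')%N.
      have h1 : n.+1%:R < r^-1 by rewrite -[n.+1%:R]invrK ltf_pV2 ?posrE ?invr_gt0.
      by rewrite ltnW //; have := lt_le_trans h1 hn'; rewrite ltr_nat => /ltnW.
    have {}h := h nn; have t := pm_T Hd y (P n).1 x; rewrite (pm_C Hd y x) in t.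
    by rewrite /B in h; lra.
  pose n := (Num.truncn r^-1).+1.
  apply: (Hr (P n).1 n); first by rewrite ltW // truncnS_gt.
  by rewrite /B (pm_xx Hd) ltW.
have [|k _ Fk] := UF y; first by move=> k _; have [_ ] := BS k y (yB k.+1).
by have [_ _] := BS k y (yB k.+1).
Qed.

(** At time [k * N] the low set is covered by Bowen balls, and these by balls of radius [r k]. With
    exponent 2 the sum is at most a constant times their total weight, hence decays like 2^-k;
    lowering the exponent by [sig] costs at most (3/2)^k, leaving (3/4)^k. *)
Lemma low_decay_null (G : M -> M) (ku ks : M -> M -> R) (al : M -> R) (Cg : R) (phi : M -> R)
    (c e e0 e1 K Ke : R) : totally_bounded d -> hyp_chart d G ku ks al Cg ->
  0 < e -> e <= e0 -> 1 <= K ->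
  (forall e n (r : R) x, e <= e0 -> 0 < r -> K * r * Cg ^+ n <= 1 -> exists2 s : seq M,
    forall y, bowen d G n x e y -> exists2 q, q \in s & d q y <= r &
    r ^+ 2 * (size s)%:R <= K * wgt G al n x) ->
  bowen_mass d G (wgt G al) e1 (e / 2) Ke ->
  low_decays d G (wgt G al) phi c e ->
  exists2 N : nat, (0 < N)%N & exists2 s : R, 0 < s < 2 &
    hausdorff_measure rd s [set p | forall k0, exists2 k, (k0 <= k)%N &
      birkhoff G phi (k * N) p <= c * (k * N)%:R] = 0%E.
Proof.
move=> tb H e_gt0 ee0 K1 Hcov Hm [N N0 HN]; exists N => //.
have K0 : 0 < K by apply: lt_le_trans K1.
have C3 : 3 <= Cg by have /andP[h1 h2] := hc_rate H point; apply: le_trans h2.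
have Cg0 : 0 < Cg by apply: lt_le_trans C3.
pose X := Cg ^+ N.
have X3 : 3 <= X.
  apply: (le_trans C3); rewrite /X -{1}[Cg]expr1 ler_weXn2l //.
  by apply: (le_trans _ C3); rewrite ler1n.
have X1 : 1 <= X by apply: le_trans X3; rewrite ler1n.
have X0 : 0 < X by apply: lt_le_trans X1.
have lnX : 0 < ln X by rewrite ln_gt0 //; apply: lt_le_trans X3; rewrite ltr1n.
have q1 : 1 < 3 / 2 :> R by lra.
(* Chosen so that X^sig <= 3/2, where the radii decrease by the factor [X] per block. *)
pose sig := Num.min 1 (ln (3 / 2) / ln X).
have sig0 : 0 < sig by rewrite lt_min ltr01 divr_gt0 // ln_gt0.
have sig1 : sig <= 1 by rewrite ge_min lexx.
have Xsig : X `^ sig <= 3 / 2.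
  apply: le_trans (_ : X `^ (ln (3 / 2) / ln X) <= _).
    by apply: ler_powR => //; rewrite ge_min lexx orbT.
  rewrite /powR (gt_eqF X0) divfK ?gt_eqF // lnK // posrE; lra.
exists (2 - sig); first by apply/andP; split; lra.
pose D k p := birkhoff G phi (k * N) p <= c * (k * N)%:R.
pose r k := (K * X ^+ k)^-1.
have Y0 k : 0 < K * X ^+ k by rewrite mulr_gt0 // exprn_gt0.
have r0 k : 0 < r k by rewrite invr_gt0.
have rE k : K * r k * Cg ^+ (k * N) <= 1.
  have -> : Cg ^+ (k * N) = X ^+ k by rewrite /X -exprM mulnC.
  by rewrite mulrAC mulfV // gt_eqF.
have /choice[E EP] : forall k, exists E : seq M, [/\ separated d G (k * N) e E,
    forall x, x \in E -> D k x & forall z, D k z -> exists2 x, x \in E & bowen d G (k * N) x e z].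
  move=> k; have ie : e = 2 * (e / 2) by rewrite mulrC divfK.
  have hL : 0 < Cg^-1 ^+ (k * N) by rewrite exprn_gt0 // invr_gt0.
  have := @maximal_separated_mass R M d G (wgt G al) Hd e1 (e / 2) Ke (Cg^-1 ^+ (k * N)) (k * N)%N (D k) Hm hL.
  rewrite -ie; apply.
  by move=> x; have /andP[] := wgt_bounds H (k * N) x.
have /choice[S SP] : forall kx : nat * M, exists s : seq M,
    (forall y, bowen d G (kx.1 * N) kx.2 e y -> exists2 q, q \in s & d q y <= r kx.1) /\
    r kx.1 ^+ 2 * (size s)%:R <= K * wgt G al (kx.1 * N) kx.2.
  by case=> k x /=; have [s h1 h2] := Hcov e (k * N)%N (r k) x ee0 (r0 k) (rE k); exists s.
have powE k : r k `^ (2 - sig) <= r k ^+ 2 * (K * (3 / 2) ^+ k).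
  have h1 : r k `^ (2 - sig) * r k `^ sig = r k ^+ 2.
    rewrite -powRD; last by rewrite (gt_eqF (r0 k)) implybT.
    by rewrite subrK powR_mulrn // ltW.
  have h2 : r k `^ sig * (K * X ^+ k) `^ sig = 1.
    rewrite -powRM ?(ltW (r0 k)) ?(ltW (Y0 k)) // mulVf ?powR1 // gt_eqF //.
  have h3 : (K * X ^+ k) `^ sig <= K * (3 / 2) ^+ k.
    have Xk0 : 0 <= X ^+ k by rewrite exprn_ge0 // ltW.
    have hK : K `^ sig <= K by rewrite -[leRHS]powRr1 ?(ltW K0) //; apply: ler_powR.
    have hX : (X ^+ k) `^ sig <= (3 / 2) ^+ k.
      rewrite -powR_mulrn ?(ltW X0) // -powRrM mulrC powRrM powR_mulrn ?powR_ge0 //.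
      by rewrite lerXn2r ?nnegrE ?powR_ge0 //; lra.
    rewrite (powRM _ (ltW K0) Xk0); exact: ler_pM (powR_ge0 _ _) (powR_ge0 _ _) hK hX.
  have -> : r k `^ (2 - sig) = r k ^+ 2 * (K * X ^+ k) `^ sig.
    by rewrite -h1 -mulrA h2 mulr1.
  by rewrite ler_wpM2l // exprn_ge0 // ltW.
apply: hausdorff_null; first by lra.
move=> eps rho eps0 rho0.
have K20 : 0 < K ^+ 2 by rewrite exprn_gt0.
have m0 : 0 < Num.min (eps / K ^+ 2) (Num.min rho (1 / 2)) by rewrite !lt_min rho0 !divr_gt0.
have q34 : 0 <= (3 / 4 : R) < 1 by apply/andP; split; lra.
have /andP[q340 q341] := q34.
have [k0 hk0] := geometric_small q34 m0.
move: hk0; rewrite !le_min => /and3P[hk1 hk2 hk3].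
have k0_gt0 : (0 < k0)%N by rewrite lt0n; apply: contraTneq hk3 => ->; rewrite expr0 -ltNge; lra.
exists (fun k => flatten [seq [seq (q, r (k0 + k)%N) | q <- S ((k0 + k)%N, x)] | x <- E (k0 + k)%N]); split.
- move=> k cc /flattenP[_ /mapP[x _ ->] /mapP[q _ ->]] /=; rewrite (ltW (r0 _)) /=.
  apply: le_trans hk2; apply: le_trans (_ : (3 / 4) ^+ (k0 + k) <= _); last first.
    by rewrite exprD ler_piMr ?exprn_ge0 // exprn_ile1 // ltW.
  have -> : (3 / 4 : R) = (4 / 3)^-1 by rewrite invf_div.
  rewrite exprVn lef_pV2 ?posrE ?exprn_gt0 ?divr_gt0 //.
  apply: le_trans (_ : X ^+ (k0 + k) <= _); last by rewrite ler_peMl // exprn_ge0 // ltW.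
  by rewrite lerXn2r ?nnegrE ?(ltW X0) //; lra.
- move=> p /(_ k0)[k kk Dp]; exists (k - k0)%N; rewrite subnKC //.
  have [_ _ cE] := EP k; have [x xE bx] := cE p Dp.
  have [hs _] := SP (k, x); have [q qS qp] := hs p bx.
  exists (q, r k); split=> //; apply/flattenP; exists [seq (q, r k) | q <- S (k, x)].
    by apply/mapP; exists x.
  by apply/mapP; exists q.
- move=> k; set kk := (k0 + k)%N; rewrite big_flatten /= big_map.
  apply: le_trans (_ : \sum_(x <- E kk) K * wgt G al (kk * N) x * (K * (3 / 2) ^+ kk) <= _).
    apply: ler_sum => x _; rewrite big_map /= big_const_seq count_predT iter_addr_0 -[_ *+ _]mulr_natr.
    have [_ h] := SP (kk, x).
    apply: le_trans (ler_wpM2r _ (powE kk)) _; first by [].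
    have -> : r kk ^+ 2 * (K * (3 / 2) ^+ kk) * (size (S (kk, x)))%:R =
      r kk ^+ 2 * (size (S (kk, x)))%:R * (K * (3 / 2) ^+ kk) by ring.
    by apply: ler_wpM2r h; rewrite mulr_ge0 ?(ltW K0) // exprn_ge0 //; lra.
  rewrite -mulr_suml -mulr_sumr.
  have [sE DE _] := EP kk.
  have h := HN kk (E kk) (ltn_addr _ k0_gt0) sE DE.
  apply: le_trans (_ : K * 2^-1 ^+ kk * (K * (3 / 2) ^+ kk) <= _).
    apply: ler_wpM2r; first by rewrite mulr_ge0 ?(ltW K0) // exprn_ge0 //; lra.
    by apply: ler_wpM2l => //; exact: ltW.
  have -> : K * 2^-1 ^+ kk * (K * (3 / 2) ^+ kk) = K ^+ 2 * (2^-1 * (3 / 2)) ^+ kk by rewrite [in RHS]exprMn; ring.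
  have -> : 2^-1 * (3 / 2) = (3 / 4 : R) by lra.
  rewrite exprD mulrA; apply: ler_wpM2r; first by rewrite exprn_ge0.
  by rewrite mulrC -ler_pdivlMr.
Qed.

End DimensionEstimates.

(** * Dimensions of the zero set *)

Section CompactRiemannian.
Variables (R : realType) (n : nat) (M : ptopologicalType).
Variables (X : riemannian_manifold R n M) (A : finite_charts X).
Hypothesis cM : compact [set: M].
Local Notation d := (mdist A).

Lemma mdist_pseudo_metric : pseudo_metric d.
Proof.
by split=> [x y|x|x y|y x z]; [exact: mdist_ge0|exact: mdistxx|exact: mdistC|exact: mdist_triangle].
Qed.

Lemma mdist_totally_bounded : totally_bounded d.
Proof.
move=> e e0; have := cM; rewrite compact_cover.
have oV (p : M) : [set: M] p -> open [set q | d p q < e] by move=> _; exact: mdist_ball_open.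
move=> /(_ _ setT (fun p => [set q | d p q < e]) oV)[|D _ DV].
  by move=> p _; exists p => //=; rewrite mdistxx.
exists (finmap.enum_fset D) => x; have [p Dp /= px] := DV x I.
by exists p => //; rewrite mdistC ltW.
Qed.

Lemma continuous_mdist (f : M -> R) x (e : R) : continuous f -> 0 < e ->
  exists2 r : R, 0 < r & forall y, d x y < r -> `|f x - f y| < e.
Proof.
by move=> cf e0; apply/(mdist_nbhs A cM); have /cvgrPdist_lt := cf x; exact.
Qed.

Lemma continuous_uniform (f : M -> R) (kap : R) : continuous f -> 0 < kap ->
  exists2 r : R, 0 < r & forall p q, d p q <= r -> `|f p - f q| <= kap.
Proof.
move=> cf k0; have k2 : 0 < kap / 2 by rewrite divr_gt0.
apply: (mdist_compact cM (P := fun r p => forall q, d p q <= r -> `|f p - f q| <= kap)) => x.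
have [r r0 Hr] := continuous_mdist x cf k2.
exists (r / 2); first by rewrite divr_gt0.
move=> y s xy /andP[s0 sr] q yq.
have hy : `|f x - f y| < kap / 2 by apply: Hr; lra.
have hq : `|f x - f q| < kap / 2 by apply: Hr; have := mdist_triangle A y x q; lra.
rewrite distrC in hy; have := ler_distD (f x) (f y) (f q); lra.
Qed.

Lemma continuous_bounded (f : M -> R) : continuous f -> exists B : R, forall x, `|f x| <= B.
Proof.
move=> cf; have [|r r0 Hr] := @mdist_compact R n M X A cM (fun r p => `|f p| <= r^-1); last by exists r^-1.
move=> x; have [r r0 Hr] := continuous_mdist x cf ltr01.
have x0 : 0 < `|f x| + 1 by rewrite ltr_wpDl.
exists (Num.min r (`|f x| + 1)^-1); first by rewrite lt_min r0 invr_gt0.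
move=> y s; rewrite !lt_min => /andP[xy _] /andP[s0 /andP[_ sx]].
apply: (le_trans (_ : _ <= `|f x| + 1)).
  have := Hr y xy; rewrite distrC => h; have := ler_normD (f y - f x) (f x); rewrite subrK; lra.
by rewrite -[leLHS]invrK lef_pV2 ?posrE ?invr_gt0 // ltW.
Qed.

Lemma holder_continuous (g : M -> R) : holder X g -> continuous g.
Proof.
move=> [C [al [C0 /andP[al0 _] Hg]]] p.
have [C1 [c [C11 c0 Hr]]] := rdist_le A cM; have C10 : 0 < C1 by lra.
apply/cvgrPdist_lt => e e0; apply/(mdist_nbhs A cM).
have eC : 0 < e / (2 * C) by rewrite divr_gt0 // mulr_gt0.
have [r /andP[r0 _] hr] := @powR_small R al _ 1 al0 eC ltr01.
exists (Num.min c (r / C1)); first by rewrite lt_min c0 divr_gt0.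
move=> q; rewrite lt_min => /andP[qc qr].
have h1 : (rdist X p q <= r%:E)%E.
  apply: (le_trans (Hr p q qc)); rewrite lee_fin mulrC -ler_pdivlMr //; exact: ltW.
have rd0 : (0 <= rdist X p q)%E.
  apply: le_ereal_inf_tmp => _ [a _ <-]; apply: integral_ge0 => s _; rewrite lee_fin; exact: sqrtr_ge0.
have h2 : (poweR (rdist X p q) al <= (r `^ al)%:E)%E.
  rewrite -poweR_EFin; apply: gt0_ler_poweR; rewrite ?(ltW al0) //.
    by rewrite in_itv /= rd0 leey.
  by rewrite in_itv /= lee_fin (ltW r0) leey.
have : (`|g p - g q|%:E <= (C * (e / (2 * C)))%:E)%E.
  apply: (le_trans (Hg p q)); rewrite EFinM; apply: lee_wpmul2l; first by rewrite lee_fin ltW.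
  by apply: (le_trans h2); rewrite lee_fin.
rewrite lee_fin => h3; apply: (le_lt_trans h3).
have -> : C * (e / (2 * C)) = e / 2 by field; rewrite gt_eqF.
by rewrite ltr_pdivrMr // ltr_pMr // ltr1n.
Qed.

End CompactRiemannian.

Lemma hausdorff_measure_null_sub (R : realType) (M : Type) (d : M -> M -> \bar R) s (A A' : set M) :
  A `<=` A' -> hausdorff_measure d s A' = 0%E -> hausdorff_measure d s A = 0%E.
Proof.
move=> AA h; apply/eqP; rewrite eq_le; apply/andP; split.
  rewrite -h; apply: ge_ereal_sup => _ [delta d0 <-].
  apply: (@le_trans _ _ (hausdorff_premeasure d s delta A')); last by apply: ereal_sup_ubound; exists delta.
  apply: le_ereal_inf_tmp => _ [U [AU dU] <-]; apply: ereal_inf_lbound; exists U => //; split=> //.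
  exact: subset_trans AU.
apply: (@le_trans _ _ (hausdorff_premeasure d s 1 A)); last by apply: ereal_sup_ubound; exists 1 => //=; exact: ltr01.
by apply: le_ereal_inf_tmp => _ [U _ <-]; apply: nneseries_ge0 => i _ _; exact: poweR_ge0.
Qed.

Lemma packing_premeasure_ge0 (R : realType) (M : pointedType) (d : M -> M -> \bar R) s (A : set M) :
  (0 <= packing_premeasure d s A)%E.
Proof.
apply: le_ereal_inf_tmp => _ [delta _ <-]; apply: ereal_sup_ubound.
by exists 0%N, (fun=> point), (fun=> 1); split; [case|case|rewrite big_ord0].
Qed.

Lemma packing_measure_lt1 (R : realType) (M : pointedType) (d : M -> M -> \bar R) s (A : set M) :
  packing_measure d s A = 0%E -> exists2 F : nat -> set M, A `<=` \bigcup_i F i &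
    forall i, (packing_premeasure d s (F i) < 1)%E.
Proof.
move=> h; have [|_ [F AF <-] hF] := @ereal_inf_lt R [set \sum_(0 <= i <oo) packing_premeasure d s (F i) |
    F in [set F : nat -> set M | A `<=` \bigcup_i F i]]%E 1%E.
  by move: h; rewrite /packing_measure => ->; rewrite lte_fin ltr01.
exists F => // i; apply: le_lt_trans hF.
apply: (le_trans _ (nneseries_lim_ge i.+1 _)); last by move=> k _ _; exact: packing_premeasure_ge0.
rewrite big_nat_recr //= leeDr // sume_ge0 // => k _; exact: packing_premeasure_ge0.
Qed.

Lemma hyp_chart_weighted (R : realType) (M : pointedType) (d : M -> M -> R) (G : M -> M)
    ku ks a (C e1 : R) : pseudo_metric d -> totally_bounded d -> hyp_chart d G ku ks a C -> 0 < e1 ->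
  exists2 e0 : R, e0 <= e1 & weighted_system d G (wgt G a) e0.
Proof.
move=> Hd tb H e10; have [e2 e20 He] := bowen_mass_exists Hd H tb.
exists (Num.min e1 e2); first by rewrite ge_min lexx.
split => //.
- by move=> n x; exact: wgt_gt0 H _ _.
- by move=> n m x; exact: wgtD.
- by apply/funext => x; rewrite /wgt big_ord0.
- have C1 := hc_C H; exists C^-1; first by rewrite invr_gt0; lra.
  by move=> n x; have /andP[] := wgt_bounds H n x.
- by rewrite lt_min e10.
move=> e; rewrite le_min => /and3P[e_gt0 ee1 ee2].
have [|K [_ K1 HK]] := He e; first by rewrite e_gt0.
exists K; split=> //; first by rewrite e_gt0 le_min ee1.
move=> n; have [Q [rho [rho0 h1 h2]]] := HK n; exists Q, rho; split=> // j x jn.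
have [h3 h4] := h1 j x jn; split=> //; apply: le_trans h4.
rewrite ler_pM2l // ler_nat; apply: sub_count => q /asboolP h; apply/asboolP.
by apply: bowenW h; rewrite ge_min lexx orbT.
Qed.

(** The sum has mean [n] times the mean of [phi] by invariance, so it cannot exceed n c
    everywhere. *)
Lemma mean_orbit_sum (R : realType) (M : ptopologicalType) (mu : probability (borel M) R) (T F : M -> M)
    (phi : M -> R) (c : R) n : compact [set: M] -> cancel T F -> continuous F -> invariant_probability T mu ->
  continuous phi -> mean phi mu < c -> exists y, \sum_(i < n) phi (iter i.+1 F y) <= n%:R * c.
Proof.
move=> cM KT cF inv cphi hc; case: n => [|n]; first by exists point; rewrite big_ord0 mul0r.
apply: contrapT => N.
have {}N y : n.+1%:R * c <= \sum_(i < n.+1) phi (iter i.+1 F y).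
  by rewrite leNgt; apply/negP => h; apply: N; exists y; exact: ltW.
have tphi := continuous_tame cM cphi.
have tI (i : 'I_n.+1) : tame (fun y => phi (iter i.+1 F y)).
  exact: (@tame_comp R M phi (iter i.+1 F) tphi (@continuous_iter M F i.+1 cF)).
have E (i : 'I_n.+1) : mean (fun y => phi (iter i.+1 F y)) mu = mean phi mu.
  apply: (@mean_invariant R M mu phi (iter i.+1 F) tphi (@continuous_iter M F i.+1 cF)) => D mD.
  exact: (invariant_inverse KT cF inv).
have := le_mean mu (tame_cst M (n.+1%:R * c)) (tame_sum _ tI) N.
rewrite mean_cst (mean_sum mu _ tI) (eq_bigr _ (fun i _ => E i)) sumr_const card_ord -[mean phi mu *+ _]mulr_natl.
by rewrite ler_pM2l ?ltr0n // leNgt hc.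
Qed.

Section SkewProductDimensions.
Variables (R : realType) (M : ptopologicalType).
Variables (X : riemannian_manifold R 2 M) (A : finite_charts X).
Variables (T Tinv : M -> M) (Es Eu : M -> {vspace 'rV[R]_2}).
Variables (g : M -> R) (h dh B : R -> R) (mu : probability (borel M) R).
Hypothesis cM : compact [set: M].
Hypothesis HT : Ck_diffeomorphism X 2 T Tinv.
Hypothesis HA : anosov_splitting X T Tinv Es Eu.
Hypothesis HM : topologically_mixing T.
Hypothesis g0 : forall p, 0 < g p.
Hypothesis Hg : holder X g.
Hypothesis Hh : fibre_profile h dh.
Hypothesis HB : forall t, 0 < B t /\ forall p, fibre_map g h t p (B t) < B t.
Hypothesis Hsrb : is_srb_inverse X T Es mu.
Local Notation d := (mdist A).
Local Notation phi := (fun p => ln (g p)).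
Local Notation psi := (fun p => ln (norm_dT_on X T Es p)).
Local Notation S n p := (\sum_(i < n) ln (g (iter i.+1 Tinv p))).
Local Notation N t := (zero_set T Tinv g h B t).

Lemma ln_weight_continuous : continuous phi.
Proof.
move=> p; apply: (@continuous_comp _ _ _ g (@ln R)); first exact: holder_continuous A cM _ Hg p.
exact: continuous_ln.
Qed.

Lemma anosov_hyp_chart : exists2 m : nat, (0 < m)%N & exists ku ks al C,
  [/\ hyp_chart d (iter m Tinv) ku ks al C,
      forall n x, wgt (iter m Tinv) al n x = expR (\sum_(j < n * m) psi (iter j.+1 Tinv x)) &
      continuous psi].
Proof.
have [eS [eU [SeS UeU nuS nuU]]] := unit_frames A cM HT HA HM (isT : (0 < 2)%N).
have Hs := anosov_hyp_splitting A cM HT HA.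
have [Cn Cn1 hn] := nuE A cM.
have [m m0 [C HC]] := hyp_chart_exists cM Hs Cn1 hn (@nuZ R 2 M X A) SeS UeU nuS nuU.
exists m => //; do 4 eexists; split; first exact: HC.
  by move=> n x; exact: (wgt_psi cM HT HA SeS UeU nuS nuU).
move=> p; apply: (@continuous_comp _ _ _ (norm_dT_on X T Es) (@ln R)).
  exact: (rho_cts cM HT HA SeS UeU nuS nuU).
apply: continuous_ln; exact: (rho_gt0 cM HT HA SeS UeU nuS nuU).
Qed.

Lemma orbit_sum_continuous n : continuous (fun p => S n p).
Proof.
have [_ _ _ [cF _]] := HT.
move=> p; apply: continuous_at_sum => i.
apply: (@continuous_comp _ _ _ (iter i.+1 Tinv) phi); first exact: continuous_iter.
exact: ln_weight_continuous.
Qed.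

Lemma orbit_sum_split n1 n2 p : S (n1 + n2) p = S n1 p + S n2 (iter n1 Tinv p).
Proof.
rewrite big_split_ord /=; congr (_ + _); apply: eq_bigr => i _.
by rewrite /= addnC iterD.
Qed.

(** The potential is [phi] summed over [m] steps, since the hyperbolic coordinates belong to the
    [m]-th power of [Tinv]. *)
Lemma zero_set_hausdorff t : t < gamma g mu -> exists2 s : R, 0 < s < 2 & hausdorff_measure (rdist X) s (N t) = 0%E.
Proof.
move=> tg; have [KT KF [cT _] [cF _]] := HT.
have Hd := mdist_pseudo_metric A; have tb := mdist_totally_bounded A cM.
have [m m0 [ku [ks [al [C [H wE cpsi]]]]]] := anosov_hyp_chart.
have mr : 0 < m%:R :> R by rewrite ltr0n.
have [ec ec0 [K K1 Hcov]] := bowen_cover Hd tb H.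
have [e0 e0c W] := hyp_chart_weighted Hd tb H ec0.
have mx := mixes_iter m0 (mixes_backward A cM HT HM).
have spec := mixing_specification Hd H tb mx.
(* Four gaps with four uses: from t to t1 for the criterion on the zero set, from t1 to t2 for
   rounding times down to multiples of the block length, from t2 to t3 for the dichotomy, and from
   t3 to the mean of the SRB measure for the contradiction. *)
pose gap := (gamma g mu - t) / 4; have gap0 : 0 < gap by rewrite divr_gt0 // subr_gt0.
pose t1 := t + gap; pose t2 := t + 2 * gap; pose t3 := t + 3 * gap.
have [tt1 t12 t23 t3g] : [/\ t < t1, t1 < t2, t2 < t3 & t3 < gamma g mu].
  have E : gamma g mu = t + 4 * gap by rewrite /gap; field.
  by rewrite /t1 /t2 /t3 E; split; lra.
pose phiG y := \sum_(s < m) phi (iter s.+1 Tinv y).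
have cphiG : continuous phiG := @orbit_sum_continuous m.
have [B1 HB1] := continuous_bounded A cM cphiG.
have [B0 HB0] := continuous_bounded A cM ln_weight_continuous.
pose BB := `|B1| + `|t2 * m%:R| + `|t3 * m%:R|.
have phiGB x : `|phiG x| <= BB.
  apply: (le_trans (HB1 x)); apply: (le_trans (ler_norm _)); rewrite /BB -addrA lerDl addr_ge0 //.
have b2 : `|t2 * m%:R| <= BB by rewrite /BB addrAC lerDr addr_ge0.
have b3 : `|t3 * m%:R| <= BB by rewrite /BB lerDr addr_ge0.
have t23m : t2 * m%:R < t3 * m%:R by rewrite ltr_pM2r.
have [e e_gt0 [ee0 [low|high]]] := decay_dichotomy W spec phiGB b2 b3 t23m
    (fun kap k0 => continuous_uniform A cM cphiG k0); last first.
  (* High decay is excluded: it would bound the mean of [phi] under the SRB measure by t3. *)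
  have [inv fe pr] := Hsrb; rewrite pr in fe.
  have := @high_decay_mean R M mu d T Tinv (mdist_nbhs A cM) (@mdist_compact R 2 M X A cM) cM KT KF cT cF inv
    m _ e0 psi phi m0 W wE cpsi ln_weight_continuous B0 t3 e HB0 e_gt0 ee0 high fe.
  by move=> h1; have := lt_le_trans t3g h1; rewrite ltxx.
have ee2 : 0 < e / 2 <= e0 by rewrite divr_gt0 //=; lra.
have [Ke Hm] := ws_mass W ee2.
have [Cr [c0 [Cr1 c00 Hr]]] := rdist_le A cM.
have eec : e <= ec by lra.
have [n n0 [s s02 Hs]] := low_decay_null Hd Cr1 c00 Hr tb H e_gt0 eec K1 Hcov Hm low.
exists s => //; apply: hausdorff_measure_null_sub Hs => p Np k0 /=.
have low1 := zero_set_low KF g0 Hh (HB t) tt1 Np.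
have nm0 : (0 < n * m)%N by rewrite muln_gt0 n0.
pose D := (n * m)%:R * (`|t1| + `|B0|).
pose k1 := (Num.truncn (D / gap)).+1.
have hk1 : D < k1%:R * gap by rewrite -ltr_pdivrMr // truncnS_gt.
have [q qk hq] := low1 ((k0 + k1) * (n * m))%N.
(* The sum over the fewer than [n * m] leftover steps is bounded by [D], which [gap] times the
   length absorbs because the time was taken beyond [k1] blocks. *)
pose k := (q %/ (n * m))%N; pose r := (q %% (n * m))%N.
have kk : (k0 + k1 <= k)%N by rewrite leq_divRL.
exists k; first by apply: leq_trans kk; rewrite leq_addr.
rewrite -(sum_iter_blocks Tinv phi).
have qE : q = (k * n * m + r)%N by rewrite -mulnA; exact: divn_eq.
rewrite qE orbit_sum_split natrD mulrDl in hq.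
set a := (k * n * m)%N in hq *.
have rn : (r <= n * m)%N by rewrite ltnW // ltn_pmod.
have hS : `|S r (iter a Tinv p)| <= r%:R * `|B0|.
  apply: (le_trans (ler_norm_sum _ _ _)); apply: (@le_trans _ _ (\sum_(i < r) `|B0|)).
    by apply: ler_sum => i _; apply: (le_trans (HB0 _)); exact: ler_norm.
  by rewrite sumr_const card_ord -[_ *+ r]mulr_natl.
have hr : r%:R * (`|t1| + `|B0|) <= D by rewrite /D ler_wpM2r ?addr_ge0 // ler_nat.
have ht : r%:R * t1 <= r%:R * `|t1| by rewrite ler_wpM2l // ler_norm.
have hS2 : - (r%:R * `|B0|) <= S r (iter a Tinv p) by move: hS; rewrite ler_norml => /andP[].
rewrite mulrDr in hr.
have ha : k1%:R * gap <= a%:R * gap.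
  rewrite ler_pM2r // ler_nat; apply: (leq_trans (n := k)).
    by apply: leq_trans kk; rewrite leq_addl.
  by rewrite /a -mulnA leq_pmulr.
have -> : t2 * m%:R * (k * n)%:R = a%:R * t1 + a%:R * gap by rewrite /t2 /t1 /a natrM; ring.
change (S a p <= a%:R * t1 + a%:R * gap).
clear -hq hS2 ht hr ha hk1; lra.
Qed.

Definition contracting (t : R) (k : nat) : set M := [set p | exists n, S n p - n%:R * t < - k%:R].

Lemma contracting_open t k x : contracting t k x ->
  exists2 e : R, 0 < e & forall y, d x y < e -> contracting t k y.
Proof.
move=> [n hn]; pose e := - k%:R - (S n x - n%:R * t).
have e0 : 0 < e by rewrite subr_gt0.
have [r r0 Hr] := continuous_mdist A cM x (@orbit_sum_continuous n) e0.
exists r => // y xy; exists n; have := Hr y xy; rewrite ltr_norml => /andP[h1 h2].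
by rewrite /e in h1; lra.
Qed.

(** Some invariant measure has mean below [t], hence arbitrarily long orbits have small sums.
    Specification attaches such an orbit to a point near [x] after a gap of fixed length, whose
    contribution a long orbit outweighs. *)
Lemma contracting_dense t k x (a : R) : gamma_min T g < t -> 0 < a ->
  exists2 y, contracting t k y & d x y < a.
Proof.
move=> gt a0; have [KT KF [cT _] [cF _]] := HT.
have Hd := mdist_pseudo_metric A; have tb := mdist_totally_bounded A cM.
have [m m0 [ku [ks [al [C [H wE cpsi]]]]]] := anosov_hyp_chart.
have mr : 0 < m%:R :> R by rewrite ltr0n.
have mx := mixes_iter m0 (mixes_backward A cM HT HM).
have spec := mixing_specification Hd H tb mx.
(* Invariant measures exist, [mu] being one, so the infimum is over a nonempty set and not a default
   value. *)
have [nu inu nut] : exists2 nu, invariant_probability T nu & gamma g nu < t.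
  apply: contrapT => no; move: gt; rewrite ltNge => /negP; apply.
  apply: lb_le_inf; first by exists (gamma g mu); exists mu => //; have [] := Hsrb.
  move=> _ [nu inu <-]; rewrite leNgt; apply/negP => h0; apply: no; by exists nu.
pose gap := (t - gamma g nu) / 3; have gap0 : 0 < gap by rewrite divr_gt0 // subr_gt0.
pose c := gamma g nu + gap.
have tE : t = c + 2 * gap by rewrite /c /gap; field.
have nuc : mean phi nu < c by rewrite /c ltrDl.
pose phiG y := \sum_(s < m) phi (iter s.+1 Tinv y).
have cphiG : continuous phiG := @orbit_sum_continuous m.
have [B1 HB1] := continuous_bounded A cM cphiG.
have kap0 : 0 < m%:R * gap by rewrite mulr_gt0.
have [r r0 Hr] := continuous_uniform A cM cphiG kap0.
pose eta := Num.min (a / 2) r; have eta0 : 0 < eta by rewrite lt_min divr_gt0.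
have [e1 e2] : eta <= a / 2 /\ eta <= r by rewrite !ge_min !lexx orbT.
have [G G0 HG] := spec eta eta0.
pose D := k%:R + G%:R * (B1 + m%:R * `|t|).
pose L := (Num.truncn (`|D| / (m%:R * gap))).+1.
have hL : `|D| < L%:R * (m%:R * gap) by rewrite -ltr_pdivrMr // truncnS_gt.
have [y hy] := mean_orbit_sum (L * m) cM KT cF inu ln_weight_continuous nuc.
have [z bz0 bzL] := HG x y 0%N L; rewrite add0n in bzL.
exists z; last by have := bz0 0%N (leqnn _); move=> /= h0; apply: (le_lt_trans h0); lra.
exists ((G + L) * m)%N; rewrite (sum_iter_blocks Tinv phi) birkhoffD.
rewrite (sum_iter_blocks Tinv phi) in hy.
have h1 : birkhoff (iter m Tinv) phiG G z <= G%:R * B1.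
  by apply: (le_trans (ler_norm _)); exact: birkhoff_norm.
have h2 := birkhoff_near (fun p q (pq : d p q <= eta) => Hr p q (le_trans pq e2)) bzL.
rewrite ler_norml in h2; have /andP[h3 _] := h2.
have h4 : - (G%:R * (m%:R * t)) <= G%:R * (m%:R * `|t|).
  by rewrite -mulrN ler_wpM2l // -mulrN ler_wpM2l // -normrN ler_norm.
have h5 : D <= `|D| := ler_norm D.
have E1 : ((G + L) * m)%:R * t = G%:R * (m%:R * t) + (L * m)%:R * c + 2 * (L%:R * (m%:R * gap)).
  by rewrite !natrM natrD tE; ring.
have E2 : D = k%:R + G%:R * B1 + G%:R * (m%:R * `|t|) by rewrite /D; ring.
change (birkhoff (iter m Tinv) phiG G z + birkhoff (iter m Tinv) phiG L (iter G (iter m Tinv) z) -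
  ((G + L) * m)%:R * t < - k%:R).
have {}hy : birkhoff (iter m Tinv) phiG L y <= (L * m)%:R * c := hy.
rewrite E1; rewrite E2 in h5 hL; clear -h1 h3 h4 h5 hL hy; lra.
Qed.

(** The bound by 2 holds for any set, by comparison of areas; the lower bound uses that the zero set
    contains the intersection of the open dense sets [contracting t k]. *)
Lemma zero_set_packing t : gamma_min T g < t -> packing_dim (rdist X) (N t) = 2%:E.
Proof.
move=> gt; have [KT KF [cT _] [cF _]] := HT.
have Hd := mdist_pseudo_metric A; have tb := mdist_totally_bounded A cM.
have [m m0 [ku [ks [al [C [H wE cpsi]]]]]] := anosov_hyp_chart.
have [Cr [c0 [Cr1 c00 Hr]]] := rdist_le A cM.
have [Cl Cl1 Hl] := mdist_le_rdist A cM.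
have C1 := hc_C H; have C0 : 0 < C by lra.
apply/eqP; rewrite eq_le; apply/andP; split.
  apply/lee_addgt0Pr => e e0; rewrite -EFinD.
  apply: ereal_inf_lbound; exists (2 + e) => //; split; first by rewrite addr_gt0.
  have [K' K'1 HK'] := net_size_upper Hd tb H.
  have s2 : 2 < 2 + e by rewrite ltrDl.
  have iC : 0 < C^-1 by rewrite invr_gt0.
  have K0 : 0 < 36 * C ^+ 4 by rewrite mulr_gt0 // exprn_gt0.
  exact: (packing_null Hd Cr1 c00 Hr _ tb s2 iC K0 K'1 (fun x b r Q r0 rb bC nQ => ball_count_lower Hd H x r0 rb bC nQ) HK').
apply: le_ereal_inf_tmp => _ [s [s0 ps] <-]; rewrite lee_fin leNgt; apply/negP => s2.
have [F NF F1] := packing_measure_lt1 ps.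
have [||| i [x [a a0 dF]]] := @baire_somewhere_dense R M d Hd (contracting t) F (@mdist_compact R 2 M X A cM).
- by move=> k x; exact: contracting_open.
- by move=> k x a; exact: contracting_dense.
- move=> p Up; apply: NF; apply: (zero_set_high KF g0 Hh (HB t)) => k; exact: Up k I.
have [ev ev0 Hv] := volume_estimate Hd H.
pose e1 := Num.min (a / 2) ev.
have [|K K1 HK] := Hv e1; first by rewrite lt_min ev0 divr_gt0 //= ge_min lexx orbT.
have K0 : 0 < K by apply: lt_le_trans K1.
have := F1 i; rewrite ltNge => /negP; apply.
have s02 : 0 < s < 2 by rewrite s0.
apply: (packing_premeasure_ge1 Hd Cl1 Hl tb s02 a0 K1 dF) => r Q r0 Kr nQ.
have Kr' : K * r * C ^+ 0 <= 1 by rewrite expr0 mulr1.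
have [hK _] := HK 0%N r Q r0 Kr' nQ 0%N x (leqnn _).
rewrite /wgt big_ord0 in hK; apply: (le_trans hK).
rewrite ler_pM2l // ler_pM2l ?exprn_gt0 // ler_nat; apply: sub_count => q /asboolP bq; apply/asboolP.
by have := bq 0%N (leqnn _); move=> /= h1; apply: (le_trans h1); rewrite ge_min lexx.
Qed.

End SkewProductDimensions.

Theorem corollary5 (R : realType) (Theta : ptopologicalType)
    (X : riemannian_manifold R 2 Theta)
    (T Tinv : Theta -> Theta) (Es Eu : Theta -> {vspace 'rV[R]_2})
    (g : Theta -> R) (h dh : R -> R) (B : R -> R)
    (muSRB : probability (borel Theta) R) :
  compact [set: Theta] ->
  Ck_diffeomorphism X 2 T Tinv ->
  anosov_splitting X T Tinv Es Eu ->
  topologically_mixing T ->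
  (forall p, 0 < g p) ->
  holder X g ->
  fibre_profile h dh ->
  (forall t, 0 < B t /\ forall p, fibre_map g h t p (B t) < B t) ->
  is_srb_inverse X T Es muSRB ->
  forall t : R, gamma_min T g < t < gamma g muSRB ->
    packing_dim (rdist X) (zero_set T Tinv g h B t) = 2%:E /\
    (hausdorff_dim (rdist X) (zero_set T Tinv g h B t) < 2%:E)%E.
Proof.
move=> cM HT HA HM g0 Hg Hh HB Hsrb t /andP[gt tg].
have [A] := finite_charts_exist X cM.
split; first exact: (zero_set_packing A cM HT HA HM g0 Hg Hh HB Hsrb gt).
have [s /andP[s0 s2] Hs] := zero_set_hausdorff A cM HT HA HM g0 Hg Hh HB Hsrb tg.
apply: (@le_lt_trans _ _ s%:E); last by rewrite lte_fin.
by apply: ereal_inf_lbound; exists s.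
Qed.
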